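(* Let $D$ be a non-empty, bounded, connected $C^{1,1}$ open set in $\mathbb{R}^d$ with $d\ge2$. Let $X=(X_t)_{t\in[0,1]}=(X^1_t,\ldots,X^d_t)_{t\in[0,1]}$ be a stochastic process in $\mathbb{R}^d$ whose components are i.i.d. zero-mean Gaussian processes with càdlàg paths starting at $0$ and common expected running supremum $\mu_t$ under the probability measure $\mathbb{P}=\mathbb{P}_0$, such that for each $t\in(0,1]$, $\sup_{s\in[0,t]}X^1_s<\infty$ $\mathbb{P}$-a.s. and $X_t$ is non-degenerate. For each $t\in(0,1]$, define a scaled process $Y^{(t)}=(Y^{(t)}_u)_{u\in[0,1]}$ of $X^1$ by $Y^{(t)}_u=\mu_t^{-1}X^1_{tu}$. If $Y^{(t)}$ converges weakly as $t\downarrow0$ to a continuous Gaussian process $Y=(Y_s)_{s\in[0,1]}$ in the space $\mathbb{D}([0,1];\mathbb{R})$ equipped with the Skorokhod $J_1$ topology, then $\mathbb{E}[\sup_{s\in[0,1]}Y_s]\le1$, and $$\lim_{t\downarrow0}\frac{|D|-Q^X_D(t)}{\mu_t}=|\partial D|\cdot\mathbb{E}\Bigl[\sup_{s\in[0,1]}Y_s\Bigr].$$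
   Context: A real-valued process is a Gaussian process if all its finite-dimensional distributions are (multivariate) Gaussian. The process $X$ is the coordinate process on the space of $\mathbb{R}^d$-valued càdlàg functions on $[0,1]$, equipped with the Borel $\sigma$-algebra of the Skorokhod $J_1$ topology (equivalently, the $\sigma$-algebra generated by coordinate projections), under a probability measure $\mathbb{P}=\mathbb{P}_0$ with $\mathbb{P}(X_0=0)=1$. $\mathbb{D}([0,1];\mathbb{R})$ is the space of real-valued càdlàg functions on $[0,1]$. Non-degenerate means $\mathbb{P}(X_t\ne0)>0$. The common expected running supremum is $\mu_t=\mathbb{E}[\sup_{s\in[0,t]}X^1_s]$ (positive and finite for $t\in(0,1]$). A continuous process is one with continuous sample paths. In the $J_1$ topology on $\mathbb{D}([0,1];\mathbb{R})$, $x_n\to x$ iff there are strictly increasing bijections $\lambda_n:[0,1]\to[0,1]$ with $\sup_{t}|\lambda_n(t)-t|\to0$ and $\sup_t|x_n(\lambda_n(t))-x(t)|\to0$. For $x\in D$, $\mathbb{P}_x(F):=\mathbb{P}(F-x)$ with $F-x=\{\omega:\omega(\cdot)+x\in F\}$; that is, $X$ under $\mathbb{P}_x$ has the law of $x+X$ under $\mathbb{P}$. The first exit time is $\tau^X_D=\inf\{t>0:X_t\in D^c\}$, and the spectral heat content is $Q^X_D(t):=\int_D\mathbb{P}_x(\tau^X_D>t)\,dx$, $t\in(0,1]$. $|D|$ is the $d$-dimensional Lebesgue measure of $D$ and $|\partial D|$ the $(d-1)$-dimensional Lebesgue (surface) measure of $\partial D$. An open set $D\subset\mathbb{R}^d$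 is $C^{1,1}$ if there exist $R_1>0$ and $\Lambda>0$ such that for every $z\in\partial D$ there exist a $C^{1,1}$ function $\phi=\phi_z:\mathbb{R}^{d-1}\to\mathbb{R}$ and an orthonormal coordinate system $CS_z$: $y=(\tilde y,y^d)$ with origin at $z$ such that $\phi(0)=0$, $\nabla\phi(0)=0$, $\|\nabla\phi\|_\infty\le\Lambda$, $|\nabla\phi(x_1)-\nabla\phi(x_2)|\le\Lambda|x_1-x_2|$, and $B(z,R_1)\cap D=B(z,R_1)\cap\{y\text{ in }CS_z:y^d>\phi(\tilde y)\}$. Equivalently, $D$ satisfies the uniform interior and exterior ball condition: there is $R>0$ such that for every $z\in\partial D$ there are open balls $B_1,B_2$ of radius $R$ with $B_1\subset D$, $B_2\subset\mathbb{R}^d\setminus\overline D$, $\partial B_1\cap\partial B_2=\{z\}$. *)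

(* Defs.v *)
From HB Require Import structures.
From mathcomp Require Import all_boot all_order all_algebra.
From mathcomp Require Import all_classical all_reals all_analysis.

Set Implicit Arguments.
Unset Strict Implicit.
Unset Printing Implicit Defensive.

Import Order.TTheory GRing.Theory Num.Theory.
Import numFieldNormedType.Exports.

Local Open Scope classical_set_scope.
Local Open Scope ring_scope.

Definition mx_coord (T : Type) m n (ij : 'I_m * 'I_n) (M : 'M[T]_(m, n)) : T :=
  M ij.1 ij.2.

(* Generated by the coordinate projections; for real entries this is the Borel
   sigma-algebra. *)
Definition mx_cylinders (R : realType) m n : set (set 'M[R]_(m, n)) :=
  [set A | exists ij (B : set R), measurable B /\ A = @mx_coord R m n ij @^-1` B].

Section mx_measurable.
Context (R : realType) (m n : nat).
Let G := @mx_cylinders R m n.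

Let mx_measurableC A : <<s G >> A -> <<s G >> (~` A).
Proof. by move=> GA; rewrite -setTD; exact: sigma_algebraCD. Qed.

HB.instance Definition _ := @isMeasurable.Build (sigma_display G)
  'M[R]_(m, n) <<s G >> (@sigma_algebra0 _ setT G) mx_measurableC
  (@sigma_algebra_bigcup _ setT G).

Lemma measurable_mx_coord ij : measurable_fun setT (@mx_coord R m n ij).
Proof.
move=> _ B mB; rewrite setTI; apply: sub_sigma_algebra.
by exists ij, B.
Qed.

Lemma measurable_fun_mxP d (T : measurableType d) (f : T -> 'M[R]_(m, n)) :
  (forall i j, measurable_fun setT (fun x => f x i j)) -> measurable_fun setT f.
Proof.
move=> mf; apply: (@measurability _ _ _ _ _ _ G) => // _ [_ [ij [B [mB ->]]] <-].
exact: (mf ij.1 ij.2).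
Qed.

End mx_measurable.

Definition rV_cons (R : realType) n (xv : R * 'rV[R]_n) : 'rV[R]_n.+1 :=
  row_mx (xv.1%:M : 'rV_1) xv.2.

(* The iterated product of the one-dimensional Lebesgue measure, with the
   convention that lebesgue_rV 0 is the unit mass on the point 'rV_0. *)
Fixpoint lebesgue_rV (R : realType) n : set 'rV[R]_n -> \bar R :=
  match n with
  | 0 => \d_(0 : 'rV[R]_0)
  | n'.+1 => pushforward (@lebesgue_measure R \x @lebesgue_rV R n')%E
                         (@rV_cons R n')
  end.

Section lebesgue_rV_measure.
Context (R : realType).

Lemma measurable_rV_cons n : measurable_fun setT (@rV_cons R n).
Proof.
apply: measurable_fun_mxP => i j.
have -> : (fun xv : R * 'rV[R]_n => rV_cons xv i j) =
    (fun xv => match @fintype.split 1 n j with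
               | inl _ => xv.1
               | inr k => @mx_coord R 1 n (i, k) xv.2
               end).
  apply/funext => xv; rewrite /rV_cons mxE.
  by case: fintype.split => k //; rewrite !mxE !ord1 eqxx mulr1n.
case: fintype.split => k; first exact: measurable_fst.
exact: (measurableT_comp (measurable_mx_coord _)).
Qed.

Definition rV_uncons n (v : 'rV[R]_n.+1) : R * 'rV[R]_n :=
  (v 0 0, \row_i v 0 (lift 0 i)).

Lemma measurable_rV_uncons n : measurable_fun setT (@rV_uncons n).
Proof.
apply/measurable_fun_pairP; split.
  exact: (@measurable_mx_coord R 1 n.+1 (0, 0)).
apply: measurable_fun_mxP => i j; rewrite /rV_uncons/=.
under eq_fun do rewrite mxE.
exact: (@measurable_mx_coord R 1 n.+1 (0, lift 0 j)).
Qed.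

Lemma rV_consK n : cancel (@rV_cons R n) (@rV_uncons n).
Proof.
move=> [x v]; rewrite /rV_uncons /rV_cons/=; congr pair.
  rewrite mxE; case: splitP => [k _|k //]; by rewrite mxE !ord1 eqxx mulr1n.
apply/rowP => i; rewrite !mxE; case: splitP => [k /=|k].
  by rewrite ord1.
by rewrite /= /bump/= !add1n => -[] ik; congr (v _ _); exact: val_inj.
Qed.

Section lebesgue_step.
Context n (m : {sigma_finite_measure set 'rV[R]_n -> \bar R}).
Local Notation p := (@lebesgue_measure R \x m)%E.

Definition lebesgue_step : set 'rV[R]_n.+1 -> \bar R :=
  pushforward p (@rV_cons R n).

Let mpre A : measurable A -> measurable (@rV_cons R n @^-1` A).
Proof.
by move=> mA; rewrite -[X in measurable X]setTI; exact: measurable_rV_cons.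
Qed.

Let step0 : lebesgue_step set0 = 0%E.
Proof. by rewrite /lebesgue_step /pushforward preimage_set0 measure0. Qed.

Let step_ge0 A : (0 <= lebesgue_step A)%E.
Proof. exact: (measure_ge0 p). Qed.

Let step_sigma_additive : semi_sigma_additive lebesgue_step.
Proof.
move=> F mF tF mUF; rewrite /lebesgue_step /pushforward preimage_bigcup.
apply: measure_semi_sigma_additive.
- by move=> k; exact: mpre.
- apply/trivIsetP => /= i j _ _ ij; rewrite -preimage_setI.
  by move/trivIsetP : tF => /(_ _ _ _ _ ij) ->//; rewrite preimage_set0.
- by rewrite -preimage_bigcup; exact: mpre.
Qed.

HB.instance Definition _ := isMeasure.Build _ _ _ lebesgue_step
  step0 step_ge0 step_sigma_additive.

Let step_sigma_finite : sigma_finite setT lebesgue_step.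
Proof.
have /sigma_finiteP[F [TF ndF mF]] := sigma_finiteT (@lebesgue_measure R).
have /sigma_finiteP[G [TG ndG mG]] := sigma_finiteT m.
exists (fun k => @rV_uncons n @^-1` (F k `*` G k)).
  rewrite -preimage_bigcup -[LHS](preimage_setT (@rV_uncons n)).
  congr preimage; rewrite -setXTT TF TG; apply/seteqP; split=> [[x y]|[x y]].
    move=> [/= [i _ Fx] [j _ Gy]]; exists (maxn i j) => //; split.
      by move: x Fx; exact/subsetPset/ndF/leq_maxl.
    by move: y Gy; exact/subsetPset/ndG/leq_maxr.
  by move=> [k _ [/= ? ?]]; split; exists k.
move=> k; have [mFk Fk] := mF k; have [mGk Gk] := mG k; split.
  rewrite -[X in measurable X]setTI; apply: measurable_rV_uncons => //.
  exact: measurableX.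
rewrite /lebesgue_step /pushforward.
have -> : @rV_cons R n @^-1` (@rV_uncons n @^-1` (F k `*` G k)) = F k `*` G k.
  rewrite -comp_preimage (_ : _ \o _ = id)//.
  by apply/funext => x; exact: rV_consK.
by rewrite product_measure1E// lte_mul_pinfty// ge0_fin_numE.
Qed.

HB.instance Definition _ := Measure_isSigmaFinite.Build _ _ _ lebesgue_step
  step_sigma_finite.

End lebesgue_step.

Let lebesgue_rV_bundle n :
  {m : {sigma_finite_measure set 'rV[R]_n -> \bar R} |
    m = @lebesgue_rV R n :> (set 'rV[R]_n -> \bar R)}.
Proof.
elim: n => [|n [m mE]].
  by exists (\d_(0 : 'rV[R]_0) : {sigma_finite_measure set 'rV[R]_0 -> \bar R}).
by exists (@lebesgue_step n m); rewrite /= /lebesgue_step mE.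
Qed.

Let lebesgue_rV0 n : @lebesgue_rV R n set0 = 0%E.
Proof. by have [m <-] := lebesgue_rV_bundle n; exact: measure0. Qed.

Let lebesgue_rV_ge0 n A : (0 <= @lebesgue_rV R n A)%E.
Proof. by have [m <-] := lebesgue_rV_bundle n; exact: measure_ge0. Qed.

Let lebesgue_rV_sigma_additive n : semi_sigma_additive (@lebesgue_rV R n).
Proof.
by have [m <-] := lebesgue_rV_bundle n; exact: measure_semi_sigma_additive.
Qed.

HB.instance Definition _ n := isMeasure.Build _ _ _ (@lebesgue_rV R n)
  (lebesgue_rV0 n) (@lebesgue_rV_ge0 n) (@lebesgue_rV_sigma_additive n).

Let lebesgue_rV_sigma_finite n : sigma_finite setT (@lebesgue_rV R n).
Proof. by have [m <-] := lebesgue_rV_bundle n; exact: sigma_finiteT. Qed.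

HB.instance Definition _ n := Measure_isSigmaFinite.Build _ _ _
  (@lebesgue_rV R n) (@lebesgue_rV_sigma_finite n).

End lebesgue_rV_measure.

(* A function on [0,1] is represented by its extension by 0 to R, so that
   equality of paths is equality on [0,1]. *)
Definition is_cadlag (R : realType) (V : normedModType R) (x : R -> V) :=
  [/\ forall t : R, 0 <= t < 1 -> x s @[s --> t^'+] --> x t,
      forall t : R, 0 < t <= 1 -> cvg (x s @[s --> t^'-])
    & forall t : R, ~~ (0 <= t <= 1) -> x t = 0].

Record cadlag (R : realType) (V : normedModType R) := Cadlag {
  cadlag_fun :> R -> V ;
  cadlagP : is_cadlag cadlag_fun }.

Definition time_change (R : realType) (l : R -> R) :=
  set_bij `[0, 1] `[0, 1] l /\ {in `[0, 1] &, {homo l : s t / s < t}}.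

Section cadlag_theory.
Context (R : realType) (V : normedModType R).

Lemma cadlag_eq (x y : cadlag V) : x =1 y -> x = y.
Proof.
case: x y => [x xP] [y yP] /= /funext xy; move: yP; rewrite -xy => yP.
by congr Cadlag; exact: Prop_irrelevance.
Qed.

Lemma is_cadlag0 : is_cadlag (fun _ : R => 0 : V).
Proof. by split=> // t _; [exact: cvg_cst|exact: is_cvg_cst]. Qed.

Definition cadlag0 : cadlag V := Cadlag is_cadlag0.

HB.instance Definition _ := gen_eqMixin (cadlag V).
HB.instance Definition _ := gen_choiceMixin (cadlag V).
HB.instance Definition _ := isPointed.Build (cadlag V) cadlag0.

(* The open balls of the metric
   inf_l max (sup_t |l t - t|) (sup_t |x (l t) - y t|). *)
Definition J1_ball (x : cadlag V) (e : R) : set (cadlag V) :=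
  [set y | exists l d, [/\ time_change l, d < e &
    forall t, 0 <= t <= 1 -> `|l t - t| <= d /\ `|x (l t) - y t| <= d]].

Let time_change_in (l : R -> R) t :
  time_change l -> 0 <= t <= 1 -> 0 <= l t <= 1.
Proof. by move=> [[lf _ _] _] t01; have := lf t; rewrite /= !in_itv/=; apply. Qed.

Lemma time_change_id : time_change (@id R).
Proof. by split=> //; split=> // t ts; exists t. Qed.

Lemma time_change_comp (l m : R -> R) :
  time_change l -> time_change m -> time_change (l \o m).
Proof.
move=> [lb li] [mb mi]; split; first exact: (set_bij_comp mb lb).
have [mf _ _] := mb; move=> s t s01 t01 st /=; apply: li; last exact: mi.
  exact: mf.
exact: mf.
Qed.

Lemma time_change_inv (l : R -> R) : time_change l ->
  exists m, time_change m /\ forall t, 0 <= t <= 1 -> l (m t) = t.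
Proof.
move=> lt; have [[lf linj ls] li] := lt.
have /choice[m mP] : forall t, exists s, 0 <= t <= 1 -> 0 <= s <= 1 /\ l s = t.
  move=> t; have [t01|t01] := boolP (0 <= t <= 1); last by exists 0.
  have [|s] := ls t; first by rewrite /= in_itv.
  by rewrite /= in_itv/= => s01 <-; exists s.
have m01 t : 0 <= t <= 1 -> 0 <= m t <= 1 by move=> /mP[].
have lm t : 0 <= t <= 1 -> l (m t) = t by move=> /mP[].
exists m; split=> //; split; first split.
- by move=> t /=; rewrite !in_itv/=; exact: m01.
- move=> s t; rewrite !inE/= !in_itv/= => s01 t01 mst.
  by rewrite -(lm s)// mst lm.
- move=> t /=; rewrite in_itv/= => t01; exists (l t).
    by rewrite /= in_itv/=; exact: time_change_in.
  apply: linj; rewrite ?inE/= ?in_itv/= ?lm//; last exact: time_change_in.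
  by apply: m01; exact: time_change_in.
- move=> s t; rewrite !in_itv/= => s01 t01 st; rewrite ltNge; apply/negP.
  rewrite le_eqVlt => /predU1P[mts|mts].
    by move: st; rewrite -(lm s)// -mts lm// ltxx.
  have := li _ _ _ _ mts; rewrite !in_itv/= !lm// => /(_ (m01 _ t01) (m01 _ s01)).
  by rewrite ltNge (ltW st).
Qed.

Let J1_ball_center x (e : R) : 0 < e -> J1_ball x e x.
Proof.
move=> e0; exists id, 0; split=> //; first exact: time_change_id.
by move=> t _; rewrite !subrr !normr0.
Qed.

Let J1_ball_sym x y e : J1_ball x e y -> J1_ball y e x.
Proof.
move=> [l [d [lt de ld]]]; have [m [mt lm]] := time_change_inv lt.
exists m, d; split=> // t t01; have m01 := time_change_in mt t01.
by have := ld _ m01; rewrite lm// distrC [`|x t - _|]distrC.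
Qed.

Let J1_ball_triangle x y z e1 e2 :
  J1_ball x e1 y -> J1_ball y e2 z -> J1_ball x (e1 + e2) z.
Proof.
move=> [l [d [lt de ld]]] [m [c [mt ce mc]]].
exists (l \o m), (d + c); split; first exact: time_change_comp.
  exact: ltrD.
move=> t t01 /=; have [m1 m2] := mc _ t01.
have [l1 l2] := ld _ (time_change_in mt t01); split.
  by rewrite -(subrKA (m t)) (le_trans (ler_normD _ _))// lerD.
by rewrite -(subrKA (y (m t))) (le_trans (ler_normD _ _))// lerD.
Qed.

HB.instance Definition _ :=
  hasNbhs.Build (cadlag V) (nbhs_ (entourage_ J1_ball)).
HB.instance Definition _ := @Nbhs_isPseudoMetric.Build R (cadlag V)
  (entourage_ J1_ball) erefl J1_ball J1_ball_center J1_ball_sym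
  J1_ball_triangle erefl.

(* The sigma-algebra they generate is also the Borel sigma-algebra of J1 when V
   is separable and complete, in particular for R and 'rV[R]_n. *)
Definition cadlag_cylinders : set (set (cadlag V)) :=
  [set A | exists t (U : set V),
    [/\ 0 <= t <= 1, open U & A = [set x : cadlag V | U (x t)]]].

Let cadlag_measurableC A :
  <<s cadlag_cylinders >> A -> <<s cadlag_cylinders >> (~` A).
Proof. by move=> GA; rewrite -setTD; exact: sigma_algebraCD. Qed.

HB.instance Definition _ := @isMeasurable.Build (sigma_display cadlag_cylinders)
  (cadlag V) <<s cadlag_cylinders >> (@sigma_algebra0 _ setT cadlag_cylinders)
  cadlag_measurableC (@sigma_algebra_bigcup _ setT cadlag_cylinders).

(* The zero path when x is not a cadlag path vanishing outside [0,1]. *)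
Definition mk_cadlag (x : R -> V) : cadlag V :=
  if pselect (is_cadlag x) is left xP then Cadlag xP else cadlag0.

Lemma mk_cadlagE x : is_cadlag x -> mk_cadlag x = x :> (R -> V).
Proof. by rewrite /mk_cadlag; case: pselect. Qed.

Definition shift_fun (x : V) (w : cadlag V) (t : R) : V :=
  if 0 <= t <= 1 then x + w t else 0.

Lemma near_right_itv (t : R) : 0 <= t < 1 -> \forall s \near t^'+, 0 <= s <= 1.
Proof.
move=> /andP[t0 t1]; near=> s; apply/andP; split.
  by rewrite (le_trans t0)// ltW//; near: s; exact: nbhs_right_gt.
by near: s; exact: nbhs_right_le.
Unshelve. all: by end_near. Qed.

Lemma near_left_itv (t : R) : 0 < t <= 1 -> \forall s \near t^'-, 0 <= s <= 1.
Proof.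
move=> /andP[t0 t1]; near=> s; apply/andP; split.
  by near: s; exact: nbhs_left_ge.
by rewrite (le_trans _ t1)// ltW//; near: s; exact: nbhs_left_lt.
Unshelve. all: by end_near. Qed.

Lemma shift_cadlag x w : is_cadlag (shift_fun x w).
Proof.
have [w1 w2 w3] := cadlagP w; rewrite /shift_fun; split=> t t01.
- have t01' : 0 <= t <= 1 by case/andP: t01 => -> /ltW.
  rewrite t01'; apply: cvg_trans; last exact: (cvgD (cvg_cst x) (w1 _ t01)).
  apply: near_eq_cvg; near=> s; rewrite ifT//; near: s.
  exact: near_right_itv.
- have /cvg_ex[l wl] := w2 _ t01; apply/cvg_ex; exists (x + l).
  apply: cvg_trans; last exact: (cvgD (cvg_cst x) wl).
  apply: near_eq_cvg; near=> s; rewrite ifT//; near: s.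
  exact: near_left_itv.
- by rewrite (negbTE t01).
Unshelve. all: by end_near. Qed.

Definition shift (x : V) (w : cadlag V) : cadlag V :=
  Cadlag (shift_cadlag x w).

End cadlag_theory.

Section component.
Context (R : realType) (n : nat).

Lemma component_cadlag (i : 'I_n) (w : cadlag 'rV[R]_n) :
  is_cadlag (fun t => w t 0 i).
Proof.
have [w1 w2 w3] := cadlagP w.
split=> t t01.
- exact: (@cvg_comp _ _ _ w (fun M => M 0 i) _ _ _ (w1 _ t01) (@coord_continuous R 1 n 0 i (w t))).
- have /cvg_ex[l wl] := w2 _ t01; apply/cvg_ex; exists (l 0 i).
  exact: (@cvg_comp _ _ _ w (fun M => M 0 i) _ _ _ wl (@coord_continuous R 1 n 0 i l)).
- by rewrite w3// mxE.
Qed.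

Definition component (i : 'I_n) (w : cadlag 'rV[R]_n) : cadlag R :=
  Cadlag (component_cadlag i w).

End component.

Section scaling.
Context (R : realType).

Definition scale_fun (c t : R) (x : cadlag R) (u : R) : R :=
  if 0 <= u <= 1 then c * x (t * u) else 0.

Lemma scale_cadlag c t x : 0 < t <= 1 -> is_cadlag (scale_fun c t x).
Proof.
move=> /andP[t0 t1]; have [x1 x2 x3] := cadlagP x.
rewrite /scale_fun; split=> u u01.
- have u01' : 0 <= u <= 1 by case/andP: u01 => -> /ltW.
  have tu : 0 <= t * u < 1.
    move: u01 => /andP[u0 u1]; rewrite mulr_ge0 ?(ltW t0)//=.
    by rewrite (le_lt_trans _ u1)// ler_piMl.
  rewrite u01'.
  have xu : x (t * s) @[s --> u^'+] --> x (t * u).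
    apply: (@increasing_cvg_at_right_comp R ( *%R t) x u +oo%O (x (t * u))) => //.
    - by move=> r s _ _; rewrite ltr_pM2l.
    - by apply: cvg_at_right_filter; apply: cvgMl_tmp; exact: cvg_id.
    - exact: x1.
  have cxu : c * x (t * s) @[s --> u^'+] --> c * x (t * u).
    exact: cvgMl_tmp xu.
  apply: cvg_trans cxu.
  apply: near_eq_cvg; near=> s; rewrite ifT//; near: s.
  exact: near_right_itv.
- have /cvg_ex[l xl] : cvg (x s @[s --> (t * u)^'-]).
    apply: x2; case/andP: u01 => u0 u1.
    by rewrite mulr_gt0//= mulr_ile1// ltW.
  have xu : x (t * s) @[s --> u^'-] --> l.
    apply: (@increasing_cvg_at_left_comp R ( *%R t) x -oo%O u l) => //.
    - by move=> r s _ _; rewrite ltr_pM2l.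
    - by apply: cvg_at_left_filter; apply: cvgMl_tmp; exact: cvg_id.
  apply/cvg_ex; exists (c * l).
  have cxu : c * x (t * s) @[s --> u^'-] --> c * l by exact: cvgMl_tmp xu.
  apply: cvg_trans cxu.
  apply: near_eq_cvg; near=> s; rewrite ifT//; near: s.
  exact: near_left_itv.
- by rewrite (negbTE u01).
Unshelve. all: by end_near. Qed.

End scaling.

Local Open Scope ereal_scope.

Section probability.
Context d (Om : measurableType d) (R : realType) (P : probability Om R).

Definition mutually_independent d' (T : measurableType d') (I : finType)
    (X : I -> Om -> T) :=
  forall (J : {set I}) (A : I -> set T), (forall i, measurable (A i)) ->
    P (\bigcap_(i in [set` J]) (X i @^-1` A i)) =
    \prod_(i in J) P (X i @^-1` A i).

Definition identically_distributed d' (T : measurableType d') (I : Type)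
    (X : I -> Om -> T) :=
  forall i j (A : set T), measurable A -> P (X i @^-1` A) = P (X j @^-1` A).

(* Point masses are Gaussian laws of variance 0; they are listed separately
   because normal_prob m 0 is not a point mass. *)
Definition gaussian_law (nu : set R -> \bar R) :=
  (exists m : R, forall A, measurable A -> nu A = \d_m A) \/
  (exists m s : R, (s != 0)%R /\
    forall A, measurable A -> nu A = normal_prob m s A).

(* Z is multivariate Gaussian, possibly degenerate, when all its linear
   combinations are univariate Gaussian. *)
Definition gaussian_vector k (Z : Om -> 'rV[R]_k) :=
  forall c : 'rV[R]_k,
    gaussian_law (pushforward P (fun w => \sum_(j < k) c 0 j * Z w 0 j)%R).

Definition gaussian_process (X : R -> Om -> R) :=
  forall k (t : 'I_k -> R), (forall j, (0 <= t j <= 1)%R) ->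
    gaussian_vector (fun w => \row_j X (t j) w).

Definition zero_mean_process (X : R -> Om -> R) :=
  forall t : R, (0 <= t <= 1)%R -> 'E_P[X t] = 0.

(* Weak convergence along the filter F of the laws of the random elements X t
   to the law of Y. *)
Definition weak_cvg (T : topologicalType) (I : Type) (F : set_system I)
    (X : I -> Om -> T) d' (Om' : measurableType d') (P' : probability Om' R)
    (Y : Om' -> T) :=
  forall f : T -> R, continuous f ->
    (exists M : R, forall x, (`|f x| <= M)%R) ->
    'E_P[f \o X t] @[t --> F] --> 'E_P'[f \o Y].

End probability.

Definition running_sup (R : realType) (x : R -> R) (t : R) : \bar R :=
  ereal_sup [set (x s)%:E | s in [set s | (0 <= s <= t)%R]].

Section coordinate_process.
Context (R : realType) (n : nat) (P : probability (cadlag 'rV[R]_n.+1) R).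

Definition expected_sup (t : R) : \bar R :=
  \int[P]_w running_sup (component ord0 w) t.

(* Y^(t); a genuine path for 0 < t <= 1 by scale_cadlag. *)
Definition scaled_component (t : R) (w : cadlag 'rV[R]_n.+1) : cadlag R :=
  mk_cadlag (scale_fun (fine (expected_sup t))^-1 t (component ord0 w)).

(* P_x F = P (F - x). The outer extension of P is used because exit events need
   not belong to the sigma-algebra of the coordinate projections, only to its
   P-completion; it agrees with P on the former and with the completed measure
   on the latter. *)
Definition law_from (x : 'rV[R]_n.+1) : set (cadlag 'rV[R]_n.+1) -> \bar R :=
  fun F => mu_ext P (shift x @^-1` F).

(* The infimum over the empty set is +oo: no exit during (0, 1]. *)
Definition exit_time (D : set 'rV[R]_n.+1) (w : cadlag 'rV[R]_n.+1) : \bar R :=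
  ereal_inf [set t%:E | t in [set t | (0 < t <= 1)%R /\ ~ D (w t)]].

Definition heat_content (D : set 'rV[R]_n.+1) (t : R) : \bar R :=
  \int[@lebesgue_rV R n.+1]_(x in D) law_from x [set w | t%:E < exit_time D w].

End coordinate_process.

Local Close Scope ereal_scope.

(* The library norm on 'rV_n is the sup norm. *)
Definition enorm (R : realType) n (v : 'rV[R]_n) : R :=
  Num.sqrt (\sum_i v 0 i ^+ 2).

Definition eball (R : realType) n (z : 'rV[R]_n) (r : R) : set 'rV[R]_n :=
  [set x | enorm (x - z) < r].

Definition boundary (T : topologicalType) (A : set T) := closure A `\` A°.

Definition gradient (R : realType) n (f : 'rV[R]_n -> R) (x : 'rV[R]_n) :
    'rV[R]_n :=
  \row_i 'D_(delta_mx 0 i) f x.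

Definition C11_fun (R : realType) n (L : R) (f : 'rV[R]_n -> R) :=
  [/\ forall x, differentiable f x,
      forall x, enorm (gradient f x) <= L
    & forall x y, enorm (gradient f x - gradient f y) <= L * enorm (x - y)].

(* The rows of the orthogonal matrix U are the axes of the coordinate system
   CS_z, y x the coordinates of x in it, tilde (y x) the first n of them. *)
Definition C11_open (R : realType) n (D : set 'rV[R]_n.+1) :=
  open D /\
  exists R1 L : R, [/\ 0 < R1, 0 < L & forall z, boundary D z ->
    exists (f : 'rV[R]_n -> R) (U : 'M[R]_n.+1),
      let y x := (x - z) *m U^T in
      let tilde (v : 'rV[R]_n.+1) := \row_(i < n) v 0 (widen_ord (leqnSn n) i) in
      [/\ C11_fun L f, f 0 = 0, gradient f 0 = 0, U *m U^T = 1%:M &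
        eball z R1 `&` D =
        eball z R1 `&` [set x | f (tilde (y x)) < y x 0 ord_max]]].

(* Only meaningful for bounded E: the library gives sup the value 0 on the
   empty set and on unbounded sets. *)
Definition ediam (R : realType) n (E : set 'rV[R]_n) : R :=
  sup [set enorm (x - y) | x in E & y in E].

(* For s >= 1; an empty E k contributes 0 ^+ s = 0. *)
Definition hausdorff_pre (R : realType) n (s : nat) (e : R) (A : set 'rV[R]_n) :
    \bar R :=
  ereal_inf [set (\sum_(k <oo) ((ediam (E k)) ^+ s)%:E)%E | E in
    [set E : (set 'rV[R]_n)^nat | A `<=` \bigcup_k E k /\
      forall k x y, E k x -> E k y -> enorm (x - y) <= e]].

Definition hausdorff (R : realType) n (s : nat) (A : set 'rV[R]_n) : \bar R :=
  ereal_sup [set hausdorff_pre s e A | e in [set e | 0 < e]].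

Definition unit_cube (R : realType) n : set 'rV[R]_n.+1 :=
  [set x | x 0 ord_max = 0 /\ forall i, 0 <= x 0 i <= 1].

(* n-dimensional Lebesgue (surface) measure in R^n.+1: the n-dimensional
   Hausdorff measure, normalized to be 1 on n-dimensional unit cubes. *)
Definition surface_measure (R : realType) n (A : set 'rV[R]_n.+1) : \bar R :=
  (hausdorff n A / hausdorff n (@unit_cube R n))%E.

(* Main.v *)
(** At the scale of [mu t], a small ball of the boundary looks like a flat piece
    of hyperplane, so a path started at height [u] above it stays in [D] up to
    time [t] exactly when the supremum over [0, t] of its component along the
    outward normal is less than [u].  That component has the law of [X^1], since
    the characteristic function of finitely many projections of [X] depends only
    on their Gram matrix; integrating [P (sup > u)] over [u > 0] thus contributes
    [mu t] per unit of surface.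

    To make this precise the boundary is cut into cells, graphs with small slope
    [e] over cubes of a common side.  The slope moves the exit height by at most
    [e] times the range of the path, whose mean is [O(mu t)], and the paths whose
    range exceeds a fixed length have probability [O(mu t ^ 2)] by Fernique's
    theorem.  Hausdorff measure is compared with the volume of the cubes through
    nearly isometric maps, and [e -> 0] after [t -> 0].

    By Fernique's theorem again, the normalized suprema of [Y^(t)] have bounded
    second moments, so their means, all equal to [1], pass to the limit and
    [E sup Y = 1]. *)

Require Import Defs.
From HB Require Import structures.
From mathcomp Require Import all_boot all_order all_algebra.
From mathcomp Require Import all_classical all_reals all_analysis.
From mathcomp Require Import measurable_realfun.
From mathcomp Require Import ring lra zify.

Set Implicit Arguments.
Unset Strict Implicit.
Unset Printing Implicit Defensive.

Import Order.TTheory GRing.Theory Num.Theory.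
Import numFieldNormedType.Exports.

Local Open Scope classical_set_scope.
Local Open Scope ring_scope.

(** * Lebesgue measure, isometries and graph coordinates *)

(** Fernique's theorem compares a process with an independent copy of itself; since [2 <= n.+1], a
    second component of [X] serves as that copy, rotated against the first by the 3-4-5 angle so
    that coefficients stay rational. The bound is used twice: finiteness of the supremum gives its
    integrability, and a level proportional to [mu t] then gives the scale-free second moment.

    Exit events belong only to the completion, so exit probabilities are not treated as measurable
    functions of the starting point: they are enclosed between measurable bounds, whose integrals
    enclose the heat content.

    Hausdorff measure is handled as a metric outer measure, subadditive for the upper bound and
    additive at positive distance for the lower one. This dictates the cells. A point near the
    boundary belongs to the first chart whose window contains it; cells whose graph meets an earlier
    window are discarded in the lower bound and counted by packing their tubes into the rims of the
    windows, whose volume vanishes with the mesh. The other cells are shrunk by the factor [1 - e]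
    to be separated. *)

Section euclidean_norm.
Context {R : realType} {n : nat}.
Implicit Types u v w : 'rV[R]_n.

Lemma enorm_ge0 v : 0 <= enorm v.
Proof. exact: sqrtr_ge0. Qed.

Lemma sum_sqr_ge0 v : 0 <= \sum_i v 0 i ^+ 2.
Proof. by apply: sumr_ge0 => i _; exact: sqr_ge0. Qed.

Lemma enorm_sqr v : enorm v ^+ 2 = \sum_i v 0 i ^+ 2.
Proof. by rewrite sqr_sqrtr// sum_sqr_ge0. Qed.

Lemma enorm0 : enorm (0 : 'rV[R]_n) = 0.
Proof.
by rewrite /enorm big1 ?sqrtr0// => i _; rewrite mxE expr0n.
Qed.

Lemma enormZ (a : R) v : enorm (a *: v) = `|a| * enorm v.
Proof.
rewrite /enorm -sqrtr_sqr -sqrtrM ?sqr_ge0//; congr Num.sqrt.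
by rewrite mulr_sumr; apply: eq_bigr => i _; rewrite mxE exprMn.
Qed.

Lemma enormN v : enorm (- v) = enorm v.
Proof. by rewrite -scaleN1r enormZ normrN1 mul1r. Qed.

Lemma enorm_distC u v : enorm (u - v) = enorm (v - u).
Proof. by rewrite -enormN opprB. Qed.

Lemma enorm_coord v i : `|v 0 i| <= enorm v.
Proof.
rewrite -sqrtr_sqr ler_wsqrtr// (bigD1 i)//= lerDl.
by apply: sumr_ge0 => j _; exact: sqr_ge0.
Qed.

(** The nonnegative sum of [(u_i |v| - v_i |u|)^2] expands to [2 |u| |v| (|u| |v| - u . v)]; the
    factor in front can be divided out once both norms are positive. *)
Lemma cauchy_schwarz u v : \sum_i u 0 i * v 0 i <= enorm u * enorm v.
Proof.
have [u0|u0] := eqVneq (enorm u) 0.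
  rewrite u0 mul0r big1// => i _.
  by have := enorm_coord u i; rewrite u0 normr_le0 => /eqP ->; rewrite mul0r.
have [v0|v0] := eqVneq (enorm v) 0.
  rewrite v0 mulr0 big1// => i _.
  by have := enorm_coord v i; rewrite v0 normr_le0 => /eqP ->; rewrite mulr0.
have up : 0 < enorm u by rewrite lt0r u0 enorm_ge0.
have vp : 0 < enorm v by rewrite lt0r v0 enorm_ge0.
have H : 0 <= \sum_i (u 0 i * enorm v - v 0 i * enorm u) ^+ 2.
  by apply: sumr_ge0 => i _; exact: sqr_ge0.
have E : \sum_i (u 0 i * enorm v - v 0 i * enorm u) ^+ 2 =
    enorm u * enorm v * 2 * (enorm u * enorm v - \sum_i u 0 i * v 0 i).
  rewrite (eq_bigr (fun i => (u 0 i ^+ 2 * enorm v ^+ 2 +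
    v 0 i ^+ 2 * enorm u ^+ 2) - (enorm u * enorm v * 2) * (u 0 i * v 0 i))).
    rewrite sumrB big_split/= -!mulr_suml -!enorm_sqr -mulr_sumr; ring.
  by move=> i _; ring.
by move: H; rewrite E pmulr_rge0 ?subr_ge0// !mulr_gt0.
Qed.

Lemma ler_enormD u v : enorm (u + v) <= enorm u + enorm v.
Proof.
rewrite -[leRHS]ger0_norm ?addr_ge0 ?enorm_ge0// -sqrtr_sqr ler_wsqrtr//.
rewrite sqrrD !enorm_sqr.
rewrite (eq_bigr (fun i => u 0 i ^+ 2 + v 0 i ^+ 2 + (u 0 i * v 0 i) *+ 2)).
  rewrite !big_split/= -addrA [leRHS]addrAC -[leRHS]addrA lerD2l lerD2l.
  by rewrite -mulr2n lerMn2r/= cauchy_schwarz.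
by move=> i _; rewrite mxE sqrrD addrAC.
Qed.

Lemma ler_enorm_dist u v w : enorm (u - w) <= enorm (u - v) + enorm (v - w).
Proof. by rewrite -(subrKA v) ler_enormD. Qed.

Lemma enorm_le_sum v : enorm v <= \sum_i `|v 0 i|.
Proof.
rewrite -[leRHS]ger0_norm ?sumr_ge0// -sqrtr_sqr ler_wsqrtr//.
suff [] : 0 <= \sum_i `|v 0 i| /\ \sum_i v 0 i ^+ 2 <= (\sum_i `|v 0 i|) ^+ 2.
  by [].
elim/big_ind2 : _ => [|x y z t [y0 xy] [t0 zt]|i _].
- by rewrite expr0n.
- split; first exact: addr_ge0.
  by rewrite (le_trans (lerD xy zt))// sqrrD addrAC lerDl mulrn_wge0// mulr_ge0.
- by split=> //; rewrite real_normK// num_real.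
Qed.

Lemma enorm_eq0 v : enorm v = 0 -> v = 0.
Proof.
move=> v0; apply/rowP => i; rewrite mxE; apply/eqP; rewrite -normr_le0 -v0.
exact: enorm_coord.
Qed.

Lemma mx_norm_le_enorm v : `|v| <= enorm v.
Proof.
rewrite /Num.norm/= mx_normrE; apply: bigmax_le; first exact: enorm_ge0.
by move=> [i j] _ /=; rewrite ord1 enorm_coord.
Qed.

Lemma enorm_le_mx_norm v : enorm v <= n%:R * `|v|.
Proof.
rewrite (le_trans (enorm_le_sum v))//.
have -> : n%:R * `|v| = \sum_(i < n) `|v|.
  by rewrite sumr_const card_ord mulr_natl.
rewrite ler_sum// => i _.
rewrite [leRHS]/Num.norm/= mx_normrE.
exact: (le_bigmax _ (fun ij : 'I_1 * 'I_n => `|v ij.1 ij.2|) (0, i)).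
Qed.

End euclidean_norm.

Section measurable_rV.
Context {R : realType}.

Lemma measurable_coord n (i : 'I_n) :
  measurable_fun setT (fun x : 'rV[R]_n => x 0 i).
Proof. exact: (@measurable_mx_coord R 1 n (0, i)). Qed.

Lemma measurable_fun_rVP d (T : measurableType d) n (f : T -> 'rV[R]_n) :
  (forall j, measurable_fun setT (fun x => f x 0 j)) -> measurable_fun setT f.
Proof. by move=> mf; apply: measurable_fun_mxP => i j; rewrite ord1. Qed.

Lemma measurable_fun_rV_comp d (T : measurableType d) n (f : T -> 'rV[R]_n) j :
  measurable_fun setT f -> measurable_fun setT (fun x => f x 0 j).
Proof. by move=> mf; apply: (measurableT_comp (measurable_coord j) mf). Qed.

Lemma measurable_rVD n d (T : measurableType d) (f g : T -> 'rV[R]_n) :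
  measurable_fun setT f -> measurable_fun setT g ->
  measurable_fun setT (fun x => f x + g x).
Proof.
move=> mf mg; apply: measurable_fun_rVP => j; under eq_fun do rewrite mxE.
by apply: measurable_funD; exact: measurable_fun_rV_comp.
Qed.

Lemma measurable_rVN n d (T : measurableType d) (f : T -> 'rV[R]_n) :
  measurable_fun setT f -> measurable_fun setT (fun x => - f x).
Proof.
move=> mf; apply: measurable_fun_rVP => j; under eq_fun do rewrite mxE.
by apply: measurableT_comp => //; exact: measurable_fun_rV_comp.
Qed.

Lemma measurable_enorm n d (T : measurableType d) (f : T -> 'rV[R]_n) :
  measurable_fun setT f -> measurable_fun setT (fun x => enorm (f x)).
Proof.
move=> mf; rewrite /enorm; apply: (@measurableT_comp _ _ _ _ _ _ (@Num.sqrt R)).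
  by apply: continuous_measurable_fun; exact: sqrt_continuous.
by apply: measurable_sum => i; apply: measurable_funX; exact: measurable_fun_rV_comp.
Qed.

Lemma measurable_preimage d1 d2 (T1 : measurableType d1) (T2 : measurableType d2)
    (f : T1 -> T2) (A : set T2) :
  measurable_fun setT f -> measurable A -> measurable (f @^-1` A).
Proof. by move=> mf mA; rewrite -[X in measurable X]setTI; exact: mf. Qed.

Lemma measurable_rV_box n (A : 'I_n -> set R) :
  (forall i, measurable (A i)) ->
  measurable [set x : 'rV[R]_n | forall i, A i (x 0 i)].
Proof.
move=> mA; have -> : [set x : 'rV[R]_n | forall i, A i (x 0 i)] =
    \bigcap_(i in [set: 'I_n]) ((fun x : 'rV[R]_n => x 0 i) @^-1` A i).
  by apply/seteqP; split=> [x Ax i _|x Ax i]; exact: Ax.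
apply: fin_bigcap_measurable => // i _.
by apply: measurable_preimage => //; exact: measurable_coord.
Qed.

(** The sigma-algebra is generated by coordinates, not by open sets. The topology comes from the sup
    norm, so an open set is the union of the rational boxes it contains, a countable family
    enumerated by [unpickle]. *)
Lemma open_rV_measurable n (D : set 'rV[R]_n) : open D -> measurable D.
Proof.
move=> oD.
pose box (p : {ffun 'I_n -> rat * rat}) :=
  [set x : 'rV[R]_n | forall i, `]ratr (p i).1, ratr (p i).2[%classic (x 0 i)].
have mbox p : measurable (box p).
  by apply: (@measurable_rV_box _ (fun i => `]ratr (p i).1, ratr (p i).2[%classic)).
have -> : D = \bigcup_(k in [set k : nat |
    exists2 p, unpickle k = Some p & box p `<=` D])
    (if unpickle k is Some p then box p else set0).
  apply/seteqP; split=> [x Dx|x [k [p pk pD]]]; last by rewrite pk => /pD.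
  have /nbhs_ballP[e /= e0 eD] := open_nbhs_nbhs (conj oD Dx).
  have /choice[p pP] i : exists p : rat * rat,
      x 0 i - e < ratr p.1 < x 0 i /\ x 0 i < ratr p.2 < x 0 i + e.
    have [|q1] := @rat_in_itvoo R (x 0 i - e) (x 0 i); first by rewrite gtrBl.
    have [|q2] := @rat_in_itvoo R (x 0 i) (x 0 i + e); first by rewrite ltrDl.
    by rewrite !in_itv/= => ? ?; exists (q1, q2).
  have bD : box [ffun i => p i] `<=` D.
    move=> y by_; apply: eD; split=> // i j; rewrite ord1 /ball/= distrC ltr_distl.
    have := by_ j; rewrite ffunE/= in_itv/=.
    have [/andP[p1 _] /andP[_ p2]] := pP j => /andP[y1 y2].
    by rewrite (lt_trans p1)//= (lt_trans y2).
  exists (pickle [ffun i => p i]); rewrite ?pickleK//.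
    by exists [ffun i => p i] => //; rewrite pickleK.
  move=> i; rewrite ffunE/= in_itv/=.
  by have [/andP[_ ->] /andP[-> _]] := pP i.
apply: bigcup_measurable => k _.
by case: (unpickle k) => // p.
Qed.

Lemma continuous_rV_measurable n (f : 'rV[R]_n -> R) :
  continuous f -> measurable_fun setT f.
Proof.
move=> cf; apply: (measurability _ (RGenOpens.measurableE R)).
move=> _ [_ [a [b ->] <-]]; rewrite setTI.
apply: open_rV_measurable; apply: open_comp => //; exact: interval_open.
Qed.

End measurable_rV.

Section measure_preserving.
Context {R : realType}.

Definition measure_preserving d1 d2 (T1 : measurableType d1)
    (T2 : measurableType d2) (m1 : set T1 -> \bar R) (m2 : set T2 -> \bar R)
    (f : T1 -> T2) :=
  measurable_fun setT f /\ forall A, measurable A -> m1 (f @^-1` A) = m2 A.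

Lemma measure_preserving_integral d1 d2 (T1 : measurableType d1)
    (T2 : measurableType d2) (m1 : {measure set T1 -> \bar R})
    (m2 : {measure set T2 -> \bar R}) (f : T1 -> T2) (g : T2 -> \bar R) A :
  measure_preserving m1 m2 f -> measurable A -> measurable_fun setT g ->
  (forall x, (0 <= g x)%E) ->
  (\int[m1]_(x in f @^-1` A) g (f x) = \int[m2]_(y in A) g y)%E.
Proof.
move=> [mf fE] mA mg g0.
rewrite -(@ge0_integral_pushforward _ _ _ _ _ f mf m1 A g)//.
- apply: eq_measure_integral => B mB _; exact: fE.
- exact: measurable_funTS.
Qed.

(** The image of the product measure agrees with it on rectangles, which determine a product of
    sigma-finite measures. *)
Lemma measure_preservingX d1 d2 (T1 : measurableType d1)
    (T2 : measurableType d2) (m1 : {sigma_finite_measure set T1 -> \bar R})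
    (m2 : {sigma_finite_measure set T2 -> \bar R}) (f : T1 -> T1) (g : T2 -> T2) :
  measure_preserving m1 m1 f -> measure_preserving m2 m2 g ->
  measure_preserving (m1 \x m2)%E (m1 \x m2)%E (fun z => (f z.1, g z.2)).
Proof.
move=> [mf fE] [mg gE].
have mfg : measurable_fun setT (fun z : T1 * T2 => (f z.1, g z.2)).
  apply/measurable_fun_pairP; split.
    exact: (measurableT_comp mf measurable_fst).
  exact: (measurableT_comp mg measurable_snd).
split=> // A mA.
pose F : {mfun _ >-> _} := HB.pack (fun z : T1 * T2 => (f z.1, g z.2))
  (isMeasurableFun.Build _ _ _ _ _ mfg).
symmetry.
apply: (@product_measure_unique _ _ _ _ _ m1 m2 (pushforward (m1 \x m2)%E F)) => //.
move=> B C mB mC.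
transitivity ((m1 \x m2)%E ((f @^-1` B) `*` (g @^-1` C))); first by [].
rewrite product_measure1E; last 2 first.
- exact: measurable_preimage.
- exact: measurable_preimage.
by congr (_ * _)%E; [exact: fE|exact: gE].
Qed.

End measure_preserving.

Section lebesgue_translation.
Context {R : realType}.

Lemma lebesgue_measure_addr (v : R) :
  measure_preserving (@lebesgue_measure R) (@lebesgue_measure R) (+%R^~ v).
Proof.
have mv : measurable_fun [set: measurableTypeR R]
    ((+%R^~ v) : measurableTypeR R -> measurableTypeR R).
  exact: measurable_funD.
split=> // A mA.
pose F : {mfun _ >-> _} := HB.pack
  ((+%R^~ v) : measurableTypeR R -> measurableTypeR R)
  (isMeasurableFun.Build _ _ _ _ _ mv).
symmetry; apply: (@lebesgue_measure_unique R (pushforward lebesgue_measure F)) => //.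
move=> _ [[a b] _ <-]; rewrite /= /pushforward/=.
have -> : (+%R^~ v) @^-1` `]a, b] = `]a - v, b - v]%classic :> set R.
  by apply/seteqP; split=> x /=; rewrite !in_itv/= ltrBlDr lerBrDr.
rewrite !lebesgue_measure_itv/= !lte_fin ltrD2r; case: ifPn => // _.
by rewrite -!EFinB; congr EFin; ring.
Qed.

Lemma lebesgue_rV_add n (v : 'rV[R]_n) :
  measure_preserving (@lebesgue_rV R n) (@lebesgue_rV R n) (+%R^~ v).
Proof.
elim: n => [|n IH] in v *.
  split=> [|A mA]; first exact: measurable_rVD.
  by congr (_ _); apply/funext => x /=; rewrite (thinmx0 v) addr0.
split=> [|A mA]; first exact: measurable_rVD.
pose v' : 'rV[R]_n := \row_i v 0 (lift 0 i).
have mcA : measurable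
    ((@rV_cons R n : measurableTypeR R * 'rV[R]_n -> _) @^-1` A).
  exact: (measurable_preimage (@measurable_rV_cons R n) mA).
have [_ /(_ _ mcA)] :=
  measure_preservingX (lebesgue_measure_addr (v 0 0)) (IH v').
rewrite /= /pushforward => <-; congr (_ _); apply/funext => -[x w] /=.
congr (A _); rewrite /rV_cons; apply/rowP => j; rewrite !mxE.
case: splitP => k jk; rewrite !mxE ?ord1 ?eqxx ?mulr1n.
  by congr (_ + v 0 _); apply/val_inj; rewrite /= jk ord1.
by congr (_ + v 0 _); apply/val_inj; rewrite /= jk.
Qed.

Lemma lebesgue_rV_box n (A : 'I_n -> set R) : (forall i, measurable (A i)) ->
  @lebesgue_rV R n [set x | forall i, A i (x 0 i)] =
  (\prod_(i < n) @lebesgue_measure R (A i))%E.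
Proof.
elim: n => [|n IH] in A * => mA.
  by rewrite big_ord0 /= diracE mem_set// => -[].
rewrite big_ord_recl -IH; last by move=> i; exact: mA.
rewrite [LHS]/= /pushforward -product_measure1E; last 2 first.
- exact: mA.
- by apply: (@measurable_rV_box _ _ (fun i => A (lift ord0 i))) => i; exact: mA.
congr (_ _); apply/seteqP; split=> [[x w] /= xw|[x w] /= [Ax Aw] i].
  split=> [|i].
    have := xw ord0; rewrite /rV_cons mxE; case: splitP => // k _.
    by rewrite !mxE !ord1 eqxx mulr1n.
  have := xw (lift ord0 i); rewrite /rV_cons mxE; case: splitP => k.
    by rewrite ord1.
  by rewrite /= /bump/= !add1n => -[] /val_inj ->.
rewrite /rV_cons mxE; case: splitP => k ik.
  by rewrite !mxE !ord1 eqxx mulr1n (_ : i = ord0)//; apply: val_inj; rewrite /= ik ord1.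
by rewrite (_ : i = lift ord0 k)//; apply: val_inj; rewrite /= ik.
Qed.

(** Half-open, so that the cubes of a grid are disjoint and still cover. *)
Definition cube n (a : 'rV[R]_n) (s : R) : set 'rV[R]_n :=
  [set x | forall i, a 0 i <= x 0 i < a 0 i + s].

Lemma cubeE n (a : 'rV[R]_n) (s : R) :
  cube a s = [set x | forall i, `[a 0 i, a 0 i + s[%classic (x 0 i)].
Proof. by apply/seteqP; split=> x H i; have := H i; rewrite /= in_itv. Qed.

Lemma measurable_cube n (a : 'rV[R]_n) (s : R) : measurable (cube a s).
Proof.
rewrite cubeE.
by apply: (@measurable_rV_box _ _ (fun i => `[a 0 i, a 0 i + s[%classic)).
Qed.

Lemma lebesgue_rV_cube n (a : 'rV[R]_n) (s : R) : 0 <= s ->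
  @lebesgue_rV R n (cube a s) = (s ^+ n)%:E.
Proof.
move=> s0; rewrite cubeE.
rewrite (@lebesgue_rV_box _ (fun i => `[a 0 i, a 0 i + s[%classic))//.
rewrite (eq_bigr (fun=> s%:E)); first by rewrite prodEFin prodr_const card_ord.
move=> i _; rewrite lebesgue_measure_itv/= lte_fin ltrDl.
case: ifPn => [_|]; first by rewrite -EFinB addrAC subrr add0r.
by rewrite -leNgt => ?; congr EFin; apply/eqP; rewrite eq_le s0.
Qed.

End lebesgue_translation.

Section lebesgue_isometry.
Context {R : realType} {n : nat}.
Notation lam := (@lebesgue_rV R n).
Implicit Types (A B : set 'rV[R]_n) (g : 'rV[R]_n -> 'rV[R]_n).

Lemma measurable_eball (z : 'rV[R]_n) r : measurable (eball z r).
Proof.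
have -> : eball z r = (fun x => enorm (x - z)) @^-1` `]-oo, r[%classic.
  by apply/seteqP; split=> x; rewrite /= in_itv.
apply: measurable_preimage => //; apply: measurable_enorm.
exact: (@measurable_rVD _ _ _ _ _ (fun=> - z)).
Qed.

Lemma lebesgue_rV_eball_lty r : (lam (eball 0 r) < +oo)%E.
Proof.
have [r0|r0] := ltP r 0.
  rewrite (_ : eball 0 r = set0) ?measure0//.
  rewrite -subset0 => x /=; rewrite /eball/= subr0 => /lt_trans/(_ r0).
  by rewrite ltNge enorm_ge0.
apply: (@le_lt_trans _ _ (lam (cube (const_mx (- r)) (r *+ 2)))).
  apply: le_measure; rewrite ?inE; [exact: measurable_eball|
    exact: measurable_cube|].
  move=> x; rewrite /eball/= subr0 => xr i; rewrite !mxE.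
  have := le_lt_trans (enorm_coord x i) xr.
  rewrite ltr_norml => /andP[/ltW -> /=].
  by rewrite mulr2n addrA addNr add0r.
by rewrite lebesgue_rV_cube ?ltry// mulrn_wge0.
Qed.

Lemma lebesgue_rV_eball_gt0 r : 0 < r -> (0 < lam (eball 0 r))%E.
Proof.
move=> r0; pose s := r / n.+1%:R.
have s0 : 0 < s by rewrite divr_gt0.
apply: (@lt_le_trans _ _ (lam (cube 0 s))).
  by rewrite lebesgue_rV_cube ?(ltW s0)// lte_fin exprn_gt0.
apply: le_measure; rewrite ?inE; [exact: measurable_cube|
  exact: measurable_eball|].
move=> x /= xs; rewrite /eball/= subr0 (le_lt_trans (enorm_le_sum x))//.
apply: (@le_lt_trans _ _ (\sum_(i < n) s)).
  apply: ler_sum => i _; have := xs i; rewrite mxE add0r => /andP[x0 xs'].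
  by rewrite ger0_norm// ltW.
rewrite sumr_const card_ord -mulr_natr /s -mulrA gtr_pMr// mulrC.
by rewrite ltr_pdivrMr// mul1r ltr_nat.
Qed.

(* For a translation invariant [mu], computing [mu A * lam B] as a double
   integral and translating each variable gives [mu A * lam B = mu B * lam (- A)]. *)
Lemma lebesgue_rV_additive_swap g A B : measurable_fun setT g ->
  {morph g : x y / x + y} -> (forall y, exists x, g x = y) ->
  measurable A -> measurable B ->
  (lam (g @^-1` A) * lam B = lam (g @^-1` B) * lam (-%R @^-1` A))%E.
Proof.
move=> mg gD gS mA mB.
have mgA : measurable (g @^-1` A) by exact: measurable_preimage.
have mgB : measurable (g @^-1` B) by exact: measurable_preimage.
have mid : measurable_fun setT (@id 'rV[R]_n) by exact: measurable_id.
have mN : measurable_fun setT (-%R : 'rV[R]_n -> 'rV[R]_n).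
  exact: measurable_rVN.
pose S := [set z : 'rV[R]_n * 'rV[R]_n | A (g z.1) /\ B (z.2 + g z.1)].
have mS : measurable S.
  apply: measurableI.
    by apply: measurable_preimage mA; exact: measurableT_comp mg measurable_fst.
  apply: measurable_preimage mB; apply: measurable_rVD; first exact: measurable_snd.
  exact: measurableT_comp mg measurable_fst.
have mf : measurable_fun setT (fun z => (\1_S z : R)%:E).
  by apply/measurable_EFinP; exact: measurable_indic.
have f0 z : (0 <= (\1_S z : R)%:E)%E by rewrite lee_fin.
have := @fubini_tonelli _ _ _ _ _ lam lam _ mf f0.
have -> : (\int[lam]_x \int[lam]_y ((\1_S (x, y) : R)%:E) =
           lam (g @^-1` A) * lam B)%E.
  rewrite (_ : (fun x => _) = fun x => (lam B * (\1_(g @^-1` A) x : R)%:E)%E).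
    rewrite ge0_integralZl//; last by apply/measurable_EFinP.
    by rewrite integral_indic// setIT muleC.
  apply/funext => x.
  rewrite (_ : (fun y => _) = fun y =>
     ((\1_(g @^-1` A) x : R)%:E * (\1_((+%R^~ (g x)) @^-1` B) y : R)%:E)%E).
    rewrite ge0_integralZl//; last first.
      apply/measurable_EFinP; apply: measurable_indic.
      by apply: measurable_preimage mB; exact: measurable_rVD.
    rewrite integral_indic//; last first.
      by apply: measurable_preimage mB; exact: measurable_rVD.
    by rewrite setIT muleC; congr (_ * _)%E; exact: (lebesgue_rV_add (g x)).2.
  apply/funext => y; rewrite -EFinM !indicE; congr EFin.
  by rewrite -natrM mulnb; congr (_%:R); congr nat_of_bool; rewrite in_setI.
move=> ->.
(* For fixed [y = g y'], the translation [x -> x + y'] turns [1_A (g x) * 1_B (y + g x)] into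
   [1_A (g x - y) * 1_B (g x)]; integrating in [y] next then produces the measure of [- A]. *)
rewrite (_ : (fun y => _) = fun y =>
   (\int[lam]_x ((\1_A (g x - y) * \1_B (g x) : R)%:E))%E); last first.
  apply/funext => y; have [y' gy'] := gS y.
  pose F x := (\1_A (g x - y) * \1_B (g x) : R)%:E.
  transitivity (\int[lam]_(x in (+%R^~ y') @^-1` setT) F (x + y')%R)%E.
    rewrite preimage_setT; apply: eq_integral => x _; rewrite /F gD gy' addrK.
    rewrite !indicE -natrM mulnb; congr (_%:R%:E); congr nat_of_bool.
    apply/idP/andP => [|[]]; rewrite !inE /S/= addrC; first by [].
    by split.
  apply: measure_preserving_integral => //.
  - exact: lebesgue_rV_add.
  - apply/measurable_EFinP; apply: measurable_funM.
      apply: (measurableT_comp (measurable_indic mA)).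
      exact: (@measurable_rVD _ _ _ _ g (fun=> - y)).
    exact: (measurableT_comp (measurable_indic mB)).
  - by move=> x; rewrite /F lee_fin mulr_ge0.
pose G (z : 'rV[R]_n * 'rV[R]_n) := (\1_A (g z.1 - z.2) * \1_B (g z.1) : R)%:E.
have mG : measurable_fun setT G.
  apply/measurable_EFinP; apply: measurable_funM.
    apply: (measurableT_comp (measurable_indic mA)).
    apply: measurable_rVD; first exact: measurableT_comp mg measurable_fst.
    by apply: measurable_rVN; exact: measurable_snd.
  apply: (measurableT_comp (measurable_indic mB)).
  exact: measurableT_comp mg measurable_fst.
have G0 z : (0 <= G z)%E by rewrite lee_fin mulr_ge0.
rewrite -(@fubini_tonelli _ _ _ _ _ lam lam G mG G0).
rewrite (_ : (fun x => _) =
    fun x => (lam (-%R @^-1` A) * (\1_(g @^-1` B) x : R)%:E)%E).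
  rewrite ge0_integralZl//; last by apply/measurable_EFinP.
  by rewrite integral_indic// setIT muleC.
apply/funext => x; rewrite /G/=.
have mNA : measurable ((fun y => g x - y) @^-1` A).
  apply: measurable_preimage mA.
  by apply: (@measurable_rVD _ _ _ _ (fun=> g x)) => //.
rewrite (_ : (fun y => _) = fun y =>
   ((\1_(g @^-1` B) x : R)%:E * (\1_((fun y => g x - y) @^-1` A) y : R)%:E)%E).
  rewrite ge0_integralZl//; last by apply/measurable_EFinP.
  rewrite integral_indic// setIT muleC; congr (_ * _)%E.
  apply: (etrans (esym ((lebesgue_rV_add (g x)).2 _ mNA))); congr (_ _).
  by apply/funext => y /=; rewrite opprD addrCA subrr addr0.
by apply/funext => y; rewrite -EFinM mulrC.
Qed.

(** Both [g] and the identity are put in the swap formula with [B] the unit ball, which is its own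
    preimage under [g]. The two right-hand sides coincide, and the measure of the ball, positive and
    finite, cancels; no determinant appears. *)
Lemma lebesgue_rV_isometry g : measurable_fun setT g ->
  {morph g : x y / x + y} -> (forall y, exists x, g x = y) ->
  (forall x, enorm (g x) = enorm x) ->
  measure_preserving lam lam g.
Proof.
move=> mg gD gS gN; split=> // A mA.
have mB : measurable (eball 0 1 : set 'rV[R]_n) := measurable_eball 0 1.
have gB : g @^-1` eball 0 1 = eball 0 1.
  by apply/seteqP; split=> x; rewrite /eball/= !subr0 gN.
have B0 := @lebesgue_rV_eball_gt0 1 ltr01.
have Boo := lebesgue_rV_eball_lty 1.
have Bfin : lam (eball 0 1) \is a fin_num by rewrite ge0_fin_numE// ltW.
have H1 := lebesgue_rV_additive_swap mg gD gS mA mB.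
have H2 := @lebesgue_rV_additive_swap id A (eball 0 1) (@measurable_id _ _ _)
  (fun x y => erefl) (fun y => ex_intro _ y erefl) mA mB.
move: H1; rewrite gB -[in RHS]H2.
move=> H; apply/eqP; rewrite eq_le.
by apply/andP; split; rewrite -(lee_pmul2r Bfin B0) H lexx.
Qed.

End lebesgue_isometry.

Section charts.
Context {R : realType} {n : nat}.

(* Coordinates [(tilde y, y_d)] centered at [chart_center] with axes the rows
   of [chart_rot], in which the boundary is the graph of [chart_fun]. *)
Record chart := Chart {
  chart_center : 'rV[R]_n.+1 ;
  chart_rot : 'M[R]_n.+1 ;
  chart_fun : 'rV[R]_n -> R }.

Definition tilde (v : 'rV[R]_n.+1) : 'rV[R]_n :=
  \row_(i < n) v 0 (widen_ord (leqnSn n) i).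

Definition chart_coord c (x : 'rV[R]_n.+1) := (x - chart_center c) *m (chart_rot c)^T.

Definition chart_base c x := tilde (chart_coord c x).

Definition chart_top c x := chart_coord c x 0 ord_max.

(** Measured along the last axis and not along the normal, so that the passage to [graph_coord] is a
    shear and preserves volume. *)
Definition chart_height c x := chart_top c x - chart_fun c (chart_base c x).

Definition chart_dtop c (v : 'rV[R]_n.+1) := (v *m (chart_rot c)^T) 0 ord_max.

Definition chart_dbase c (v : 'rV[R]_n.+1) := tilde (v *m (chart_rot c)^T).

(** The inverse of the pair ([chart_base], [chart_height]) when the rotation is orthogonal: the
    point at height [u] over the graph point of base [t]. *)
Definition chart_point c (t : 'rV[R]_n) (u : R) : 'rV[R]_n.+1 :=
  chart_center c + (\row_(i < n.+1)
    (if unlift ord_max i is Some j then t 0 j else u + chart_fun c t)) *m chart_rot c.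

Lemma tildeD v w : tilde (v + w) = tilde v + tilde w.
Proof. by apply/rowP => i; rewrite !mxE. Qed.

Lemma chart_dtopD c v w : chart_dtop c (v + w) = chart_dtop c v + chart_dtop c w.
Proof. by rewrite /chart_dtop mulmxDl mxE. Qed.

Lemma chart_dbaseD c v w :
  chart_dbase c (v + w) = chart_dbase c v + chart_dbase c w.
Proof. by rewrite /chart_dbase mulmxDl tildeD. Qed.

Lemma chart_baseD c x v : chart_base c (x + v) = chart_base c x + chart_dbase c v.
Proof. by rewrite /chart_base /chart_coord addrAC mulmxDl tildeD. Qed.

Lemma chart_topD c x v : chart_top c (x + v) = chart_top c x + chart_dtop c v.
Proof. by rewrite /chart_top /chart_coord addrAC mulmxDl mxE. Qed.

Lemma widen_lift (i : 'I_n) : widen_ord (leqnSn n) i = lift ord_max i.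
Proof. by apply: val_inj; rewrite /= /bump leqNgt ltn_ord. Qed.

Lemma enorm_tilde (v : 'rV[R]_n.+1) :
  enorm v ^+ 2 = enorm (tilde v) ^+ 2 + v 0 ord_max ^+ 2.
Proof.
rewrite !enorm_sqr big_ord_recr/=; congr (_ + _).
by apply: eq_bigr => i _; rewrite mxE.
Qed.

Section orthogonal.
Variables (c : chart) (cU : chart_rot c *m (chart_rot c)^T = 1%:M).

Lemma chart_rotK : (chart_rot c)^T *m chart_rot c = 1%:M.
Proof. exact: mulmx1C. Qed.

Lemma enorm_rot (v : 'rV[R]_n.+1) : enorm (v *m (chart_rot c)^T) = enorm v.
Proof.
have dotE (w : 'rV[R]_n.+1) : \sum_i w 0 i ^+ 2 = (w *m w^T) 0 0.
  by rewrite mxE; apply: eq_bigr => i _; rewrite mxE expr2.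
rewrite /enorm !dotE trmx_mul trmxK mulmxA -(mulmxA v) chart_rotK.
by rewrite mulmx1.
Qed.

Lemma enorm_rotV (v : 'rV[R]_n.+1) : enorm (v *m chart_rot c) = enorm v.
Proof. by rewrite -enorm_rot -mulmxA cU mulmx1. Qed.

Lemma chart_displacement v :
  enorm v ^+ 2 = enorm (chart_dbase c v) ^+ 2 + chart_dtop c v ^+ 2.
Proof. by rewrite -enorm_rot enorm_tilde. Qed.

Lemma enorm_chart_dbase v : enorm (chart_dbase c v) <= enorm v.
Proof.
by rewrite -(@ler_pXn2r _ 2) ?nnegrE ?enorm_ge0// chart_displacement lerDl sqr_ge0.
Qed.

Lemma norm_chart_dtop v : `|chart_dtop c v| <= enorm v.
Proof.
rewrite -(@ler_pXn2r _ 2) ?nnegrE ?enorm_ge0// chart_displacement.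
by rewrite real_normK ?num_real// lerDr sqr_ge0.
Qed.

Lemma chart_base_dist x y :
  enorm (chart_base c x - chart_base c y) <= enorm (x - y).
Proof.
by rewrite -{1}(subrKC y x) chart_baseD addrAC subrr add0r enorm_chart_dbase.
Qed.

Lemma chart_coord_point t u :
  chart_coord c (chart_point c t u) = \row_(i < n.+1)
    (if unlift ord_max i is Some j then t 0 j else u + chart_fun c t).
Proof.
by rewrite /chart_coord /chart_point addrAC subrr add0r -mulmxA cU mulmx1.
Qed.

Lemma chart_base_point t u : chart_base c (chart_point c t u) = t.
Proof.
apply/rowP => i; rewrite /chart_base chart_coord_point !mxE widen_lift.
by rewrite liftK.
Qed.

Lemma chart_height_point t u : chart_height c (chart_point c t u) = u.
Proof.
rewrite /chart_height chart_base_point /chart_top chart_coord_point mxE.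
by rewrite unlift_none addrK.
Qed.

Lemma chart_pointK x : chart_point c (chart_base c x) (chart_height c x) = x.
Proof.
rewrite /chart_point /chart_height subrK.
suff -> : \row_(i < n.+1) (if unlift ord_max i is Some j then chart_base c x 0 j
    else chart_top c x) = chart_coord c x.
  by rewrite /chart_coord -mulmxA chart_rotK mulmx1 subrKC.
apply/rowP => i; rewrite mxE; case: unliftP => [j ->|->] //.
by rewrite /chart_base mxE widen_lift.
Qed.

(** The recursion defining [lebesgue_rV] splits off the first coordinate while charts single out the
    last one; this isometry moves the vertical coordinate to the front. *)
Let split_rot (x : 'rV[R]_n.+1) : 'rV[R]_n.+1 :=
  rV_cons (chart_dtop c x, chart_dbase c x).

Lemma rV_unconsK : cancel (@rV_uncons R n) (@rV_cons R n).
Proof.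
move=> v; apply/rowP => j; rewrite /rV_cons mxE; case: splitP => k jk.
  by rewrite !mxE !ord1 eqxx mulr1n; congr (v _ _); apply: val_inj; rewrite /= jk ord1.
by rewrite !mxE; congr (v _ _); apply: val_inj; rewrite /= jk.
Qed.

Lemma enorm_rV_cons (a : R) (v : 'rV[R]_n) :
  enorm (rV_cons (a, v)) ^+ 2 = a ^+ 2 + enorm v ^+ 2.
Proof.
have [ea ev] : rV_uncons (rV_cons (a, v)) = (a, v) by exact: rV_consK.
rewrite !enorm_sqr big_ord_recl; congr (_ ^+ 2 + _); first exact: ea.
by apply: eq_bigr => i _; rewrite -[in RHS]ev mxE.
Qed.

Lemma measurable_tilde d (T : measurableType d) (f : T -> 'rV[R]_n.+1) :
  measurable_fun setT f -> measurable_fun setT (fun x => tilde (f x)).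
Proof.
move=> mf; apply: measurable_fun_rVP => j; under eq_fun do rewrite mxE.
exact: measurable_fun_rV_comp.
Qed.

Lemma measurable_chart_dtop : measurable_fun setT (chart_dtop c).
Proof.
rewrite /chart_dtop; under eq_fun do rewrite mxE; apply: measurable_sum => i.
by apply: measurable_funM => //; exact: measurable_coord.
Qed.

Lemma measurable_chart_dbase : measurable_fun setT (chart_dbase c).
Proof.
apply: measurable_tilde; apply: measurable_fun_rVP => j.
under eq_fun do rewrite mxE; apply: measurable_sum => i.
by apply: measurable_funM => //; exact: measurable_coord.
Qed.

Lemma measure_preserving_comp d1 d2 d3 (T1 : measurableType d1)
    (T2 : measurableType d2) (T3 : measurableType d3) (m1 : set T1 -> \bar R)
    (m2 : set T2 -> \bar R) (m3 : set T3 -> \bar R) (f : T1 -> T2) (g : T2 -> T3) :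
  measure_preserving m1 m2 f -> measure_preserving m2 m3 g ->
  measure_preserving m1 m3 (g \o f).
Proof.
move=> [mf fE] [mg gE]; split; first exact: measurableT_comp.
move=> A mA; rewrite comp_preimage fE ?gE//; exact: measurable_preimage.
Qed.

Let split_rot_preserving :
  measure_preserving (@lebesgue_rV R n.+1) (@lebesgue_rV R n.+1) split_rot.
Proof.
apply: lebesgue_rV_isometry.
- apply: (measurableT_comp (@measurable_rV_cons R n)).
  apply/measurable_fun_pairP; split; first exact: measurable_chart_dtop.
  exact: measurable_chart_dbase.
- move=> x y; rewrite /split_rot chart_dtopD chart_dbaseD /rV_cons/=.
  by apply/rowP => j; rewrite !mxE; case: splitP => k _; rewrite !mxE// mulrnDl.
- move=> y; exists ((\row_(i < n.+1) (if unlift ord_max i is Some j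
     then (rV_uncons y).2 0 j else (rV_uncons y).1)) *m chart_rot c).
  rewrite /split_rot /chart_dtop /chart_dbase -mulmxA cU mulmx1 -[RHS]rV_unconsK.
  congr rV_cons; rewrite /rV_uncons/= mxE unlift_none; congr pair.
  by apply/rowP => i; rewrite !mxE widen_lift liftK mxE.
- move=> x; apply/eqP; rewrite -(@eqrXn2 _ 2) ?enorm_ge0// enorm_rV_cons.
  by rewrite chart_displacement addrC.
Qed.

Definition graph_coord x : R * 'rV[R]_n := (chart_height c x, chart_base c x).

(** A translation, the isometry [split_rot], the identification with a product, and a shear by the
    graph function are composed. The shear preserves the product measure because, for each fixed
    base point, it translates the height: Fubini is applied with the height as inner variable. *)
Lemma graph_coord_preserving : measurable_fun setT (chart_fun c) ->
  measure_preserving (@lebesgue_rV R n.+1)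
    (@lebesgue_measure R \x @lebesgue_rV R n)%E graph_coord.
Proof.
move=> mf.
have -> : graph_coord = (fun z => (z.1 - chart_fun c z.2, z.2)) \o
    (@rV_uncons R n \o (split_rot \o (+%R^~ (- chart_center c)))).
  apply/funext => x; rewrite /comp /split_rot rV_consK /graph_coord.
  by rewrite /chart_height /chart_top /chart_base /chart_coord.
apply: (@measure_preserving_comp _ _ _ _ _ _ _
    (@lebesgue_measure R \x @lebesgue_rV R n)%E).
  apply: (@measure_preserving_comp _ _ _ _ _ _ _ (@lebesgue_rV R n.+1)).
    apply: measure_preserving_comp split_rot_preserving.
    exact: lebesgue_rV_add.
  split; first exact: measurable_rV_uncons.
  move=> A mA; rewrite /= /pushforward -comp_preimage.
  by congr (_ _); apply/funext => z; rewrite /= rV_consK.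
have mS : measurable_fun setT
    (fun z : measurableTypeR R * 'rV[R]_n => (z.1 - chart_fun c z.2, z.2)).
  apply/measurable_fun_pairP; split; last exact: measurable_snd.
  apply: measurable_funB; first exact: measurable_fst.
  exact: (measurableT_comp mf measurable_snd).
split => // A mA.
have mSA := measurable_preimage mS mA.
have mI B : measurable B ->
    measurable_fun setT (fun z : measurableTypeR R * 'rV[R]_n => (\1_B z : R)%:E).
  by move=> mB; apply/measurable_EFinP; exact: measurable_indic.
have I0 B z : (0 <= (\1_B z : R)%:E)%E by rewrite lee_fin.
have mE B : measurable B -> ((@lebesgue_measure R \x @lebesgue_rV R n) B =
    \int[@lebesgue_rV R n]_v \int[lebesgue_measure]_x (\1_B (x, v) : R)%:E)%E.
  move=> mB; rewrite -(@fubini_tonelli2 _ _ _ _ _ (@lebesgue_measure R)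
    (@lebesgue_rV R n) _ (mI _ mB))//.
  by rewrite integral_indic// setIT.
apply: (etrans (mE _ mSA)); apply: etrans (esym (mE _ mA)).
apply: eq_integral => v _.
transitivity (\int[lebesgue_measure]_(x in (+%R^~ (- chart_fun c v)%R) @^-1` setT)
   (\1_A ((x - chart_fun c v)%R, v) : R)%:E)%E; first by rewrite preimage_setT.
apply: (@measure_preserving_integral _ _ _ _ _ lebesgue_measure lebesgue_measure
   _ (fun x => (\1_A (x, v) : R)%:E)) => //; first exact: lebesgue_measure_addr.
by apply: (measurableT_comp (mI _ mA)); exact: measurable_pair2.
Qed.

(* Cylinders over a base set are products in graph coordinates. *)
Lemma integral_chart_strip (A : set 'rV[R]_n) (J : set R) (h : R -> \bar R) :
  measurable_fun setT (chart_fun c) -> measurable A -> measurable J ->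
  measurable_fun setT h -> (forall x, 0 <= h x)%E ->
  (\int[@lebesgue_rV R n.+1]_(x in [set x | J (chart_height c x) /\ A (chart_base c x)])
     h (chart_height c x) =
   @lebesgue_rV R n A * \int[lebesgue_measure]_(x in J) h x)%E.
Proof.
move=> mf mA mJ mh h0.
have mp := graph_coord_preserving mf.
have mJA : measurable (J `*` A : set (measurableTypeR R * 'rV[R]_n)).
  exact: measurableX.
transitivity (\int[(@lebesgue_measure R \x @lebesgue_rV R n)]_(z in J `*` A) h z.1)%E.
  rewrite -(measure_preserving_integral mp mJA)//.
  exact: (measurableT_comp mh measurable_fst).
rewrite integral_mkcond fubini_tonelli2//; last 2 first.
- apply/(measurable_restrictT _ _).1 => //.
  by apply: measurable_funTS; exact: (measurableT_comp mh measurable_fst).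
- by move=> z; rewrite patchE; case: ifP.
rewrite (_ : (fun y => _) = fun y =>
    ((\int[lebesgue_measure]_(x in J) h x) * (\1_A y : R)%:E)%E).
  rewrite ge0_integralZl//; [|by apply/measurable_EFinP|exact: integral_ge0].
  by rewrite integral_indic// setIT muleC.
apply/funext => v; rewrite indicE; case: (boolP (v \in A)) => vA.
  rewrite mule1 [RHS]integral_mkcond; apply: eq_integral => x _.
  by rewrite !patchE in_setX vA andbT.
rewrite mule0; apply: integral0_eq => x _.
by rewrite patchE in_setX (negbTE vA) andbF.
Qed.

End orthogonal.

End charts.

(** * Gaussian vectors and their characteristic functions *)

Section bounded_integrals.
Context d (T : measurableType d) (R : realType) (P : probability T R).
Implicit Types f g : T -> R.

Lemma bounded_integrable f (M : R) : measurable_fun setT f ->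
  (forall w, `|f w| <= M) -> P.-integrable setT (EFin \o f).
Proof.
move=> mf fM; apply: measurable_bounded_integrable => //.
  by rewrite (le_lt_trans (probability_le1 P measurableT))// ltry.
exists M; split; first exact: num_real.
by move=> x Mx w _; exact: (le_trans (fM w) (ltW Mx)).
Qed.

Lemma bounded_Rintegral_cvg (f_ : nat -> T -> R) f (M : R) :
  (forall m, measurable_fun setT (f_ m)) -> (forall m w, `|f_ m w| <= M) ->
  (forall w, f_ ^~ w @ \oo --> f w) ->
  \int[P]_w f_ m w @[m --> \oo] --> \int[P]_w f w.
Proof.
move=> mf_ fM ff.
have mf : measurable_fun setT f by apply: measurable_fun_cvg => // w _.
have fMl w : `|f w| <= M.
  have : `|f_ m w| @[m --> \oo] --> `|f w| by exact: cvg_norm.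
  by move/cvg_lim => <- //; apply: limr_le => //;
    [apply/cvg_ex; eexists; exact: (cvg_norm (ff w))|exact: nearW].
have [|||||_ _ H] := @dominated_convergence _ _ _ P setT measurableT
  (fun m => EFin \o f_ m) (EFin \o f) (fun=> M%:E).
- by move=> m; exact/measurable_EFinP.
- exact/measurable_EFinP.
- by apply: aeW => w _; apply/fine_cvgP; split; [exact: nearW|exact: ff].
- exact: (@bounded_integrable (fun=> M) `|M|).
- by apply: aeW => w m _; rewrite lee_fin.
apply: fine_cvg; rewrite fineK; last first.
  by apply: integrable_fin_num => //; exact: bounded_integrable fMl.
exact: H.
Qed.

End bounded_integrals.

(** * Equality of laws from equality of characteristic functions *)

Section sign_iteration.
Context {R : realType}.
Implicit Types x y : R.

(** The Newton-Schulz iteration for the sign function: an odd polynomial fixing [-1], [0] and [1]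
    whose iterates drive the nonzero points of [[-1, 1]] to their sign. *)
Definition sign_step x : R := (3 * x - x ^+ 3) / 2.

Lemma sign_step_itv x : 0 <= x <= 1 -> x <= sign_step x <= 1.
Proof.
move=> /andP[x0 x1].
have E1 : sign_step x - x = x * (1 - x) * (1 + x) / 2.
  by rewrite /sign_step; field.
have E2 : 1 - sign_step x = (1 - x) ^+ 2 * (2 + x) / 2.
  by rewrite /sign_step; field.
by rewrite -subr_ge0 E1 -[X in _ && X]subr_ge0 E2; apply/andP; split;
  rewrite !mulr_ge0 ?subr_ge0 ?addr_ge0 ?sqr_ge0.
Qed.

Lemma sign_stepN x : sign_step (- x) = - sign_step x.
Proof. by rewrite /sign_step; field. Qed.

Lemma iter_sign_stepN m x : iter m sign_step (- x) = - iter m sign_step x.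
Proof. by elim: m => //= m ->; exact: sign_stepN. Qed.

Lemma iter_sign_step_itv m x : 0 <= x <= 1 -> x <= iter m sign_step x <= 1.
Proof.
move=> /[dup] x01 /andP[x0 x1]; elim: m => [|m /andP[xm m1]]; first by rewrite lexx.
have /sign_step_itv/andP[h1 h2] : 0 <= iter m sign_step x <= 1.
  by rewrite (le_trans x0 xm).
by rewrite iterS h2 (le_trans xm h1).
Qed.

Lemma norm_iter_sign_step m x : `|x| <= 1 -> `|iter m sign_step x| <= 1.
Proof.
have H y : 0 <= y <= 1 -> `|iter m sign_step y| <= 1.
  move=> /[dup] /andP[y0 _] /(iter_sign_step_itv m)/andP[h1 h2].
  by rewrite ger0_norm// (le_trans y0).
have [x0|/ltW x0] := leP 0 x => x1.
  by apply: H; rewrite x0 -[X in X <= _]ger0_norm.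
rewrite -normrN -iter_sign_stepN; apply: H.
by rewrite oppr_ge0 x0 -[X in X <= _]ler0_norm.
Qed.

(** [1 - sign_step y = (1 - (y + y ^ 2) / 2) (1 - y)], and the iterates stay above [x], so every
    step multiplies the gap by at most [1 - x / 2]. *)
Lemma iter_sign_step_gap m x : 0 <= x <= 1 ->
  1 - iter m sign_step x <= (1 - x / 2) ^+ m.
Proof.
move=> /[dup] x01 /andP[x0 x1]; elim: m => [|m IH].
  by rewrite expr0 lerBlDr lerDl.
have /andP[h1 h2] := iter_sign_step_itv m x01.
rewrite iterS; set y := iter m sign_step x in h1 h2 IH *.
have -> : 1 - sign_step y = (1 - (y + y ^+ 2) / 2) * (1 - y).
  by rewrite /sign_step; field.
have y1 : 0 <= 1 - y by rewrite subr_ge0.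
rewrite [leRHS]exprS ler_pM//.
- rewrite subr_ge0 ler_pdivrMr// mul1r -[2]/(1 + 1) lerD// exprn_ile1//.
  exact: le_trans h1.
- rewrite lerB// ler_pM2r ?invr_gt0//.
  by rewrite (le_trans h1)// lerDl sqr_ge0.
Qed.

Lemma iter_sign_step_cvg x : `|x| <= 1 ->
  iter m sign_step x @[m --> \oo] --> Num.sg x.
Proof.
have H y : 0 < y <= 1 -> iter m sign_step y @[m --> \oo] --> (1 : R).
  move=> /andP[y0 y1]; have y01 : 0 <= y <= 1 by rewrite (ltW y0).
  have gap : (1 - y / 2) ^+ m @[m --> \oo] --> (0 : R).
    apply: cvg_expr; rewrite ger0_norm; last by lra.
    by lra.
  apply: (@squeeze_cvgr _ _ _ _ (fun m => 1 - (1 - y / 2) ^+ m) (fun=> 1)).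
  - apply: nearW => m; have /andP[_ ->] := iter_sign_step_itv m y01.
    by rewrite andbT lerBlDr addrC -lerBlDr iter_sign_step_gap.
  - by rewrite -[X in _ --> X]subr0; apply: cvgB gap; exact: cvg_cst.
  - exact: cvg_cst.
have [x0|x0|<-] := ltgtP 0 x => x1.
- by rewrite gtr0_sg//; apply: H; rewrite x0 -[X in X <= _]gtr0_norm.
- rewrite ltr0_sg//.
  have : iter m sign_step (- x) @[m --> \oo] --> (1 : R).
    by apply: H; rewrite oppr_gt0 x0 -[X in X <= _]ltr0_norm.
  move=> /cvgN; apply: cvg_trans; apply: near_eq_cvg; apply: nearW => m.
  by rewrite fctE iter_sign_stepN opprK.
- rewrite sgr0; rewrite (_ : (fun m => _) = fun=> 0); first exact: cvg_cst.
  apply/funext; elim=> //= m ->; rewrite /sign_step; ring.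
Qed.

End sign_iteration.

Section cramer_wold.
Context d1 d2 (T1 : measurableType d1) (T2 : measurableType d2) (R : realType)
  (P1 : probability T1 R) (P2 : probability T2 R) (k : nat).
Variables (Z1 : 'I_k -> T1 -> R) (Z2 : 'I_k -> T2 -> R).
Hypothesis mZ1 : forall j, measurable_fun setT (Z1 j).
Hypothesis mZ2 : forall j, measurable_fun setT (Z2 j).

Definition ridge (c z : 'I_k -> R) := \sum_j c j * z j.

(** Equality of characteristic functions without complex numbers: the phases [0] and [- pi / 2] give
    the real and imaginary parts. *)
Hypothesis cfE : forall c phi,
  \int[P1]_w cos (ridge c (Z1^~ w) + phi) =
  \int[P2]_w cos (ridge c (Z2^~ w) + phi).

Implicit Types (F G : ('I_k -> R) -> R) (c z : 'I_k -> R).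

Let test F := [/\ measurable_fun setT (fun w => F (Z1^~ w)),
  measurable_fun setT (fun w => F (Z2^~ w)),
  exists M : R, forall z, `|F z| <= M &
  forall c phi, \int[P1]_w (F (Z1^~ w) * cos (ridge c (Z1^~ w) + phi)) =
                \int[P2]_w (F (Z2^~ w) * cos (ridge c (Z2^~ w) + phi))].

(** The multipliers of the class [test]. They are closed under products by mere composition, hence
    under polynomials, which is what the iteration of [sign_step] requires. *)
Let mult G := forall F, test F -> test (fun z => F z * G z).

Let measurable_ridge1 c phi :
  measurable_fun setT (fun w => ridge c (Z1^~ w) + phi).
Proof.
apply: measurable_funD => //; apply: measurable_sum => j.
exact: measurable_funM.
Qed.

Let measurable_ridge2 c phi :
  measurable_fun setT (fun w => ridge c (Z2^~ w) + phi).
Proof.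
apply: measurable_funD => //; apply: measurable_sum => j.
exact: measurable_funM.
Qed.

Let mcos1 c phi : measurable_fun setT (fun w => cos (ridge c (Z1^~ w) + phi)).
Proof.
apply: measurableT_comp (measurable_ridge1 c phi).
by apply: continuous_measurable_fun; exact: continuous_cos.
Qed.

Let mcos2 c phi : measurable_fun setT (fun w => cos (ridge c (Z2^~ w) + phi)).
Proof.
apply: measurableT_comp (measurable_ridge2 c phi).
by apply: continuous_measurable_fun; exact: continuous_cos.
Qed.

Lemma norm_cos (x : R) : `|cos x| <= 1.
Proof. by rewrite ler_norml cos_geN1 cos_le1. Qed.

Let norm_mul_cos (a x M : R) : `|a| <= M -> `|a * cos x| <= M.
Proof.
move=> aM; rewrite normrM (le_trans _ aM)// ler_piMr//; exact: norm_cos.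
Qed.

Let test_int1 F c phi : test F ->
  P1.-integrable setT (EFin \o (fun w => F (Z1^~ w) * cos (ridge c (Z1^~ w) + phi))).
Proof.
move=> [mF1 _ [M FM] _]; apply: (@bounded_integrable _ _ _ _ _ M).
  exact: measurable_funM.
by move=> w; exact: norm_mul_cos.
Qed.

Let test_int2 F c phi : test F ->
  P2.-integrable setT (EFin \o (fun w => F (Z2^~ w) * cos (ridge c (Z2^~ w) + phi))).
Proof.
move=> [_ mF2 [M FM] _]; apply: (@bounded_integrable _ _ _ _ _ M).
  exact: measurable_funM.
by move=> w; exact: norm_mul_cos.
Qed.

Let test1 : test (fun=> 1).
Proof.
split=> //; first by exists 1 => z; rewrite normr1.
move=> c phi; under eq_Rintegral do rewrite mul1r.
by rewrite cfE; under [RHS]eq_Rintegral do rewrite mul1r.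
Qed.

Let test_lin (a : R) F G : test F -> test G -> test (fun z => a * F z + G z).
Proof.
move=> tF tG; have [mF1 mF2 [M FM] FE] := tF; have [mG1 mG2 [N GN] GE] := tG.
split.
- by apply: measurable_funD => //; exact: measurable_funM.
- by apply: measurable_funD => //; exact: measurable_funM.
- exists (`|a| * M + N) => z; rewrite (le_trans (ler_normD _ _))// lerD//.
  by rewrite normrM ler_wpM2l.
- move=> c phi; under eq_Rintegral do rewrite mulrDl -mulrA.
  rewrite RintegralD//; [|exact: integrableZl (test_int1 _ _ tF)|exact: test_int1].
  rewrite RintegralZl//; last exact: test_int1.
  under [RHS]eq_Rintegral do rewrite mulrDl -mulrA.
  rewrite RintegralD//; [|exact: integrableZl (test_int2 _ _ tF)|exact: test_int2].
  rewrite RintegralZl//; last exact: test_int2.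
  by rewrite FE GE.
Qed.

Let test_lim (F_ : nat -> ('I_k -> R) -> R) F (M : R) : (forall m, test (F_ m)) ->
  (forall m z, `|F_ m z| <= M) -> (forall z, F_ ^~ z @ \oo --> F z) -> test F.
Proof.
move=> tF FM FF; split.
- apply: (@measurable_fun_cvg _ _ _ _ (fun m w => F_ m (Z1^~ w))) => [m|w _].
    by have [] := tF m.
  exact: FF.
- apply: (@measurable_fun_cvg _ _ _ _ (fun m w => F_ m (Z2^~ w))) => [m|w _].
    by have [] := tF m.
  exact: FF.
- exists M => z; have : `|F_ m z| @[m --> \oo] --> `|F z| by exact: cvg_norm.
  move/cvg_lim => <- //; apply: limr_le; last exact: nearW.
  by apply/cvg_ex; eexists; exact: (cvg_norm (FF z)).
- move=> c phi.
  have c1 : \int[P1]_w (F_ m (Z1^~ w) * cos (ridge c (Z1^~ w) + phi)) @[m --> \oo] -->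
      \int[P1]_w (F (Z1^~ w) * cos (ridge c (Z1^~ w) + phi)).
    apply: (@bounded_Rintegral_cvg _ _ _ _ _ _ M) => [m|m w|w].
    - by apply: measurable_funM => //; have [] := tF m.
    - exact: norm_mul_cos.
    - by apply: cvgMr_tmp; exact: FF.
  have c2 : \int[P2]_w (F_ m (Z2^~ w) * cos (ridge c (Z2^~ w) + phi)) @[m --> \oo] -->
      \int[P2]_w (F (Z2^~ w) * cos (ridge c (Z2^~ w) + phi)).
    apply: (@bounded_Rintegral_cvg _ _ _ _ _ _ M) => [m|m w|w].
    - by apply: measurable_funM => //; have [] := tF m.
    - exact: norm_mul_cos.
    - by apply: cvgMr_tmp; exact: FF.
  have E m : \int[P1]_w (F_ m (Z1^~ w) * cos (ridge c (Z1^~ w) + phi)) =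
      \int[P2]_w (F_ m (Z2^~ w) * cos (ridge c (Z2^~ w) + phi)).
    by have [_ _ _ ->] := tF m.
  move: c1; under eq_fun do rewrite E; move=> c1.
  exact: cvg_unique c1 c2.
Qed.

Let mult_lin (a : R) F G : mult F -> mult G -> mult (fun z => a * F z + G z).
Proof.
move=> mF mG H tH; have := test_lin a (mF _ tH) (mG _ tH).
by congr test; apply/funext => z; rewrite mulrDr mulrCA.
Qed.

Let multM F G : mult F -> mult G -> mult (fun z => F z * G z).
Proof.
move=> mF mG H tH; have := mG _ (mF _ tH).
by congr test; apply/funext => z; rewrite mulrA.
Qed.

Let mult_cst (a : R) : mult (fun=> a).
Proof.
move=> F tF; have := test_lin (a - 1) tF tF.
by congr test; apply/funext => z; rewrite mulrBl mul1r subrK mulrC.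
Qed.

Let mult_lim (G_ : nat -> ('I_k -> R) -> R) G : (forall m, mult (G_ m)) ->
  (forall m z, `|G_ m z| <= 1) -> (forall z, G_ ^~ z @ \oo --> G z) -> mult G.
Proof.
move=> mG G1 GG F tF; have [_ _ [M FM] _] := tF.
apply: (@test_lim (fun m z => F z * G_ m z) _ M).
- by move=> m; exact: mG.
- by move=> m z; rewrite normrM (le_trans _ (FM z))// ler_piMr.
- by move=> z; apply: cvgMl_tmp; exact: GG.
Qed.

(** The product of two cosines is half the sum of the cosines of the sum and of the difference,
    whose frequencies [c + a] and [c - a] are again covered by the test property of [F]. *)
Let mult_cos a psi : mult (fun z => cos (ridge a z + psi)).
Proof.
move=> F tF; have [mF1 mF2 [M FM] FE] := tF; split.
- exact: measurable_funM.
- exact: measurable_funM.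
- by exists M => z; exact: norm_mul_cos.
- move=> c phi.
  pose cp j := c j + a j; pose cm j := c j - a j.
  have E z : F z * cos (ridge a z + psi) * cos (ridge c z + phi) =
      2^-1 * (F z * cos (ridge cp z + (phi + psi))) +
      2^-1 * (F z * cos (ridge cm z + (phi - psi))).
    have -> : ridge cp z + (phi + psi) = (ridge c z + phi) + (ridge a z + psi).
      rewrite /ridge /cp; under eq_bigr do rewrite mulrDl.
      by rewrite big_split/=; ring.
    have -> : ridge cm z + (phi - psi) = (ridge c z + phi) - (ridge a z + psi).
      rewrite /ridge /cm; under eq_bigr do rewrite mulrBl.
      by rewrite sumrB; ring.
    move: (ridge a z + psi) (ridge c z + phi) => u v.
    by rewrite cosD cosB; field.
  under eq_Rintegral do rewrite E; under [RHS]eq_Rintegral do rewrite E.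
  rewrite !RintegralD//; try exact: integrableZl (test_int1 _ _ tF);
    try exact: integrableZl (test_int2 _ _ tF).
  rewrite !RintegralZl//; try exact: test_int1; try exact: test_int2.
  by rewrite !FE.
Qed.

Let mult_iter m G : mult G -> mult (fun z => iter m sign_step (G z)).
Proof.
move=> mG; elim: m => //= m IH.
have := mult_lin (3 / 2) IH (multM (mult_cst (- 2^-1)) (multM IH (multM IH IH))).
by congr mult; apply/funext => z; rewrite /sign_step; field.
Qed.

Let mult_sg G : mult G -> (forall z, `|G z| <= 1) -> mult (fun z => Num.sg (G z)).
Proof.
move=> mG G1; apply: (mult_lim (fun m => mult_iter m mG)) => [m z|z].
  exact: norm_iter_sign_step.
exact: iter_sign_step_cvg.
Qed.

Let mult_sg_coord j (b : R) : mult (fun z => Num.sg (z j - b)).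
Proof.
pose a (m : nat) i : R := if i == j then m.+1%:R^-1 else 0.
have aE m z : ridge (a m) z = z j / m.+1%:R.
  rewrite /ridge (bigD1 j)//= big1 ?addr0; first by rewrite /a eqxx mulrC.
  by move=> i /negbTE ij; rewrite /a ij mul0r.
pose G m z := cos (ridge (a m) z + (- (b / m.+1%:R) - pi / 2)).
apply: (@mult_lim (fun m z => Num.sg (G m z))).
- move=> m; apply: mult_sg; first exact: mult_cos.
  by move=> z; exact: norm_cos.
- by move=> m z; rewrite normr_sg lern1 leq_b1.
- move=> z.
  have GE m : G m z = sin ((z j - b) / m.+1%:R).
    by rewrite /G aE addrA -mulrBl cosBpihalf.
  (* Once [|z_j - b| / (m + 1) < pi], the sine has the sign of [z_j - b], so the sequence is
     eventually constant. *)
  apply: cvg_near_cst.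
  have : (`|z j - b| / m.+1%:R) @[m --> \oo] --> (0 : R).
    rewrite -[X in _ --> X](mulr0 `|z j - b|); apply: cvgMl_tmp.
    exact: cvg_harmonic.
  move=> /cvgrPdist_lt/(_ _ (pi_gt0 R)); apply: filterS => m.
  rewrite sub0r normrN normrM !normr_id ger0_norm ?invr_ge0// => zm.
  rewrite GE; set y := z j - b in zm *.
  have m0 : (0 : R) < m.+1%:R^-1 by rewrite invr_gt0.
  case: (ltgtP 0 y) => y0.
  - rewrite !gtr0_sg// sin_gt0_pi// mulr_gt0//=.
    by rewrite gtr0_norm in zm.
  - rewrite !ltr0_sg// -oppr_gt0 -sinN sin_gt0_pi//.
    rewrite -mulNr mulr_gt0 ?oppr_gt0//=.
    by rewrite ltr0_norm in zm.
  - by rewrite -y0 mul0r sin0.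
Qed.

(** With [s] the sign of [z_j - b], the polynomial [1 - s / 2 - s ^ 2 / 2] takes the value [1] at
    [s = -1] and [s = 0], and [0] at [s = 1]. *)
Let mult_le j (b : R) : mult (fun z => (z j <= b)%R%:R).
Proof.
have ms := mult_sg_coord j b.
have := mult_lin (- 2^-1) ms (mult_lin (- 2^-1) (multM ms ms) (mult_cst 1)).
congr mult; apply/funext => z; case: (ltgtP (z j) b) => zb.
- by rewrite ltr0_sg ?subr_lt0//=; field.
- by rewrite gtr0_sg ?subr_gt0//=; field.
- by rewrite zb subrr sgr0 !mulr0 !add0r.
Qed.

(* The functions [F] for which [E F(Z) cos(c.Z + phi)] agrees for both vectors
   are stable under multiplication by [cos(a.z + psi)], hence by polynomials in
   [sin((z_j - b) / m)]; iterating [(3 x - x ^ 3) / 2] yields the sign of the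
   sine, and [m -> oo] the sign of [z_j - b]. *)
Lemma cramer_wold (b : 'I_k -> R) :
  P1 [set w | forall j, Z1 j w <= b j] = P2 [set w | forall j, Z2 j w <= b j].
Proof.
have tP s : test (fun z => \prod_(j <- s) (z j <= b j)%R%:R).
  elim: s => [|j s IH]; first by under eq_fun do rewrite big_nil.
  under eq_fun do rewrite big_cons mulrC.
  exact: mult_le.
have [_ _ _ /(_ (fun=> 0) 0)] := tP (index_enum 'I_k).
have r0 z : ridge (fun=> 0) z = 0.
  by rewrite /ridge big1// => j _; rewrite mul0r.
have prodE z : \prod_(j : 'I_k) (z j <= b j)%R%:R * cos (ridge (fun=> 0) z + 0) =
    \1_[set z | forall j, z j <= b j] z :> R.
  rewrite r0 addr0 cos0 mulr1 indicE.
  have [zb|zb] := pselect (forall j, z j <= b j).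
    by rewrite mem_set// big1// => j _; rewrite zb.
  rewrite memNset//; have /existsNP[j /negP/negbTE zj] := zb.
  by rewrite (bigD1 j)//= zj mul0r.
under eq_Rintegral do rewrite prodE; under [RHS]eq_Rintegral do rewrite prodE.
rewrite /Rintegral.
pose A1 := [set w | forall j, Z1 j w <= b j].
pose A2 := [set w | forall j, Z2 j w <= b j].
have mA1 : measurable A1.
  rewrite (_ : A1 = \bigcap_(j in [set: 'I_k]) (Z1 j @^-1` `]-oo, b j])).
    by apply: fin_bigcap_measurable => // j _; exact: measurable_preimage.
  apply/seteqP; split=> w H j; last by have := H j I; rewrite /= in_itv.
  by move=> _; rewrite /= in_itv/=; exact: H.
have mA2 : measurable A2.
  rewrite (_ : A2 = \bigcap_(j in [set: 'I_k]) (Z2 j @^-1` `]-oo, b j])).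
    by apply: fin_bigcap_measurable => // j _; exact: measurable_preimage.
  apply/seteqP; split=> w H j; last by have := H j I; rewrite /= in_itv.
  by move=> _; rewrite /= in_itv/=; exact: H.
rewrite (_ : (fun w => _) = (fun w => (\1_A1 w)%:E)); last first.
  by apply/funext => w.
rewrite (_ : (fun w : T2 => _) = (fun w => (\1_A2 w)%:E)); last first.
  by apply/funext => w.
rewrite !integral_indic// !setIT => E.
by rewrite -[LHS]fineK ?fin_num_measure// E fineK// fin_num_measure.
Qed.

End cramer_wold.

(** * Layer-cake formula and the standard normal law *)

Section layer_cake.
Context {R : realType}.
Local Notation leb := (@lebesgue_measure R).

Lemma integral_subgraph (a : R) : 0 <= a ->
  (\int[leb]_(u in `[0%R, +oo[) (\1_[set u | u < a] u : R)%:E = a%:E)%E.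
Proof.
move=> a0; have -> : [set u | u < a] = `]-oo, a[%classic.
  by apply/seteqP; split=> u; rewrite /= in_itv.
rewrite integral_indic//=.
rewrite (_ : _ `&` _ = `[0, a[%classic); last first.
  apply/seteqP; split=> u; rewrite /= !in_itv/= ?andbT; first by move=> [-> ->].
  by move=> /andP[-> ->].
rewrite lebesgue_measure_itv/= lte_fin; case: ifPn => [_|].
  by rewrite oppr0 adde0.
by rewrite -leNgt => a0'; congr EFin; apply/eqP; rewrite eq_le a0.
Qed.

Lemma measurable_superlevel d (T : measurableType d) (f : T -> R) u :
  measurable_fun setT f -> measurable [set x | u < f x].
Proof.
move=> mf; rewrite (_ : mkset _ = f @^-1` `]u, +oo[); first exact: measurable_preimage.
by apply/seteqP; split=> z /=; rewrite in_itv/= andbT.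
Qed.

Lemma measurable_sublevel d (T : measurableType d) (f : T -> R) u :
  measurable_fun setT f -> measurable [set x | f x <= u].
Proof.
move=> mf; rewrite (_ : mkset _ = f @^-1` `]-oo, u]); first exact: measurable_preimage.
by apply/seteqP; split=> z /=; rewrite in_itv/=.
Qed.

(** Tonelli on the subgraph of [f]. The weight lets the formula serve both for measures with a
    density and for isolating one factor of a product of independent variables. *)
Lemma layer_cake_weighted d (T : measurableType d)
    (m : {sigma_finite_measure set T -> \bar R}) (g f : T -> R) :
  measurable_fun setT g -> (forall x, 0 <= g x) ->
  measurable_fun setT f -> (forall x, 0 <= f x) ->
  (\int[m]_x (f x * g x)%:E =
   \int[leb]_(u in `[0%R, +oo[) \int[m]_(x in [set x | (u < f x)%R]) (g x)%:E)%E.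
Proof.
move=> mg g0 mf f0.
pose S := [set z : T * measurableTypeR R | z.2 < f z.1 /\ 0 <= z.2].
have mS1 : measurable [set z : T * measurableTypeR R | z.2 < f z.1].
  rewrite (_ : mkset _ = [set z : T * measurableTypeR R | 0 < f z.1 - z.2]).
    apply: measurable_superlevel; apply: measurable_funB => //.
    exact: (measurableT_comp mf measurable_fst).
  by apply/seteqP; split=> z /=; rewrite subr_gt0.
have mS2 : measurable [set z : T * measurableTypeR R | 0 <= z.2].
  rewrite (_ : mkset _ = (fun z : T * measurableTypeR R => z.2) @^-1` `[0, +oo[).
    by apply: measurable_preimage => //; exact: measurable_snd.
  by apply/seteqP; split=> z /=; rewrite in_itv/= andbT.
have mS : measurable S by exact: measurableI.
have mI : measurable_fun setT (fun z => (g z.1 * \1_S z : R)%:E).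
  apply/measurable_EFinP; apply: measurable_funM; last exact: measurable_indic.
  exact: (measurableT_comp mg measurable_fst).
have I0 z : (0 <= (g z.1 * \1_S z : R)%:E)%E by rewrite lee_fin mulr_ge0.
have F := @fubini_tonelli _ _ _ _ _ m leb _ mI I0.
transitivity (\int[m]_x \int[leb]_u (g x * \1_S (x, u) : R)%:E)%E.
  apply: eq_integral => x _; rewrite mulrC EFinM -(integral_subgraph (f0 x)).
  rewrite -ge0_integralZl ?lee_fin//; last first.
    apply/measurable_EFinP; apply: measurable_funTS; apply: measurable_indic.
    by rewrite (_ : [set u | u < f x] = `]-oo, f x[%classic).
  rewrite [LHS]integral_mkcond.
  apply: eq_integral => u _; rewrite patchE !indicE.
  have [u0|u0] := leP 0 u; last first.
    rewrite memNset; last by rewrite /= in_itv/= andbT leNgt u0.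
    by rewrite memNset ?mulr0// => -[_ /=]; rewrite leNgt u0.
  rewrite mem_set; last by rewrite /= in_itv/= u0.
  rewrite -EFinM; congr (_ * (nat_of_bool _)%:R)%:E.
  by apply/idP/idP; rewrite !inE /S/=; [split|case].
rewrite F; rewrite [RHS]integral_mkcond; apply: eq_integral => u _.
rewrite patchE; have [u0|u0] := leP 0 u; last first.
  rewrite memNset; last by rewrite /= in_itv/= andbT leNgt u0.
  apply: integral0_eq => x _; rewrite indicE memNset ?mulr0//.
  by move=> [_ /=]; rewrite leNgt u0.
rewrite mem_set; last by rewrite /= in_itv/= u0.
rewrite [RHS]integral_mkcond; apply: eq_integral => x _.
rewrite patchE indicE; have [fu|fu] := ltP u (f x).
  by rewrite !mem_set ?mulr1.
by rewrite !memNset ?mulr0//= ?ltNge ?fu//; rewrite /S/= => -[]; rewrite ltNge fu.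
Qed.

Lemma layer_cake d (T : measurableType d)
    (m : {sigma_finite_measure set T -> \bar R}) (f : T -> R) :
  measurable_fun setT f -> (forall x, 0 <= f x) ->
  (\int[m]_x (f x)%:E = \int[leb]_(u in `[0%R, +oo[) m [set x | (u < f x)%R])%E.
Proof.
move=> mf f0; have := @layer_cake_weighted _ _ m (fun=> 1) f.
under eq_integral do rewrite mulr1; move=> ->//.
apply: eq_integral => u _.
by rewrite integral_cst ?mul1e//; exact: measurable_superlevel.
Qed.

(** The layer-cake formula reduces the integral of [f] to the measures of its superlevel sets, where
    the density is known by hypothesis. *)
Lemma integral_density d (T : measurableType d)
    (m nu : {sigma_finite_measure set T -> \bar R}) (g f : T -> R) :
  measurable_fun setT g -> (forall x, 0 <= g x) ->
  (forall A, measurable A -> nu A = \int[m]_(x in A) (g x)%:E)%E ->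
  measurable_fun setT f -> (forall x, 0 <= f x) ->
  (\int[nu]_x (f x)%:E = \int[m]_x (f x * g x)%:E)%E.
Proof.
move=> mg g0 nuE mf f0; rewrite layer_cake// layer_cake_weighted//.
by apply: eq_integral => u _; rewrite nuE//; exact: measurable_superlevel.
Qed.

End layer_cake.

Section standard_normal.
Context {R : realType}.
Local Notation leb := (@lebesgue_measure R).
Local Notation N01 := (@normal_prob R 0 1).

Lemma lebesgue_integral_scale (s : R) (g : R -> \bar R) : 0 < s ->
  measurable_fun setT g -> (forall x, 0 <= g x)%E ->
  (\int[leb]_x g x = s%:E * \int[leb]_x g (s * x)%R)%E.
Proof.
move=> s0 mg g0; pose s' := NngNum (ltW s0).
have ms : measurable_fun [set: measurableTypeR R]
    (( *%R s) : measurableTypeR R -> measurableTypeR R).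
  exact: measurable_funM.
have mp : measure_preserving (mscale s' leb) leb ( *%R s).
  split=> // A mA.
  pose F : {mfun _ >-> _} := HB.pack
    (( *%R s) : measurableTypeR R -> measurableTypeR R)
    (isMeasurableFun.Build _ _ _ _ _ ms).
  symmetry.
  apply: (@lebesgue_measure_unique R (pushforward (mscale s' leb) F)) => //.
  move=> _ [[a b] _ <-]; rewrite /= /pushforward/= /mscale/=.
  have -> : ( *%R s) @^-1` `]a, b] = `]a / s, b / s]%classic :> set R.
    apply/seteqP; split=> x /=; rewrite !in_itv/= ltr_pdivrMr// ler_pdivlMr//;
      by rewrite ![x * s]mulrC.
  rewrite !lebesgue_measure_itv/= !lte_fin ltr_pM2r ?invr_gt0//.
  case: ifPn; rewrite ?mule0// => _.
  by rewrite -!EFinB -EFinM; congr EFin; field; rewrite gt_eqF.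
have := measure_preserving_integral mp measurableT mg g0.
rewrite preimage_setT => <-; rewrite ge0_integral_mscale//.
exact: measurableT_comp mg ms.
Qed.

Lemma lebesgue_integral_translate (v : R) (g : R -> \bar R) :
  measurable_fun setT g -> (forall x, 0 <= g x)%E ->
  (\int[leb]_x g x = \int[leb]_x g (x + v)%R)%E.
Proof.
move=> mg g0.
have := measure_preserving_integral (lebesgue_measure_addr v) measurableT mg g0.
by rewrite preimage_setT.
Qed.

Lemma lebesgue_integral_opp (g : R -> \bar R) :
  measurable_fun setT g -> (forall x, 0 <= g x)%E ->
  (\int[leb]_x g x = \int[leb]_x g (- x)%R)%E.
Proof.
move=> mg g0.
have mp : measure_preserving leb leb (-%R : R -> R).
  split=> [|A mA]; first exact: measurable_funN.
  exact: lebesgue_measureN.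
have := measure_preserving_integral mp measurableT mg g0.
by rewrite preimage_setT.
Qed.

Lemma normal_pdfN_sd (m s x : R) : normal_pdf m (- s) x = normal_pdf m s x.
Proof.
by rewrite /normal_pdf oppr_eq0 /normal_peak /normal_fun sqrrN.
Qed.

Lemma normal_peak_scale (s : R) : 0 < s -> normal_peak s = s^-1 * normal_peak 1.
Proof.
move=> s0; rewrite /normal_peak -mulrnAr sqrtrM ?sqr_ge0//.
by rewrite sqrtr_sqr gtr0_norm// invfM expr1n mul1r.
Qed.

Lemma normal_pdf_scale (m s x : R) : 0 < s ->
  s * normal_pdf m s (s * x + m) = normal_pdf 0 1 x.
Proof.
move=> s0; rewrite /normal_pdf oner_eq0 gt_eqF// normal_peak_scale//.
rewrite !mulrA divff ?gt_eqF// mul1r; congr (_ * _); rewrite /normal_fun.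
congr expR; rewrite addrK subr0 expr1n !mulr2n; field.
by rewrite gt_eqF// addr_gt0 ?exprn_gt0.
Qed.

Lemma integral_normal_prob (m s : R) (f : R -> R) : 0 < s ->
  measurable_fun setT f -> (forall x, 0 <= f x) ->
  (\int[normal_prob m s]_x (f x)%:E = \int[leb]_x (f x * normal_pdf m s x)%:E)%E.
Proof.
move=> s0 mf f0; apply: (@integral_density _ _ _ leb (normal_prob m s)) => //.
  exact: measurable_normal_pdf.
exact: normal_pdf_ge0.
Qed.

Lemma integral_normal_prob01 (m s : R) (f : R -> R) : 0 < s ->
  measurable_fun setT f -> (forall x, 0 <= f x) ->
  (\int[normal_prob m s]_x (f x)%:E = \int[N01]_x (f (s * x + m)%R)%:E)%E.
Proof.
move=> s0 mf f0.
have mp := @measurable_normal_pdf R m s.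
have p0 := @normal_pdf_ge0 R m s.
have mg : measurable_fun setT (fun x => (f x * normal_pdf m s x)%:E).
  by apply/measurable_EFinP; exact: measurable_funM.
have mt : measurable_fun setT (fun x : R => s * x + m).
  by apply: measurable_funD => //; exact: measurable_funM.
have g0 x : (0 <= (f x * normal_pdf m s x)%:E)%E by rewrite lee_fin mulr_ge0.
have mft : measurable_fun setT (fun x => f (s * x + m)) by exact: measurableT_comp.
apply: (etrans (integral_normal_prob m s0 mf f0)).
apply: (etrans (lebesgue_integral_translate m mg g0)).
pose g x := (f (x + m) * normal_pdf m s (x + m))%:E.
have mgm : measurable_fun setT g.
  by apply: (measurableT_comp mg); exact: measurable_funD.
apply: (etrans (@lebesgue_integral_scale s g s0 mgm (fun x => g0 _))).
apply: (etrans _ (esym (integral_normal_prob 0 ltr01 mft (fun x => f0 _)))).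
rewrite -ge0_integralZl ?lee_fin ?(ltW s0)//; last 2 first.
- exact: (measurableT_comp mg mt).
- by move=> x _; exact: g0.
by apply: eq_integral => x _; rewrite /g -EFinM mulrCA normal_pdf_scale.
Qed.

Lemma integral_normal_opp (f : R -> R) :
  measurable_fun setT f -> (forall x, 0 <= f x) ->
  (\int[N01]_x (f (- x)%R)%:E = \int[N01]_x (f x)%:E)%E.
Proof.
move=> mf f0.
have mN : measurable_fun setT (-%R : R -> R) by exact: measurable_funN.
have mg : measurable_fun setT (fun x => (f x * normal_pdf 0 1 x)%:E).
  apply/measurable_EFinP; apply: measurable_funM => //.
  exact: measurable_normal_pdf.
have g0 x : (0 <= (f x * normal_pdf 0 1 x)%:E)%E.
  by rewrite lee_fin mulr_ge0// normal_pdf_ge0.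
apply: (etrans (integral_normal_prob 0 ltr01 (measurableT_comp mf mN) (fun x => f0 _))).
apply: (etrans _ (esym (integral_normal_prob 0 ltr01 mf f0))).
apply: (etrans _ (esym (lebesgue_integral_opp mg g0))).
apply: eq_integral => x _; congr (_ * _)%:E.
by rewrite /normal_pdf oner_eq0 /normal_fun !subr0 sqrrN.
Qed.

(** The two factorizations of a joint Gaussian density: if [X] is standard normal and [U] given [X]
    has mean [a X] and deviation [b], then [U] has deviation [c], and [X] given [U] has mean
    [a U / c ^ 2] and deviation [b / c]. *)
Lemma normal_pdf_convolution (a b u x : R) : 0 < a -> 0 < b ->
  let c := Num.sqrt (a ^+ 2 + b ^+ 2) in
  normal_pdf (a * x) b u * normal_pdf 0 1 x =
  normal_pdf 0 c u * normal_pdf (a * u / c ^+ 2) (b / c) x.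
Proof.
move=> a0 b0 c.
have c2 : c ^+ 2 = a ^+ 2 + b ^+ 2 by rewrite sqr_sqrtr// addr_ge0 ?sqr_ge0.
have c0 : 0 < c by rewrite sqrtr_gt0 addr_gt0// exprn_gt0.
have bc0 : 0 < b / c by rewrite divr_gt0.
rewrite /normal_pdf oner_eq0 !gt_eqF// (normal_peak_scale b0).
rewrite (normal_peak_scale c0) (normal_peak_scale bc0).
have E : normal_fun (a * x) b u * normal_fun 0 1 x =
    normal_fun 0 c u * normal_fun (a * u / c ^+ 2) (b / c) x.
  rewrite /normal_fun -!expRD; congr expR.
  have cE : c ^+ 2 != 0 by rewrite gt_eqF// exprn_gt0.
  rewrite expr_div_n; move: cE; rewrite c2 => cE.
  clearbody c; rewrite !mulr2n; field.
  by rewrite cE -c2 !gt_eqF// addr_gt0// exprn_gt0.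
move: E; move: (normal_fun _ _ _) (normal_fun _ _ _) (normal_fun _ _ _)
  (normal_fun _ _ _) => f1 f2 f3 f4 E; clearbody c.
move: (normal_peak 1) => p; transitivity (b^-1 * p * p * (f4 * f3)); first by ring.
by rewrite E; field; rewrite !gt_eqF.
Qed.

End standard_normal.

Lemma Rintegral_prob_cst d (T : measurableType d) (R : realType)
  (P : probability T R) (r : R) : \int[P]_w r = r.
Proof.
rewrite Rintegral_cst// -[RHS]mulr1; congr (_ * _).
exact: (congr1 fine (probability_setT P)).
Qed.

Section gaussian_cf.
Context {R : realType}.
Local Notation leb := (@lebesgue_measure R).
Local Notation N01 := (@normal_prob R 0 1).

Lemma measurable_normal_pdf2 (a b : R) : b != 0 ->
  measurable_fun setT (fun z : measurableTypeR R * measurableTypeR R =>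
    normal_pdf (a * z.1) b z.2).
Proof.
move=> b0; rewrite /normal_pdf (negbTE b0); apply: measurable_funM => //.
rewrite /normal_fun; apply: (measurableT_comp (@measurable_expR R)).
apply: measurable_funM => //; apply: measurable_funN.
apply: measurable_funX; apply: measurable_funB; first exact: measurable_snd.
by apply: measurable_funM => //; exact: measurable_fst.
Qed.

(* Completing the square in [normal_pdf_convolution] makes the inner integral
   that of a normal density. *)
Lemma integral_normal_rotation (a b : R) (f : R -> R) : 0 < a -> 0 < b ->
  measurable_fun setT f -> (forall x, 0 <= f x) ->
  (\int[N01]_x \int[N01]_y (f (a * x + b * y)%R)%:E =
   \int[N01]_x (f (Num.sqrt (a ^+ 2 + b ^+ 2) * x)%R)%:E)%E.
Proof.
move=> a0 b0 mf f0; set c := Num.sqrt _.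
have c0 : 0 < c by rewrite sqrtr_gt0 addr_gt0// exprn_gt0.
have p0 := @normal_pdf_ge0 R.
pose h (z : measurableTypeR R * measurableTypeR R) :=
  (f z.2 * normal_pdf (a * z.1) b z.2)%:E.
have mh : measurable_fun setT h.
  apply/measurable_EFinP; apply: measurable_funM.
    exact: (measurableT_comp mf measurable_snd).
  by apply: measurable_normal_pdf2; rewrite gt_eqF.
have h0 z : (0 <= h z)%E by rewrite lee_fin mulr_ge0.
transitivity (\int[N01]_x \int[leb]_y h (x, y))%E.
  apply: eq_integral => x _.
  apply: (etrans _ (integral_normal_prob (a * x) b0 mf f0)).
  apply: (etrans _ (esym (integral_normal_prob01 (a * x) b0 mf f0))).
  by apply: eq_integral => y _; rewrite addrC.
apply: (etrans (@fubini_tonelli _ _ _ _ _ N01 leb h mh h0)).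
transitivity (\int[normal_prob 0 c]_x (f x)%:E)%E; last first.
  apply: (etrans (integral_normal_prob01 0 c0 mf f0)).
  by apply: eq_integral => x _; rewrite addr0.
apply: (etrans _ (esym (integral_normal_prob 0 c0 mf f0))).
apply: eq_integral => u _.
pose g x := f u * normal_pdf (a * x) b u.
have mg : measurable_fun setT g.
  apply: measurable_funM => //.
  have /measurable_normal_pdf2 mp : b != 0 by rewrite gt_eqF.
  exact: (measurableT_comp (mp a) (measurable_pair2 u)).
have g0 x : 0 <= g x by rewrite mulr_ge0.
apply: (etrans (integral_normal_prob 0 ltr01 mg g0)).
rewrite (_ : (fun x => _) = fun x => ((f u * normal_pdf 0 c u)%:E *
    (normal_pdf (a * u / c ^+ 2) (b / c) x)%:E)%E).
  rewrite ge0_integralZl ?lee_fin ?mulr_ge0//; last 2 first.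
  - by apply/measurable_EFinP; exact: measurable_normal_pdf.
  - by move=> x _; rewrite lee_fin.
  by rewrite integral_normal_pdf mule1.
apply/funext => x; rewrite /g -EFinM -!(mulrA (f u)).
by congr (_ * _)%:E; exact: normal_pdf_convolution.
Qed.

Lemma N01_integrable_bounded (f : R -> R) : measurable_fun setT f ->
  (forall x, `|f x| <= 1) -> N01.-integrable setT (EFin \o f).
Proof. exact: (@bounded_integrable _ _ _ N01). Qed.

Definition normal_cf (s : R) := \int[N01]_x cos (s * x).

Let msin (s : R) : measurable_fun setT (fun x => sin (s * x)).
Proof.
apply: (@measurableT_comp _ _ _ _ _ _ (@sin R)).
  by apply: continuous_measurable_fun; exact: continuous_sin.
exact: measurable_funM.
Qed.

Let mcos (s : R) : measurable_fun setT (fun x => cos (s * x)).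
Proof.
apply: (@measurableT_comp _ _ _ _ _ _ (@cos R)).
  by apply: continuous_measurable_fun; exact: continuous_cos.
exact: measurable_funM.
Qed.

Lemma norm_sin (x : R) : `|sin x| <= 1.
Proof. by rewrite ler_norml sin_geN1 sin_le1. Qed.

Lemma normal_cf0 : normal_cf 0 = 1.
Proof.
rewrite /normal_cf; under eq_Rintegral do rewrite mul0r cos0.
exact: (Rintegral_prob_cst N01).
Qed.

(* The restriction to nonnegative integrands is circumvented by adding
   [fun x => `|f x|]. *)
Lemma ge0_transfer d1 d2 (T1 : measurableType d1) (T2 : measurableType d2)
    (m1 : {measure set T1 -> \bar R}) (m2 : {measure set T2 -> \bar R})
    (A1 : T1 -> R) (A2 : T2 -> R) :
  measurable_fun setT A1 -> measurable_fun setT A2 ->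
  (forall f : R -> R, measurable_fun setT f -> (forall x, 0 <= f x) ->
    (\int[m1]_x (f (A1 x))%:E = \int[m2]_x (f (A2 x))%:E)%E) ->
  forall f : R -> R, measurable_fun setT f ->
    m2.-integrable setT (EFin \o (f \o A2)) ->
    m1.-integrable setT (EFin \o (f \o A1)) /\
    (\int[m1]_x (f (A1 x))%:E = \int[m2]_x (f (A2 x))%:E)%E.
Proof.
move=> mA1 mA2 E f mf i2.
have mnf : measurable_fun setT (fun x => `|f x|) by exact: measurableT_comp.
have En := E _ mnf (fun x => normr_ge0 _).
have i1 : m1.-integrable setT (EFin \o (f \o A1)).
  apply/integrableP; split; first by apply/measurable_EFinP; exact: measurableT_comp.
  under eq_integral do rewrite /=.
  rewrite (_ : (fun x => _) = fun x => (`|f (A1 x)|)%:E)//.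
  by rewrite En; have /integrableP[] := i2.
split=> //.
have in1 := integrable_norm i1; have in2 := integrable_norm i2.
have pos x : 0 <= f x + `|f x|.
  by have := ler_norm (- f x); rewrite normrN => ?; lra.
have := E (fun x => f x + `|f x|) (measurable_funD mf mnf) pos.
under eq_integral do rewrite EFinD.
rewrite integralD//.
under [in RHS]eq_integral do rewrite EFinD.
rewrite integralD// En.
have F1 := integrable_fin_num measurableT i1.
have F2 := integrable_fin_num measurableT i2.
have Fn := integrable_fin_num measurableT in2.
rewrite -[X in (X + _ = _)%E](fineK F1) -[X in (_ = X + _)%E](fineK F2).
rewrite -[X in (_ = _ + X)%E](fineK Fn) -[X in (_ + X = _)%E](fineK Fn).
rewrite -!EFinD => -[] /addIr H.
by apply: (etrans (esym (fineK F1))); apply: (etrans _ (fineK F2)); rewrite H.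
Qed.

Lemma normal_sin0 (s : R) : \int[N01]_x sin (s * x) = 0.
Proof.
have mN : measurable_fun setT (-%R : R -> R) by exact: measurable_funN.
have [_ E] := @ge0_transfer _ _ _ _ N01 N01 (fun x => - x) id mN (@measurable_id _ _ _)
  integral_normal_opp (fun x => sin (s * x)) (msin s)
  (N01_integrable_bounded (msin s) (fun x => norm_sin _)).
have : \int[N01]_x sin (s * (- x)) = \int[N01]_x sin (s * x) by congr fine.
under eq_Rintegral do rewrite mulrN sinN -mulN1r.
rewrite RintegralZl//; last exact: (N01_integrable_bounded (msin s) (fun x => norm_sin _)).
by rewrite mulN1r => /eqP; rewrite eq_sym -addr_eq0 -mulr2n mulrn_eq0 => /eqP.
Qed.

(** The rotation formula holds for nonnegative integrands, hence the use of [1 + cos]. Expanding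
    [cos (a x + b y)], the product of sines integrates to [0] by symmetry. The rotation also
    requires positive coefficients, so zero ones are treated apart. *)
Lemma normal_cfM (a b : R) : 0 <= a -> 0 <= b ->
  normal_cf a * normal_cf b = normal_cf (Num.sqrt (a ^+ 2 + b ^+ 2)).
Proof.
rewrite le_eqVlt => /predU1P[<-|a0].
  by move=> b0; rewrite normal_cf0 mul1r expr0n add0r sqrtr_sqr ger0_norm.
rewrite le_eqVlt => /predU1P[<-|b0].
  by rewrite normal_cf0 mulr1 expr0n addr0 sqrtr_sqr gtr0_norm.
have m1 : measurable_fun setT (fun x : R => 1 + cos x).
  apply: measurable_funD => //.
  by apply: continuous_measurable_fun; exact: continuous_cos.
have f0 (x : R) : 0 <= 1 + cos x by have := cos_geN1 x; lra.
have ic s := N01_integrable_bounded (mcos s) (fun x => norm_cos _).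
have is_ s := N01_integrable_bounded (msin s) (fun x => norm_sin _).
have i1 : N01.-integrable setT (EFin \o (fun=> 1)).
  by apply: N01_integrable_bounded => // x; rewrite normr1.
have EE s : (\int[N01]_x (1 + cos (s * x))%:E = (1 + normal_cf s)%:E)%E.
  rewrite -[LHS]fineK; last first.
    by apply: integrable_fin_num => //; exact: (integrableD _ i1 (ic s)).
  congr EFin; rewrite -/(Rintegral _ _ _) RintegralD//.
  by rewrite (Rintegral_prob_cst N01).
have := integral_normal_rotation a0 b0 m1 f0; rewrite EE.
rewrite (_ : (fun x => _) = fun x => (1 + normal_cf b * cos (a * x))%:E).
  rewrite -[X in X = _ -> _]fineK; last first.
    apply: integrable_fin_num => //.
    exact: (integrableD _ i1 (integrableZl _ _ (ic a))).
  move=> []; rewrite -/(Rintegral _ _ _) RintegralD//; last first.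
    exact: (integrableZl _ _ (ic a)).
  rewrite RintegralZl// (Rintegral_prob_cst N01) mulrC.
  by move=> /addrI ->.
apply/funext => x.
have E y : 1 + cos (a * x + b * y) =
    1 + (cos (a * x) * cos (b * y) - sin (a * x) * sin (b * y)) by rewrite cosD.
under eq_integral do rewrite E.
have i2 : N01.-integrable setT (EFin \o (fun y => cos (a * x) * cos (b * y))).
  exact: (integrableZl measurableT _ (ic b)).
have i3 : N01.-integrable setT (EFin \o (fun y => sin (a * x) * sin (b * y))).
  exact: (integrableZl measurableT _ (is_ b)).
have i4 : N01.-integrable setT (EFin \o (fun y => cos (a * x) * cos (b * y) -
    sin (a * x) * sin (b * y))).
  exact: (integrableB _ i2 i3).
rewrite -[LHS]fineK; last first.
  by apply: integrable_fin_num => //; exact: (integrableD _ i1 i4).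
congr EFin; rewrite -/(Rintegral _ _ _) RintegralD// RintegralB//.
rewrite !RintegralZl//.
by rewrite normal_sin0 mulr0 subr0 (Rintegral_prob_cst N01) mulrC.
Qed.

End gaussian_cf.

Lemma integral_prob_cst d (T : measurableType d) (R : realType)
  (P : probability T R) (r : R) : (\int[P]_w r%:E = r%:E)%E.
Proof.
by rewrite integral_cst// -[RHS]mule1; congr (_ * _)%E; exact: (probability_setT P).
Qed.

Section gaussian_variable.
Context {R : realType}.
Local Notation leb := (@lebesgue_measure R).
Local Notation N01 := (@normal_prob R 0 1).

Let msqr : measurable_fun setT (fun x : R => x ^+ 2).
Proof. exact: measurable_funX. Qed.

(** With [y = x ^ 2 / 4], the bound [y * exp (- y) <= 1] absorbs the square at the price of half the
    exponent, which leaves the density of variance [2]; [4 * sqrt 2] is [4] times the ratio of the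
    peaks. *)
Lemma normal_sqr_lty : (\int[N01]_x (x ^+ 2)%:E < +oo)%E.
Proof.
apply: (@le_lt_trans _ _ (\int[leb]_x ((4 * Num.sqrt 2)%:E * (normal_pdf 0 (Num.sqrt 2) x)%:E)%E)%E).
  have -> : (\int[N01]_x (x ^+ 2)%:E =
      \int[leb]_x (x ^+ 2 * normal_pdf 0 1 x)%:E)%E.
    exact: (integral_normal_prob 0 ltr01 msqr (fun x => sqr_ge0 x)).
  apply: ge0_le_integral => //=.
  - by move=> x _; rewrite lee_fin mulr_ge0 ?sqr_ge0 ?normal_pdf_ge0.
  - apply/measurable_EFinP; apply: measurable_funM => //.
    exact: measurable_normal_pdf.
  - apply/measurable_EFinP; apply: measurable_funM => //.
    exact: measurable_normal_pdf.
  - move=> x _; rewrite lee_fin.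
    have s2 : 0 < Num.sqrt 2 :> R by rewrite sqrtr_gt0.
    pose y := x ^+ 2 / 4.
    have y0 : 0 <= y by rewrite divr_ge0 ?sqr_ge0.
    have xy : x ^+ 2 = 4 * y by rewrite /y mulrCA divff ?mulr1.
    have ye : y * expR (- y) <= 1.
      rewrite expRN ler_pdivrMr ?expR_gt0// mul1r.
      by rewrite (le_trans _ (expR_ge1Dx y))// lerDr.
    rewrite /normal_pdf oner_eq0 gt_eqF// (normal_peak_scale s2).
    have -> : normal_fun 0 1 x = expR (- y) * expR (- y).
      by rewrite /normal_fun -expRD subr0 xy expr1n; congr expR; field.
    have -> : normal_fun 0 (Num.sqrt 2) x = expR (- y).
      by rewrite /normal_fun subr0 xy sqr_sqrtr//; congr expR; field.
    have p0 : 0 <= normal_peak 1 :> R by exact: normal_peak_ge0.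
    move: p0 (expR_ge0 (- y)) ye s2; rewrite xy; clearbody y.
    move: (normal_peak 1) (expR (- y)) (Num.sqrt 2) => p e r p0 e0 ye r0.
    have -> : 4 * r * (r^-1 * p * e) = 4 * p * e * 1 by field; rewrite gt_eqF.
    have -> : 4 * y * (p * (e * e)) = 4 * p * e * (y * e) by ring.
    by rewrite ler_wpM2l// !mulr_ge0.
rewrite ge0_integralZl ?lee_fin ?mulr_ge0//; last 2 first.
- by apply/measurable_EFinP; exact: measurable_normal_pdf.
- by move=> x _; rewrite lee_fin normal_pdf_ge0.
by rewrite integral_normal_pdf mule1 ltry.
Qed.

(** Kept as a symbol: [gauss_cf] divides by it, for which positivity suffices. *)
Definition normal_m2 := \int[N01]_x (x ^+ 2).

Lemma normal_m2_gt0 : 0 < normal_m2.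
Proof.
rewrite -lte_fin /normal_m2 /Rintegral fineK; last first.
  by rewrite ge0_fin_numE ?normal_sqr_lty// integral_ge0// => x _; rewrite lee_fin sqr_ge0.
have -> : (\int[N01]_x (x ^+ 2)%:E = \int[leb]_x (x ^+ 2 * normal_pdf 0 1 x)%:E)%E.
  exact: (integral_normal_prob 0 ltr01 msqr (fun x => sqr_ge0 x)).
have p2 : 0 < normal_pdf 0 1 2 :> R.
  by rewrite /normal_pdf oner_eq0 mulr_gt0 ?normal_peak_gt0 ?oner_eq0 ?expR_gt0.
have pge x : `[(1 : R), 2]%classic x -> normal_pdf 0 1 2 <= normal_pdf 0 1 x.
  rewrite /= in_itv/= => /andP[x1 x2].
  rewrite /normal_pdf oner_eq0 ler_wpM2l ?normal_peak_ge0// /normal_fun ler_expR.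
  rewrite ler_pM2r ?invr_gt0 ?expr1n ?mulr2n// lerN2 !subr0.
  by rewrite ler_pXn2r// nnegrE// (le_trans _ x1).
apply: (@lt_le_trans _ _ (\int[leb]_(x in `[1%R, 2%R]) (normal_pdf 0 1 2)%:E)%E).
  by rewrite integral_cst//= lebesgue_measure_itv/= lte_fin ltr1n -EFinB
    -EFinM lte_fin mulr_gt0// subr_gt0 ltr1n.
rewrite integral_mkcond; apply: ge0_le_integral => //=.
- by move=> x _; rewrite patchE; case: ifP => // _; rewrite lee_fin ltW.
- apply/(measurable_restrictT _ _).1 => //.
- apply/measurable_EFinP; apply: measurable_funM => //.
  exact: measurable_normal_pdf.
- move=> x _; rewrite patchE; case: ifPn; last first.
    by rewrite lee_fin mulr_ge0 ?sqr_ge0 ?normal_pdf_ge0.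
  rewrite inE => x12; rewrite lee_fin.
  rewrite (le_trans (pge _ x12))// ler_peMl ?normal_pdf_ge0//.
  by move: x12; rewrite /= in_itv/= => /andP[x1 _]; rewrite exprn_ege1.
Qed.

Lemma normal_sqr_integrable : N01.-integrable setT (fun x => (x ^+ 2)%:E).
Proof.
apply/integrableP; split; first exact/measurable_EFinP.
rewrite (_ : (fun x => _) = fun x => (x ^+ 2)%:E); first exact: normal_sqr_lty.
by apply/funext => x; rewrite /= ger0_norm// sqr_ge0.
Qed.

Context d (T : measurableType d) (P : probability T R).

(** Point masses and normal laws become one case, the law of [s N + m] with [N] standard normal:
    [s = 0] gives the point masses, and a negative deviation is replaced by its absolute value since
    the density depends on its square. *)
Lemma gaussian_law_rep (A : T -> R) : measurable_fun setT A ->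
  gaussian_law (pushforward P A) ->
  exists m s : R, 0 <= s /\ forall f : R -> R, measurable_fun setT f ->
    (forall x, 0 <= f x) ->
    (\int[P]_w (f (A w))%:E = \int[N01]_x (f (s * x + m)%R)%:E)%E.
Proof.
move=> mA lawA.
pose A' : T -> measurableTypeR R := A.
have mA' : measurable_fun setT A' by [].
have pf (f : R -> R) : measurable_fun setT f -> (forall x, 0 <= f x) ->
    (\int[P]_w (f (A w))%:E = \int[pushforward P A']_x (f x)%:E)%E.
  move=> mf f0; have mfE : measurable_fun setT (EFin \o f) by exact/measurable_EFinP.
  rewrite (@ge0_integral_pushforward _ _ _ _ _ A' mA' P setT (EFin \o f))//.
  by move=> y _; rewrite lee_fin.
case: lawA => [[m mE]|[m [s [s0 sE]]]].
  exists m, 0; split=> // f mf f0; rewrite pf//.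
  transitivity (\int[\d_(m : measurableTypeR R)]_x (f x)%:E)%E.
    by apply: eq_measure_integral => B mB _; exact: mE.
  rewrite integral_dirac//; last exact/measurable_EFinP.
  rewrite diracT mul1e; under eq_integral do rewrite mul0r add0r.
  by rewrite (integral_prob_cst N01).
exists m, `|s|; split=> // f mf f0; rewrite pf//.
have s0' : 0 < `|s| by rewrite normr_gt0.
apply: (etrans _ (integral_normal_prob01 m s0' mf f0)).
apply: eq_measure_integral => B mB _; apply: (etrans (sE _ mB)).
apply: eq_integral => x _.
by case: (ger0P s) => // _; rewrite normal_pdfN_sd.
Qed.

Definition centered_gaussian (A : T -> R) :=
  [/\ measurable_fun setT A, gaussian_law (pushforward P A) &
      (\int[P]_w (A w)%:E = 0)%E].

(** The value at [1] of the characteristic function of the centered Gaussian law of variance [e];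
    the square root of [e / normal_m2] is the corresponding scale. *)
Definition gauss_cf (e : R) := normal_cf (Num.sqrt (e / normal_m2)).

Lemma gauss_cfD (e e' : R) : 0 <= e -> 0 <= e' ->
  gauss_cf e * gauss_cf e' = gauss_cf (e + e').
Proof.
move=> e0 e0'; rewrite /gauss_cf normal_cfM ?sqrtr_ge0//.
have m0 := ltW normal_m2_gt0.
by rewrite (sqr_sqrtr (divr_ge0 e0 m0)) (sqr_sqrtr (divr_ge0 e0' m0)) mulrDl.
Qed.

Lemma gauss_cf0 : gauss_cf 0 = 1.
Proof. by rewrite /gauss_cf mul0r sqrtr0 normal_cf0. Qed.

(** Writing the law as that of [s N + m], the symmetry of [N] makes [m] the mean, hence [0]. The
    second moment is then [s ^ 2 * normal_m2], which determines [s >= 0] and so the characteristic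
    function. *)
Lemma centered_gaussianP (A : T -> R) : centered_gaussian A ->
  [/\ P.-integrable setT (fun w => (A w ^+ 2)%:E),
      \int[P]_w cos (A w) = gauss_cf (\int[P]_w (A w ^+ 2)) &
      \int[P]_w sin (A w) = 0].
Proof.
move=> [mA lawA meanA]; have [m [s [s0 E]]] := gaussian_law_rep mA lawA.
have mt : measurable_fun setT (fun x : R => s * x + m).
  by apply: measurable_funD => //; exact: measurable_funM.
have tr := @ge0_transfer _ _ _ _ _ P N01 A _ mA mt E.
have i1 : N01.-integrable setT (EFin \o (fun=> 1 : R)).
  by apply: N01_integrable_bounded => // x; rewrite normr1.
have ix : N01.-integrable setT (EFin \o (fun x : R => x)).
  apply: (le_integrable _ _ _ (integrableD _ i1 normal_sqr_integrable)) => //.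
    by apply/measurable_EFinP; exact: measurable_id.
  move=> x _; rewrite /= lee_fin [leRHS]ger0_norm ?addr_ge0 ?sqr_ge0//.
  by rewrite -(real_normK (num_real x)); move: `|x| (normr_ge0 x) => y y0; nra.
have isx : N01.-integrable setT (EFin \o (fun x : R => s * x)).
  exact: integrableZl ix.
have im : N01.-integrable setT (EFin \o (fun=> m)).
  by have := integrableZl measurableT m i1; under eq_fun do rewrite -EFinM mulr1.
have x0 : \int[N01]_x x = 0.
  have mN : measurable_fun setT (-%R : R -> R) by exact: measurable_funN.
  have [_ H] := @ge0_transfer _ _ _ _ _ N01 N01 (fun x => - x) id mN
    (@measurable_id _ _ _) integral_normal_opp id (@measurable_id _ _ _) ix.
  have : \int[N01]_x (- x) = \int[N01]_x x by congr fine.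
  under eq_Rintegral do rewrite -mulN1r.
  rewrite RintegralZl//.
  by rewrite mulN1r => /eqP; rewrite eq_sym -addr_eq0 -mulr2n mulrn_eq0 => /eqP.
have m0 : m = 0.
  have [_ H] := tr id (@measurable_id _ _ _) (integrableD measurableT isx im).
  have : fine (\int[P]_w (A w)%:E)%E = \int[N01]_x (s * x + m) by congr fine.
  rewrite meanA RintegralD// RintegralZl// x0 mulr0 add0r (Rintegral_prob_cst N01).
  by [].
have itr (f : R -> R) : measurable_fun setT f ->
    N01.-integrable setT (EFin \o (fun x => f (s * x))) ->
    P.-integrable setT (EFin \o (f \o A)) /\
    \int[P]_w (f (A w)) = \int[N01]_x f (s * x).
  move=> mf fi; have [] := tr f mf; last first.
    move=> h1 h2; split=> //; rewrite /Rintegral h2.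
    by congr fine; apply: eq_integral => x _; rewrite m0 addr0.
  by move: fi; congr (_.-integrable _ _); apply/funext => x /=; rewrite m0 addr0.
have [iA2 A2] : P.-integrable setT (EFin \o ((fun x => x ^+ 2) \o A)) /\
    \int[P]_w (A w ^+ 2) = s ^+ 2 * normal_m2.
  have [|h1 h2] := itr _ msqr.
    have := integrableZl measurableT (s ^+ 2) normal_sqr_integrable.
    by congr (_.-integrable _ _); apply/funext => x /=; rewrite -EFinM exprMn.
  split=> //; rewrite h2; under eq_Rintegral do rewrite exprMn.
  by rewrite RintegralZl//; exact: normal_sqr_integrable.
split=> //.
- have mc : measurable_fun setT (@cos R).
    by apply: continuous_measurable_fun; exact: continuous_cos.
  have [|_ ->] := itr _ mc.
    apply: N01_integrable_bounded; last by move=> x; exact: norm_cos.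
    by apply: measurableT_comp => //; exact: measurable_funM.
  rewrite /gauss_cf A2 mulfK ?gt_eqF ?normal_m2_gt0// sqrtr_sqr ger0_norm//.
- have mc : measurable_fun setT (@sin R).
    by apply: continuous_measurable_fun; exact: continuous_sin.
  have [|_ ->] := itr _ mc; last exact: normal_sin0.
  apply: N01_integrable_bounded; last by move=> x; exact: norm_sin.
  by apply: measurableT_comp => //; exact: measurable_funM.
Qed.

End gaussian_variable.

(** * Suprema of isotropic Gaussian processes *)

Lemma integral_indicT d (T : measurableType d) (R : realType)
    (m : {measure set T -> \bar R}) (A : set T) : measurable A ->
  (\int[m]_x (\1_A x : R)%:E = m A)%E.
Proof. by move=> mA; rewrite integral_indic// setIT. Qed.

Lemma measurable_tail_probability d (T : measurableType d) (R : realType)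
    (P : probability T R) (f : T -> R) : measurable_fun setT f ->
  measurable_fun setT (fun u : R => P [set w | u < f w]).
Proof.
move=> mf; have mS u := measurable_superlevel u mf.
rewrite (_ : (fun u => _) = (fun u => (fine (P [set w | u < f w]))%:E)).
  apply/measurable_EFinP; apply: nonincreasing_measurable => // u v uv.
  rewrite fine_le ?fin_num_measure//; apply: le_measure; rewrite ?inE//.
  by move=> w /=; exact: le_lt_trans.
by apply/funext => u; rewrite fineK// fin_num_measure.
Qed.

(** * Independent components and Gram matrices *)

Section independent_products.
Context d (T : measurableType d) (R : realType) (P : probability T R) (I : finType).
Variable X : I -> T -> R.
Hypothesis mX : forall i, measurable_fun setT (X i).
Hypothesis X_indep : forall A : I -> set R, (forall i, measurable (A i)) ->
  P (\bigcap_(i in [set: I]) (X i @^-1` A i)) = (\prod_i P (X i @^-1` A i))%E.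
Implicit Types (h : I -> R -> R) (s : seq I).

Let upd h a (g : R -> R) i := if i == a then g else h i.

Let prod_upd h a g w :
  \prod_i upd h a g i (X i w) = g (X a w) * \prod_(i | i != a) h i (X i w).
Proof.
rewrite (bigD1 a)//= {1}/upd eqxx; congr (_ * _).
by apply: eq_bigr => i /negbTE ia; rewrite /upd ia.
Qed.

Let prodD h a w :
  \prod_i h i (X i w) = h a (X a w) * \prod_(i | i != a) h i (X i w).
Proof. by rewrite (bigD1 a). Qed.

Let mprod h (p : pred I) : (forall i, measurable_fun setT (h i)) ->
  measurable_fun setT (fun w => \prod_(i | p i) h i (X i w)).
Proof.
move=> mh; under eq_fun do rewrite big_mkcond/=; apply: measurable_prod => i _.
by case: (p i) => //; exact: measurableT_comp.
Qed.

(* Layer-cake in one factor at a time reduces to indicators. *)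
Lemma indep_ge0_prod h : (forall i, measurable_fun setT (h i)) ->
  (forall i x, 0 <= h i x) ->
  (\int[P]_w (\prod_i h i (X i w))%:E = \prod_i \int[P]_w (h i (X i w))%:E)%E.
Proof.
suff H s : forall h, (forall i, measurable_fun setT (h i)) ->
    (forall i x, 0 <= h i x) ->
    (forall i, i \notin s -> exists2 A, measurable A & h i = \1_A) ->
    (\int[P]_w (\prod_i h i (X i w))%:E = \prod_i \int[P]_w (h i (X i w))%:E)%E.
  by move=> mh h0; apply: (H (index_enum I)) => // i; rewrite mem_index_enum.
(* The list [s] contains every factor that may fail to be an indicator; when it is empty, the claim
   is the independence hypothesis. *)
elim: s => [|a s IH] {}h mh h0 hA.
  have /choice[A AE] : forall i, exists A, measurable A /\ h i = \1_A.
    by move=> i; have [//|A mA hiA] := hA i; exists A.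
  have mA i := (AE i).1; have hE i := (AE i).2.
  have mXA i : measurable (X i @^-1` A i) by exact: measurable_preimage.
  transitivity (P (\bigcap_(i in [set: I]) (X i @^-1` A i))).
    rewrite -integral_indicT; last exact: fin_bigcap_measurable.
    apply: eq_integral => w _; congr EFin; rewrite [RHS]indicE.
    have [Aw|Aw] := pselect (forall i, A i (X i w)).
      rewrite mem_set; last by move=> i _; exact: Aw.
      by rewrite big1// => i _; rewrite hE indicE mem_set.
    rewrite memNset; last by apply: contra_not Aw => Aw i; exact: Aw.
    have /existsNP[i Ai] := Aw.
    by rewrite (bigD1 i)//= hE indicE memNset ?mul0r.
  rewrite X_indep//; apply: eq_bigr => i _; rewrite hE.
  by rewrite -integral_indicT.
have mG := mprod (fun i => i != a) mh.
have G0 w : 0 <= \prod_(i | i != a) h i (X i w) by apply: prodr_ge0.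
have mha : measurable_fun setT (fun w => h a (X a w)) by exact: measurableT_comp.
under eq_integral do rewrite (prodD h a).
rewrite layer_cake_weighted// (bigD1 a)//= [in RHS]layer_cake//.
pose c := (\prod_(i | i != a) \int[P]_w (h i (X i w))%:E)%E.
have c0 : (0 <= c)%E.
  by apply: prode_ge0 => i _; apply: integral_ge0 => w _; rewrite lee_fin.
rewrite muleC -/c -ge0_integralZl//; last first.
  by apply: measurable_funTS; exact: measurable_tail_probability.
apply: eq_integral => u _.
(* At level [u] of the layer-cake formula, factor [a] is replaced by the indicator of its superlevel
   set, so the induction hypothesis applies with one factor fewer in the list. *)
pose h' := upd h a (\1_[set x | u < h a x]).
have mS : measurable [set x | u < h a x] by exact: measurable_superlevel.
have mSX : measurable [set w | u < h a (X a w)].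
  exact: (measurable_preimage (mX a) mS).
have h'E i w : i != a -> h' i (X i w) = h i (X i w).
  by rewrite /h' /upd => /negbTE ->.
have := IH h'; rewrite (bigD1 a)//=.
have -> : (\prod_(i | i != a) \int[P]_w (h' i (X i w))%:E)%E = c.
  apply: eq_bigr => i ia; apply: eq_integral => w _.
  by rewrite h'E.
have -> : (\int[P]_w (h' a (X a w))%:E = P [set w | (u < h a (X a w))%R])%E.
  rewrite -integral_indicT//; apply: eq_integral => w _.
  by rewrite /h' /upd eqxx !indicE.
rewrite muleC => <-; last 3 first.
- by move=> i; rewrite /h' /upd; case: eqP => // _; exact: measurable_indic.
- by move=> i x; rewrite /h' /upd; case: eqP.
- move=> i si; rewrite /h' /upd; case: eqP => [_|/eqP ia].
    by exists [set x | u < h a x].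
  by apply: hA; rewrite inE negb_or ia.
rewrite integral_mkcond; apply: eq_integral => w _.
rewrite (prod_upd h a) indicE patchE.
case: (boolP (w \in _)); rewrite ?notin_setE ?inE/= => hw.
  by rewrite mem_set// mul1r.
by rewrite memNset// mul0r.
Qed.

Let prod_bounded h : (forall i, exists M : R, forall x, `|h i x| <= M) ->
  exists M : R, forall w, `|\prod_i h i (X i w)| <= M.
Proof.
move=> /choice[M hM]; exists (\prod_i M i) => w; rewrite normr_prod.
by apply: ler_prod => i _; rewrite normr_ge0 hM.
Qed.

Let prod_integrable h : (forall i, measurable_fun setT (h i)) ->
  (forall i, exists M : R, forall x, `|h i x| <= M) ->
  P.-integrable setT (EFin \o (fun w => \prod_i h i (X i w))).
Proof.
move=> mh /prod_bounded[M hM]; apply: bounded_integrable hM.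
exact: (mprod predT).
Qed.

Let comp_integrable h i : (forall i, measurable_fun setT (h i)) ->
  (forall i, exists M : R, forall x, `|h i x| <= M) ->
  P.-integrable setT (EFin \o (fun w => h i (X i w))).
Proof.
move=> mh hM; have [M hiM] := hM i.
apply: (@bounded_integrable _ _ _ _ _ M) => [|w]; last exact: hiM.
exact: measurableT_comp.
Qed.

(** Reduction to nonnegative factors, one at a time: with [M] a bound for [h a], the product is the
    difference of the products where factor [a] is replaced by [h a + M] and by the constant [M]. *)
Lemma indep_bounded_prod h : (forall i, measurable_fun setT (h i)) ->
  (forall i, exists M : R, forall x, `|h i x| <= M) ->
  \int[P]_w (\prod_i h i (X i w)) = \prod_i \int[P]_w (h i (X i w)).
Proof.
suff H s : forall h, (forall i, measurable_fun setT (h i)) ->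
    (forall i, exists M : R, forall x, `|h i x| <= M) ->
    (forall i, i \notin s -> forall x, 0 <= h i x) ->
    \int[P]_w (\prod_i h i (X i w)) = \prod_i \int[P]_w (h i (X i w)).
  by move=> mh hM; apply: (H (index_enum I)) => // i; rewrite mem_index_enum.
elim: s => [|a s IH] {}h mh hM h0.
  rewrite /Rintegral indep_ge0_prod//; last by move=> i; exact: h0.
  rewrite (eq_bigr (fun i => (\int[P]_w h i (X i w))%:E)).
    by rewrite prodEFin.
  by move=> i _; rewrite fineK//; apply: integrable_fin_num => //; exact: comp_integrable.
have [M0 hM0] := hM a; pose M := `|M0|.
have haM x : `|h a x| <= M by rewrite (le_trans (hM0 x))// ler_norm.
pose h1 := upd h a (fun x => h a x + M).
pose h2 := upd h a (fun=> M).
have mh1 i : measurable_fun setT (h1 i).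
  by rewrite /h1 /upd; case: eqP => // _; exact: measurable_funD.
have mh2 i : measurable_fun setT (h2 i).
  by rewrite /h2 /upd; case: eqP.
have hM1 i : exists N : R, forall x, `|h1 i x| <= N.
  rewrite /h1 /upd; case: eqP => // _; exists (M + M) => x.
  by rewrite (le_trans (ler_normD _ _))// lerD// normr_id.
have hM2 i : exists N : R, forall x, `|h2 i x| <= N.
  by rewrite /h2 /upd; case: eqP => // _; exists M => x; rewrite normr_id.
have h10 i : i \notin s -> forall x, 0 <= h1 i x.
  move=> si x; rewrite /h1 /upd; case: eqP => [_|/eqP ia].
    by rewrite -lerBlDr sub0r; have := haM x; rewrite ler_norml => /andP[].
  by apply: h0; rewrite inE negb_or ia.
have h20 i : i \notin s -> forall x, 0 <= h2 i x.
  move=> si x; rewrite /h2 /upd; case: eqP => [_|/eqP ia]; first exact: normr_ge0.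
  by apply: h0; rewrite inE negb_or ia.
have E w : \prod_i h i (X i w) = \prod_i h1 i (X i w) - \prod_i h2 i (X i w).
  by rewrite (prodD h a) /h1 /h2 !prod_upd -mulrBl addrK.
under eq_Rintegral do rewrite E.
rewrite RintegralB//; [|exact: prod_integrable|exact: prod_integrable].
rewrite (IH _ mh1 hM1 h10) (IH _ mh2 hM2 h20).
rewrite (bigD1 a)//= [X in _ - X](bigD1 a)//= [RHS](bigD1 a)//=.
have -> : \prod_(i | i != a) \int[P]_w h1 i (X i w) =
    \prod_(i | i != a) \int[P]_w h i (X i w).
  by apply: eq_bigr => i /negbTE ia; rewrite /h1 /upd ia.
have -> : \prod_(i | i != a) \int[P]_w h2 i (X i w) =
    \prod_(i | i != a) \int[P]_w h i (X i w).
  by apply: eq_bigr => i /negbTE ia; rewrite /h2 /upd ia.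
rewrite -mulrBl; congr (_ * _); rewrite /h1 /h2 /upd eqxx.
rewrite RintegralD ?Rintegral_prob_cst ?addrK//; first exact: comp_integrable.
by apply: (@bounded_integrable _ _ _ _ _ `|M|) => // w.
Qed.

(** Variables are moved one by one out of the cosine into the product [h], using [cos (A + X) = cos
    A cos X - cos (A - pi / 2) sin X]. The shifted phase keeps both terms in the form of the
    induction hypothesis, and the second vanishes because the sines have mean zero. *)
Lemma indep_cos_sum phi : (forall i, \int[P]_w sin (X i w) = 0) ->
  \int[P]_w cos (phi + \sum_i X i w) = cos phi * \prod_i \int[P]_w cos (X i w).
Proof.
move=> sin0_.
have mc : measurable_fun setT (@cos R).
  by apply: continuous_measurable_fun; exact: continuous_cos.
have ms : measurable_fun setT (@sin R).
  by apply: continuous_measurable_fun; exact: continuous_sin.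
have H s : forall h psi, uniq s -> (forall i, measurable_fun setT (h i)) ->
    (forall i, exists M : R, forall x, `|h i x| <= M) ->
    (forall i, i \in s -> h i = fun=> 1) ->
    \int[P]_w (cos (psi + \sum_(i <- s) X i w) * \prod_i h i (X i w)) =
    cos psi * \prod_(i <- s) \int[P]_w cos (X i w) *
    \prod_i \int[P]_w h i (X i w).
  elim: s => [|a s IH] h psi us mh hM h1.
    under eq_Rintegral do rewrite big_nil addr0.
    rewrite RintegralZl//; last exact: prod_integrable.
    by rewrite indep_bounded_prod// big_nil mulr1.
  have /andP[as_ us'] : (a \notin s) && uniq s by [].
  pose hc := upd h a (@cos R); pose hs := upd h a (@sin R).
  have mhc i : measurable_fun setT (hc i) by rewrite /hc /upd; case: eqP.
  have mhs i : measurable_fun setT (hs i) by rewrite /hs /upd; case: eqP.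
  have hMc i : exists M : R, forall x, `|hc i x| <= M.
    by rewrite /hc /upd; case: eqP => // _; exists 1 => x; exact: norm_cos.
  have hMs i : exists M : R, forall x, `|hs i x| <= M.
    by rewrite /hs /upd; case: eqP => // _; exists 1 => x; exact: norm_sin.
  have neq i : i \in s -> (i == a) = false.
    by move=> si; apply/eqP => ia; move: as_; rewrite -ia si.
  have h1c i : i \in s -> hc i = fun=> 1.
    by move=> si; rewrite /hc /upd neq// h1// inE si orbT.
  have h1s i : i \in s -> hs i = fun=> 1.
    by move=> si; rewrite /hs /upd neq// h1// inE si orbT.
  have E w : cos (psi + \sum_(i <- a :: s) X i w) * \prod_i h i (X i w) =
      cos (psi + \sum_(i <- s) X i w) * \prod_i hc i (X i w) -
      cos (psi - pi / 2 + \sum_(i <- s) X i w) * \prod_i hs i (X i w).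
    rewrite big_cons !prod_upd (prodD h a) h1 ?inE ?eqxx// mul1r.
    rewrite (addrAC psi) cosBpihalf addrCA cosD; ring.
  have iT (g : I -> R -> R) c : (forall i, measurable_fun setT (g i)) ->
      (forall i, exists M : R, forall x, `|g i x| <= M) ->
      P.-integrable setT (EFin \o (fun w =>
        cos (c + \sum_(i <- s) X i w) * \prod_i g i (X i w))).
    move=> mg gM; have [M gM'] := prod_bounded gM.
    apply: (@bounded_integrable _ _ _ _ _ M) => [|w].
      apply: measurable_funM; last exact: (mprod predT).
      by apply: measurableT_comp => //; apply: measurable_funD => //; exact: measurable_sum.
    rewrite normrM (le_trans _ (gM' w))// ler_piMl//; exact: norm_cos.
  under eq_Rintegral do rewrite E.
  rewrite RintegralB//; [|exact: iT|exact: iT].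
  rewrite (IH hc psi)// (IH hs)// big_cons.
  have -> : \prod_i \int[P]_w hs i (X i w) = 0.
    by rewrite (bigD1 a)//= /hs /upd eqxx sin0_ mul0r.
  rewrite mulr0 subr0 (bigD1 a)//= [in RHS](bigD1 a)//= h1 ?inE ?eqxx//.
  rewrite Rintegral_prob_cst mul1r {1}/hc /upd eqxx.
  have -> : \prod_(i | i != a) \int[P]_w hc i (X i w) =
      \prod_(i | i != a) \int[P]_w h i (X i w).
    by apply: eq_bigr => i /negbTE ia; rewrite /hc /upd ia.
  ring.
have := H (index_enum I) (fun _ _ => 1) phi (index_enum_uniq I).
move=> E; transitivity (\int[P]_w (cos (phi + \sum_i X i w) * \prod_(i : I) 1)).
  by apply: eq_Rintegral => w _; rewrite big1_eq mulr1.
rewrite E//; last by move=> i; exists 1 => x; rewrite normr1.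
rewrite [X in _ * X]big1 ?mulr1// => i _.
by rewrite Rintegral_prob_cst.
Qed.

End independent_products.

Section cadlag_measurability.
Context {R : realType}.

Lemma measurable_eval (t : R) : 0 <= t <= 1 ->
  measurable_fun setT (fun x : cadlag R => x t).
Proof.
move=> t01; apply: (measurability _ (RGenOpens.measurableE R)).
move=> _ [_ [a [b ->] <-]]; rewrite setTI; apply: sub_sigma_algebra.
by exists t, `]a, b[%classic; split=> //; exact: interval_open.
Qed.

Lemma measurable_component n (i : 'I_n) :
  measurable_fun setT (component i : cadlag 'rV[R]_n -> cadlag R).
Proof.
apply: (@measurability _ _ _ _ _ _ (cadlag_cylinders (V := R))) => //.
move=> _ [_ [t [U [t01 oU ->]]] <-]; rewrite setTI; apply: sub_sigma_algebra.
exists t, ((fun v : 'rV[R]_n => v 0 i) @^-1` U); split=> //.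
by apply: open_comp => // v _; exact: coord_continuous.
Qed.

Lemma measurable_eval_coord n (i : 'I_n) (t : R) : 0 <= t <= 1 ->
  measurable_fun setT (fun w : cadlag 'rV[R]_n => w t 0 i).
Proof.
move=> t01.
exact: (measurableT_comp (measurable_eval t01) (measurable_component i)).
Qed.

End cadlag_measurability.

Lemma Rintegral_sum d (T : measurableType d) (R : realType)
    (m : {measure set T -> \bar R}) (I : Type) (s : seq I) (f : I -> T -> R) :
  (forall i, m.-integrable setT (EFin \o f i)) ->
  m.-integrable setT (EFin \o (fun x => \sum_(i <- s) f i x)) /\
  \int[m]_x (\sum_(i <- s) f i x) = \sum_(i <- s) \int[m]_x f i x.
Proof.
move=> fi; elim: s => [|a s [IH1 IH2]].
  split.
    by apply: eq_integrable (integrable0 _ _) => // x _; rewrite /= big_nil.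
  by under eq_Rintegral do rewrite big_nil; rewrite Rintegral_cst// mul0r big_nil.
split.
  apply: eq_integrable (integrableD _ (fi a) IH1) => // x _.
  by rewrite /= big_cons.
under eq_Rintegral do rewrite big_cons.
by rewrite RintegralD// IH2 big_cons.
Qed.

Lemma square_integrable_mul d (T : measurableType d) (R : realType)
    (m : {measure set T -> \bar R}) (f g : T -> R) :
  measurable_fun setT f -> measurable_fun setT g ->
  m.-integrable setT (fun x => (f x ^+ 2)%:E) ->
  m.-integrable setT (fun x => (g x ^+ 2)%:E) ->
  m.-integrable setT (EFin \o (fun x => f x * g x)).
Proof.
move=> mf mg f2 g2.
apply: (le_integrable _ _ _ (integrableD _ f2 g2)) => //.
  by apply/measurable_EFinP; exact: measurable_funM.
move=> x _; rewrite /= lee_fin normrM [leRHS]ger0_norm ?addr_ge0 ?sqr_ge0//.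
rewrite -(real_normK (num_real (f x))) -(real_normK (num_real (g x))).
move: `|f x| `|g x| (normr_ge0 (f x)) (normr_ge0 (g x)) => a b a0 b0; nra.
Qed.

Section gaussian_coordinates.
Context {R : realType} {n : nat} (P : probability (cadlag 'rV[R]_n.+1) R).
Hypotheses (X_indep : mutually_independent P (@component R n.+1))
  (X_id : identically_distributed P (@component R n.+1))
  (X_gauss : forall i : 'I_n.+1, gaussian_process P (fun t w => w t 0 i))
  (X_mean : forall i : 'I_n.+1, zero_mean_process P (fun t w => w t 0 i)).
Implicit Types (w : cadlag 'rV[R]_n.+1) (i : 'I_n.+1) (s t : R).

Lemma identical_integral (f : cadlag R -> R) i :
  measurable_fun setT f -> (forall x, 0 <= f x) ->
  (\int[P]_w (f (component i w))%:E = \int[P]_w (f (component ord0 w))%:E)%E.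
Proof.
move=> mf f0; have mfE : measurable_fun setT (EFin \o f) by exact/measurable_EFinP.
have pE j : (\int[P]_w (f (component j w))%:E =
    \int[pushforward P (component j)]_x (f x)%:E)%E.
  rewrite (@ge0_integral_pushforward _ _ _ _ _ _ (measurable_component j) P
    setT (EFin \o f))//.
  by move=> y _; rewrite lee_fin.
apply: (etrans (pE i)); apply: etrans (esym (pE ord0)).
apply: eq_measure_integral; [exact: measurable_component|exact: measurable_component|move=> ? ? B mB _; exact: X_id].
Qed.

Lemma identical_integrable (f : cadlag R -> R) i :
  measurable_fun setT f ->
  P.-integrable setT (EFin \o (fun w => f (component ord0 w))) ->
  \int[P]_w f (component i w) = \int[P]_w f (component ord0 w).
Proof.
move=> mf i0.
have [] := @ge0_transfer _ _ _ _ _ P P (f \o component i) (f \o component ord0)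
  (measurableT_comp mf (measurable_component i))
  (measurableT_comp mf (measurable_component ord0)) _ id (@measurable_id _ _ _) i0.
  move=> g mg g0; apply: (@identical_integral (g \o f)) => //.
    exact: measurableT_comp.
  by move=> x; exact: g0.
by move=> _ E; congr fine.
Qed.

Lemma coord_centered i t : 0 <= t <= 1 ->
  centered_gaussian P (fun w => w t 0 i).
Proof.
move=> t01; split; first exact: measurable_eval_coord.
  have := X_gauss i (fun _ : 'I_1 => t01) (const_mx 1).
  congr (gaussian_law (pushforward P _)); apply/funext => w.
  by rewrite big_ord1 !mxE mul1r.
by have := X_mean i t01; rewrite unlock.
Qed.

Lemma coord_square i t : 0 <= t <= 1 ->
  P.-integrable setT (fun w => (w t 0 i ^+ 2)%:E).
Proof. by move=> /(coord_centered i)/centered_gaussianP[]. Qed.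

Lemma coord_mul_integrable i s t : 0 <= s <= 1 -> 0 <= t <= 1 ->
  P.-integrable setT (EFin \o (fun w => w s 0 i * w t 0 i)).
Proof.
move=> s01 t01; apply: square_integrable_mul; try exact: coord_square;
  exact: measurable_eval_coord.
Qed.

Lemma coord_integrable i t : 0 <= t <= 1 ->
  P.-integrable setT (EFin \o (fun w => w t 0 i)).
Proof.
move=> t01.
have := @square_integrable_mul _ _ _ P (fun w => w t 0 i) (fun=> 1)
  (measurable_eval_coord i t01) (@measurable_cst _ _ _ _ _ (1 : R)) (coord_square i t01).
rewrite (_ : (fun w => w t 0 i * 1) = fun w => w t 0 i); last first.
  by apply/funext => w; rewrite mulr1.
apply; apply: (@bounded_integrable _ _ _ P (fun=> 1 ^+ 2) 1) => // w.
by rewrite expr1n normr1.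
Qed.

Let r s t := \int[P]_w (w s 0 ord0 * w t 0 ord0).

Lemma coord_covariance i s t : 0 <= s <= 1 -> 0 <= t <= 1 ->
  \int[P]_w (w s 0 i * w t 0 i) = r s t.
Proof.
move=> s01 t01; apply: (@identical_integrable (fun x => x s * x t)).
  by apply: measurable_funM; exact: measurable_eval.
exact: coord_mul_integrable.
Qed.

Section combination.
Variables (k : nat) (t : 'I_k -> R) (t01 : forall a, 0 <= t a <= 1).

Let A (u : 'I_k -> R) i w := \sum_a u a * w (t a) 0 i.

Lemma combination_centered u i : centered_gaussian P (A u i).
Proof.
have iX a : P.-integrable setT (EFin \o (fun w => u a * w (t a) 0 i)).
  exact: (integrableZl measurableT _ (coord_integrable i (t01 a))).
have [iA EA] := Rintegral_sum (index_enum 'I_k) iX.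
split.
- apply: measurable_sum => a; apply: measurable_funM => //.
  exact: measurable_eval_coord.
- have := X_gauss i t01 (\row_a u a).
  congr (gaussian_law (pushforward P _)); apply/funext => w.
  by apply: eq_bigr => a _; rewrite !mxE.
- rewrite -[LHS]fineK; last exact: (integrable_fin_num measurableT iA).
  congr EFin; apply: (etrans EA); rewrite big1// => a _.
  rewrite RintegralZl//; last exact: coord_integrable.
  have [_ _ E] := coord_centered i (t01 a).
  by rewrite /Rintegral E mulr0.
Qed.

Lemma combination_square u i :
  \int[P]_w (A u i w ^+ 2) = \sum_a \sum_b u a * u b * r (t a) (t b).
Proof.
have iX a b : P.-integrable setT (EFin \o (fun w => u a * u b *
    (w (t a) 0 i * w (t b) 0 i))).
  exact: (integrableZl measurableT _ (coord_mul_integrable i (t01 a) (t01 b))).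
have E w : A u i w ^+ 2 =
    \sum_a \sum_b u a * u b * (w (t a) 0 i * w (t b) 0 i).
  rewrite expr2 /A mulr_suml; apply: eq_bigr => a _.
  by rewrite mulr_sumr; apply: eq_bigr => b _; rewrite mulrACA.
under eq_Rintegral do rewrite E.
have [_ ->] := Rintegral_sum (index_enum 'I_k)
  (fun a => (Rintegral_sum (index_enum 'I_k) (iX a)).1).
apply: eq_bigr => a _.
have [_ ->] := Rintegral_sum (index_enum 'I_k) (iX a).
apply: eq_bigr => b _; rewrite RintegralZl//; last exact: coord_mul_integrable.
by rewrite coord_covariance.
Qed.

(** Independence factors the mean over the components; each factor is the value of [gauss_cf] at a
    quadratic form in the covariances, and [gauss_cfD] gathers them into one variance. *)
Lemma combination_cf (u : 'I_n.+1 -> 'I_k -> R) phi :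
  \int[P]_w cos (phi + \sum_i A (u i) i w) =
  cos phi * gauss_cf (\sum_i \sum_a \sum_b u i a * u i b * r (t a) (t b)).
Proof.
have cA i := combination_centered (u i) i.
have mA i : measurable_fun setT (A (u i) i) by have [] := cA i.
have mg i : measurable_fun setT (fun x : cadlag R => \sum_a u i a * x (t a)).
  by apply: measurable_sum => a; apply: measurable_funM => //; exact: measurable_eval.
rewrite (@indep_cos_sum _ _ _ P 'I_n.+1 (fun i => A (u i) i))//; first last.
- by move=> i; have [] := centered_gaussianP (cA i).
- move=> B mB.
  have := @X_indep [set: 'I_n.+1]%SET
    (fun i => (fun x : cadlag R => \sum_a u i a * x (t a)) @^-1` B i).
  rewrite (_ : [set` [set: 'I_n.+1]%SET] = [set: 'I_n.+1]); last first.
    by apply/seteqP; split=> i //= _; rewrite inE.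
  rewrite (eq_bigl predT); last by move=> i; rewrite inE.
  by apply=> i; exact: measurable_preimage.
congr (_ * _).
have E i : \int[P]_w cos (A (u i) i w) =
    gauss_cf (\sum_a \sum_b u i a * u i b * r (t a) (t b)).
  by have [_ -> _] := centered_gaussianP (cA i); rewrite combination_square.
under eq_bigr do rewrite E.
have e0 i : 0 <= \sum_a \sum_b u i a * u i b * r (t a) (t b).
  by rewrite -(combination_square (u i) i) Rintegral_ge0// => w _; exact: sqr_ge0.
suff [] : 0 <= \sum_i \sum_a \sum_b u i a * u i b * r (t a) (t b) /\
  \prod_i gauss_cf (\sum_a \sum_b u i a * u i b * r (t a) (t b)) =
  gauss_cf (\sum_i \sum_a \sum_b u i a * u i b * r (t a) (t b)) by [].
elim/big_rec2 : _ => [|i x y _ [y0 ->]]; first by rewrite gauss_cf0.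
by rewrite gauss_cfD// addr_ge0.
Qed.

(* The characteristic function of the projections [alpha a . X_(t a)] involves
   the vectors [alpha a] only through their Gram matrix. *)
Lemma gram_law (alpha beta : 'I_k -> 'I_n.+1 -> R) (b : 'I_k -> R) :
  (forall a a', \sum_i alpha a i * alpha a' i = \sum_i beta a i * beta a' i) ->
  P [set w : cadlag 'rV[R]_n.+1 | forall a, \sum_i alpha a i * w (t a) 0 i <= b a] =
  P [set w : cadlag 'rV[R]_n.+1 | forall a, \sum_i beta a i * w (t a) 0 i <= b a].
Proof.
move=> gram.
have mL (al : 'I_k -> 'I_n.+1 -> R) a :
    measurable_fun setT (fun w : cadlag 'rV[R]_n.+1 => \sum_i al a i * w (t a) 0 i).
  apply: measurable_sum => i; apply: measurable_funM => //.
  exact: measurable_eval_coord.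
apply: (@cramer_wold _ _ _ _ _ P P k (fun a w => \sum_i alpha a i * w (t a) 0 i)
  (fun a w => \sum_i beta a i * w (t a) 0 i)) => // c phi.
have E (al : 'I_k -> 'I_n.+1 -> R) :
    \int[P]_w cos (ridge c (fun a => \sum_i al a i * w (t a) 0 i) + phi) =
    cos phi * gauss_cf (\sum_a \sum_a' c a * c a' * r (t a) (t a') *
      \sum_i al a i * al a' i).
  rewrite -[RHS]/(_ * gauss_cf _).
  transitivity (\int[P]_w cos (phi + \sum_i A (fun a => c a * al a i) i w)).
    apply: eq_Rintegral => w _; congr cos; rewrite addrC; congr (_ + _).
    rewrite /ridge /A exchange_big/=; apply: eq_bigr => a _.
    by rewrite mulr_sumr; apply: eq_bigr => i _; rewrite mulrA.
  rewrite combination_cf; congr (_ * gauss_cf _).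
  rewrite exchange_big/=; apply: eq_bigr => a _.
  rewrite exchange_big/=; apply: eq_bigr => a' _.
  by rewrite mulr_sumr; apply: eq_bigr => i _; ring.
rewrite !E; congr (_ * gauss_cf _).
by apply: eq_bigr => a _; apply: eq_bigr => a' _; rewrite gram.
Qed.

End combination.
End gaussian_coordinates.

(** * Running suprema along countably many times *)

Section regular_paths.
Context {R : realType}.
Implicit Types (x y : R -> R) (s t b : R).

(** The properties of paths on which suprema rely. Stated for bare functions, they pass to linear
    combinations and absolute values, which then need not be rebuilt as elements of [cadlag]. *)
Definition regular_path x :=
  (forall t, 0 <= t < 1 -> x s @[s --> t^'+] --> x t) /\
  exists M : R, forall s, 0 <= s <= 1 -> `|x s| <= M.

(** Around each time the path is bounded on the left by its left limit, on the right by right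
    continuity, and at the time itself by its value; compactness of [[0, 1]] makes the bound
    uniform. Outside [[0, 1]] the path is zero, so the same argument covers the end points. *)
Lemma regular_cadlag (x : cadlag R) : regular_path x.
Proof.
have [x1 x2 x3] := cadlagP x; split=> //.
have := @segment_compact R 0 1 => /compact_near_coveringP /(_ R (pinfty_nbhs R)
  (fun M s => `|x s| <= M) _) cov.
suff : \forall M \near +oo, `[0, 1]%classic `<=` (fun s => `|x s| <= M).
  move=> /filter_ex[M MP]; exists M => s s01; apply: MP.
  by rewrite /= in_itv.
apply: cov => t _.
have loc (F : set_system R) (FF : ProperFilter F) : cvg (x s @[s --> F]) ->
    exists M : R, \forall s \near F, `|x s| <= M.
  move=> /cvg_ex[l xl]; exists (`|l| + 1).
  have /cvgrPdist_le/(_ _ ltr01) := xl.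
  apply: filterS => s ls; rewrite -(subrK l (x s)) addrC.
  by rewrite (le_trans (ler_normD _ _))// lerD2l distrC.
have zero (F : set_system R) (FF : ProperFilter F) :
    (\forall s \near F, ~~ (0 <= s <= 1)) ->
    exists M : R, \forall s \near F, `|x s| <= M.
  by exists 0; near do rewrite x3 ?normr0//.
have [L HL] : exists M : R, \forall s \near t^'-, `|x s| <= M.
  have [t0|t0] := leP t 0.
    apply: zero; near=> s; apply/negP => /andP[s0 _].
    have : s < t by near: s; exact: nbhs_left_lt.
    by rewrite ltNge (le_trans t0).
  have [t1|t1] := leP t 1; first by apply: loc; apply: x2; rewrite t0.
  apply: zero; near=> s; apply/negP => /andP[_ s1].
  have : 1 < s by near: s; exact: nbhs_left_gt.
  by rewrite ltNge s1.
have [M HM] : exists M : R, \forall s \near t^'+, `|x s| <= M.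
  have [t1|t1] := leP 1 t.
    apply: zero; near=> s; apply/negP => /andP[_ s1].
    have : t < s by near: s; exact: nbhs_right_gt.
    by rewrite ltNge (le_trans s1).
  have [t0|t0] := leP 0 t.
    by apply: loc; apply/cvg_ex; exists (x t); apply: x1; rewrite t0.
  apply: zero; near=> s; apply/negP => /andP[s0 _].
  have : s < 0 by near: s; exact: nbhs_right_lt.
  by rewrite ltNge s0.
have [A AP] : exists A : R, \forall s \near t, `|x s| <= A.
  exists (Num.max `|x t| (Num.max L M)).
  move: HL HM; rewrite /at_left /at_right !near_withinE => HL HM.
  near=> s.
  have [st|st|->] := ltgtP s t; last by rewrite le_max lexx.
  - rewrite !le_max (_ : `|x s| <= L) ?orbT//.
    by move: st; near: s.
  - rewrite !le_max (_ : `|x s| <= M) ?orbT//.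
    by move: st; near: s.
exists ([set s | `|x s| <= A], [set M | A <= M]).
  by split=> //=; exists A; split; [exact: num_real|move=> M' /ltW].
by move=> [s M'] [/= xs AM]; exact: (le_trans xs).
Unshelve. all: by end_near. Qed.

Lemma regularD x y : regular_path x -> regular_path y ->
  regular_path (fun s => x s + y s).
Proof.
move=> [x1 [M xM]] [y1 [N yN]]; split.
  by move=> t t01; exact: (cvgD (x1 _ t01) (y1 _ t01)).
by exists (M + N) => s s01; rewrite (le_trans (ler_normD _ _))// lerD// ?xM ?yN.
Qed.

Lemma regularZ (c : R) x : regular_path x -> regular_path (fun s => c * x s).
Proof.
move=> [x1 [M xM]]; split; first by move=> t t01; exact: (cvgM (cvg_cst c) (x1 _ t01)).
by exists (`|c| * M) => s s01; rewrite normrM ler_wpM2l// xM.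
Qed.

Lemma regular_norm x : regular_path x -> regular_path (fun s => `|x s|).
Proof.
move=> [x1 [M xM]]; split; first by move=> t t01; exact: (cvg_norm (x1 _ t01)).
by exists M => s s01; rewrite normr_id xM.
Qed.

Lemma regular_sum (I : Type) (r : seq I) (x : I -> R -> R) :
  (forall i, regular_path (x i)) -> regular_path (fun s => \sum_(i <- r) x i s).
Proof.
move=> xr; elim: r => [|i r IH].
  under eq_fun do rewrite big_nil.
  by split=> [t _|]; [exact: cvg_cst|exists 0 => s _; rewrite normr0].
under eq_fun do rewrite big_cons.
exact: (regularD (xr i) IH).
Qed.

Definition rsup x t := fine (running_sup x t).

Lemma rsupE x t : regular_path x -> 0 <= t <= 1 ->
  running_sup x t = (rsup x t)%:E.
Proof.
move=> [_ [M xM]] /andP[t0 t1]; rewrite /rsup fineK//.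
have le1 : (running_sup x t <= M%:E)%E.
  apply: ge_ereal_sup => _ [s /= /andP[s0 st] <-]; rewrite lee_fin.
  by rewrite (le_trans (ler_norm _))// xM// s0 (le_trans st).
have le2 : ((x 0)%:E <= running_sup x t)%E.
  by apply: ereal_sup_ubound; exists 0 => //=; rewrite lexx.
by rewrite fin_numE; apply/andP; split; apply/eqP => E; rewrite E in le1 le2.
Qed.

Lemma le_rsup x s t : regular_path x -> t <= 1 -> 0 <= s <= t -> x s <= rsup x t.
Proof.
move=> rx t1 /andP[s0 st]; rewrite -lee_fin -rsupE//.
  by apply: ereal_sup_ubound; exists s => //=; rewrite s0.
by rewrite (le_trans s0).
Qed.

Lemma rsup_le x t b : regular_path x -> 0 <= t <= 1 ->
  (forall s, 0 <= s <= t -> x s <= b) -> rsup x t <= b.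
Proof.
move=> rx t01 xb; rewrite -lee_fin -rsupE//.
by apply: ge_ereal_sup => _ [s /= st <-]; rewrite lee_fin xb.
Qed.

Lemma rsup_mono x s t : regular_path x -> 0 <= s -> s <= t <= 1 ->
  rsup x s <= rsup x t.
Proof.
move=> rx s0 /andP[st t1]; apply: rsup_le => //.
  by rewrite s0 (le_trans st).
move=> u /andP[u0 us]; apply: le_rsup => //.
by rewrite u0 (le_trans us).
Qed.

(** The rationals clipped to [[0, 1]] and indexed by all integers, [0] standing for the codes of no
    rational. The times [t * dense_time k] are dense in [[0, t]] and include [t]. *)
Definition dense_time (k : nat) : R :=
  Num.min 1 (Num.max 0 (ratr (odflt 0 (@unpickle rat k)))).

Lemma dense_time01 k : 0 <= dense_time k <= 1.
Proof. by rewrite /dense_time le_min ler01 le_max lexx/= ge_min lexx. Qed.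

Lemma dense_timeP (q : rat) : 0 <= (ratr q : R) <= 1 ->
  exists k, dense_time k = ratr q.
Proof.
move=> /andP[q0 q1]; exists (pickle q); rewrite /dense_time pickleK/=.
by rewrite max_r// min_r.
Qed.

Lemma rsup_leP x t b : regular_path x -> 0 < t <= 1 ->
  rsup x t <= b <-> forall k, x (t * dense_time k) <= b.
Proof.
move=> rx /andP[t0 t1].
have rt k : 0 <= t * dense_time k <= t.
  have /andP[d0 d1] := dense_time01 k.
  by rewrite mulr_ge0 ?(ltW t0)//= ler_piMr// ltW.
split=> [xb k|xb]; first by apply: le_trans xb; exact: le_rsup.
apply: rsup_le => //; first by rewrite ltW.
move=> s /andP[s0]; rewrite le_eqVlt => /predU1P[->|st].
  (* Right continuity gives no access to the right end point from within [[0, t]]; it has to be one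
     of the sampled times, at ratio [1]. *)
  have [|k Ek] := @dense_timeP 1; first by rewrite rmorph1 ler01 lexx.
  by have := xb k; rewrite Ek rmorph1 mulr1.
apply/ler_addgt0Pr => e e0.
have [x1 _] := rx.
have s01 : 0 <= s < 1 by rewrite s0 (lt_le_trans st).
have /cvgrPdist_le/(_ _ e0) := x1 _ s01.
rewrite /at_right near_withinE => -[d/= d0 dP].
have sd : s / t < Num.min 1 ((s + d) / t).
  by rewrite lt_min ltr_pdivrMr// mul1r st ltr_pM2r ?invr_gt0// ltrDl.
have [q] := rat_in_itvoo sd.
rewrite in_itv/= lt_min => /andP[sq /andP[q1 qd]].
have q0 : 0 <= ratr q :> R by rewrite (le_trans _ (ltW sq))// divr_ge0// ltW.
have [|k Ek] := @dense_timeP q; first by rewrite q0 ltW.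
have := xb k; rewrite Ek => xk.
have stq : s < t * ratr q by rewrite mulrC -ltr_pdivrMr.
have tqd : t * ratr q < s + d by rewrite mulrC -ltr_pdivlMr.
have := dP (t * ratr q); rewrite /ball_/= => /(_ _ stq) H.
have {}H : `|x s - x (t * ratr q)| <= e.
  by apply: H; rewrite ltr_norml; lra.
by move: H; rewrite ler_norml; lra.
Qed.

Lemma rsup_gtP x t b : regular_path x -> 0 < t <= 1 ->
  b < rsup x t <-> exists k, b < x (t * dense_time k).
Proof.
move=> rx t01; split=> [bx|[k bx]].
  apply: contrapT => /forallNP H; move: bx; rewrite ltNge => /negP; apply.
  by apply/(rsup_leP _ rx t01) => k; rewrite leNgt; apply/negP.
rewrite ltNge; apply/negP => /(rsup_leP _ rx t01)/(_ k).
by rewrite leNgt bx.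
Qed.

Lemma measurable_rsup d (T : measurableType d) (x : T -> R -> R) t :
  0 < t <= 1 -> (forall w, regular_path (x w)) ->
  (forall s, 0 <= s <= 1 -> measurable_fun setT (fun w => x w s)) ->
  measurable_fun setT (fun w => rsup (x w) t).
Proof.
move=> t01 rx mx; apply: (measurability _ (RGenOInfty.measurableE R)).
move=> _ [_ [b ->] <-]; rewrite setTI.
rewrite (_ : _ @^-1` _ = \bigcup_k [set w | b < x w (t * dense_time k)]).
  apply: bigcup_measurable => k _.
  have mk : measurable_fun setT (fun w => x w (t * dense_time k)).
    apply: mx; have /andP[d0 d1] := dense_time01 k; case/andP: t01 => t0 t1.
    by rewrite mulr_ge0 ?(ltW t0)//= mulr_ile1// ltW.
  rewrite (_ : [set _ | _] = (fun w => x w (t * dense_time k)) @^-1` `]b, +oo[).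
    exact: measurable_preimage.
  by apply/seteqP; split=> w /=; rewrite in_itv/= andbT.
apply/seteqP; split=> w /=; rewrite in_itv/= andbT.
  by move=> /(rsup_gtP _ (rx w) t01)[k]; exists k.
by move=> [k _ bk]; apply/(rsup_gtP _ (rx w) t01); exists k.
Qed.

End regular_paths.

Lemma ge0_le_integral_pr d (T : measurableType d) (R : realType)
    (P : {measure set T -> \bar R}) (f g : T -> R) :
  measurable_fun setT f -> measurable_fun setT g ->
  (forall w, 0 <= f w <= g w) ->
  (\int[P]_w (f w)%:E <= \int[P]_w (g w)%:E)%E.
Proof.
move=> mf mg fg; apply: ge0_le_integral => //.
- by move=> w _; rewrite lee_fin; case/andP: (fg w).
- exact/measurable_EFinP.
- exact/measurable_EFinP.
- by move=> w _; rewrite lee_fin; case/andP: (fg w).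
Qed.

(** * Fernique's second-moment bound *)

Section fernique.
Context d (T : measurableType d) (R : realType) (P : probability T R).
(** [N0] and [N1] stand for the sup norms of independent copies [X0] and [X1], and [U] and [V] for
    those of [(4 X0 - 3 X1) / 5] and [(3 X0 + 4 X1) / 5], a pair with the same joint law. Inverting
    this rotation expresses [3 V] and [4 V] as in [V0] and [V1]. *)
Variables (N0 N1 U V : T -> R).
Hypotheses (mN0 : measurable_fun setT N0) (mN1 : measurable_fun setT N1)
  (mU : measurable_fun setT U) (mV : measurable_fun setT V)
  (N0_ge0 : forall w, 0 <= N0 w)
  (N01 : forall a b, P ([set w | N0 w <= a] `&` [set w | N1 w <= b]) =
    (P [set w | N0 w <= a]%R * P [set w | N1 w <= b]%R)%E)
  (UV : forall a b, P ([set w | U w <= a] `&` [set w | V w <= b]) =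
    P ([set w | N0 w <= a] `&` [set w | N1 w <= b]))
  (U_law : forall a, P [set w | U w <= a] = P [set w | N0 w <= a])
  (N1_law : forall a, P [set w | N1 w <= a] = P [set w | N0 w <= a])
  (V0 : forall w, 3 * V w <= 4 * U w + 5 * N0 w)
  (V1 : forall w, 4 * V w <= 3 * U w + 5 * N1 w).

Implicit Types (f g : T -> R) (r : R).

Definition tail f r := fine (P [set w | r < f w]).

Lemma tailE f r : measurable_fun setT f -> P [set w | r < f w] = (tail f r)%:E.
Proof. by move=> mf; rewrite fineK// fin_num_measure//; exact: measurable_superlevel. Qed.

Lemma le_prob (A B : set T) : measurable A -> measurable B -> A `<=` B ->
  (P A <= P B)%E.
Proof. by move=> mA mB AB; apply: le_measure; rewrite ?inE. Qed.

Lemma tail_anti f r r' : measurable_fun setT f -> r <= r' -> tail f r' <= tail f r.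
Proof.
move=> mf rr; rewrite -lee_fin -!tailE//; apply: le_prob.
- exact: measurable_superlevel.
- exact: measurable_superlevel.
- by move=> w /=; exact: le_lt_trans.
Qed.

Lemma sublevel_tail f r : measurable_fun setT f ->
  P [set w | f w <= r] = (1 - tail f r)%:E.
Proof.
move=> mf; rewrite EFinB -tailE// -probability_setC//; last exact: measurable_superlevel.
by congr (P _); apply/seteqP; split=> w /=; rewrite leNgt => /negP.
Qed.

Lemma tail_ge0 f r : 0 <= tail f r.
Proof. by rewrite fine_ge0. Qed.

(** When [U <= s] and [V > r], the inequalities [V0] and [V1] force [N0 > (3 r - 4 s) / 5] and
    [N1 > (4 r - 3 s) / 5], and the latter bound is no smaller than the former. Both events are
    intersections for independent variables, whence the two products. *)
Lemma fernique_rotation (s r : R) : 0 <= s -> 0 <= r ->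
  (1 - tail N0 s) * tail N0 r <= tail N0 ((3 * r - 4 * s) / 5) ^+ 2.
Proof.
move=> s0 r0; set q := (3 * r - 4 * s) / 5.
have mlo f a : measurable_fun setT f -> measurable [set w | f w <= a].
  exact: measurable_sublevel.
have mhi f a : measurable_fun setT f -> measurable [set w | a < f w].
  exact: measurable_superlevel.
have t1 a : tail N1 a = tail N0 a.
  have := N1_law a; rewrite !sublevel_tail// => -[]; lra.
pose A := [set w | U w <= s] `&` [set w | r < V w].
pose B := [set w | q < N0 w] `&` [set w | q < N1 w].
have AB : (P A <= P B)%E.
  apply: le_prob; [exact: measurableI (mlo _ _ mU) (mhi _ _ mV)|
    exact: measurableI (mhi _ _ mN0) (mhi _ _ mN1)|].
  move=> w [/= us rv]; have := V0 w; have := V1 w; rewrite /q => h1 h0.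
  by split; rewrite /= /q; lra.
have split_ (f g : T -> R) a b : measurable_fun setT f -> measurable_fun setT g ->
    P ([set w | f w <= a] `&` [set w | g w <= b]) =
    (P [set w | f w <= a]%R - P ([set w | f w <= a]%R `&` [set w | b < g w]%R))%E.
  move=> mf mg.
  have -> : P [set w | f w <= a] =
      (P ([set w | (f w <= a)%R] `&` [set w | (g w <= b)%R]) +
       P ([set w | (f w <= a)%R] `&` [set w | (b < g w)%R]))%E.
    rewrite -measureU//; first last.
    - apply/seteqP; split=> w //= -[[_ gb] [_]].
      by rewrite ltNge gb.
    - by apply: measurableI; [exact: mlo|exact: mhi].
    - by apply: measurableI; exact: mlo.
    congr (P _); rewrite -setIUr; apply/seteqP; split=> w; last by case.
    by move=> fa; split=> //=; case: (leP (g w) b); [left|right].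
  rewrite addeK// fin_num_measure//.
  by apply: measurableI; [exact: mlo|exact: mhi].
have PA : P A = ((1 - tail N0 s) * tail N0 r)%:E.
  have mA : measurable A by apply: measurableI; [exact: mlo|exact: mhi].
  have := split_ U V s r mU mV; rewrite UV N01 U_law N1_law !sublevel_tail//.
  rewrite -/A -(fineK (fin_num_measure P _ mA)) -EFinM -EFinB => -[E].
  by congr EFin; move: E; set a := tail _ _; set b := tail _ _; lra.
have PB : P B = (tail N0 q ^+ 2)%:E.
  have mB : measurable B by apply: measurableI; exact: mhi.
  have mC : measurable ([set w | N0 w <= q] `&` [set w | q < N1 w]).
    by apply: measurableI; [exact: mlo|exact: mhi].
  have E1 := split_ N0 N1 q q mN0 mN1.
  have E2 : P [set w | q < N1 w] =
      (P B + P ([set w | (N0 w <= q)%R] `&` [set w | (q < N1 w)%R]))%E.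
    rewrite -measureU//; last first.
      apply/seteqP; split=> w // -[[qn _] [nq _]].
      by have : N0 w <= q := nq; rewrite leNgt => /negP; apply.
    congr (P _); rewrite -setIUl; apply/seteqP; split=> w; last by case.
    by move=> fa; split=> //=; case: (leP (N0 w) q); [right|left].
  move: E1 E2; rewrite N01 N1_law !sublevel_tail// tailE// t1.
  rewrite -(fineK (fin_num_measure P _ mB)) -(fineK (fin_num_measure P _ mC)).
  rewrite -EFinM -EFinB -EFinD => -[E1] [E2]; congr EFin.
  by move: E1 E2; set a := tail _ _; nra.
by move: AB; rewrite PA PB lee_fin.
Qed.

Variables (s : R) (s_gt0 : 0 < s) (tail_s : tail N0 s <= 8^-1).

(** [8 s <= r] is what makes [(3 r - 4 s) / 5] at least [r / 2]. Of the two factors on the right of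
    the rotation bound one is kept and the other is at most [1/8], while the factor on the left is
    at least [7/8]. *)
Lemma fernique_step r : 8 * s <= r -> tail N0 r <= tail N0 (r / 2) / 7.
Proof.
have s0 := s_gt0; move=> sr.
have h1 := fernique_rotation (ltW s_gt0) (_ : 0 <= r).
have h2 : tail N0 ((3 * r - 4 * s) / 5) <= tail N0 (r / 2).
  by apply: tail_anti => //; lra.
have h3 : tail N0 (r / 2) <= tail N0 s by apply: tail_anti => //; lra.
have {}h1 : (1 - tail N0 s) * tail N0 r <= tail N0 ((3 * r - 4 * s) / 5) ^+ 2.
  by apply: h1; lra.
have := tail_ge0 N0 r; have := tail_ge0 N0 (r / 2).
have := tail_ge0 N0 ((3 * r - 4 * s) / 5).
move: h1 h2 h3 tail_s; set a := tail _ s; set b := tail _ r; set c := tail _ (r / 2).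
set e := tail _ (_ / 5) => h1 h2 h3 h4 e0 c0 b0.
have : (7 / 8) * b <= (1 - a) * b by apply: ler_wpM2r => //; lra.
have : e ^+ 2 <= c * 8^-1.
  by rewrite expr2; apply: ler_pM => //; lra.
by lra.
Qed.

Let q j : R := 8 * s * 2 ^+ j.

Let q_gt0 j : 0 < q j.
Proof. by rewrite !mulr_gt0// exprn_gt0. Qed.

Lemma fernique_tail j : tail N0 (q j) <= 7^-1 ^+ j / 8.
Proof.
elim: j => [|j IH].
  rewrite expr0 mul1r; apply: le_trans tail_s; apply: tail_anti => //.
  by rewrite /q expr0 mulr1; move: s_gt0; lra.
have qE : q j.+1 / 2 = q j by rewrite /q exprS; field.
have := @fernique_step (q j.+1); rewrite qE.
have -> : 8 * s <= q j.+1.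
  by rewrite /q ler_peMr ?mulr_ge0 ?(ltW s_gt0)// exprn_ege1// ler1n.
move=> /(_ isT); rewrite exprS; lra.
Qed.

Let sq_min j (w : T) := Num.min (N0 w) (q j) ^+ 2.

Let msq_min j : measurable_fun setT (sq_min j).
Proof. by apply: measurable_funX; exact: measurable_minr. Qed.

(** Raising the truncation from [q j] to [q j.+1] costs at most [q j.+1 ^ 2] on the event
    [q j < N0], that is [32 (4/7) ^ j s ^ 2]. This geometric series has sum [(224/3) s ^ 2], to
    which the first level adds [64 s ^ 2]; the total is below [139 s ^ 2]. *)
Lemma fernique_truncated j :
  (\int[P]_w (sq_min j w)%:E <= ((139 - 224 / 3 * (4 / 7) ^+ j) * s ^+ 2)%:E)%E.
Proof.
have q0 := q_gt0; elim: j => [|j IH].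
  apply: (@le_trans _ _ (\int[P]_w (64 * s ^+ 2)%:E)%E).
    apply: ge0_le_integral_pr => // w; rewrite sqr_ge0/=.
    have -> : 64 * s ^+ 2 = q 0%N ^+ 2 by rewrite /q expr0; ring.
    rewrite ler_pXn2r// ?nnegrE ?(ltW (q0 _))//; first by rewrite ge_min lexx orbT.
    by rewrite le_min N0_ge0 (ltW (q0 _)).
  rewrite integral_prob_cst lee_fin expr0.
  have := sqr_ge0 s; lra.
apply: (@le_trans _ _ (\int[P]_w (sq_min j w +
    q j.+1 ^+ 2 * \1_[set w | q j < N0 w] w)%:E)%E).
  apply: ge0_le_integral_pr => //.
    apply: measurable_funD => //; apply: measurable_funM => //.
    by apply: measurable_indic; exact: measurable_superlevel.
  move=> w; rewrite sqr_ge0/= /sq_min indicE.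
  have qq : q j <= q j.+1 by rewrite /q exprS; have := q0 j; rewrite /q; lra.
  have n0 := N0_ge0 w; have a0 := q0 j; have b0 := q0 j.+1.
  have [nq|qn] := leP (N0 w) (q j).
    rewrite min_l; last exact: le_trans qq.
    by rewrite lerDl mulr_ge0// sqr_ge0.
  rewrite mem_set//= mulr1; apply: (@le_trans _ _ (q j.+1 ^+ 2)).
    rewrite ler_pXn2r// ?nnegrE ?(ltW b0)//; first by rewrite ge_min lexx orbT.
    by rewrite le_min N0_ge0 (ltW b0).
  by rewrite lerDr sqr_ge0.
have mA : measurable [set w | q j < N0 w] by exact: measurable_superlevel.
under eq_integral do rewrite EFinD.
rewrite ge0_integralD//; first last.
- by apply/measurable_EFinP; apply: measurable_funM => //; exact: measurable_indic.
- by move=> w _; rewrite lee_fin mulr_ge0// sqr_ge0.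
- exact/measurable_EFinP.
- by move=> w _; rewrite lee_fin sqr_ge0.
under [X in (_ + X)%E]eq_integral do rewrite EFinM.
rewrite ge0_integralZl_EFin//; first last.
- exact: sqr_ge0.
- by apply/measurable_EFinP; exact: measurable_indic.
rewrite (etrans (integral_indicT P mA) (tailE (q j) mN0)).
apply: (le_trans (leeD IH (lexx _))).
rewrite -EFinM -EFinD lee_fin.
have h : q j.+1 ^+ 2 * tail N0 (q j) <= q j.+1 ^+ 2 * (7^-1 ^+ j / 8).
  by rewrite ler_wpM2l ?sqr_ge0// fernique_tail.
apply: (le_trans (lerD (lexx _) h)).
have -> : q j.+1 ^+ 2 * (7^-1 ^+ j / 8) = 32 * (4 / 7) ^+ j * s ^+ 2.
  have -> : (4 / 7) ^+ j = 2 ^+ j * 2 ^+ j * 7^-1 ^+ j :> R.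
    by rewrite -!exprMn; congr (_ ^+ _); field.
  by rewrite /q [2 ^+ j.+1]exprS; move: (2 ^+ j) (7^-1 ^+ j) => a b; field.
rewrite -mulrDl [(4 / 7) ^+ j.+1]exprS; apply: ler_wpM2r; first exact: sqr_ge0.
by move: ((4 / 7) ^+ j) => x; lra.
Qed.

(** Monotone convergence of the truncations. The constant is rounded up to the square [144], which
    at the level [16 mean_sup t] gives [(192 mean_sup t) ^ 2]. *)
Lemma fernique_moment : (\int[P]_w (N0 w ^+ 2)%:E <= (144 * s ^+ 2)%:E)%E.
Proof.
have q0 := q_gt0.
have lim w : (fun j => (sq_min j w)%:E) @ \oo --> (N0 w ^+ 2)%:E.
  apply: cvg_near_cst; exists (Num.bound (N0 w / (8 * s))) => // j /= mj.
  rewrite /sq_min min_l//.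
  have s8 : 0 < 8 * s by rewrite mulr_gt0.
  rewrite /q mulrC -ler_pdivrMr//.
  apply: (@le_trans _ _ (Num.bound (N0 w / (8 * s)))%:R).
    by apply/ltW/archi_boundP; rewrite divr_ge0// ltW.
  rewrite -natrX ler_nat (leq_trans mj)// ltnW// ltn_expl//.
under eq_integral do rewrite -(cvg_lim _ (lim _))//.
rewrite monotone_convergence//; first last.
- move=> w _ i j ij; rewrite lee_fin /sq_min.
  rewrite ler_pXn2r// ?nnegrE ?le_min ?N0_ge0 ?(ltW (q0 _))//=.
  rewrite ge_min lexx/= ge_min; apply/orP; right.
  by rewrite /q ler_pM2l ?mulr_gt0// ler_weXn2l// ler1n.
- by move=> j w _; rewrite lee_fin sqr_ge0.
- by move=> j; exact/measurable_EFinP.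
apply: lime_le.
  apply: ereal_nondecreasing_is_cvgn => i j ij; apply: ge0_le_integral_pr => // w.
  rewrite sqr_ge0 /sq_min/=.
  rewrite ler_pXn2r// ?nnegrE ?le_min ?N0_ge0 ?(ltW (q0 _))//=.
  rewrite ge_min lexx/= ge_min; apply/orP; right.
  by rewrite /q ler_pM2l ?mulr_gt0// ler_weXn2l// ler1n.
apply: nearW => j; apply: (le_trans (fernique_truncated j)); rewrite lee_fin.
apply: ler_wpM2r; first exact: sqr_ge0.
have : 0 <= (4 / 7) ^+ j :> R by rewrite exprn_ge0//; lra.
by lra.
Qed.

End fernique.

Section sup_laws.
Context {R : realType} {n : nat} (P : probability (cadlag 'rV[R]_n.+1) R).
Hypotheses (X_indep : mutually_independent P (@component R n.+1))
  (X_id : identically_distributed P (@component R n.+1))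
  (X_gauss : forall i : 'I_n.+1, gaussian_process P (fun t w => w t 0 i))
  (X_mean : forall i : 'I_n.+1, zero_mean_process P (fun t w => w t 0 i)).
Implicit Types (w : cadlag 'rV[R]_n.+1) (u v : 'I_n.+1 -> R) (t b : R).

Definition dot u v := \sum_i u i * v i.

Definition lin u w (s : R) := \sum_i u i * w s 0 i.

Lemma lin_regular u w : regular_path (lin u w).
Proof.
by apply: regular_sum => i; apply: regularZ; exact: (regular_cadlag (component i w)).
Qed.

Lemma measurable_lin u s : 0 <= s <= 1 -> measurable_fun setT (fun w => lin u w s).
Proof.
move=> s01; apply: measurable_sum => i; apply: measurable_funM => //.
exact: measurable_eval_coord.
Qed.

Definition lsup u t w := rsup (lin u w) t.

Definition labs u t w := rsup (fun s => `|lin u w s|) t.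

Lemma measurable_lsup u t : 0 < t <= 1 -> measurable_fun setT (lsup u t).
Proof.
move=> t01; apply: measurable_rsup => // [w|s s01]; first exact: lin_regular.
exact: measurable_lin.
Qed.

Lemma measurable_labs u t : 0 < t <= 1 -> measurable_fun setT (labs u t).
Proof.
move=> t01; apply: measurable_rsup => // [w|s s01].
  exact/regular_norm/lin_regular.
by apply: measurableT_comp => //; exact: measurable_lin.
Qed.

(** Continuity from above along the events imposing only the first [m] constraints, to which the
    finite case applies. *)
Lemma gram_law_seq (t : nat -> R) (alpha beta : nat -> 'I_n.+1 -> R) (b : nat -> R) :
  (forall a, 0 <= t a <= 1) ->
  (forall a a', dot (alpha a) (alpha a') = dot (beta a) (beta a')) ->
  P [set w | forall a, lin (alpha a) w (t a) <= b a] =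
  P [set w | forall a, lin (beta a) w (t a) <= b a].
Proof.
move=> t01 gram.
pose S (al : nat -> 'I_n.+1 -> R) (m : nat) :=
  [set w : cadlag 'rV[R]_n.+1 | forall a : 'I_m, lin (al a) w (t a) <= b a].
have mS al m : measurable (S al m).
  rewrite (_ : S al m = \bigcap_k [set w | (k < m)%N -> lin (al k) w (t k) <= b k]).
    apply: bigcapT_measurable => k; have [km|km] := boolP (k < m)%N.
      rewrite (_ : [set _ | _] = [set w | lin (al k) w (t k) <= b k]).
        by apply: measurable_sublevel; exact: measurable_lin.
      by apply/seteqP; split=> w /=; [exact|].
    rewrite (_ : [set _ | _] = setT)//.
    by apply/seteqP; split=> w.
  apply/seteqP; split=> w wS; first by move=> k _ km; exact: (wS (Ordinal km)).
  by move=> a; exact: (wS a I (ltn_ord a)).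
have SE al : [set w | forall a, lin (al a) w (t a) <= b a] = \bigcap_m S al m.
  apply/seteqP; split=> [w wS m _ a|w wS a]; first exact: wS.
  exact: (wS a.+1 I ord_max).
have Sc al : (P \o S al) @ \oo --> P [set w | forall a, lin (al a) w (t a) <= b a].
  rewrite SE; apply: nonincreasing_cvg_mu => //.
  - by rewrite -ge0_fin_numE// fin_num_measure.
  - exact: bigcapT_measurable.
  - move=> i j ij; rewrite subsetEset => w wS a.
    exact: (wS (widen_ord ij a)).
apply: (cvg_unique _ (Sc alpha)) => //.
rewrite (_ : P \o S alpha = P \o S beta); first exact: Sc.
by apply/funext => m /=; apply: gram_law => // a a'; exact: gram.
Qed.

Let time01 t k : 0 < t <= 1 -> 0 <= t * dense_time k <= 1.
Proof.
move=> /andP[t0 t1]; have /andP[d0 d1] := @dense_time01 R k.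
by rewrite mulr_ge0 ?(ltW t0)//= mulr_ile1// ltW.
Qed.

Lemma lsup_law u v t b : 0 < t <= 1 -> dot u u = dot v v ->
  P [set w | lsup u t w <= b] = P [set w | lsup v t w <= b].
Proof.
move=> t01 uv.
have E u' : [set w | lsup u' t w <= b] =
    [set w | forall k, lin u' w (t * dense_time k) <= b].
  by apply/seteqP; split=> w /(rsup_leP _ (lin_regular u' w) t01).
rewrite !E.
apply: (@gram_law_seq (fun k => t * dense_time k) (fun=> u) (fun=> v) (fun=> b)).
  by move=> k; exact: time01.
by move=> _ _; exact: uv.
Qed.

Lemma labs_law2 u u' v v' t b b' : 0 < t <= 1 ->
  dot u u = dot v v -> dot u u' = dot v v' -> dot u' u' = dot v' v' ->
  P ([set w | labs u t w <= b] `&` [set w | labs u' t w <= b']) =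
  P ([set w | labs v t w <= b] `&` [set w | labs v' t w <= b']).
Proof.
move=> t01 uv uv' uv''.
(* Two absolute suprema become a single sequence of linear constraints: the lowest bit of [a] is the
   sign, the next one chooses between [u] and [u'], and the remaining bits number the time. *)
pose al u u' (a : nat) i := (-1) ^+ odd a * (if odd a./2 then u' i else u i) : R.
pose bb (a : nat) := if odd a./2 then b' else b.
have E u1 u2 : [set w | labs u1 t w <= b] `&` [set w | labs u2 t w <= b'] =
    [set w | forall a, lin (al u1 u2 a) w (t * dense_time a./2./2) <= bb a].
  have linE a w s : lin (al u1 u2 a) w s =
      (-1) ^+ odd a * (if odd a./2 then lin u2 w s else lin u1 w s).
    rewrite /lin /al; case: (odd a./2); rewrite mulr_sumr;
    by apply: eq_bigr => i _; rewrite mulrA.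
  have aP (x c : R) : `|x| <= c <-> forall e : bool, (-1) ^+ e * x <= c.
    split=> [/ler_normlP[h1 h2] []|h].
    - by rewrite expr1 mulN1r.
    - by rewrite expr0 mul1r.
    - apply/ler_normlP; split; first by have := h true; rewrite expr1 mulN1r.
      by have := h false; rewrite expr0 mul1r.
  have r1 w := regular_norm (lin_regular u1 w).
  have r2 w := regular_norm (lin_regular u2 w).
  apply/seteqP; split=> w.
    move=> [/(rsup_leP _ (r1 w) t01) h1 /(rsup_leP _ (r2 w) t01) h2] a.
    rewrite linE /bb; case: (odd a./2).
      by move: (h2 a./2./2) => /aP.
    by move: (h1 a./2./2) => /aP.
  move=> h; split; apply/(rsup_leP _ _ t01) => // k; apply/aP => e.
    have := h (e + (false + k.*2).*2)%N.
    by rewrite linE /bb oddD !odd_double addbF oddb !half_bit_double odd_double.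
  have := h (e + (true + k.*2).*2)%N.
  by rewrite linE /bb oddD !odd_double addbF oddb !half_bit_double oddD odd_double.
rewrite !E; apply: gram_law_seq => [a|a a']; first exact: time01.
have dE u1 u2 : dot (al u1 u2 a) (al u1 u2 a') =
    (-1) ^+ odd a * (-1) ^+ odd a' *
    (if odd a./2 then if odd a'./2 then dot u2 u2 else dot u1 u2
     else if odd a'./2 then dot u1 u2 else dot u1 u1).
  rewrite /dot /al; case: (odd a./2); case: (odd a'./2); rewrite mulr_sumr;
  by apply: eq_bigr => i _; ring.
by rewrite !dE uv uv' uv''.
Qed.

Definition axis (i j : 'I_n.+1) : R := (i == j)%:R.

Lemma dot_axis i j : dot (axis i) (axis j) = (i == j)%:R.
Proof.
rewrite /dot (bigD1 i)//= big1 ?addr0; first by rewrite /axis eqxx mul1r eq_sym.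
by move=> k ki; rewrite /axis eq_sym (negbTE ki) mul0r.
Qed.

Lemma dotC u v : dot u v = dot v u.
Proof. by apply: eq_bigr => i _; rewrite mulrC. Qed.

Lemma dotDl u u' v : dot (u + u') v = dot u v + dot u' v.
Proof. by rewrite /dot -big_split; apply: eq_bigr => i _; rewrite /= mulrDl. Qed.

Lemma dotZl (c : R) u v : dot (fun i => c * u i) v = c * dot u v.
Proof. by rewrite /dot mulr_sumr; apply: eq_bigr => i _; rewrite mulrA. Qed.

Lemma lin_axis i w s : lin (axis i) w s = w s 0 i.
Proof.
rewrite /lin (bigD1 i)//= big1 ?addr0; first by rewrite /axis eqxx mul1r.
by move=> k ki; rewrite /axis eq_sym (negbTE ki) mul0r.
Qed.

Lemma linD u v w s : lin (u + v) w s = lin u w s + lin v w s.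
Proof. by rewrite /lin -big_split; apply: eq_bigr => i _; rewrite /= mulrDl. Qed.

Lemma linZ (c : R) u w s : lin (fun i => c * u i) w s = c * lin u w s.
Proof. by rewrite /lin mulr_sumr; apply: eq_bigr => i _; rewrite mulrA. Qed.

Lemma labs_indep i j t a b : i != j -> 0 < t <= 1 ->
  P ([set w | labs (axis i) t w <= a] `&` [set w | labs (axis j) t w <= b]) =
  (P [set w | labs (axis i) t w <= a]%R * P [set w | labs (axis j) t w <= b]%R)%E.
Proof.
move=> ij t01.
pose S c := [set x : cadlag R | rsup (fun s => `|x s|) t <= c].
have mS c : measurable (S c).
  apply: measurable_sublevel; apply: measurable_rsup => // [x|s s01].
    exact/regular_norm/regular_cadlag.
  by apply: measurableT_comp => //; exact: measurable_eval.
have E k c : [set w | labs (axis k) t w <= c] = component k @^-1` S c.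
  apply/seteqP; split=> w; rewrite /labs /S /= ; congr (rsup _ _ <= _);
  by apply/funext => s; rewrite lin_axis.
rewrite !E.
have := @X_indep [set i; j]%SET (fun k => S (if k == i then a else b)) (fun=> mS _).
rewrite big_setU1/= ?inE// big_set1 eqxx eq_sym (negbTE ij) => <-.
congr (P _); apply/seteqP; split=> w.
  move=> [wi wj] k /=; rewrite !inE => /orP[/eqP->|/eqP->]; first by rewrite eqxx.
  by rewrite eq_sym (negbTE ij).
move=> h; split.
  by have := h i; rewrite /= !inE eqxx; apply.
by have := h j; rewrite /= !inE eqxx orbT eq_sym (negbTE ij); apply.
Qed.

Lemma labs_axis_law i j t a : 0 < t <= 1 ->
  P [set w | labs (axis i) t w <= a] = P [set w | labs (axis j) t w <= a].
Proof.
move=> t01; rewrite -[LHS](congr1 P (setIid _)) -[RHS](congr1 P (setIid _)).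
by apply: labs_law2 => //; rewrite !dot_axis !eqxx.
Qed.

(** Component [j] plays the independent copy. The vectors [u] and [v] below are orthonormal, like
    the two axes, so the Gram matrices agree and the rotated pair of suprema has the joint law of
    the original one. *)
Lemma labs_moment i j t (s : R) : i != j -> 0 < t <= 1 -> 0 < s ->
  tail P (labs (axis i) t) s <= 8^-1 ->
  (\int[P]_w (labs (axis i) t w ^+ 2)%:E <= (144 * s ^+ 2)%:E)%E.
Proof.
move=> ij t01 s0 ts.
pose u : 'I_n.+1 -> R := (fun k => 4 / 5 * axis i k) + (fun k => - (3 / 5) * axis j k).
pose v : 'I_n.+1 -> R := (fun k => 3 / 5 * axis i k) + (fun k => 4 / 5 * axis j k).
have dotE a b c e : dot ((fun k => a * axis i k) + (fun k => b * axis j k))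
    ((fun k => c * axis i k) + (fun k => e * axis j k)) = a * c + b * e.
  rewrite dotDl !dotZl (dotC (axis i)) (dotC (axis j)) !dotDl !dotZl !dot_axis.
  by rewrite !eqxx (eq_sym j) (negbTE ij)/=; ring.
have uu : dot u u = 1 by rewrite dotE; field.
have uv : dot u v = 0 by rewrite dotE; field.
have vv : dot v v = 1 by rewrite dotE; field.
have rn u' w := regular_norm (lin_regular u' w).
have t1 : t <= 1 by case/andP: t01.
have tw : 0 <= t <= 1 by case/andP: t01 => /ltW ->.
have le u' w x : 0 <= x <= t -> `|lin u' w x| <= labs u' t w.
  by move=> xt; apply: (@le_rsup _ (fun s => `|lin u' w s|)).
apply: (@fernique_moment _ _ _ P (labs (axis i) t) (labs (axis j) t) (labs u t)
  (labs v t)) => //; try exact: measurable_labs.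
- by move=> w; apply: le_trans (le _ w 0 _) => //; rewrite lexx; case/andP: tw.
- by move=> a b; exact: labs_indep.
- move=> a b; apply: labs_law2 => //; rewrite ?uu ?uv ?vv dot_axis ?eqxx//.
  by rewrite (negbTE ij).
- move=> a; rewrite -[LHS](congr1 P (setIid _)) -[RHS](congr1 P (setIid _)).
  by apply: labs_law2 => //; rewrite uu dot_axis eqxx.
- by move=> a; exact: labs_axis_law.
- move=> w; rewrite mulrC -ler_pdivlMr//; apply: rsup_le => // x xt.
  have := le u w x xt; have := le (axis i) w x xt.
  have : lin u w x = 4 / 5 * lin (axis i) w x + - (3 / 5) * lin (axis j) w x.
    by rewrite linD !linZ.
  have -> : lin v w x = 3 / 5 * lin (axis i) w x + 4 / 5 * lin (axis j) w x.
    by rewrite linD !linZ.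
  move: (lin u w x) (lin (axis i) w x) (lin (axis j) w x) => U X0 X1.
  by move=> UE /ler_normlP[? ?] /ler_normlP[? ?]; rewrite ler_norml; apply/andP; split; lra.
- move=> w; rewrite mulrC -ler_pdivlMr//; apply: rsup_le => // x xt.
  have := le u w x xt; have := le (axis j) w x xt.
  have : lin u w x = 4 / 5 * lin (axis i) w x + - (3 / 5) * lin (axis j) w x.
    by rewrite linD !linZ.
  have -> : lin v w x = 3 / 5 * lin (axis i) w x + 4 / 5 * lin (axis j) w x.
    by rewrite linD !linZ.
  move: (lin u w x) (lin (axis i) w x) (lin (axis j) w x) => U X0 X1.
  by move=> UE /ler_normlP[? ?] /ler_normlP[? ?]; rewrite ler_norml; apply/andP; split; lra.
Qed.

End sup_laws.

Section integral_tools.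
Context d (T : measurableType d) (R : realType) (P : probability T R).
Implicit Types f g : T -> R.

Lemma markov_tail f (s : R) : measurable_fun setT f -> (forall w, 0 <= f w) ->
  (s%:E * P [set w | (s < f w)%R] <= \int[P]_w (f w)%:E)%E.
Proof.
move=> mf f0; have [s0|s0] := leP s 0.
  apply: (@le_trans _ _ 0%E); last by apply: integral_ge0 => w _; rewrite lee_fin.
  by rewrite mule_le0_ge0 ?lee_fin// measure_ge0.
have mA : measurable [set w | s < f w] by exact: measurable_superlevel.
rewrite -(integral_indicT P mA) -ge0_integralZl_EFin//; last exact: ltW; first last.
- by apply/measurable_EFinP; exact: measurable_indic.
under eq_integral do rewrite -EFinM.
apply: ge0_le_integral_pr => //.
  by apply: measurable_funM => //; exact: measurable_indic.
move=> w; rewrite mulr_ge0 ?(ltW s0)//= indicE.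
have [sf|sf] := ltP s (f w); first by rewrite mem_set//= mulr1 ltW.
by rewrite memNset/= ?mulr0//; apply/negP; rewrite -leNgt.
Qed.

Lemma same_law_mean f g : measurable_fun setT f -> measurable_fun setT g ->
  (forall w, 0 <= f w) -> (forall w, 0 <= g w) ->
  (forall b, 0 <= b -> P [set w | f w <= b] = P [set w | g w <= b]) ->
  (\int[P]_w (f w)%:E = \int[P]_w (g w)%:E)%E.
Proof.
move=> mf mg f0 g0 fg; rewrite !layer_cake//; apply: eq_integral => b.
rewrite inE/= in_itv/= andbT => b0.
have := fg _ b0; rewrite !sublevel_tail// => -[E].
apply: (etrans (tailE P b mf)); apply: etrans (esym (tailE P b mg)).
by congr EFin; lra.
Qed.

End integral_tools.

(** * The mean supremum: finiteness, positivity, limit at time zero *)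

Section sup_means.
Context {R : realType} {n : nat} (P : probability (cadlag 'rV[R]_n.+1) R).
Hypotheses (n_gt0 : (2 <= n.+1)%N)
  (X_start : P [set w : cadlag 'rV[R]_n.+1 | w 0 = 0] = 1%E)
  (X_indep : mutually_independent P (@component R n.+1))
  (X_id : identically_distributed P (@component R n.+1))
  (X_gauss : forall i : 'I_n.+1, gaussian_process P (fun t w => w t 0 i))
  (X_mean : forall i : 'I_n.+1, zero_mean_process P (fun t w => w t 0 i))
  (X_nondeg : forall t : R, 0 < t <= 1 ->
    (0 < P [set w : cadlag 'rV[R]_n.+1 | (w t != 0)%R])%E).
Implicit Types (w : cadlag 'rV[R]_n.+1) (u v : 'I_n.+1 -> R) (t b : R)
  (i j : 'I_n.+1).

(** Equal to [lsup] almost surely, since paths start at [0], but nonnegative everywhere, as the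
    layer-cake formula requires. *)
Definition posup u t w := Num.max 0 (lsup u t w).

Lemma posup_ge0 u t w : 0 <= posup u t w.
Proof. by rewrite le_max lexx. Qed.

Lemma le_posup u t w s : t <= 1 -> 0 <= s <= t -> lin u w s <= posup u t w.
Proof.
by move=> t1 st; rewrite le_max (le_rsup (lin_regular u w) t1 st) orbT.
Qed.

Lemma measurable_posup u t : 0 < t <= 1 -> measurable_fun setT (posup u t).
Proof.
by move=> t01; apply: measurable_maxr => //; exact: measurable_lsup.
Qed.

Lemma le_labs u t w s : t <= 1 -> 0 <= s <= t -> `|lin u w s| <= labs u t w.
Proof.
by move=> t1 st; apply: (@le_rsup _ (fun s => `|lin u w s|)) => //;
  exact/regular_norm/lin_regular.
Qed.

Lemma labs_ge0 u t w : 0 <= t <= 1 -> 0 <= labs u t w.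
Proof.
move=> /andP[t0 t1]; apply: le_trans (normr_ge0 _) (@le_labs u t w 0 t1 _).
by rewrite lexx.
Qed.

Lemma labs_mono u s t w : 0 <= s -> s <= t <= 1 -> labs u s w <= labs u t w.
Proof.
by move=> s0 st; apply: rsup_mono => //; exact/regular_norm/lin_regular.
Qed.

Lemma posup_le_labs u t w : 0 <= t <= 1 -> posup u t w <= labs u t w.
Proof.
move=> t01; rewrite ge_max labs_ge0//; apply: rsup_le => //; first exact: lin_regular.
move=> s st; apply: le_trans (ler_norm _) (le_labs _ _ _ st).
by case/andP: t01.
Qed.

Lemma labs_le_posup u t w : 0 <= t <= 1 ->
  labs u t w <= posup u t w + posup (fun i => -1 * u i) t w.
Proof.
move=> t01; apply: rsup_le => //; first exact/regular_norm/lin_regular.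
move=> s st; have t1 : t <= 1 by case/andP: t01.
have h1 := le_posup u w t1 st; have h2 := le_posup (fun i => -1 * u i) w t1 st.
move: h1 h2; rewrite linZ => h1 h2.
have := posup_ge0 u t w; have := posup_ge0 (fun i => -1 * u i) t w.
by rewrite ler_norml; lra.
Qed.

Lemma posup_mean_law u v t : 0 < t <= 1 -> dot u u = dot v v ->
  (\int[P]_w (posup u t w)%:E = \int[P]_w (posup v t w)%:E)%E.
Proof.
move=> t01 uv; apply: same_law_mean; try exact: measurable_posup.
- by move=> w; exact: posup_ge0.
- by move=> w; exact: posup_ge0.
move=> b b0.
have E u' : [set w | posup u' t w <= b] = [set w | lsup u' t w <= b].
  by apply/seteqP; split=> w /=; rewrite ge_max b0.
by rewrite !E; exact: lsup_law.
Qed.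

Lemma start_ae : {ae P, forall w, w 0 = 0}.
Proof.
have m0 : measurable [set w : cadlag 'rV[R]_n.+1 | w 0 = 0].
  rewrite (_ : [set _ | _] = \bigcap_(i in [set: 'I_n.+1])
    ((fun w : cadlag 'rV[R]_n.+1 => w 0 0 i) @^-1` [set 0])).
    apply: fin_bigcap_measurable => // i _; apply: measurable_preimage => //.
    by apply: measurable_eval_coord; rewrite lexx ler01.
  apply/seteqP; split=> w /=; first by move=> w0 i _ /=; rewrite w0 mxE.
  by move=> w0; apply/rowP => i; rewrite mxE; exact: w0.
exists (~` [set w : cadlag 'rV[R]_n.+1 | w 0 = 0]); split => //.
- exact: measurableC.
- by rewrite probability_setC// X_start subee.
Qed.

Lemma expected_supE t : 0 < t <= 1 ->
  (expected_sup P t = \int[P]_w (posup (axis ord0) t w)%:E)%E.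
Proof.
move=> t01; have t01' : 0 <= t <= 1 by case/andP: t01 => /ltW ->.
have sE w : running_sup (component ord0 w) t = (lsup (axis ord0) t w)%:E.
  rewrite rsupE//; last exact: regular_cadlag.
  by congr (rsup _ _)%:E; apply/funext => s; rewrite lin_axis.
rewrite /expected_sup; under eq_integral do rewrite sE.
apply: ae_eq_integral => //.
- by apply/measurable_EFinP; exact: measurable_lsup.
- by apply/measurable_EFinP; exact: measurable_posup.
apply: filterS start_ae => w w0 _; congr EFin; rewrite /posup max_r//.
apply: (@le_trans _ _ (lin (axis ord0) w 0)); first by rewrite lin_axis w0 mxE.
apply: le_rsup; [exact: lin_regular|by case/andP: t01|].
by rewrite lexx; case/andP: t01'.
Qed.

Lemma posup_mean u t : 0 < t <= 1 -> dot u u = 1 ->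
  (\int[P]_w (posup u t w)%:E = expected_sup P t)%E.
Proof.
move=> t01 uu; rewrite expected_supE//; apply: posup_mean_law => //.
by rewrite uu dot_axis eqxx.
Qed.

(** The absolute supremum is at most the sum of the positive suprema along the axis and along its
    opposite, which have the same mean because both vectors have norm one. *)
Lemma labs_mean_le i t : 0 < t <= 1 ->
  (\int[P]_w (labs (axis i) t w)%:E <= 2%:E * expected_sup P t)%E.
Proof.
move=> t01; have t01' : 0 <= t <= 1 by case/andP: t01 => /ltW ->.
pose v (k : 'I_n.+1) : R := -1 * axis i k.
apply: (@le_trans _ _ (\int[P]_w (posup (axis i) t w + posup v t w)%:E)%E).
  apply: ge0_le_integral_pr => //; first exact: measurable_labs.
    by apply: measurable_funD; exact: measurable_posup.
  by move=> w; rewrite labs_ge0//= labs_le_posup.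
under eq_integral do rewrite EFinD.
rewrite ge0_integralD//; first last.
- by apply/measurable_EFinP; exact: measurable_posup.
- by move=> w _; rewrite lee_fin posup_ge0.
- by apply/measurable_EFinP; exact: measurable_posup.
- by move=> w _; rewrite lee_fin posup_ge0.
rewrite !posup_mean//; first by rewrite mule_natl mule2n.
- by rewrite /v dotZl dotC dotZl dot_axis eqxx mulrA mulrNN !mulr1.
- by rewrite dot_axis eqxx.
Qed.

Lemma other_axis i : exists j : 'I_n.+1, i != j.
Proof.
have [->|i0] := eqVneq i ord0; last by exists ord0.
by exists (Ordinal n_gt0).
Qed.

(** Paths are bounded, so the events [k < labs] decrease to the empty set. Such a level is all that
    Fernique's bound asks for, which yields integrability before any mean is known to be finite. *)
Lemma labs_tail i t : 0 < t <= 1 ->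
  exists2 s : R, 0 < s & tail P (labs (axis i) t) s <= 8^-1.
Proof.
move=> t01; have mN := measurable_labs (axis i) t01.
pose F (k : nat) := [set w | k%:R < labs (axis i) t w].
have mF k : measurable (F k) by exact: measurable_superlevel.
have FI : \bigcap_k F k = set0.
  apply/seteqP; split=> // w wF.
  have := wF (Num.bound (labs (axis i) t w)) I; rewrite /F/= ltNge => /negP; apply.
  by apply/ltW/archi_boundP/labs_ge0; case/andP: t01 => /ltW ->.
have : (P \o F) @ \oo --> P (\bigcap_k F k).
  apply: nonincreasing_cvg_mu => //.
  - by rewrite -ge0_fin_numE// fin_num_measure.
  - by rewrite FI.
  - move=> a b ab; rewrite subsetEset => w /=; apply: le_lt_trans.
    by rewrite ler_nat.
rewrite FI measure0 => /fine_cvgP[_] /cvgrPdist_le/(_ 8^-1).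
have e0 : (0 : R) < 8^-1 by rewrite invr_gt0.
move=> /(_ e0)[k _ /(_ k.+1)]/=; rewrite leqnSn => /(_ isT).
rewrite sub0r normrN => h; exists k.+1%:R; first by rewrite ltr0n.
by rewrite (le_trans (ler_norm _)).
Qed.

Lemma labs_integrable i t : 0 < t <= 1 ->
  P.-integrable setT (fun w => (labs (axis i) t w)%:E).
Proof.
move=> t01; have t01' : 0 <= t <= 1 by case/andP: t01 => /ltW ->.
have [s s0 ts] := labs_tail i t01; have [j ij] := other_axis i.
have M := @labs_moment _ _ P X_indep X_id X_gauss X_mean i j t s ij t01 s0 ts.
have mN := measurable_labs (axis i) t01.
have iN2 : P.-integrable setT (fun w => (labs (axis i) t w ^+ 2)%:E).
  apply/integrableP; split; first by apply/measurable_EFinP; exact: measurable_funX.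
  under eq_integral do rewrite gee0_abs ?lee_fin ?sqr_ge0//.
  by apply: (le_lt_trans M); rewrite ltry.
have i1 : P.-integrable setT (EFin \o cst (1 : R)).
  by apply: finite_measure_integrable_cst.
apply: (le_integrable _ _ _ (integrableD _ i1 iN2)) => //; first exact/measurable_EFinP.
move=> w _; rewrite /= lee_fin ger0_norm ?labs_ge0// ger0_norm ?addr_ge0 ?sqr_ge0//.
by move: (labs _ _ _) => x; nra.
Qed.

Lemma expected_sup_fin t : 0 < t <= 1 -> expected_sup P t \is a fin_num.
Proof.
move=> t01; have t01' : 0 <= t <= 1 by case/andP: t01 => /ltW ->.
rewrite expected_supE// ge0_fin_numE; last first.
  by apply: integral_ge0 => w _; rewrite lee_fin posup_ge0.
apply: (@le_lt_trans _ _ (\int[P]_w (labs (axis ord0) t w)%:E)%E).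
  apply: ge0_le_integral_pr; [exact: measurable_posup|exact: measurable_labs|].
  by move=> w; rewrite posup_ge0 posup_le_labs.
rewrite -ge0_fin_numE; first exact: (integrable_fin_num measurableT (labs_integrable _ _)).
by apply: integral_ge0 => w _; rewrite lee_fin labs_ge0.
Qed.

Definition mean_sup t := fine (expected_sup P t).

Lemma mean_supE t : 0 < t <= 1 -> expected_sup P t = (mean_sup t)%:E.
Proof. by move=> t01; rewrite fineK// expected_sup_fin. Qed.

Lemma mean_sup_ge0 t : 0 < t <= 1 -> 0 <= mean_sup t.
Proof.
move=> t01; rewrite /mean_sup fine_ge0// expected_supE//.
by apply: integral_ge0 => w _; rewrite lee_fin posup_ge0.
Qed.

(** A zero mean would make the absolute supremum of every component vanish almost surely, hence
    [w t = 0] almost surely, against non-degeneracy. *)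
Lemma mean_sup_gt0 t : 0 < t <= 1 -> 0 < mean_sup t.
Proof.
move=> t01; have t01' : 0 <= t <= 1 by case/andP: t01 => /ltW ->.
rewrite lt_def mean_sup_ge0// andbT; apply/eqP => m0.
have : (0 < P [set w : cadlag 'rV[R]_n.+1 | (w t != 0)%R])%E by exact: X_nondeg.
apply/negP; rewrite -leNgt.
have z i : P [set w | 0 < labs (axis i) t w] = 0%E.
  have mN := measurable_labs (axis i) t01.
  have : (\int[P]_w `|(labs (axis i) t w)%:E| = 0)%E.
    under eq_integral do rewrite gee0_abs ?lee_fin ?labs_ge0//.
    apply/eqP; rewrite eq_le; apply/andP; split.
      by rewrite (le_trans (labs_mean_le i t01))// mean_supE// m0 mule0.
    by apply: integral_ge0 => w _; rewrite lee_fin labs_ge0.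
  move=> /ae_eq_integral_abs => /(_ measurableT) [].
    exact/measurable_EFinP.
  move=> N [mN0 N0 sub].
  apply/eqP; rewrite -measure_le0 -N0; apply: le_prob => //.
    exact: measurable_superlevel.
  move=> w /= w0; apply: sub => /= /(_ I) [E].
  by rewrite E ltxx in w0.
apply: (@le_trans _ _ (P (\big[setU/set0]_i [set w | 0 < labs (axis i) t w]))).
  apply: le_prob.
  - rewrite (_ : [set _ | _] = ~` \bigcap_(i in [set: 'I_n.+1])
      ((fun w : cadlag 'rV[R]_n.+1 => w t 0 i) @^-1` [set 0])).
      apply: measurableC; apply: fin_bigcap_measurable => // i _.
      by apply: measurable_preimage => //; exact: measurable_eval_coord.
    apply/seteqP; split=> w /=.
      by move=> /eqP w0 h; apply: w0; apply/rowP => i; rewrite mxE; exact: h.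
    by move=> h; apply/eqP => w0; apply: h => i _ /=; rewrite w0 mxE.
  - by apply: bigsetU_measurable => i _; apply: measurable_superlevel; exact: measurable_labs.
  - move=> w /= w0; rewrite -bigcup_mkord_ord.
    apply: contrapT => h; move/eqP: w0; apply; apply/rowP => i; rewrite mxE.
    apply/eqP/negPn/negP => wi; apply: h; exists (val i) => /=; first exact: ltn_ord.
    have /andP[t0' t1'] := t01'.
    have := @le_labs (axis i) t w t t1'; rewrite inord_val t0' lexx lin_axis.
    by move=> /(_ isT); apply: lt_le_trans; rewrite normr_gt0.
suff [_ ->] : measurable (\big[setU/set0]_(i < n.+1) [set w | 0 < labs (axis i) t w]) /\
  P (\big[setU/set0]_(i < n.+1) [set w | 0 < labs (axis i) t w]) = 0%E by [].
elim/big_rec : _ => [|i A _ [mA A0]]; first by rewrite measure0.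
have mi : measurable [set w | 0 < labs (axis i) t w].
  by apply: measurable_superlevel; exact: measurable_labs.
split; first exact: measurableU.
by rewrite measureU0//; exact: z.
Qed.

Lemma labs_mean i t : 0 < t <= 1 ->
  (\int[P]_w (labs (axis i) t w)%:E <= (2 * mean_sup t)%:E)%E.
Proof. by move=> t01; rewrite EFinM -mean_supE//; exact: labs_mean_le. Qed.

(* Fernique's bound at the level [16 mean_sup t], exceeded with probability at
   most 1/8 by Markov's inequality. *)
Lemma labs_square_mean i t : 0 < t <= 1 ->
  (\int[P]_w (labs (axis i) t w ^+ 2)%:E <= ((192 * mean_sup t) ^+ 2)%:E)%E.
Proof.
move=> t01; have t01' : 0 <= t <= 1 by case/andP: t01 => /ltW ->.
have m0 := mean_sup_gt0 t01; have [j ij] := other_axis i.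
have -> : (192 * mean_sup t) ^+ 2 = 144 * (16 * mean_sup t) ^+ 2 by ring.
apply: (@labs_moment _ _ P X_indep X_id X_gauss X_mean i j) => //.
  by rewrite mulr_gt0.
have mN := measurable_labs (axis i) t01.
have := markov_tail P (16 * mean_sup t) mN (fun w => labs_ge0 _ _ t01').
move=> /le_trans/(_ (labs_mean i t01)).
rewrite (tailE P _ mN) -EFinM lee_fin -mulrA mulrCA => h.
rewrite -(ler_pM2l m0) -(ler_pM2l (_ : 0 < 16 :> R))//.
by move: h; lra.
Qed.

Lemma mean_sup_le_labs t : 0 < t <= 1 ->
  ((mean_sup t)%:E <= \int[P]_w (labs (axis ord0) t w)%:E)%E.
Proof.
move=> t01; have t01' : 0 <= t <= 1 by case/andP: t01 => /ltW ->.
rewrite -mean_supE// expected_supE//.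
apply: ge0_le_integral_pr; [exact: measurable_posup|exact: measurable_labs|].
by move=> w; rewrite posup_ge0 posup_le_labs.
Qed.

(** Dominated convergence along the times [1 / (k + 1)]: absolute suprema tend to [0] by right
    continuity at time zero, under the supremum at time [1]. Their monotonicity in time then covers
    all small times. *)
Lemma mean_sup_cvg0 : mean_sup t @[t --> (0 : R)^'+] --> 0.
Proof.
pose t_ (k : nat) : R := k.+1%:R^-1.
have t_01 k : 0 < t_ k <= 1.
  by rewrite invr_gt0 ltr0n/= invf_le1 ?ltr0n// ler1n.
have t_01' k : 0 <= t_ k <= 1 by case/andP: (t_01 k) => /ltW ->.
have t1 : 0 < (1 : R) <= 1 by rewrite ltr01 lexx.
have := @dominated_convergence _ _ _ P setT measurableT
  (fun k w => (labs (axis ord0) (t_ k) w)%:E) (fun=> 0%E)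
  (fun w => (labs (axis ord0) 1 w)%:E).
case.
- by move=> k; apply/measurable_EFinP; exact: measurable_labs.
- exact: measurable_cst.
- apply: filterS start_ae => w w0 _; apply: cvg_EFin; first exact: nearW.
  have [x1 _] := lin_regular (axis ord0) w.
  have l0 : lin (axis ord0) w 0 = 0 by rewrite lin_axis w0 mxE.
  have := x1 0; rewrite lexx ltr01 l0 => /(_ isT)/cvgrPdist_le x0.
  apply/cvgrPdist_le => e e0; have := x0 _ e0.
  rewrite /at_right near_withinE => -[d/= d0 dP].
  have [m md] : exists m : nat, d^-1 < m%:R.
    by exists (Num.bound d^-1); apply: archi_boundP; rewrite invr_ge0 ltW.
  exists m => // k /= mk; rewrite sub0r normrN ger0_norm ?labs_ge0//.
  apply: rsup_le => //; first exact/regular_norm/lin_regular.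
  move=> s /andP[s0 sk]; have [->|s0'] := eqVneq s 0.
    by rewrite lin_axis w0 mxE normr0 ltW.
  have {}s0 : 0 < s by rewrite lt_def s0'.
  have := dP s; rewrite /ball_/= !sub0r !normrN; apply => //.
  rewrite gtr0_norm// (le_lt_trans sk)// /t_ invf_plt ?posrE ?ltr0n//.
  by rewrite (lt_trans md)// ltr_nat ltnS.
- exact: labs_integrable.
- apply: nearW => w k _; rewrite gee0_abs ?lee_fin ?labs_ge0// labs_mono//.
  + by case/andP: (t_01' k).
  + by rewrite lexx andbT; case/andP: (t_01' k).
move=> _ _; rewrite integral0 => /fine_cvgP[_] /cvgrPdist_le C.
apply/cvgrPdist_le => e e0; have [k _ /(_ k (leqnn k))/=] := C _ e0.
rewrite sub0r normrN => /(le_trans (ler_norm _)) ke.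
have /andP[k0 k1] := t_01 k.
near=> s.
have s01 : 0 < s <= 1.
  apply/andP; split; first by near: s; exact: nbhs_right_gt.
  by apply: le_trans k1; near: s; exact: nbhs_right_le.
rewrite sub0r normrN ger0_norm ?mean_sup_ge0// (le_trans _ ke)//.
have fk := integrable_fin_num measurableT (labs_integrable ord0 (t_01 k)).
rewrite -lee_fin (fineK fk).
rewrite (le_trans (mean_sup_le_labs s01))//; case/andP: (s01) => s0 s1.
apply: ge0_le_integral_pr; [exact: measurable_labs|exact: measurable_labs|].
move=> w; rewrite labs_ge0 ?(ltW s0)//=; apply: labs_mono; first exact: ltW.
by rewrite k1 andbT; near: s; exact: nbhs_right_le.
Unshelve. all: by end_near. Qed.

End sup_means.

(** * Mean supremum of the limit process *)

Lemma dist_max (R : realType) (c a b : R) :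
  `|Num.max c a - Num.max c b| <= `|a - b|.
Proof.
have h1 := ler_norm (a - b); have h2 := ler_norm (b - a); rewrite distrC in h2.
by case: (leP c a) => ca; case: (leP c b) => cb; rewrite ler_norml; lra.
Qed.

Lemma dist_min (R : realType) (c a b : R) :
  `|Num.min c a - Num.min c b| <= `|a - b|.
Proof.
have h1 := ler_norm (a - b); have h2 := ler_norm (b - a); rewrite distrC in h2.
by case: (leP c a) => ca; case: (leP c b) => cb; rewrite ler_norml; lra.
Qed.

(** A time change is a bijection of [[0, 1]], so composing a path with it leaves its supremum
    unchanged and only the uniform distance counts. *)
Lemma J1_rsup (R : realType) (x y : cadlag R) (e : R) :
  J1_ball x e y -> `|rsup x 1 - rsup y 1| <= e.
Proof.
move=> [l [d [[[lf _ ls] _] de ld]]].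
have rx := regular_cadlag x; have ry := regular_cadlag y.
have i01 : 0 <= (1 : R) <= 1 by rewrite ler01 lexx.
have h1 : rsup y 1 <= rsup x 1 + d.
  apply: rsup_le => // t t01; have [_] := ld t t01.
  have : x (l t) <= rsup x 1.
    by apply: le_rsup => //; have := lf t; rewrite /= !in_itv/=; exact.
  by rewrite ler_norml; lra.
have h2 : rsup x 1 <= rsup y 1 + d.
  apply: rsup_le => // s s01.
  have [|t] := ls s; first by rewrite /= in_itv.
  rewrite /= in_itv/= => t01 <-; have [_] := ld t t01.
  have := le_rsup ry (lexx 1) t01.
  by rewrite ler_norml; lra.
by rewrite ler_norml; lra.
Qed.

Lemma continuous_rsup (R : realType) (phi : R -> R) :
  (forall a b, `|phi a - phi b| <= `|a - b|) ->
  continuous (fun x : cadlag R => phi (rsup x 1)).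
Proof.
move=> lip x; apply/(@cvgrPdist_le _ _ _ _ (nbhs_filter x)) => e e0; near=> y.
apply: (le_trans (lip _ _)); apply: J1_rsup; near: y.
exact: nbhsx_ballx.
Unshelve. all: by end_near. Qed.

Lemma rsup_scale (R : realType) (c t : R) (x : cadlag R) : 0 < c -> 0 < t <= 1 ->
  rsup (mk_cadlag (scale_fun c t x)) 1 = c * rsup x t.
Proof.
move=> c0 t01; rewrite mk_cadlagE; last exact: scale_cadlag.
have rx := regular_cadlag x.
have rs := regular_cadlag (Cadlag (scale_cadlag c x t01)).
case/andP: (t01) => t0 t1; have i01 : 0 <= (1 : R) <= 1 by rewrite ler01 lexx.
apply/eqP; rewrite eq_le; apply/andP; split.
  apply: (rsup_le rs) => // s s01; rewrite /= /scale_fun s01 ler_pM2l//.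
  apply: le_rsup => //; case/andP: s01 => s0 s1.
  by rewrite mulr_ge0 ?(ltW t0)//= ler_piMr// ltW.
rewrite -ler_pdivlMl//; apply: (rsup_le rx); first by rewrite (ltW t0).
move=> s /andP[s0 st]; rewrite ler_pdivlMl//.
have st01 : 0 <= s / t <= 1 by rewrite divr_ge0 ?(ltW t0)//= ler_pdivrMr// mul1r.
have := le_rsup rs (lexx 1) st01; rewrite /= /scale_fun st01.
by rewrite mulrCA mulfV ?gt_eqF// mulr1.
Qed.

Section weak_limit.
Context {R : realType} {n : nat} (P : probability (cadlag 'rV[R]_n.+1) R).
Hypotheses (n_gt0 : (2 <= n.+1)%N)
  (X_start : P [set w : cadlag 'rV[R]_n.+1 | w 0 = 0] = 1%E)
  (X_indep : mutually_independent P (@component R n.+1))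
  (X_id : identically_distributed P (@component R n.+1))
  (X_gauss : forall i : 'I_n.+1, gaussian_process P (fun t w => w t 0 i))
  (X_mean : forall i : 'I_n.+1, zero_mean_process P (fun t w => w t 0 i))
  (X_nondeg : forall t : R, 0 < t <= 1 ->
    (0 < P [set w : cadlag 'rV[R]_n.+1 | (w t != 0)%R])%E).
Context (d' : measure_display) (Om' : measurableType d') (P' : probability Om' R)
  (Y : Om' -> cadlag R).
Hypotheses (Y_measurable : measurable_fun setT Y)
  (Y_lim : weak_cvg P (0 : R)^'+ (scaled_component P) P' Y).

Let mu t := mean_sup P t.

Let mu_gt0 t : 0 < t <= 1 -> 0 < mu t.
Proof. exact: mean_sup_gt0. Qed.

Lemma rsup_scaled t w : 0 < t <= 1 ->
  rsup (scaled_component P t w) 1 = lsup (axis ord0) t w / mu t.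
Proof.
move=> t01; rewrite /scaled_component rsup_scale// ?invr_gt0 ?mu_gt0// mulrC.
by congr (rsup _ _ / _); apply/funext => s; rewrite lin_axis.
Qed.

Let S (w : Om') := rsup (Y w) 1.

Let mS : measurable_fun setT S.
Proof.
apply: measurable_rsup => [|w|s s01]; first by rewrite ltr01 lexx.
  exact: regular_cadlag.
exact: (measurableT_comp (measurable_eval s01) Y_measurable).
Qed.

(** A bounded 1-Lipschitz function of the supremum is an admissible test function for weak
    convergence, by continuity of the supremum in the [J1] topology. *)
Lemma weak_limit_phi (phi : R -> R) (M : R) :
  (forall a b, `|phi a - phi b| <= `|a - b|) -> (forall a, `|phi a| <= M) ->
  (\int[P]_w (phi (lsup (axis ord0) t w / mu t))%:E)%E @[t --> (0 : R)^'+] -->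
  (\int[P']_w (phi (S w))%:E)%E.
Proof.
move=> lip bd.
have := Y_lim (continuous_rsup lip) (ex_intro _ M (fun x => bd _)).
rewrite unlock; apply: cvg_trans; apply: near_eq_cvg; near=> t.
apply: eq_integral => w _ /=; rewrite rsup_scaled//.
apply/andP; split; first by near: t; exact: nbhs_right_gt.
by near: t; exact: nbhs_right_le.
Unshelve. all: by end_near. Qed.

Let lsup_ge0 t : 0 < t <= 1 -> {ae P, forall w, 0 <= lsup (axis ord0) t w}.
Proof.
move=> t01; apply: filterS (start_ae X_start) => w w0.
apply: (@le_trans _ _ (lin (axis ord0) w 0)); first by rewrite lin_axis w0 mxE.
apply: le_rsup; [exact: lin_regular|by case/andP: t01|].
by rewrite lexx; case/andP: t01 => /ltW.
Qed.

Let near01 : \forall t \near (0 : R)^'+, 0 < t <= 1.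
Proof.
near=> t; apply/andP; split; first by near: t; exact: nbhs_right_gt.
by near: t; exact: nbhs_right_le.
Unshelve. all: by end_near. Qed.

(** The negative part truncated at [1] is bounded and Lipschitz; its mean is [0] for every [t],
    hence also in the limit. *)
Lemma limit_sup_ge0 : {ae P', forall w, 0 <= S w}.
Proof.
pose phi (a : R) := Num.max 0 (Num.min 1 (- a)).
have phi0 a : 0 <= phi a by rewrite le_max lexx.
have lip a b : `|phi a - phi b| <= `|a - b|.
  rewrite (le_trans (dist_max _ _ _))// (le_trans (dist_min _ _ _))//.
  by rewrite opprK addrC distrC.
have bd a : `|phi a| <= 1.
  by rewrite ger0_norm// /phi ge_max ler01 ge_min lexx.
have mphi : measurable_fun setT phi.
  by apply: measurable_maxr => //; apply: measurable_minr => //; exact: measurable_oppr.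
have L := weak_limit_phi lip bd.
have E0 : (\int[P']_w (phi (S w))%:E = 0)%E.
  apply/(cvg_unique _ L) => //; apply: cvg_near_cst; apply: filterS near01 => t t01.
  rewrite (@ae_eq_integral _ _ _ P setT (fun=> 0%E)) ?integral0//.
    apply/measurable_EFinP; apply: measurableT_comp => //.
    by apply: measurable_funM => //; exact: measurable_lsup.
  apply: filterS (lsup_ge0 t01) => w w0 _; congr EFin.
  have := mu_gt0 t01; rewrite /phi => m0.
  rewrite max_l// ge_min oppr_le0 divr_ge0 ?orbT//; exact: ltW.
have : (\int[P']_w `|(phi (S w))%:E| = 0)%E.
  by apply: (etrans _ E0); apply: eq_integral => w _; rewrite gee0_abs// lee_fin.
move=> /ae_eq_integral_abs => /(_ measurableT) [].
  by apply/measurable_EFinP; exact: measurableT_comp.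
move=> N [mN N0 sub]; exists N; split => // w /= w0; apply: sub => /= /(_ I) [E].
apply: w0; rewrite leNgt; apply/negP => S0.
have p : 0 < Num.min 1 (- S w) by rewrite lt_min ltr01 oppr_gt0.
by move: E p; rewrite /phi max_r => [->|]; [rewrite ltxx|rewrite le_min ler01 oppr_ge0 ltW].
Qed.

Let Z t (w : cadlag 'rV[R]_n.+1) := posup (axis ord0) t w / mu t.

Let mZ t : 0 < t <= 1 -> measurable_fun setT (Z t).
Proof. by move=> t01; apply: measurable_funM => //; exact: measurable_posup. Qed.

Let Z_ge0 t w : 0 < t <= 1 -> 0 <= Z t w.
Proof. by move=> t01; rewrite divr_ge0 ?posup_ge0// ltW// mu_gt0. Qed.

Let Z_mean t : 0 < t <= 1 -> (\int[P]_w (Z t w)%:E = 1)%E.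
Proof.
move=> t01; under eq_integral do rewrite /Z mulrC EFinM.
rewrite ge0_integralZl_EFin//; first last.
- by rewrite invr_ge0 ltW// mu_gt0.
- by apply/measurable_EFinP; exact: measurable_posup.
- by move=> w _; rewrite lee_fin posup_ge0.
rewrite -expected_supE// mean_supE// -EFinM mulVf// gt_eqF//.
exact: mu_gt0.
Qed.

Let Z_square t : 0 < t <= 1 -> (\int[P]_w (Z t w ^+ 2)%:E <= (192 ^+ 2)%:E)%E.
Proof.
move=> t01; have m0 := mu_gt0 t01.
have mN := measurable_labs (axis ord0) t01.
have t01' : 0 <= t <= 1 by case/andP: t01 => /ltW ->.
apply: (@le_trans _ _ (\int[P]_w ((mu t)^-1 ^+ 2 * labs (axis ord0) t w ^+ 2)%:E)%E).
  apply: ge0_le_integral_pr.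
  - by apply: measurable_funX; exact: mZ.
  - by apply: measurable_funM => //; exact: measurable_funX.
  move=> w; rewrite sqr_ge0/= /Z mulrC exprMn ler_wpM2l ?sqr_ge0//.
  rewrite ler_pXn2r// ?nnegrE ?posup_ge0 ?labs_ge0//.
  exact: posup_le_labs.
under eq_integral do rewrite EFinM.
rewrite ge0_integralZl_EFin//; first last.
- exact: sqr_ge0.
- by apply/measurable_EFinP; exact: measurable_funX.
- by move=> w _; rewrite lee_fin sqr_ge0.
have := labs_square_mean n_gt0 X_start X_indep X_id X_gauss X_mean X_nondeg ord0 t01.
move=> h; apply: (le_trans (lee_wpmul2l _ h)); first by rewrite lee_fin sqr_ge0.
rewrite -EFinM lee_fin -exprMn mulrCA mulVf ?mulr1// gt_eqF//.
Qed.

(** [z <= min M z + z ^ 2 / M] for [z >= 0]. Since the normalized suprema have mean [1] and second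
    moment at most [192 ^ 2], truncation loses at most [192 ^ 2 / M], uniformly in [t]; both bounds
    survive the limit. *)
Lemma limit_truncated (M : R) : 0 < M ->
  ((1 - 192 ^+ 2 / M)%:E <= \int[P']_w (Num.min M (Num.max 0 (S w)))%:E <= 1)%E.
Proof.
move=> M0; pose phi (a : R) := Num.min M (Num.max 0 a).
have phi0 a : 0 <= phi a by rewrite le_min le_max lexx (ltW M0).
have lip a b : `|phi a - phi b| <= `|a - b|.
  by rewrite (le_trans (dist_min _ _ _))// dist_max.
have bd a : `|phi a| <= M by rewrite ger0_norm// /phi ge_min lexx.
have mphi : measurable_fun setT phi.
  by apply: measurable_minr => //; exact: measurable_maxr.
have L := weak_limit_phi lip bd.
have phiE t w : 0 < t <= 1 -> phi (lsup (axis ord0) t w / mu t) = Num.min M (Z t w).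
  move=> t01; have m0 : 0 <= (mu t)^-1 by rewrite invr_ge0 ltW// mu_gt0.
  by rewrite /phi /Z /posup maxr_pMl// mul0r.
have mMZ t : 0 < t <= 1 -> measurable_fun setT (fun w => Num.min M (Z t w)).
  by move=> t01; apply: measurable_minr => //; exact: mZ.
have up t : 0 < t <= 1 ->
    (\int[P]_w (phi (lsup (axis ord0) t w / mu t))%:E <= 1)%E.
  move=> t01; under eq_integral do rewrite phiE//.
  rewrite -(Z_mean t01); apply: ge0_le_integral_pr; [exact: mMZ|exact: mZ|].
  by move=> w; rewrite le_min (ltW M0) Z_ge0//= ge_min lexx orbT.
have lo t : 0 < t <= 1 ->
    ((1 - 192 ^+ 2 / M)%:E <= \int[P]_w (phi (lsup (axis ord0) t w / mu t))%:E)%E.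
  move=> t01; under eq_integral do rewrite phiE//.
  have mZ2 : measurable_fun setT (fun w => M^-1 * Z t w ^+ 2).
    by apply: measurable_funM => //; apply: measurable_funX; exact: mZ.
  have : (\int[P]_w (Z t w)%:E <=
      \int[P]_w (Num.min M (Z t w) + M^-1 * Z t w ^+ 2)%:E)%E.
    apply: ge0_le_integral_pr; [exact: mZ|by apply: measurable_funD => //; exact: mMZ|].
    move=> w; rewrite Z_ge0//=; have := Z_ge0 w t01; move: (Z t w) => z z0.
    case: (leP M z) => [zM|zM].
      rewrite -(ler_pM2l M0) mulrDr mulrA mulfV ?gt_eqF// mul1r; nra.
    by rewrite lerDl mulr_ge0 ?sqr_ge0// invr_ge0 ltW.
  rewrite Z_mean//; under [leRHS]eq_integral do rewrite EFinD.
  rewrite ge0_integralD//; first last.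
  - exact/measurable_EFinP.
  - by move=> w _; rewrite lee_fin mulr_ge0 ?sqr_ge0// invr_ge0 ltW.
  - by apply/measurable_EFinP; exact: mMZ.
  - by move=> w _; rewrite lee_fin le_min (ltW M0) Z_ge0.
  under [X in (_ <= _ + X)%E]eq_integral do rewrite EFinM.
  rewrite ge0_integralZl_EFin//; first last.
  - by rewrite invr_ge0 ltW.
  - by apply/measurable_EFinP; apply: measurable_funX; exact: mZ.
  - by move=> w _; rewrite lee_fin sqr_ge0.
  have Z2 := Z_square t01.
  have M0' : (0 <= M^-1%:E)%E by rewrite lee_fin invr_ge0 ltW.
  move=> h; have := le_trans h (leeD (lexx _) (lee_wpmul2l M0' Z2)).
  by rewrite EFinB leeBlDr// mulrC EFinM.
have LC : cvg ((\int[P]_w (phi (lsup (axis ord0) t w / mu t))%:E)%E @[t --> (0 : R)^'+]).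
  by apply/cvg_ex; eexists; exact: L.
rewrite -(cvg_lim _ L)//; apply/andP; split.
  by apply: lime_ge => //; apply: filterS near01 => t; exact: lo.
by apply: lime_le => //; apply: filterS near01 => t; exact: up.
Qed.

Lemma limit_sup_mean : (\int[P']_w running_sup (Y w) 1 = 1)%E.
Proof.
have i01 : 0 <= (1 : R) <= 1 by rewrite ler01 lexx.
transitivity (\int[P']_w (Num.max 0 (S w))%:E)%E.
  under eq_integral do rewrite (rsupE (regular_cadlag _) i01).
  apply: ae_eq_integral => //; [exact/measurable_EFinP| |].
    by apply/measurable_EFinP; exact: measurable_maxr.
  by apply: filterS limit_sup_ge0 => w w0 _; congr EFin; rewrite max_r.
have trunc (M : R) : 0 < M ->
    (\int[P']_w (Num.min M (Num.max 0 (S w)))%:E <= \int[P']_w (Num.max 0 (S w))%:E)%E.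
  move=> M0; apply: ge0_le_integral_pr.
  - by apply: measurable_minr => //; exact: measurable_maxr.
  - exact: measurable_maxr.
  - by move=> w; rewrite le_min le_max lexx (ltW M0)/= ge_min lexx orbT.
apply/eqP; rewrite eq_le; apply/andP; split.
  have lim w : (fun k : nat => (Num.min k.+1%:R (Num.max 0 (S w)))%:E) @ \oo -->
      (Num.max 0 (S w))%:E.
    apply: cvg_near_cst; exists (Num.bound (Num.max 0 (S w))) => // k /= mk.
    rewrite min_r// ltW//; apply: lt_le_trans (archi_boundP _) _; first by rewrite le_max lexx.
    by rewrite ler_nat leqW.
  under eq_integral do rewrite -(cvg_lim _ (lim _))//.
  have mono w : {homo (fun k : nat => (Num.min k.+1%:R (Num.max 0 (S w)))%:E) : i j / (i <= j)%N >-> (i <= j)%E}.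
    move=> i j ij; rewrite lee_fin le_min !ge_min lexx orbT andbT.
    by rewrite ler_nat ltnS ij.
  rewrite monotone_convergence//; first last.
  - by move=> k w _; rewrite lee_fin le_min le_max lexx ler0n.
  - by move=> k; apply/measurable_EFinP; apply: measurable_minr => //; exact: measurable_maxr.
  apply: lime_le.
    apply: ereal_nondecreasing_is_cvgn => i j ij; apply: ge0_le_integral_pr.
    - by apply: measurable_minr => //; exact: measurable_maxr.
    - by apply: measurable_minr => //; exact: measurable_maxr.
    - by move=> w; rewrite -!lee_fin mono// lee_fin le_min le_max lexx ler0n.
  apply: nearW => k.
  by have /andP[] := @limit_truncated k.+1%:R (ltr0Sn _ _).
apply/lee_addgt0Pr => e e0; rewrite -leeBlDr//.
(* At this truncation level the loss [192 ^ 2 / M] is exactly [e]. *)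
have M0 : 0 < 192 ^+ 2 / e by rewrite divr_gt0// exprn_gt0.
have /andP[h _] := limit_truncated M0.
apply: le_trans (trunc _ M0); apply: le_trans h; rewrite -EFinB lee_fin.
rewrite lerD2l lerN2 invfM invrK mulrA mulfV ?mul1r// gt_eqF// exprn_gt0//.
Qed.

End weak_limit.

(** * Hausdorff measure *)

Section ediam.
Context {R : realType} {m : nat}.
Implicit Types (E F : set 'rV[R]_m) (e : R).

(** Since [ediam] falls back to [0] on unbounded sets, boundedness has to be carried by a separate
    predicate before [ediam] can be compared with distances. *)
Definition ediam_le e E := forall x y, E x -> E y -> enorm (x - y) <= e.

Lemma ediam_set0 : ediam (set0 : set 'rV[R]_m) = 0.
Proof.
by rewrite /ediam (_ : [set _ | _ in _ & _ in _] = set0) ?sup0//;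
  apply/seteqP; split=> // _ [x []].
Qed.

Lemma le_ediam e E x y : ediam_le e E -> E x -> E y -> enorm (x - y) <= ediam E.
Proof.
move=> Ee Ex Ey; apply: ub_le_sup; last by exists x => //; exists y.
by exists e => _ [a Ea [b Eb <-]]; exact: Ee.
Qed.

Lemma ediam_ge0 e E : ediam_le e E -> 0 <= ediam E.
Proof.
move=> Ee; have [[x Ex]|/nonemptyPn ->] := pselect (E !=set0); last by rewrite ediam_set0.
by apply: le_trans (le_ediam Ee Ex Ex); exact: enorm_ge0.
Qed.

Lemma ediam_ub e E : 0 <= e -> ediam_le e E -> ediam E <= e.
Proof.
move=> e0 Ee; have [[x Ex]|/nonemptyPn ->] := pselect (E !=set0); last by rewrite ediam_set0.
apply: ge_sup; first by exists (enorm (x - x)); exists x => //; exists x.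
by move=> _ [a Ea [b Eb <-]]; exact: Ee.
Qed.

End ediam.

Section hausdorff_pre.
Context {R : realType} {m : nat} (s : nat).
Implicit Types (A B : set 'rV[R]_m) (E : (set 'rV[R]_m)^nat) (e : R).
Local Open Scope ereal_scope.

Definition pre_cover e A : set ((set 'rV[R]_m)^nat) :=
  [set E | A `<=` \bigcup_k E k /\ forall k, ediam_le e (E k)].

Definition diam_sum E : \bar R := \sum_(k <oo) ((ediam (E k)) ^+ s)%:E.

Lemma pre_le e A E : pre_cover e A E -> hausdorff_pre s e A <= diam_sum E.
Proof. by move=> [AE Ee]; apply: ereal_inf_lbound; exists E. Qed.

Lemma le_pre e A x : (forall E, pre_cover e A E -> x <= diam_sum E) ->
  x <= hausdorff_pre s e A.
Proof.
move=> H; apply: le_ereal_inf_tmp => _ [E [AE Ee] <-]; apply: H.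
by split=> // k a b; exact: Ee.
Qed.

Lemma diam_term_ge0 e A E k : pre_cover e A E -> 0 <= ((ediam (E k)) ^+ s)%:E.
Proof. by move=> [_ Ee]; rewrite lee_fin exprn_ge0// (ediam_ge0 (Ee k)). Qed.

Lemma pre_ge0 e A : 0 <= hausdorff_pre s e A.
Proof.
apply: le_pre => E AE; apply: nneseries_ge0 => k _ _; exact: diam_term_ge0 AE.
Qed.

Lemma pre_mono e A B : A `<=` B -> hausdorff_pre s e A <= hausdorff_pre s e B.
Proof.
move=> AB; apply: le_pre => E [BE Ee]; apply: pre_le; split=> //.
exact: subset_trans BE.
Qed.

Lemma pre_anti e e' A : (e <= e')%R -> hausdorff_pre s e' A <= hausdorff_pre s e A.
Proof.
move=> ee; apply: le_pre => E [BE Ee]; apply: pre_le; split=> // k x y Ex Ey.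
exact: le_trans (Ee k x y Ex Ey) ee.
Qed.

Lemma pre_approx e A (d : R) : (0 < d)%R -> hausdorff_pre s e A \is a fin_num ->
  exists2 E, pre_cover e A E & diam_sum E < hausdorff_pre s e A + d%:E.
Proof.
move=> d0 fA; have [_ [E [AE Ee] <-] lt] := lb_ereal_inf_adherent d0 fA.
by exists E.
Qed.

(** The cover is completed by empty sets, which contribute nothing because the exponent is
    positive. *)
Lemma pre_single e A (d : R) : (0 < s)%N -> (0 <= d <= e)%R -> ediam_le d A ->
  hausdorff_pre s e A <= (d ^+ s)%:E.
Proof.
move=> s0 /andP[d0 de] Ad.
pose E k : set 'rV[R]_m := if k is 0 then A else set0.
apply: (@le_trans _ _ (diam_sum E)).
  apply: pre_le; split; first by move=> x Ax; exists 0%N.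
  by move=> [|k] x y //= Ax Ay; exact: le_trans (Ad _ _ Ax Ay) de.
rewrite /diam_sum (nneseries_split 0 1)//; last first.
  move=> [|k] _; rewrite lee_fin exprn_ge0//= ?(ediam_ge0 Ad)//.
  by rewrite ediam_set0.
rewrite big_nat1 /= eseries0 ?adde0; last first.
  by move=> [|k] //= _ _; rewrite ediam_set0 expr0n; case: s s0.
by rewrite lee_fin lerXn2r// ?nnegrE ?(ediam_ge0 Ad)//; exact: ediam_ub.
Qed.

(** Nearly optimal covers of the two sets are interleaved, even indices for the first and odd ones
    for the second, and partial sums of even length are compared. *)
Lemma pre_setU e A B :
  hausdorff_pre s e (A `|` B) <= hausdorff_pre s e A + hausdorff_pre s e B.
Proof.
have [->|] := eqVneq (hausdorff_pre s e B) +oo.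
  by rewrite addey ?leey// -ltNye (lt_le_trans _ (pre_ge0 _ _)).
rewrite -ltey -ge0_fin_numE ?pre_ge0// => fB.
have [->|] := eqVneq (hausdorff_pre s e A) +oo.
  by rewrite addye ?leey// -ltNye (lt_le_trans _ (pre_ge0 _ _)).
rewrite -ltey -ge0_fin_numE ?pre_ge0// => fA.
apply/lee_addgt0Pr => d d0; have d2 : (0 < d / 2)%R by rewrite divr_gt0.
have [E EA ltE] := pre_approx d2 fA; have [F FB ltF] := pre_approx d2 fB.
have -> : d%:E = (d / 2)%:E + (d / 2)%:E by rewrite -EFinD; congr EFin; lra.
rewrite addeACA; apply: le_trans (leeD (ltW ltE) (ltW ltF)).
pose G k := if odd k then F k./2 else E k./2.
have GAB : pre_cover e (A `|` B) G.
  have [AE Ee] := EA; have [BF Fe] := FB; split.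
    move=> x [/AE[k _ Ex]|/BF[k _ Fx]].
      by exists k.*2 => //; rewrite /G odd_double doubleK.
    by exists k.*2.+1 => //; rewrite /G /= odd_double/= uphalf_double.
  by move=> k; rewrite /G; case: ifP => _; [exact: Fe|exact: Ee].
apply: (le_trans (pre_le GAB)); apply: lime_le.
  by apply: is_cvg_ereal_nneg_natsum_cond => k _ _; exact: diam_term_ge0 GAB.
apply: nearW => k; apply: (@le_trans _ _ (\sum_(0 <= i < k.*2) ((ediam (G i)) ^+ s)%:E)).
  apply: lee_sum_nneg_natr => //; last by rewrite -addnn leq_addr.
  by move=> i _ _; exact: diam_term_ge0 GAB.
have -> : \sum_(0 <= i < k.*2) ((ediam (G i)) ^+ s)%:E =
    \sum_(0 <= i < k) ((ediam (E i)) ^+ s)%:E + \sum_(0 <= i < k) ((ediam (F i)) ^+ s)%:E.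
  elim: k => [|k IH]; first by rewrite !big_geq// adde0.
  rewrite doubleS !big_nat_recr//= IH /G /= odd_double/= doubleK uphalf_double.
  by rewrite addeACA addeA.
by apply: leeD; apply: nneseries_lim_ge => i _ _;
  [exact: diam_term_ge0 EA|exact: diam_term_ge0 FB].
Qed.

Lemma pre_bigcup (I : Type) (r : seq I) e (A : I -> set 'rV[R]_m) (c : R) :
  (forall i, hausdorff_pre s e (A i) <= c%:E) -> (0 < s)%N -> (0 < e)%R ->
  hausdorff_pre s e (\big[setU/set0]_(i <- r) A i) <= ((size r)%:R * c)%:E.
Proof.
move=> Ac s0 e0; elim: r => [|i r IH].
  rewrite big_nil mul0r; apply: (le_trans (@pre_single e set0 0 s0 _ _)) => //.
    by rewrite lexx ltW.
  by rewrite expr0n; case: s s0.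
rewrite big_cons (le_trans (pre_setU _ _ _))//= -natr1 mulrDl mul1r addrC EFinD.
exact: leeD.
Qed.

Lemma pre_separated e A B (d : R) : (0 < s)%N -> (e < d)%R ->
  (forall x y, A x -> B y -> (d <= enorm (x - y))%R) ->
  hausdorff_pre s e A + hausdorff_pre s e B <= hausdorff_pre s e (A `|` B).
Proof.
move=> s0 ed AB; apply: le_pre => E [ABE Ee].
pose F C k := if `[< E k `&` C !=set0 >] then E k else set0.
have cF C : C `<=` A `|` B -> pre_cover e C (F C).
  move=> CAB; split.
    move=> x Cx; have [k _ Ex] := ABE _ (CAB _ Cx); exists k => //.
    by rewrite /F; case: asboolP => //; case; exists x.
  by move=> k; rewrite /F; case: asboolP => [?|? x y []]; exact: Ee.
have fA := cF A (@subsetUl _ A B); have fB := cF B (@subsetUr _ A B).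
apply: (le_trans (leeD (pre_le fA) (pre_le fB))).
rewrite /diam_sum -nneseriesD; last 2 first.
- by move=> k _ _; exact: diam_term_ge0 fA.
- by move=> k _ _; exact: diam_term_ge0 fB.
apply: lee_nneseries => k _.
  by rewrite adde_ge0//; [exact: diam_term_ge0 fA|exact: diam_term_ge0 fB].
have z : ((ediam (set0 : set 'rV[R]_m)) ^+ s)%:E = 0.
  by rewrite ediam_set0 expr0n; case: s s0.
have p : 0 <= ((ediam (E k)) ^+ s)%:E by rewrite lee_fin exprn_ge0// (ediam_ge0 (Ee k)).
rewrite /F; case: asboolP => [[x [Ex Ax]]|_]; case: asboolP => [[y [Ey By]]|_];
  rewrite ?z ?adde0 ?add0e//.
by have := le_trans (AB _ _ Ax By) (Ee _ _ _ Ex Ey); rewrite leNgt ed.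
Qed.

End hausdorff_pre.

Lemma pre_lipschitz (R : realType) m m' (s : nat) (A : set 'rV[R]_m)
    (f : 'rV[R]_m -> 'rV[R]_m') (L e : R) : (0 < L) -> (0 < e) ->
  (forall x y, A x -> A y -> enorm (f x - f y) <= L * enorm (x - y)) ->
  (hausdorff_pre s e (f @` A) <= (L ^+ s)%:E * hausdorff_pre s (e / L) A)%E.
Proof.
move=> L0 e0 lip; have Ls : 0 < L ^+ s by rewrite exprn_gt0.
rewrite muleC -lee_pdivrMr// muleC; apply: le_pre => E [AE Ee].
rewrite muleC lee_pdivrMr// muleC.
(* The cover is cut to [A], the only place where [f] is known to be Lipschitz. *)
pose F k := f @` (E k `&` A).
have dF k x y : (E k `&` A) x -> (E k `&` A) y ->
    enorm (f x - f y) <= L * ediam (E k).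
  move=> [Ex Ax] [Ey Ay]; apply: (le_trans (lip _ _ Ax Ay)).
  by rewrite ler_pM2l// (le_ediam (Ee k)).
have cF : pre_cover e (f @` A) F.
  split.
    move=> _ [x Ax <-]; have [k _ Ex] := AE _ Ax; exists k => //.
    by exists x.
  move=> k _ _ [x Ex <-] [y Ey <-]; apply: (le_trans (dF _ _ _ Ex Ey)).
  rewrite mulrC -ler_pdivlMr//; apply: ediam_ub => //.
  by rewrite divr_ge0// ltW.
apply: (le_trans (pre_le s cF)).
rewrite /diam_sum -nneseriesZl//; last first.
  by move=> k _; rewrite lee_fin exprn_ge0// (ediam_ge0 (Ee k)).
apply: lee_nneseries => k _; first by move=> _; exact: diam_term_ge0 cF.
rewrite -EFinM lee_fin -exprMn lerXn2r// ?nnegrE ?(ediam_ge0 (proj2 cF k))//.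
  by rewrite mulr_ge0 ?(ltW L0)// (ediam_ge0 (Ee k)).
apply: ediam_ub; first by rewrite mulr_ge0 ?(ltW L0)// (ediam_ge0 (Ee k)).
by move=> _ _ [x Ex <-] [y Ey <-]; exact: dF.
Qed.

Section hausdorff.
Context {R : realType} {m : nat} (s : nat) (s_gt0 : (0 < s)%N).
Implicit Types (A B : set 'rV[R]_m).
Local Open Scope ereal_scope.

Lemma pre_le_hausdorff e A : (0 < e)%R -> hausdorff_pre s e A <= hausdorff s A.
Proof. by move=> e0; apply: ereal_sup_ubound; exists e. Qed.

Lemma hausdorff_le A x : (forall e, (0 < e)%R -> hausdorff_pre s e A <= x) ->
  hausdorff s A <= x.
Proof. by move=> H; apply: ge_ereal_sup => _ [e /= e0 <-]; exact: H. Qed.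

Lemma hausdorff_ge0 A : 0 <= hausdorff s A.
Proof. exact: le_trans (pre_ge0 s 1 A) (pre_le_hausdorff A ltr01). Qed.

Lemma hausdorff_mono A B : A `<=` B -> hausdorff s A <= hausdorff s B.
Proof.
move=> AB; apply: hausdorff_le => e e0.
exact: le_trans (pre_mono s e AB) (pre_le_hausdorff _ e0).
Qed.

Lemma hausdorff_setU A B : hausdorff s (A `|` B) <= hausdorff s A + hausdorff s B.
Proof.
apply: hausdorff_le => e e0; apply: (le_trans (pre_setU _ _ _ _)).
by apply: leeD; exact: pre_le_hausdorff.
Qed.

Lemma hausdorff_set0 : hausdorff s (set0 : set 'rV[R]_m) = 0.
Proof.
apply/eqP; rewrite eq_le hausdorff_ge0 andbT; apply: hausdorff_le => e e0.
apply: (le_trans (@pre_single _ _ s e set0 0 s_gt0 _ _)) => //.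
  by rewrite lexx ltW.
by rewrite expr0n; case: s s_gt0.
Qed.

(** The two suprema over the mesh are treated independently; a mesh below [e], [e'] and [d] then
    serves both sets at once. *)
Lemma hausdorff_separated A B (d : R) : (0 < d)%R ->
  (forall x y, A x -> B y -> (d <= enorm (x - y))%R) ->
  hausdorff s A + hausdorff s B <= hausdorff s (A `|` B).
Proof.
move=> d0 AB; have hA := hausdorff_mono (@subsetUl _ A B).
have hB := hausdorff_mono (@subsetUr _ A B).
have [->|] := eqVneq (hausdorff s (A `|` B)) +oo; first by rewrite leey.
rewrite -ltey => fAB.
have fB : hausdorff s B \is a fin_num.
  by rewrite ge0_fin_numE ?hausdorff_ge0//; exact: le_lt_trans fAB.
rewrite -leeBrDr//; apply: hausdorff_le => e e0; rewrite leeBrDr// addeC.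
have fA : hausdorff_pre s e A \is a fin_num.
  rewrite ge0_fin_numE ?pre_ge0//; apply: le_lt_trans fAB.
  exact: le_trans (pre_le_hausdorff A e0) hA.
rewrite -leeBrDr//; apply: hausdorff_le => e' e0'; rewrite leeBrDr// addeC.
pose r : R := Num.min (d / 2)%R (Num.min e e').
have r0 : (0 < r)%R by rewrite !lt_min e0 e0' divr_gt0.
apply: le_trans (pre_le_hausdorff _ r0).
have rd : (r < d)%R.
  by apply: (@le_lt_trans _ _ (d / 2)%R); [rewrite ge_min lexx|lra].
apply: le_trans (pre_separated s_gt0 rd AB).
by apply: leeD; apply: pre_anti; rewrite !ge_min lexx ?orbT.
Qed.

End hausdorff.

Lemma hausdorff_lipschitz (R : realType) m m' (s : nat) (A : set 'rV[R]_m)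
    (f : 'rV[R]_m -> 'rV[R]_m') (L : R) : (0 < L) ->
  (forall x y, A x -> A y -> enorm (f x - f y) <= L * enorm (x - y)) ->
  (hausdorff s (f @` A) <= (L ^+ s)%:E * hausdorff s A)%E.
Proof.
move=> L0 lip; apply: hausdorff_le => e e0.
apply: (le_trans (pre_lipschitz s L0 e0 lip)).
apply: lee_wpmul2l; first by rewrite lee_fin exprn_ge0// ltW.
by apply: pre_le_hausdorff; rewrite divr_gt0.
Qed.

(** * Normalized surface measure *)

Section surface.
Context {R : realType} {n : nat} (n_gt0 : (0 < n)%N).
Implicit Types A B : set 'rV[R]_n.+1.

(** Projected to the first [n] coordinates, each set of a cover lies in a box of half-side its
    diameter around one of its points, of volume [2 ^ n] times the [n]-th power of the diameter. The
    boxes cover a cube of volume [1], so the sum is at least [2 ^ - n]. *)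
Lemma hausdorff_unit_cube_gt0 : (0 < hausdorff n (@unit_cube R n))%E.
Proof.
have p0 : (0 < 2^-1 ^+ n :> R) by rewrite exprn_gt0.
apply: (@lt_le_trans _ _ (2^-1 ^+ n)%:E); first by rewrite lte_fin.
apply: le_trans (pre_le_hausdorff _ _ ltr01); apply: le_pre => E EU.
have [UE Ee] := EU.
have dE k := ediam_ge0 (Ee k).
pose pt k := if pselect (E k !=set0) is left H then sval (cid H) else 0.
pose I k (i : 'I_n) := `[tilde (pt k) 0 i - ediam (E k), tilde (pt k) 0 i + ediam (E k)]%classic.
pose B k := [set t : 'rV[R]_n | forall i, I k i (t 0 i)].
have mB k : measurable (B k) by apply: (@measurable_rV_box _ _ (I k)) => i; exact: measurable_itv.
have lB k : (@lebesgue_rV R n (B k) = (2 ^+ n)%:E * ((ediam (E k)) ^+ n)%:E)%E.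
  rewrite (@lebesgue_rV_box _ _ (I k)); last by move=> i; exact: measurable_itv.
  rewrite (eq_bigr (fun=> (2 * ediam (E k))%:E)).
    by rewrite prodEFin prodr_const card_ord -EFinM exprMn.
  move=> i _; rewrite lebesgue_measure_itv/= lte_fin.
  have := dE k; move: (ediam _) (tilde _ _ _) => a b a0.
  case: ifPn => [_|h]; first by rewrite -EFinB; congr EFin; ring.
  by congr EFin; rewrite -leNgt in h; lra.
have cover : cube (0 : 'rV[R]_n) 1 `<=` \bigcup_k B k.
  move=> t t01; pose x : 'rV[R]_n.+1 :=
    \row_i (if unlift ord_max i is Some j then t 0 j else 0).
  have xt : tilde x = t.
    by apply/rowP => i; rewrite !mxE widen_lift liftK.
  have Ux : unit_cube x.
    split; first by rewrite mxE unlift_none.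
    move=> i; rewrite mxE; case: unliftP => [j _|_]; last by rewrite lexx ler01.
    by have := t01 j; rewrite mxE add0r => /andP[-> /ltW].
  have [k _ Ex] := UE _ Ux; exists k => // i.
  have Ept : E k (pt k).
    rewrite /pt; case: pselect => [H|[]]; last by exists x.
    by case: cid.
  rewrite /I /= in_itv/=.
  have := le_trans (enorm_coord (x - pt k) (widen_ord (leqnSn n) i)) (le_ediam (Ee k) Ex Ept).
  by rewrite -[in t 0 i]xt ![tilde _ 0 i]mxE !mxE ler_norml => /andP[? ?];
    apply/andP; split; lra.
have : (1 <= \sum_(k <oo) @lebesgue_rV R n (B k))%E.
  rewrite -(_ : @lebesgue_rV R n (cube 0 1) = 1%E); last first.
    by rewrite lebesgue_rV_cube// expr1n.
  apply: measure_sigma_subadditive => //; exact: measurable_cube.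
under eq_eseriesr do rewrite lB.
rewrite nneseriesZl//; last by move=> k _; exact: diam_term_ge0 EU.
rewrite exprVn -lee_pdivrMl ?exprn_gt0// mule1.
by [].
Qed.

(** The cube is cut into [N ^ n] cubes of side [1 / N], whose diameter is at most [(n + 1) / N]; the
    powers of [N] cancel in the sum. *)
Lemma hausdorff_unit_cube_fin : hausdorff n (@unit_cube R n) \is a fin_num.
Proof.
rewrite ge0_fin_numE ?hausdorff_ge0//.
suff : (hausdorff n (@unit_cube R n) <= (n.+1%:R ^+ n)%:E)%E.
  by move/le_lt_trans; apply; rewrite ltry.
apply: hausdorff_le => e e0.
have [N Ne] : exists N : nat, n.+1%:R / e < N%:R.
  by exists (Num.bound (n.+1%:R / e)); apply: archi_boundP; rewrite divr_ge0// ltW.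
have N0 : (0 < N)%N.
  by rewrite -(ltr0n R); apply: le_lt_trans Ne; rewrite divr_ge0// ltW.
have NR : 0 < N%:R :> R by rewrite ltr0n.
pose A (f : {ffun 'I_n -> 'I_N}) := [set x : 'rV[R]_n.+1 | x 0 ord_max = 0 /\
  forall i : 'I_n, (f i)%:R / N%:R <= x 0 (widen_ord (leqnSn n) i) <= (f i).+1%:R / N%:R].
pose d : R := n.+1%:R / N%:R.
have Ad f : ediam_le d (A f).
  move=> x y [x0 xf] [y0 yf]; apply: (le_trans (enorm_le_sum _)).
  rewrite big_ord_recr/= !mxE x0 y0 subrr normr0 addr0.
  apply: (@le_trans _ _ (\sum_(i < n) N%:R^-1)).
    apply: ler_sum => i _; rewrite !mxE; have := xf i; have := yf i.
    rewrite -natr1 mulrDl mul1r ler_norml => /andP[? ?] /andP[? ?].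
    by apply/andP; split; lra.
  by rewrite sumr_const card_ord -[leLHS]mulr_natl /d ler_wpM2r ?invr_ge0 ?ler0n// ler_nat.
have de : 0 <= d <= e.
  rewrite divr_ge0//= ler_pdivrMr// mulrC -ler_pdivrMr// ltW//.
have sub : @unit_cube R n `<=` \big[setU/set0]_(f <- enum {ffun 'I_n -> 'I_N}) A f.
  move=> x [x0 x01].
  have /choice[f fP] : forall i : 'I_n, exists k : 'I_N, k%:R / N%:R <=
      x 0 (widen_ord (leqnSn n) i) <= k.+1%:R / N%:R.
    move=> i; set u := x 0 _; have /andP[u0 u1] : 0 <= u <= 1 by exact: x01.
    have [u1'|u1'] := eqVneq u 1.
      have kN : (N.-1 < N)%N by rewrite prednK.
      exists (Ordinal kN) => /=; rewrite prednK// u1' divff ?gt_eqF// lexx andbT.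
      by rewrite ler_pdivrMr// mul1r ler_nat leq_pred.
    have {u1'}u1 : u < 1 by rewrite lt_def eq_sym u1'.
    have uN : 0 <= u * N%:R by rewrite mulr_ge0.
    have /andP[h1 h2] := truncn_itv uN.
    have kN : (Num.truncn (u * N%:R) < N)%N.
      by rewrite -(ltr_nat R); apply: (le_lt_trans h1); rewrite gtr_pMl.
    by exists (Ordinal kN) => /=; rewrite ler_pdivrMr// ler_pdivlMr// h1 ltW.
  rewrite -bigcup_seq; exists (finfun f); first by rewrite /= mem_enum.
  by split=> // i; rewrite ffunE; exact: fP.
apply: (le_trans (pre_mono n e sub)).
have := @pre_bigcup _ _ n _ (enum {ffun 'I_n -> 'I_N}) e A (d ^+ n)
  (fun f => pre_single n_gt0 de (Ad f)) n_gt0 e0.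
move/le_trans; apply; rewrite lee_fin.
have -> : size (enum {ffun 'I_n -> 'I_N}) = (N ^ n)%N.
  by rewrite -cardE card_ffun !card_ord.
by rewrite natrX -exprMn /d mulrCA mulfV ?gt_eqF// mulr1.
Qed.

Let k := fine (hausdorff n (@unit_cube R n)).

Let k_gt0 : 0 < k.
Proof. by rewrite fine_gt0// hausdorff_unit_cube_gt0/= -ge0_fin_numE ?hausdorff_ge0// hausdorff_unit_cube_fin. Qed.

Lemma surface_measureE A : surface_measure A = ((k^-1)%:E * hausdorff n A)%E.
Proof.
rewrite /surface_measure -(fineK hausdorff_unit_cube_fin) -/k muleC.
by rewrite inver gt_eqF.
Qed.

Let kV : (0 <= (k^-1)%:E)%E.
Proof. by rewrite lee_fin invr_ge0 ltW. Qed.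

Lemma surface_ge0 A : (0 <= surface_measure A)%E.
Proof. by rewrite surface_measureE mule_ge0// hausdorff_ge0. Qed.

Lemma surface_mono A B : A `<=` B -> (surface_measure A <= surface_measure B)%E.
Proof. by move=> AB; rewrite !surface_measureE lee_wpmul2l// hausdorff_mono. Qed.

Lemma surface_setU A B :
  (surface_measure (A `|` B) <= surface_measure A + surface_measure B)%E.
Proof.
rewrite !surface_measureE -ge0_muleDr ?hausdorff_ge0// lee_wpmul2l//.
exact: hausdorff_setU.
Qed.

Lemma surface_separated A B (d : R) : (0 < d)%R ->
  (forall x y, A x -> B y -> (d <= enorm (x - y))%R) ->
  (surface_measure A + surface_measure B <= surface_measure (A `|` B))%E.
Proof.
move=> d0 AB; rewrite !surface_measureE -ge0_muleDr ?hausdorff_ge0// lee_wpmul2l//.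
exact: hausdorff_separated AB.
Qed.

Lemma surface_set0 : surface_measure (set0 : set 'rV[R]_n.+1) = 0%E.
Proof. by rewrite surface_measureE hausdorff_set0// mule0. Qed.

Lemma surface_unit_cube : surface_measure (@unit_cube R n) = 1%E.
Proof.
rewrite surface_measureE -(fineK hausdorff_unit_cube_fin) -EFinM mulVf//.
by rewrite gt_eqF.
Qed.

Lemma surface_lipschitz A (f : 'rV[R]_n.+1 -> 'rV[R]_n.+1) (L : R) : 0 < L ->
  (forall x y, A x -> A y -> enorm (f x - f y) <= L * enorm (x - y)) ->
  (surface_measure (f @` A) <= (L ^+ n)%:E * surface_measure A)%E.
Proof.
move=> L0 lip; rewrite !surface_measureE muleCA lee_wpmul2l//.
exact: hausdorff_lipschitz.
Qed.

Lemma surface_bigsetU (I : Type) (r : seq I) (A : I -> set 'rV[R]_n.+1) :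
  (surface_measure (\big[setU/set0]_(i <- r) A i) <=
   \sum_(i <- r) surface_measure (A i))%E.
Proof.
elim: r => [|i r IH]; first by rewrite !big_nil surface_set0.
by rewrite !big_cons (le_trans (surface_setU _ _))// leeD.
Qed.

(** A common positive distance takes the place of Carathéodory measurability in the additivity of
    the outer measure. *)
Lemma surface_bigsetU_separated (I : choiceType) (r : seq I) (A : I -> set 'rV[R]_n.+1)
    (d : R) : 0 < d -> uniq r ->
  (forall i j x y, i != j -> A i x -> A j y -> d <= enorm (x - y)) ->
  (\sum_(i <- r) surface_measure (A i) <=
   surface_measure (\big[setU/set0]_(i <- r) A i))%E.
Proof.
move=> d0 ur sep; elim: r ur => [|i r IH]; first by rewrite !big_nil surface_set0.
move=> /andP[ir ur]; rewrite !big_cons.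
apply: (le_trans (leeD (lexx _) (IH ur))); apply: (surface_separated d0) => x y Ax.
rewrite -bigcup_seq => -[j /= jr Ay]; apply: (sep i j) => //.
by apply: contraNneq ir => ->.
Qed.

End surface.

(** * Decomposition of the boundary into graph cells *)

Section enorm_topology.
Context {R : realType} {m : nat}.
Implicit Types (A D : set 'rV[R]_m) (x y : 'rV[R]_m) (e : R).

Lemma nbhs_enorm x (B : set 'rV[R]_m) :
  nbhs x B <-> exists2 e : R, 0 < e & forall y, enorm (y - x) < e -> B y.
Proof.
split=> [/nbhs_ballP[e /= e0 eB]|[e e0 eB]].
  exists e => // y yx; apply: eB; rewrite -ball_normE /ball_/= distrC.
  exact: le_lt_trans (mx_norm_le_enorm _) yx.
apply/nbhs_ballP; exists (e / m.+1%:R) => /=; first by rewrite divr_gt0.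
move=> y; rewrite -ball_normE /ball_/= distrC => yx; apply: eB.
apply: (le_lt_trans (enorm_le_mx_norm _)).
apply: (@le_lt_trans _ _ (m.+1%:R * `|y - x|)).
  by rewrite ler_wpM2r// ler_nat.
by rewrite mulrC -ltr_pdivlMr.
Qed.

Lemma open_enorm D x : open D -> D x ->
  exists2 e : R, 0 < e & forall y, enorm (y - x) < e -> D y.
Proof. by move=> oD Dx; apply/nbhs_enorm; exact: open_nbhs_nbhs. Qed.

Lemma closure_enorm A x :
  closure A x <-> forall e, 0 < e -> exists2 y, A y & enorm (y - x) < e.
Proof.
split=> [Ax e e0|H B /nbhs_enorm[e e0 eB]].
  have [|y [Ay yx]] := Ax [set y | enorm (y - x) < e]; last by exists y.
  by apply/nbhs_enorm; exists e.
by have [y Ay yx] := H _ e0; exists y; split=> //; exact: eB.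
Qed.

Lemma boundary_openP D x : open D -> boundary D x <-> closure D x /\ ~ D x.
Proof. by move=> /interior_id oD; rewrite /boundary oD. Qed.

(* The last point of the segment from x to y before leaving D. *)
Lemma segment_boundary D x y : open D -> D x -> ~ D y ->
  exists2 z, boundary D z & enorm (x - z) <= enorm (x - y).
Proof.
move=> oD Dx Dy; pose p (t : R) := x + t *: (y - x).
pose S := [set t : R | 0 <= t <= 1 /\ ~ D (p t)].
have S1 : S 1 by rewrite /S /= ler01 lexx /p scale1r subrKC.
have lbS : lbound S 0 by move=> t [/andP[]].
have iS : has_inf S by split; [exists 1|exists 0].
pose t0 := inf S.
have t00 : 0 <= t0 by apply: lb_le_inf => //; exists 1.
have t01 : t0 <= 1 by apply: ge_inf => //; exists 0.
have pp s t : p s - p t = (s - t) *: (y - x).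
  by rewrite /p opprD addrACA subrr add0r scalerBl.
have dp s t : enorm (p s - p t) = `|s - t| * enorm (y - x) by rewrite pp enormZ.
pose K := enorm (y - x) + 1.
have K0 : 0 < K by rewrite ltr_wpDl// enorm_ge0.
have dK s t : enorm (p s - p t) <= `|s - t| * K.
  by rewrite dp ler_wpM2l// lerDl.
have nD : ~ D (p t0).
  move=> Dp; have [e e0 eD] := open_enorm oD Dp.
  have [t St tt0] := inf_adherent (divr_gt0 e0 K0) iS.
  have [_] := St; apply; apply: eD; apply: (le_lt_trans (dK _ _)).
  have t0t : t0 <= t by apply: ge_inf => //; exists 0.
  by rewrite ger0_norm ?subr_ge0// -ltr_pdivlMr// ltrBlDl.
exists (p t0); last first.
  have -> : x = p 0 by rewrite /p scale0r addr0.
  have p1 : y = p 1 by rewrite /p scale1r subrKC.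
  rewrite [in leRHS]p1 {1}(_ : p 0 = x) /p ?scale0r ?addr0// -/(p t0).
  rewrite -{1}(_ : p 0 = x); last by rewrite /p scale0r addr0.
  rewrite dp sub0r normrN ger0_norm// scale1r (enorm_distC x) subrKC.
  by rewrite -[leRHS]mul1r ler_wpM2r// enorm_ge0.
apply/(boundary_openP _ oD); split=> //; apply/closure_enorm => e e0.
have t0_neq0 : t0 != 0.
  by apply/eqP => E; apply: nD; rewrite E /p scale0r addr0.
have {t0_neq0 t00}t00 : 0 < t0 by rewrite lt_def t0_neq0.
pose t := Num.max 0 (t0 - e / (2 * K)).
have eK : 0 < e / (2 * K) by rewrite divr_gt0// mulr_gt0.
have tt0 : t < t0 by rewrite gt_max t00 ltrBlDr ltrDl.
exists (p t).
  apply: contrapT => Dt; have St : S t.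
    split=> //; rewrite le_max lexx/=; exact: le_trans (ltW tt0) t01.
  have : t0 <= t by apply: ge_inf => //; exists 0.
  by rewrite leNgt tt0.
apply: (le_lt_trans (dK _ _)); rewrite ler0_norm ?subr_le0 ?(ltW tt0)// opprB.
have : t0 - t <= e / (2 * K).
  by rewrite lerBlDl -lerBlDr le_max lexx orbT.
move=> h; apply: (@le_lt_trans _ _ (e / (2 * K) * K)); first by rewrite ler_pM2r.
rewrite invfM mulrA -mulrA mulVf ?gt_eqF// mulr1; lra.
Qed.

Lemma finite_net A (e : R) : compact A -> 0 < e ->
  exists s : seq 'rV[R]_m, (forall z, z \in s -> A z) /\
    forall x, A x -> exists2 z, z \in s & enorm (x - z) < e.
Proof.
rewrite compact_cover => cA e0.
have [|x Ax|D' D'A cov] := cA _ A (fun z => [set x | enorm (x - z) < e]°).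
- by move=> z _; exact: open_interior.
- exists x => //; apply/nbhs_enorm; exists e => // y.
- exists (finmap.enum_fset D'); split.
    by move=> z zD; have := D'A z zD; rewrite inE.
  move=> x /cov[z /= zD zx]; exists z => //.
  exact: (interior_subset zx).
Qed.

End enorm_topology.

Section mean_value.
Context {R : realType} {n : nat}.

Lemma deriv_gradient (f : 'rV[R]_n -> R) x v : differentiable f x ->
  'D_v f x = \sum_i v 0 i * gradient f x 0 i.
Proof.
move=> df; rewrite deriveE// {1}(row_sum_delta v) linear_sum/=.
apply: eq_bigr => i _; rewrite linearZ/= mxE deriveE//.
Qed.

(** The one-dimensional mean value theorem on the segment from [y] to [x], where the derivative is
    the scalar product of [x - y] with the gradient. *)
Lemma mean_value_lipschitz (f : 'rV[R]_n -> R) (x y : 'rV[R]_n) (M : R) :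
  (forall z, differentiable f z) ->
  (forall t : R, 0 <= t <= 1 -> enorm (gradient f (y + t *: (x - y))) <= M) ->
  `|f x - f y| <= M * enorm (x - y).
Proof.
move=> df gM; pose v := x - y; pose g (t : R) := f (y + t *: v).
have dg (t : R) : is_derive t (1 : R) g ('D_v f (y + t *: v)).
  have E : (fun h : R => h^-1 *: (g (h *: 1 + t) - g t)) =
      (fun h : R => h^-1 *: (f (h *: v + (y + t *: v)) - f (y + t *: v))).
    apply/funext => h; rewrite /g; congr (_ *: (f _ - _)).
    by rewrite [h *: 1]mulr1 scalerDl addrCA.
  have := @diff_derivable _ _ _ f (y + t *: v) v (df _).
  rewrite /derivable -E => dd.
  apply: DeriveDef; first exact: dd.
  by rewrite /derive -E.
have cg : {within `[0, 1], continuous g}.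
  apply: derivable_within_continuous => t _.
  by have [] := dg t.
have [t t01] := MVT_segment ler01 (fun t _ => dg t) cg.
rewrite /g scale1r scale0r addr0 subrKC subr0 mulr1 => ->.
rewrite in_itv/= in t01; rewrite deriv_gradient//.
have G := gM _ t01; rewrite -/v in G *.
have h1 := cauchy_schwarz v (gradient f (y + t *: v)).
have h2 := cauchy_schwarz (- v) (gradient f (y + t *: v)).
have E2 : \sum_i (- v) 0 i * gradient f (y + t *: v) 0 i =
    - \sum_i v 0 i * gradient f (y + t *: v) 0 i.
  by rewrite -sumrN; apply: eq_bigr => i _; rewrite mxE mulNr.
rewrite E2 enormN in h2.
have h3 : enorm v * enorm (gradient f (y + t *: v)) <= M * enorm v.
  by rewrite mulrC ler_wpM2r// enorm_ge0.
by rewrite ler_norml; apply/andP; split; lra.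
Qed.

End mean_value.

(** * Charts of small slope *)

Section adapted_charts.
Context {R : realType} {n : nat}.
Implicit Types (D : set 'rV[R]_n.+1) (c : @chart R n) (t : 'rV[R]_n)
  (x y : 'rV[R]_n.+1) (e b : R).

Definition box b t := forall i, `|t 0 i| <= b.

(** The slope [e], chosen in advance, replaces the [C11] constant; the price is the size [b] of the
    block where the chart is valid. Measurability is asked on the whole space, where integrals in
    graph coordinates are taken. *)
Definition adapted D c e b :=
  [/\ chart_rot c *m (chart_rot c)^T = 1%:M,
      forall t t', box b t -> box b t' ->
        `|chart_fun c t - chart_fun c t'| <= e * enorm (t - t'),
      forall x, box b (chart_base c x) -> `|chart_height c x| <= b ->
        (D x <-> 0 < chart_height c x) &
      measurable_fun setT (chart_fun c)].

Lemma enorm_box b t : box b t -> enorm t <= n%:R * b.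
Proof.
move=> tb; apply: (le_trans (enorm_le_sum _)).
apply: (le_trans (ler_sum _ (fun i _ => tb i))).
by rewrite sumr_const card_ord mulr_natl.
Qed.

Lemma box_dist b t t' e : box b t -> enorm (t - t') <= e -> box (b + e) t'.
Proof.
move=> tb tt i; have := tb i; have := le_trans (enorm_coord _ i) tt.
by rewrite !mxE !ler_norml => /andP[? ?] /andP[? ?]; apply/andP; split; lra.
Qed.

Lemma boxW b b' t : b <= b' -> box b t -> box b' t.
Proof. by move=> bb tb i; exact: le_trans (tb i) bb. Qed.

Lemma chart_base_center c : chart_base c (chart_center c) = 0.
Proof.
by apply/rowP => i; rewrite /chart_base /chart_coord subrr mul0mx !mxE.
Qed.

Lemma chart_height_center c : chart_fun c 0 = 0 -> chart_height c (chart_center c) = 0.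
Proof.
move=> f0; rewrite /chart_height chart_base_center f0 subr0.
by rewrite /chart_top /chart_coord subrr mul0mx mxE.
Qed.

Lemma chart_height_dist D c e b x y : adapted D c e b -> e <= 1 ->
  box b (chart_base c x) -> box b (chart_base c y) ->
  `|chart_height c x - chart_height c y| <= 2 * enorm (x - y).
Proof.
move=> [cU lip _ _] e1 bx by_.
have h1 := lip _ _ bx by_; have h2 := chart_base_dist cU x y.
have h3 : `|chart_top c x - chart_top c y| <= enorm (x - y).
  have -> : chart_top c x = chart_top c y + chart_dtop c (x - y).
    by rewrite -chart_topD subrKC.
  by rewrite addrAC subrr add0r norm_chart_dtop.
have h4 : e * enorm (chart_base c x - chart_base c y) <= 1 * enorm (x - y).
  have [e0|e0] := leP 0 e; first by apply: ler_pM => //; exact: enorm_ge0.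
  apply: (@le_trans _ _ 0); last by rewrite mul1r enorm_ge0.
  by rewrite mulr_le0_ge0 ?enorm_ge0// ltW.
rewrite /chart_height; move: h1 h3 h4; rewrite mul1r !ler_norml.
move=> /andP[? ?] /andP[? ?] ?; apply/andP; split; lra.
Qed.

Lemma chart_point_dist c t t' u u' : chart_rot c *m (chart_rot c)^T = 1%:M ->
  enorm (chart_point c t u - chart_point c t' u') <=
  enorm (t - t') + `|(u + chart_fun c t) - (u' + chart_fun c t')|.
Proof.
move=> cU; rewrite /chart_point opprD addrACA subrr add0r -mulmxBl enorm_rotV//.
set v := (X in enorm X).
have vt : tilde v = t - t'.
  by apply/rowP => i; rewrite !mxE widen_lift liftK.
have vm : v 0 ord_max = (u + chart_fun c t) - (u' + chart_fun c t').
  by rewrite !mxE unlift_none.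
have := enorm_tilde v; rewrite vt vm; move: (_ - (u' + _)) => a h.
rewrite -(ler_pXn2r (n := 2))// ?nnegrE ?enorm_ge0 ?addr_ge0 ?enorm_ge0//.
rewrite h sqrrD real_normK ?num_real// lerD2r lerDl mulrn_wge0// mulr_ge0//.
exact: enorm_ge0.
Qed.

(** Halving the block keeps all points within [b / 4] of [x] in the region where the sign of the
    height decides membership in [D]. A negative height stays negative nearby, and over a point of
    height [0] small positive heights reach [D]. *)
Lemma adapted_boundary D c e b x : open D -> 0 < b -> e <= 1 -> adapted D c e b ->
  box (b / 2) (chart_base c x) -> `|chart_height c x| <= b / 2 ->
  (boundary D x <-> chart_height c x = 0).
Proof.
move=> oD b0 e1 ad xb xh; have [cU lip DP _] := ad.
have b2 : b / 2 <= b by lra.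
have xB := boxW b2 xb; have xH := le_trans xh b2.
have near_V d y : 0 < d -> d <= b / 4 -> enorm (x - y) <= d ->
    [/\ box b (chart_base c y), `|chart_height c y| <= b &
        `|chart_height c x - chart_height c y| <= 2 * d].
  move=> d0 db xy.
  have yb : box b (chart_base c y).
    apply: (@boxW (b / 2 + d)); first lra.
    by apply: box_dist xb _; apply: le_trans xy; exact: chart_base_dist.
  have := chart_height_dist ad e1 xB yb => h.
  have {}h : `|chart_height c x - chart_height c y| <= 2 * d.
    by rewrite (le_trans h)// ler_pM2l.
  split=> //; move: xh h; rewrite !ler_norml => /andP[? ?] /andP[? ?].
  by apply/andP; split; lra.
split=> [/(boundary_openP _ oD)[/closure_enorm cx nDx]|h0].
  have : chart_height c x <= 0 by rewrite leNgt; apply/negP => /(DP _ xB xH).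
  rewrite le_eqVlt => /predU1P[//|hx].
  pose d := Num.min (b / 4) (- chart_height c x / 4).
  have d0 : 0 < d by rewrite lt_min; apply/andP; split; lra.
  have [y Dy yx] := cx _ d0.
  have [||yb yh] := near_V d y d0; first by rewrite ge_min lexx.
    by rewrite enorm_distC ltW.
  have {}Dy := (DP _ yb yh).1 Dy.
  have : d <= - chart_height c x / 4 by rewrite ge_min lexx orbT.
  by rewrite ler_norml => ? /andP[? ?]; lra.
apply/(boundary_openP _ oD); split; last by move=> /(DP _ xB xH); rewrite h0 ltxx.
apply/closure_enorm => d d0.
pose u := Num.min (d / 2) b.
have u0 : 0 < u by rewrite lt_min; apply/andP; split; lra.
exists (chart_point c (chart_base c x) u).
  apply/DP; rewrite ?chart_base_point ?chart_height_point//.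
  by rewrite gtr0_norm// ge_min lexx orbT.
rewrite -{2}(chart_pointK cU x) h0.
apply: (le_lt_trans (chart_point_dist _ _ _ _ cU)).
rewrite subrr enorm0 !add0r addrK gtr0_norm//.
by apply: (@le_lt_trans _ _ (d / 2)); [rewrite ge_min lexx|lra].
Qed.

(** The gradient vanishes at the center and is [L]-Lipschitz, so its norm is at most [L n b <= e] on
    the box. A point of the block is within [(2 n + 1) b] of [z], less than [R1]. Both conditions
    fix [b] independently of [z]. *)
Lemma C11_adapted D (e : R) : C11_open D -> 0 < e -> e <= 1 ->
  exists2 b : R, 0 < b & forall z, boundary D z ->
    exists c, [/\ chart_center c = z, chart_fun c 0 = 0 & adapted D c e b].
Proof.
move=> [oD [R1 [L [R10 L0 H]]]] e0 e1.
pose b := Num.min R1 (e / L) / (2 * n + 2)%:R.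
have n2 : 0 < (2 * n + 2)%:R :> R by rewrite ltr0n addn2.
have b0 : 0 < b by rewrite divr_gt0// lt_min R10 divr_gt0.
have bR : (2 * n + 2)%:R * b <= R1 by rewrite mulrC divfK ?gt_eqF// ge_min lexx.
have be : (2 * n + 2)%:R * b <= e / L.
  by rewrite mulrC divfK ?gt_eqF// ge_min lexx orbT.
have nE : (2 * n + 2)%:R = 2 * n%:R + 2 :> R by rewrite natrD natrM.
rewrite nE in bR be.
have n0 : 0 <= n%:R :> R by [].
have nb : 0 <= n%:R * b by rewrite mulr_ge0// ltW.
have nbe : L * (n%:R * b) <= e.
  rewrite mulrC -ler_pdivlMr//; apply: le_trans be; lra.
exists b => // z /H[f [U [[df _ gL] f0 g0 UU DE]]].
exists (Chart z U f); split=> //.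
have lip t t' : box b t -> box b t' -> `|f t - f t'| <= e * enorm (t - t').
  move=> tb tb'; apply: mean_value_lipschitz => // s /andP[s0 s1].
  rewrite -[gradient _ _]subr0 -g0 (le_trans (gL _ _))// subr0.
  apply: le_trans nbe; rewrite ler_pM2l//; apply: enorm_box => i.
  have := tb i; have := tb' i; rewrite !mxE !ler_norml => /andP[? ?] /andP[? ?].
  by apply/andP; split; nra.
split=> //=; last first.
  by apply: continuous_rV_measurable => t; exact: differentiable_continuous.
move=> x xb xh.
suff xz : enorm (x - z) < R1.
  have E : eball z R1 x by [].
  rewrite /chart_height subr_gt0 /=.
  split=> [Dx|h].
    by have : (eball z R1 `&` D) x by []; rewrite DE => -[].
  by have [] : (eball z R1 `&` D) x by rewrite DE; split.
have box0 : box b (0 : 'rV[R]_n) by move=> i; rewrite mxE normr0 ltW.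
have fb : `|f (chart_base (Chart z U f) x)| <= n%:R * b.
  have := lip _ _ xb box0; rewrite f0 !subr0 => /le_trans; apply.
  rewrite -[leRHS]mul1r ler_pM ?enorm_ge0 ?(ltW e0)//.
  exact: enorm_box.
have -> : enorm (x - z) = enorm (chart_coord (Chart z U f) x).
  by rewrite /chart_coord (@enorm_rot _ _ (Chart z U f)).
have h1 : enorm (chart_base (Chart z U f) x) <= n%:R * b by exact: enorm_box.
have h2 : `|chart_top (Chart z U f) x| <= b + n%:R * b.
  move: xh fb; rewrite /chart_height /= !ler_norml => /andP[? ?] /andP[? ?].
  by apply/andP; split; lra.
have := enorm_tilde (chart_coord (Chart z U f) x).
rewrite -/(chart_base _ _) -/(chart_top _ _) => h3.
apply: (@le_lt_trans _ _ (n%:R * b + (b + n%:R * b))); last lra.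
rewrite -(ler_pXn2r (n := 2))// ?nnegrE ?enorm_ge0//; last lra.
rewrite h3 sqrrD lerD//; last first.
  rewrite -(real_normK (num_real (chart_top _ _))) lerXn2r// ?nnegrE//; lra.
have : enorm (chart_base (Chart z U f) x) ^+ 2 <= (n%:R * b) ^+ 2.
  by rewrite lerXn2r// ?nnegrE// enorm_ge0.
move/le_trans; apply; rewrite lerDl mulrn_wge0// mulr_ge0//; lra.
Qed.

End adapted_charts.

Lemma packing d (T : measurableType d) (R : realType) (m : {measure set T -> \bar R})
    (I : eqType) (r : seq I) (F : I -> set T) (U : set T) :
  uniq r -> (forall i, measurable (F i)) -> measurable U ->
  (forall i, i \in r -> F i `<=` U) ->
  (forall i j, i \in r -> j \in r -> i != j -> F i `&` F j = set0) ->
  (\sum_(i <- r) m (F i) <= m U)%E.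
Proof.
move=> ur mF; elim: r U ur => [|i r IH] U ur mU FU FF; first by rewrite big_nil.
have /andP[ir {}ur] := ur; rewrite big_cons.
have mUF : measurable (U `\` F i) by exact: measurableD.
have h : (\sum_(j <- r) m (F j) <= m (U `\` F i))%E.
  apply: IH => //; last first.
    by move=> j l jr lr; apply: FF; rewrite inE ?jr ?lr orbT.
  move=> j jr x Fj; split; first by apply: FU Fj; rewrite inE jr orbT.
  move=> Fi; have : (F i `&` F j) x by [].
  rewrite FF// ?inE ?eqxx ?jr ?orbT//.
  by apply: contraNneq ir => ->.
apply: (le_trans (leeD (lexx _) h)).
rewrite -measureU//; last by apply/seteqP; split=> // x [? []].
apply: le_measure; rewrite ?inE//; first exact: measurableU.
by move=> x [Fi|[]//]; apply: FU Fi; rewrite inE eqxx.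
Qed.

(** A mean value bound for powers, in which [1 <= K] allows [K ^ m] in place of [K ^ (m - 1)]. *)
Lemma expr_sub_le (R : realType) (m : nat) (u v K : R) : 0 <= v -> v <= u ->
  u <= K -> 1 <= K -> u ^+ m - v ^+ m <= m%:R * (u - v) * K ^+ m.
Proof.
move=> v0 vu uK K1; have u0 : 0 <= u by lra.
have K0 : 0 <= K by lra.
elim: m => [|m IH]; first by rewrite !expr0 subrr !mul0r.
have -> : u ^+ m.+1 - v ^+ m.+1 = u * (u ^+ m - v ^+ m) + v ^+ m * (u - v).
  by rewrite !exprS; ring.
have h1 : u * (u ^+ m - v ^+ m) <= K * (m%:R * (u - v) * K ^+ m).
  apply: ler_pM => //; rewrite subr_ge0 lerXn2r// ?nnegrE//.
have h2 : v ^+ m * (u - v) <= K ^+ m * (u - v).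
  apply: ler_wpM2r; first lra.
  by rewrite lerXn2r// ?nnegrE//; lra.
have h3 : K ^+ m * (u - v) <= K ^+ m.+1 * (u - v).
  apply: ler_wpM2r; first lra.
  by rewrite exprS ler_peMl// exprn_ge0.
apply: (le_trans (lerD h1 (le_trans h2 h3))).
by rewrite -natr1 exprS le_eqVlt; apply/orP; left; apply/eqP; ring.
Qed.

Lemma lebesgue_rV_shell (R : realType) n (r r' : R) : 0 <= r' -> r' <= r ->
  @lebesgue_rV R n (cube (const_mx (- r)) (2 * r) `\` cube (const_mx (- r')) (2 * r')) =
  ((2 * r) ^+ n - (2 * r') ^+ n)%:E.
Proof.
move=> r0 rr; have m1 := @measurable_cube R n (const_mx (- r)) (2 * r).
have m2 := @measurable_cube R n (const_mx (- r')) (2 * r').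
have E1 := @lebesgue_rV_cube R n (const_mx (- r)) (2 * r).
have E2 := @lebesgue_rV_cube R n (const_mx (- r')) (2 * r').
have sub : cube (const_mx (- r')) (2 * r') `<=` cube (const_mx (- r) : 'rV[R]_n) (2 * r).
  by move=> t tr i; have := tr i; rewrite !mxE => /andP[? ?]; apply/andP; split; lra.
rewrite EFinB -E1; last lra.
rewrite -E2; last lra.
apply: (etrans (measureD m1 m2 _)); last by rewrite setIidr.
by apply: (le_lt_trans (_ : _ <= ((2 * r) ^+ n)%:E)%E); [rewrite -E1//; lra|rewrite ltry].
Qed.

Section strips.
Context {R : realType} {n : nat} (c : @chart R n).
Hypotheses (cU : chart_rot c *m (chart_rot c)^T = 1%:M)
  (mf : measurable_fun setT (chart_fun c)).
Variables (A : set 'rV[R]_n) (J : set R).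
Hypotheses (mA : measurable A) (mJ : measurable J).

Let strip := [set x | J (chart_height c x) /\ A (chart_base c x)].

Let mJA : measurable (J `*` A : set (measurableTypeR R * 'rV[R]_n)).
Proof. exact: measurableX. Qed.

Lemma measurable_strip : measurable strip.
Proof.
have [mg _] := graph_coord_preserving cU mf.
exact: (measurable_preimage mg mJA).
Qed.

Lemma lebesgue_strip : @lebesgue_rV R n.+1 strip = (lebesgue_measure J * lebesgue_rV A)%E.
Proof.
have [_ gE] := graph_coord_preserving cU mf.
apply: (etrans (gE _ mJA)); exact: product_measure1E.
Qed.

End strips.

Section cells.
Context {R : realType} {n : nat}.
Implicit Types (D : set 'rV[R]_n.+1) (t : 'rV[R]_n) (x y v : 'rV[R]_n.+1).

(** A margin [e s / 2] is removed on each side, which leaves cubes of side [(1 - e) s]; distinct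
    shrunk cubes of a grid are at distance at least [e s]. *)
Definition shrunk_cube (e : R) (p : 'rV[R]_n) (s : R) : set 'rV[R]_n :=
  [set t | forall i, p 0 i + e * s / 2 <= t 0 i <= p 0 i + s - e * s / 2].

(* The used cells cover the boundary and, by [cell_tube], every point from which
   [D] can be left by a short displacement; the good ones, pairwise separated
   once shrunk, account for all but a negligible part of the surface. *)
Record cells D (e : R) := Cells {
  cell_index : finType ;
  cell_chart : cell_index -> @chart R n ;
  cell_corner : cell_index -> 'rV[R]_n ;
  cell_side : R ;
  cell_reach : R ;
  cell_gap : R ;
  cell_used : pred cell_index ;
  cell_good : pred cell_index ;
  cell_side_gt0 : 0 < cell_side ;
  cell_reach_gt0 : 0 < cell_reach ;
  cell_gap_gt0 : 0 < cell_gap ;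
  cell_good_used : forall c, cell_good c -> cell_used c ;
  cell_rot : forall c, chart_rot (cell_chart c) *m (chart_rot (cell_chart c))^T = 1%:M ;
  cell_measurable : forall c, measurable_fun setT (chart_fun (cell_chart c)) ;
  cell_cover : forall x, boundary D x -> exists c, [/\ cell_used c,
    cube (cell_corner c) cell_side (chart_base (cell_chart c) x) &
    chart_height (cell_chart c) x = 0] ;
  cell_tube : forall x y, D x -> ~ D y -> enorm (x - y) < cell_reach ->
    exists c, [/\ cell_used c,
      cube (cell_corner c) cell_side (chart_base (cell_chart c) x) &
      0 < chart_height (cell_chart c) x < cell_side] ;
  cell_local : forall c x v, cube (cell_corner c) cell_side (chart_base (cell_chart c) x) ->
    `|chart_height (cell_chart c) x| <= cell_side -> enorm v < cell_reach ->
    (D (x + v) <-> 0 < chart_height (cell_chart c) (x + v)) /\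
    `|chart_fun (cell_chart c) (chart_base (cell_chart c) (x + v)) -
      chart_fun (cell_chart c) (chart_base (cell_chart c) x)| <= e * enorm v ;
  cell_boundary : forall c x, cube (cell_corner c) cell_side (chart_base (cell_chart c) x) ->
    chart_height (cell_chart c) x = 0 -> boundary D x ;
  cell_lipschitz : forall c t t', cube (cell_corner c) cell_side t ->
    cube (cell_corner c) cell_side t' ->
    `|chart_fun (cell_chart c) t - chart_fun (cell_chart c) t'| <= e * enorm (t - t') ;
  cell_separated : forall c c' x y, c != c' -> cell_good c -> cell_good c' ->
    shrunk_cube e (cell_corner c) cell_side (chart_base (cell_chart c) x) ->
    chart_height (cell_chart c) x = 0 ->
    shrunk_cube e (cell_corner c') cell_side (chart_base (cell_chart c') y) ->
    chart_height (cell_chart c') y = 0 -> cell_gap <= enorm (x - y) }.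

End cells.

(** * Construction of the cells from finitely many charts *)

Section decomposition.
Context {R : realType} {n : nat}.
Variables (D : set 'rV[R]_n.+1) (e b : R) (J N : nat) (cs : 'I_J -> @chart R n).
Implicit Types (t : 'rV[R]_n) (x y v : 'rV[R]_n.+1) (j : 'I_J)
  (q : {ffun 'I_n -> 'I_N}).
Hypotheses (oD : open D) (e_gt0 : 0 < e) (e_le1 : e <= 1) (b_gt0 : 0 < b)
  (ad : forall j, adapted D (cs j) e b) (f0 : forall j, chart_fun (cs j) 0 = 0).
(** Windows have half-width [a], whereas the charts are valid up to [4 a] and the description of the
    boundary by [adapted_boundary] up to [2 a]: displaced points stay within reach of the chart. *)
Let a := b / 4.
Hypothesis net : forall x, boundary D x ->
  exists j, enorm (x - chart_center (cs j)) < a / 4.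
Let s := 2 * a / N%:R.
(** A bound for the diameter of a tube: [n s] for the base, [2 s] for the height, and [n s] for the
    variation of the graph, whose slope is at most [1]. *)
Let k := (2 * n + 2)%:R * s.
Hypotheses (N_gt0 : (0 < N)%N) (k_small : k <= a / 8).

Let a_gt0 : 0 < a. Proof. by rewrite divr_gt0. Qed.

Let s_gt0 : 0 < s.
Proof. by rewrite divr_gt0 ?mulr_gt0 ?ltr0n. Qed.

Let ks : 2 * s <= k.
Proof. by rewrite ler_pM2r// ler_nat leq_addl. Qed.

Let W j : set 'rV[R]_n.+1 :=
  [set x | (forall i : 'I_n, `|chart_base (cs j) x 0 i| < a) /\ `|chart_height (cs j) x| < a].

Let p q : 'rV[R]_n := \row_i (- a + (q i)%:R * s).

Let Ns : N%:R * s = 2 * a.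
Proof. by rewrite mulrC divfK// gt_eqF// ltr0n. Qed.

Lemma cell_cube_cover t : (forall i : 'I_n, `|t 0 i| < a) -> exists q, cube (p q) s t.
Proof.
move=> ta.
have /choice[f fP] : forall i : 'I_n, exists m : 'I_N,
    - a + m%:R * s <= t 0 i < - a + m%:R * s + s.
  move=> i; have := ta i; rewrite ltr_norml => /andP[t1 t2].
  have u0 : 0 <= (t 0 i + a) / s by rewrite divr_ge0 ?ltW//; lra.
  have /andP[h1 h2] := truncn_itv u0.
  have mN : (Num.truncn ((t 0 i + a) / s)%R < N)%N.
    rewrite -(ltr_nat R); apply: (le_lt_trans h1).
    by rewrite ltr_pdivrMr// Ns; lra.
  exists (Ordinal mN) => /=; move: (Num.truncn _) h1 h2 => m.
  rewrite ler_pdivlMr// ltr_pdivrMr// -natr1 mulrDl mul1r.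
  by move=> h1 h2; apply/andP; split; lra.
by exists (finfun f) => i; rewrite mxE ffunE; exact: fP.
Qed.

Lemma cell_cube_box q t : cube (p q) s t -> box a t.
Proof.
move=> tq i; have := tq i; rewrite mxE => /andP[h1 h2].
have q0 : 0 <= (q i)%:R * s by rewrite mulr_ge0// ltW.
have qN : (q i)%:R * s + s <= N%:R * s.
  by rewrite -[X in _ + X]mul1r -mulrDl ler_pM2r// natr1 ler_nat.
by rewrite Ns in qN; rewrite ler_norml; apply/andP; split; lra.
Qed.

Lemma cell_cube_inj q q' t : cube (p q) s t -> cube (p q') s t -> q = q'.
Proof.
move=> tq tq'; apply/ffunP => i; apply: val_inj => /=.
have := tq i; have := tq' i; rewrite !mxE => /andP[h1 h2] /andP[h3 h4].
have key (m m' : nat) : m%:R * s <= t 0 i + a -> t 0 i + a < m'%:R * s + s ->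
    (m <= m')%N.
  move=> l1 l2; rewrite -ltnS -(ltr_nat R) -natr1 -(ltr_pM2r s_gt0) mulrDl mul1r.
  exact: le_lt_trans l1 l2.
by apply/eqP; rewrite eqn_leq !key//; lra.
Qed.

Lemma cell_cube_dist q t t' : cube (p q) s t -> cube (p q) s t' ->
  enorm (t - t') <= n%:R * s.
Proof.
move=> tq tq'; apply: enorm_box => i; have := tq i; have := tq' i.
rewrite !mxE => /andP[? ?] /andP[? ?].
by rewrite ler_norml; apply/andP; split; lra.
Qed.

Let tube j q : set 'rV[R]_n.+1 :=
  [set x | cube (p q) s (chart_base (cs j) x) /\ `|chart_height (cs j) x| < s].

(** A point near the boundary is attributed to the first chart whose window contains it; a cell is
    used when its tube holds a point that no earlier window contains, and good when no earlier
    window meets its piece of boundary. *)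
Let used (c : 'I_J * {ffun 'I_n -> 'I_N}) :=
  `[< exists2 x, tube c.1 c.2 x & forall i : 'I_J, (i < c.1)%N -> ~ W i x >].

Let good (c : 'I_J * {ffun 'I_n -> 'I_N}) := used c &&
  `[< forall x, cube (p c.2) s (chart_base (cs c.1) x) ->
    chart_height (cs c.1) x = 0 -> forall i : 'I_J, (i < c.1)%N -> ~ W i x >].

Lemma tube_dist j q x y : tube j q x -> tube j q y -> enorm (x - y) <= k.
Proof.
move=> [xq xs] [yq ys]; have [cU lip _ _] := ad j.
rewrite -(chart_pointK cU x) -(chart_pointK cU y).
apply: (le_trans (chart_point_dist _ _ _ _ cU)).
have h1 := cell_cube_dist xq yq.
have ab : a <= b by rewrite /a; have := b_gt0; lra.
have h2 := lip _ _ (boxW ab (cell_cube_box xq)) (boxW ab (cell_cube_box yq)).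
have h3 : e * enorm (chart_base (cs j) x - chart_base (cs j) y) <= 1 * (n%:R * s).
  by apply: ler_pM => //; [exact: ltW|exact: enorm_ge0].
have kE : k = n%:R * s + (2 * s + 1 * (n%:R * s)) by rewrite /k natrD natrM; ring.
rewrite kE lerD//; move: xs ys h2; rewrite ltr_norml ltr_norml ler_norml.
move=> /andP[? ?] /andP[? ?] /andP[? ?].
by rewrite ler_norml; apply/andP; split; lra.
Qed.

(** The net puts [x] in some window, and the least index of a window containing [x] gives the cell.
    The point [z] has height [0] in that chart, which bounds the height of [x] by twice its distance
    to [z]. *)
Lemma cell_near_boundary x z (r : R) : boundary D z -> enorm (x - z) <= r -> r <= s / 4 ->
  exists j q, [/\ used (j, q), cube (p q) s (chart_base (cs j) x) &
    `|chart_height (cs j) x| <= 2 * r].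
Proof.
move=> bz xz rs; have k4 := ks; have k8 := k_small; have a0 := a_gt0; have s0 := s_gt0.
have r0 : 0 <= r := le_trans (enorm_ge0 _) xz.
have ab : b = 4 * a by rewrite /a; lra.
have [j0 zj0] := net bz.
have Wj0 : W j0 x.
  have [cU _ _ _] := ad j0; have xc : enorm (x - chart_center (cs j0)) < a / 2.
    have := ler_enorm_dist x z (chart_center (cs j0)); lra.
  have h1 := chart_base_dist cU x (chart_center (cs j0)).
  rewrite chart_base_center subr0 in h1.
  have h2 i : `|chart_base (cs j0) x 0 i| < a / 2.
    exact: le_lt_trans (enorm_coord _ i) (le_lt_trans h1 xc).
  split=> [i|]; first by have := h2 i; lra.
  have := @chart_height_dist _ _ D (cs j0) e b x (chart_center (cs j0)) (ad j0) e_le1.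
  rewrite chart_height_center// chart_base_center subr0 => /(_ _ _)/le_lt_trans.
  apply; last lra; first by move=> i; have := h2 i; lra.
  by move=> i; rewrite mxE normr0 ltW.
have [j /asboolP Wj jmin] := @arg_minnP _ j0 (fun j => `[< W j x >]) val (asboolT Wj0).
have [cU _ DP _] := ad j.
have xB : box a (chart_base (cs j) x) by move=> i; have [h _] := Wj; exact/ltW/h.
have zB : box (b / 2) (chart_base (cs j) z).
  apply: (@boxW _ _ (a + r)); first lra.
  by apply: box_dist xB _; apply: le_trans xz; exact: chart_base_dist.
have xb : box b (chart_base (cs j) x) by apply: boxW xB; lra.
have zb : box b (chart_base (cs j) z) by apply: boxW zB; lra.
have hd := chart_height_dist (ad j) e_le1 xb zb.
have zh : chart_height (cs j) z = 0.
  apply/(adapted_boundary oD b_gt0 e_le1 (ad j) zB) => //.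
  have [_ xh] := Wj; move: xh hd; rewrite ltr_norml !ler_norml.
  by move=> /andP[? ?] /andP[? ?]; apply/andP; split; lra.
rewrite zh subr0 in hd.
have [q xq] := cell_cube_cover (proj1 Wj); exists j, q.
have xh : `|chart_height (cs j) x| <= 2 * r by lra.
split=> //; apply/asboolP; exists x; first by split => //=; lra.
move=> i ij Wi; have := jmin i (asboolT Wi).
by rewrite leqNgt; move: ij => /= ->.
Qed.

Lemma cell_boundary_fact j q x : cube (p q) s (chart_base (cs j) x) ->
  chart_height (cs j) x = 0 -> boundary D x.
Proof.
move=> xq xh; apply/(adapted_boundary oD b_gt0 e_le1 (ad j)) => //.
  by apply: (@boxW _ _ a); [rewrite /a; have := b_gt0; lra|exact: cell_cube_box xq].
by rewrite xh normr0; have := b_gt0; lra.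
Qed.

Lemma cell_local_fact j q x v : cube (p q) s (chart_base (cs j) x) ->
  `|chart_height (cs j) x| <= s -> enorm v < s / 4 ->
  (D (x + v) <-> 0 < chart_height (cs j) (x + v)) /\
  `|chart_fun (cs j) (chart_base (cs j) (x + v)) -
    chart_fun (cs j) (chart_base (cs j) x)| <= e * enorm v.
Proof.
move=> xq xs vs; have [cU lip DP _] := ad j; have s0 := s_gt0.
have k4 := ks; have k8 := k_small; have a0 := a_gt0.
have ab : b = 4 * a by rewrite /a; lra.
have xB := cell_cube_box xq.
have xb : box b (chart_base (cs j) x) by apply: boxW xB; lra.
have d1 : enorm (chart_base (cs j) (x + v) - chart_base (cs j) x) <= enorm v.
  by have := chart_base_dist cU (x + v) x; rewrite addrAC subrr add0r.
have vb : box b (chart_base (cs j) (x + v)).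
  apply: (@boxW _ _ (a + enorm v)); first lra.
  by apply: box_dist xB _; rewrite enorm_distC.
split.
  apply: DP => //; have := chart_height_dist (ad j) e_le1 vb xb.
  rewrite (_ : x + v - x = v); last by rewrite addrAC subrr add0r.
  move=> h; move: xs h; rewrite !ler_norml.
  by move=> /andP[? ?] /andP[? ?]; apply/andP; split; lra.
by rewrite (le_trans (lip _ _ vb xb))// ler_wpM2l// ltW.
Qed.

(** Within one chart, shrunk cubes of the grid are [e s] apart. Across charts, a point of the
    earlier shrunk cell is at least [e s / 2] inside the sides of its window, so a closer point
    would lie in that window, contrary to the goodness of the later cell. *)
Lemma cell_separated_fact (c c' : 'I_J * {ffun 'I_n -> 'I_N}) x y :
  c != c' -> good c -> good c' ->
  shrunk_cube e (p c.2) s (chart_base (cs c.1) x) -> chart_height (cs c.1) x = 0 ->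
  shrunk_cube e (p c'.2) s (chart_base (cs c'.1) y) -> chart_height (cs c'.1) y = 0 ->
  e * s / 2 <= enorm (x - y).
Proof.
have s0 := s_gt0; have k4 := ks; have k8 := k_small; have a0 := a_gt0.
have ab : b = 4 * a by rewrite /a; lra.
have es : 0 < e * s by rewrite mulr_gt0.
have es1 : e * s <= s by rewrite ler_piMl// ltW.
have sub q t : shrunk_cube e (p q) s t -> cube (p q) s t.
  by move=> tq i; have /andP[? ?] := tq i; apply/andP; split; lra.
have main (d d' : 'I_J * {ffun 'I_n -> 'I_N}) u v : (d.1 < d'.1)%N -> good d' ->
  shrunk_cube e (p d.2) s (chart_base (cs d.1) u) -> chart_height (cs d.1) u = 0 ->
  shrunk_cube e (p d'.2) s (chart_base (cs d'.1) v) -> chart_height (cs d'.1) v = 0 ->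
  e * s / 2 <= enorm (u - v).
  move=> dd /andP[_ /asboolP gd] ud uh vd vh.
  rewrite leNgt; apply/negP => uv; apply: (gd v (sub _ _ vd) vh d.1 dd).
  have [cU _ _ _] := ad d.1.
  have h1 := le_lt_trans (chart_base_dist cU u v) uv.
  have uB := cell_cube_box (sub _ _ ud).
  have ub : box b (chart_base (cs d.1) u) by apply: boxW uB; lra.
  have vb : box b (chart_base (cs d.1) v).
    apply: (@boxW _ _ (a + e * s / 2)); first lra.
    exact: box_dist uB (ltW h1).
  have := chart_height_dist (ad d.1) e_le1 ub vb.
  rewrite uh sub0r normrN => h2; split; last by lra.
  move=> i; have := ud i; rewrite mxE => /andP[l1 l2].
  have := le_lt_trans (enorm_coord _ i) h1; rewrite [X in `|X|]mxE [X in _ + X]mxE.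
  have q0 : 0 <= (d.2 i)%:R * s by rewrite mulr_ge0// ltW.
  have qN : (d.2 i)%:R * s + s <= N%:R * s.
    by rewrite -[X in _ + X]mul1r -mulrDl ler_pM2r// natr1 ler_nat.
  rewrite Ns in qN; rewrite !ltr_norml => /andP[? ?].
  by apply/andP; split; lra.
move=> cc gc gc' xc xh yc yh.
case: (ltngtP c.1 c'.1) => [ltc|ltc|E]; first exact: (main c c').
  by rewrite enorm_distC; exact: (main c' c).
case: c c' E cc gc gc' xc xh yc yh => [j q] [j' q'] /= /val_inj <- {j'} cc _ _ xq xh yq yh.
have [cU _ _ _] := ad j.
have /existsP[i qi] : [exists i, q i != q' i].
  rewrite -negb_forall; apply: contra cc => /forallP qq.
  by apply/eqP; congr pair; apply/ffunP => i; exact/eqP.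
have := le_trans (enorm_coord _ i) (chart_base_dist cU x y).
rewrite [X in `|X|]mxE [X in _ + X]mxE.
have pE r : p r 0 i = - a + (r i)%:R * s by rewrite mxE.
have := xq i; have := yq i; rewrite !pE => /andP[l1 l2] /andP[l3 l4].
have ss (m m' : nat) : (m < m')%N -> m%:R * s + s <= m'%:R * s.
  by move=> mm; rewrite -[X in _ + X]mul1r -mulrDl ler_pM2r// natr1 ler_nat.
move: qi; rewrite neq_ltn => /orP[/ss h|/ss h]; rewrite ler_norml => /andP[? ?]; lra.
Qed.

(** A neighbourhood of the part of the graph above the boundary of the base cube of window [j]:
    thickness of order [k] both vertically and horizontally. *)
Let rim j : set 'rV[R]_n.+1 := [set x | `]- (3 * k), 3 * k[%classic (chart_height (cs j) x) /\
  (cube (const_mx (- (a + 2 * k))) (2 * (a + 2 * k)) `\`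
   cube (const_mx (- (a - 2 * k))) (2 * (a - 2 * k))) (chart_base (cs j) x)].

(** A bad tube contains a boundary point inside some earlier window and a point outside it. Heights
    in the tube being at most [2 k], the second point can only be outside laterally, and the
    diameter [k] keeps the whole tube close to the side of the window. *)
Lemma bad_rim c : used c -> ~~ good c ->
  exists i : 'I_J, tube c.1 c.2 `<=` rim i.
Proof.
have s0 := s_gt0; have k4 := ks; have k8 := k_small; have a0 := a_gt0.
have ab : b = 4 * a by rewrite /a; lra.
move=> uc; rewrite /good uc/= => /asboolPn/existsNP[y /not_implyP[yq /not_implyP[yh]]].
move=> /existsNP[i /not_implyP[ic /contrapT Wy]].
have [x xt xW] := asboolP _ uc; exists i.
have yt : tube c.1 c.2 y by split=> //; rewrite yh normr0.
have by_ := cell_boundary_fact yq yh.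
have [cU _ _ _] := ad i.
have yB : box a (chart_base (cs i) y) by move=> m; have [h _] := Wy; exact/ltW/h.
have yb : box b (chart_base (cs i) y) by apply: boxW yB; lra.
have hy : chart_height (cs i) y = 0.
  apply/(adapted_boundary oD b_gt0 e_le1 (ad i)) => //; first by apply: boxW yB; lra.
  by have [_ h] := Wy; lra.
have near_y w : enorm (y - w) <= k -> box (a + k) (chart_base (cs i) w) /\
    `|chart_height (cs i) w| <= 2 * k.
  move=> yw; have wB : box (a + k) (chart_base (cs i) w).
    by apply: box_dist yB _; apply: le_trans yw; exact: chart_base_dist.
  split=> //; have wb : box b (chart_base (cs i) w) by apply: boxW wB; lra.
  have := chart_height_dist (ad i) e_le1 yb wb; rewrite hy sub0r normrN; lra.
have [m xm] : exists m, a <= `|chart_base (cs i) x 0 m|.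
  apply: contrapT => /forallNP h; apply: (xW i ic); split.
    by move=> m; rewrite ltNge; apply/negP/h.
  by have [_ h2] := near_y x (tube_dist yt xt); lra.
move=> w wt; have [wB wh] := near_y w (tube_dist yt wt); split.
  by rewrite /= in_itv/= -ltr_norml; lra.
split.
  move=> l; have := wB l; rewrite !mxE ler_norml => /andP[? ?].
  by apply/andP; split; lra.
move=> /(_ m); rewrite !mxE => /andP[w1 w2].
have := le_trans (enorm_coord _ m) (le_trans (chart_base_dist cU x w) (tube_dist xt wt)).
by move: xm; rewrite !mxE ler_norml ler_normr => /orP[?|?] /andP[? ?]; lra.
Qed.

Let mtube j q : measurable (tube j q) /\
  @lebesgue_rV R n.+1 (tube j q) = (2 * s * s ^+ n)%:E.
Proof.
have s0 := s_gt0; have [cU _ _ mf] := ad j.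
have E : tube j q = [set x | `]- s, s[%classic (chart_height (cs j) x) /\
    cube (p q) s (chart_base (cs j) x)].
  by apply/seteqP; split=> x [h1 h2]; split=> //; move: h2 h1;
    rewrite /= in_itv/= ltr_norml.
rewrite E; split; first exact: (measurable_strip cU mf (measurable_cube _ _)).
rewrite (lebesgue_strip cU mf (measurable_cube _ _))// lebesgue_measure_itv/= lte_fin.
rewrite ifT; last lra.
by rewrite lebesgue_rV_cube 1?ltW// -EFinB -EFinM; congr EFin; ring.
Qed.

Let mrim j : measurable (rim j) /\ @lebesgue_rV R n.+1 (rim j) =
  (6 * k * ((2 * (a + 2 * k)) ^+ n - (2 * (a - 2 * k)) ^+ n))%:E.
Proof.
have s0 := s_gt0; have k4 := ks; have k8 := k_small; have [cU _ _ mf] := ad j.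
have mS : measurable (cube (const_mx (- (a + 2 * k)) : 'rV[R]_n) (2 * (a + 2 * k)) `\`
   cube (const_mx (- (a - 2 * k))) (2 * (a - 2 * k))).
  by apply: measurableD; exact: measurable_cube.
split; first exact: (measurable_strip cU mf mS).
rewrite (lebesgue_strip cU mf mS)// lebesgue_measure_itv/= lte_fin.
rewrite ifT; last lra.
rewrite lebesgue_rV_shell; [|lra|lra].
by rewrite -EFinB -EFinM; congr EFin; ring.
Qed.

(** Tubes of one chart are disjoint, so for each of the [J ^ 2] pairs of charts the bad ones pack
    into a rim. Dividing the volume of the rim by the height [2 s] of a tube leaves
    [6 k / (2 s) = 6 n + 6] times the volume of a shell, which vanishes with [k]. *)
Lemma bad_count : #|[pred c | used c && ~~ good c]|%:R * s ^+ n <=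
  J%:R ^+ 2 * ((6 * n + 6)%:R * ((2 * (a + 2 * k)) ^+ n - (2 * (a - 2 * k)) ^+ n)).
Proof.
have s0 := s_gt0; have k4 := ks; have k8 := k_small.
set B := [pred c | used c && ~~ good c].
have /choice[f fP] : forall c, exists i : 'I_J, B c -> tube c.1 c.2 `<=` rim i.
  move=> c; have [/andP[uc gc]|_] := boolP (B c); last by exists c.1.
  by have [i ri] := bad_rim uc gc; exists i.
set V := 6 * k * ((2 * (a + 2 * k)) ^+ n - (2 * (a - 2 * k)) ^+ n).
have V0 : 0 <= V.
  apply: mulr_ge0; first lra.
  by rewrite subr_ge0 lerXn2r// ?nnegrE; lra.
have one (ji : 'I_J * 'I_J) :
    \sum_(c | B c && ((c.1, f c) == ji)) (2 * s * s ^+ n) <= V.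
  rewrite -lee_fin -sumEFin -big_filter.
  have [mr Er] := mrim ji.2; rewrite -Er.
  rewrite (eq_bigr (fun c => @lebesgue_rV R n.+1 (tube c.1 c.2))); last first.
    by move=> c _; have [_ ->] := mtube c.1 c.2.
  apply: (@packing _ _ _ (@lebesgue_rV R n.+1) _ _ (fun c => tube c.1 c.2)) => //.
  - by rewrite filter_uniq// index_enum_uniq.
  - by move=> c; have [] := mtube c.1 c.2.
  - move=> c; rewrite mem_filter => /andP[/andP[Bc /eqP <-] _] /=; exact: fP.
  - move=> c c'; rewrite !mem_filter => /andP[/andP[_ /eqP E] _].
    move=> /andP[/andP[_ /eqP E'] _] cc; apply/seteqP; split=> // x [[xc _] [xc' _]].
    case: c c' E E' cc xc xc' => [j q] [j' q'] /= <- [<- _] /eqP cc xc xc'.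
    by apply: cc; congr pair; exact: cell_cube_inj xc xc'.
have tot : #|B|%:R * (2 * s * s ^+ n) <= J%:R ^+ 2 * V.
  rewrite mulr_natl -sumr_const (partition_big (fun c => (c.1, f c)) predT)//=.
  apply: (le_trans (ler_sum _ (fun ji _ => one ji))).
  rewrite sumr_const (_ : #|_| = (J * J)%N); last by rewrite card_prod !card_ord.
  by rewrite -[leLHS]mulr_natl natrM expr2.
have s2 : 0 < 2 * s by rewrite mulr_gt0.
rewrite -(ler_pM2l s2); apply: le_trans (_ : _ <= J%:R ^+ 2 * V) _.
  by apply: le_trans tot; rewrite le_eqVlt; apply/orP; left; apply/eqP; ring.
rewrite /V /k; set u := (_ ^+ n - _).
have -> : (6 * n + 6 = 3 * (2 * n + 2))%N by lia.
rewrite natrM.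
by rewrite le_eqVlt; apply/orP; left; apply/eqP; ring.
Qed.

Lemma decomposition_cells : exists C : cells D e,
  #|[pred c : cell_index C | cell_used c && ~~ cell_good c]|%:R * cell_side C ^+ n <=
  J%:R ^+ 2 * ((6 * n + 6)%:R * ((2 * (a + 2 * k)) ^+ n - (2 * (a - 2 * k)) ^+ n)).
Proof.
have s0 := s_gt0.
(* The reach [s / 4] bounds heights by [s / 2] through [cell_near_boundary], safely below the side
   [s]; the gap [e s / 2] is that of [cell_separated_fact]. *)
unshelve refine (ex_intro _ (@Cells _ _ D e ('I_J * {ffun 'I_n -> 'I_N})%type
  (fun c => cs c.1) (fun c => p c.2) s (s / 4) (e * s / 2) used good
  s0 _ _ _ _ _ _ _ _ _ _ _) _).
- by rewrite divr_gt0.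
- by rewrite divr_gt0// mulr_gt0.
- by move=> c /andP[].
- by move=> c; have [] := ad c.1.
- by move=> c; have [] := ad c.1.
- move=> x bx; have s4 : 0 <= s / 4 by rewrite divr_ge0// ltW.
  have [|j [q [u xq xh]]] := @cell_near_boundary x x 0 bx _ s4.
    by rewrite subrr enorm0.
  exists (j, q); split=> //=; apply/eqP; rewrite -normr_le0.
  by rewrite mulr0 in xh.
- move=> x y Dx Dy xy; have [z bz xz] := segment_boundary oD Dx Dy.
  have [j [q [u xq xh]]] := cell_near_boundary bz (le_trans xz (ltW xy)) (lexx _).
  exists (j, q); split=> //=.
  have ss : s / 4 <= s by lra.
  have v0 : enorm (0 : 'rV[R]_n.+1) < s / 4 by rewrite enorm0 divr_gt0.
  have [] := @cell_local_fact j q x 0 xq _ v0; first lra.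
  rewrite addr0 => -[/(_ Dx) -> _] _ /=.
  by apply: le_lt_trans (ler_norm _) _; lra.
- by move=> c x v; exact: cell_local_fact.
- by move=> c x; exact: cell_boundary_fact.
- move=> c t t' tc tc'; have [_ lip _ _] := ad c.1.
  have ab : a <= b by rewrite /a; have := b_gt0; lra.
  by apply: lip; apply: boxW ab _; exact: cell_cube_box.
- exact: cell_separated_fact.
- exact: bad_count.
Qed.

End decomposition.

Lemma bounded_closure (R : realType) m (D : set 'rV[R]_m) :
  bounded_set D -> bounded_set (closure D).
Proof.
move=> [M [_ DM]]; exists (M + 2); split; first exact: num_real.
move=> M' MM x /closure_enorm/(_ 1 ltr01)[y Dy yx].
have := DM (M + 1) _ y Dy; rewrite ltrDl ltr01 => /(_ isT) yM.
have h : `|x - y| <= 1.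
  by apply: (le_trans (mx_norm_le_enorm _)); rewrite enorm_distC ltW.
have /= -> // : `|x| <= M'.
have {}yM : `|y| <= M + 1 := yM.
by have := ler_normD (x - y) y; rewrite subrK; lra.
Qed.

Lemma compact_boundary (R : realType) m (D : set 'rV[R]_m) :
  open D -> bounded_set D -> compact (boundary D).
Proof.
move=> oD bD; apply: bounded_closed_compact.
  have [M [rM DM]] := bounded_closure bD; exists M; split=> // M' MM x [cx _].
  exact: DM cx.
apply: closedI; first exact: closed_closure.
by apply: open_closedC; exact: open_interior.
Qed.

Lemma cell_decomposition (R : realType) n (D : set 'rV[R]_n.+1) (e d : R) :
  C11_open D -> bounded_set D -> 0 < e -> e <= 1 -> 0 < d ->
  exists C : cells D e,
    #|[pred c : cell_index C | cell_used c && ~~ cell_good c]|%:R *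
      cell_side C ^+ n <= d.
Proof.
move=> D11 bD e0 e1 d0; have [oD _] := D11.
have [b b0 adz] := C11_adapted D11 e0 e1.
have a16 : 0 < b / 4 / 4 by rewrite !divr_gt0.
have [zs [zsD net]] := finite_net (compact_boundary oD bD) a16.
have /choice[f fP] : forall z, exists c, boundary D z ->
    [/\ chart_center c = z, chart_fun c 0 = 0 & adapted D c e b].
  move=> z; have [/adz[c cP]|nz] := pselect (boundary D z); first by exists c.
  by exists (Chart 0 0 (fun=> 0)).
pose cs (j : 'I_(size zs)) := f (tnth (in_tuple zs) j).
have zsj j : boundary D (tnth (in_tuple zs) j) by apply: zsD; exact: mem_tnth.
have ad j : adapted D (cs j) e b by have [] := fP _ (zsj j).
have f0 j : chart_fun (cs j) 0 = 0 by have [] := fP _ (zsj j).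
have net' x : boundary D x -> exists j, enorm (x - chart_center (cs j)) < b / 4 / 4.
  move=> /net[z zz xz]; have /tnthP[j zj] : z \in in_tuple zs by [].
  by exists j; have [-> _ _] := fP _ (zsj j); rewrite -zj.
set J := size zs in cs zsj ad f0 net'.
pose a := b / 4; pose K : R := Num.max 1 (4 * a).
pose C0 : R := J%:R ^+ 2 * ((6 * n + 6)%:R * (n%:R * 8 * K ^+ n)).
have a0 : 0 < a by rewrite divr_gt0.
have C00 : 0 <= C0.
  by rewrite !mulr_ge0// exprn_ge0// le_max ler01.
(* The one inequality [k (8 / a + C0 / d) <= 1] yields both [k <= a / 8] and [C0 k <= d]. The factor
   [8] in [C0] comes from the width [8 k] of the shell between the two cubes. *)
pose N := (Num.bound ((2 * n + 2)%:R * (2 * a) * (8 / a + C0 / d))).+1.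
have N0 : (0 < N)%N by [].
have nn : 0 < (2 * n + 2)%:R :> R by rewrite ltr0n addn2.
have kb : (2 * n + 2)%:R * (2 * a / N%:R) * (8 / a + C0 / d) <= 1.
  rewrite mulrA mulrAC ler_pdivrMr ?ltr0n// mul1r.
  apply: le_trans (ltW (archi_boundP _)) _; last by rewrite ler_nat leqnSn.
  by rewrite !mulr_ge0// ?addr_ge0 ?divr_ge0// ltW.
set k := (2 * n + 2)%:R * (2 * a / N%:R) in kb.
have k0 : 0 < k by rewrite mulr_gt0// divr_gt0// ?mulr_gt0 ?ltr0n.
have k8 : k <= a / 8.
  have : k * (8 / a) <= 1.
    by apply: le_trans kb; rewrite ler_pM2l// lerDl divr_ge0// ltW.
  rewrite mulrA ler_pdivrMr// mul1r => h; lra.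
have kd : C0 * k <= d.
  have : k * (C0 / d) <= 1.
    by apply: le_trans kb; rewrite ler_pM2l// lerDr divr_ge0// ltW.
  by rewrite mulrA ler_pdivrMr// mul1r mulrC.
have [C CP] := decomposition_cells oD e0 e1 b0 ad f0 net' N0 k8.
exists C; apply: (le_trans CP).
apply: le_trans kd; rewrite /C0 -[leRHS]mulrA.
apply: ler_wpM2l; first by rewrite exprn_ge0.
rewrite -[leRHS]mulrA; apply: ler_wpM2l; first by [].
rewrite -/a -/k.
have uv : 2 * (a + 2 * k) - 2 * (a - 2 * k) = 8 * k by ring.
have := @expr_sub_le _ n (2 * (a + 2 * k)) (2 * (a - 2 * k)) K; rewrite uv.
have -> : n%:R * (8 * k) * K ^+ n = n%:R * 8 * K ^+ n * k by ring.
apply; [lra|lra| |by rewrite le_max lexx].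
by rewrite le_max; apply/orP; right; lra.
Qed.

(** * Heat content near the boundary *)

Section surface_sandwich.
Context {R : realType} {n : nat} (n_gt0 : (0 < n)%N).
Variables (D : set 'rV[R]_n.+1) (e : R) (C : cells D e).
Hypotheses (e_gt0 : 0 < e) (e_lt1 : e < 1).
Let s := cell_side C.
Let s_gt0 : 0 < s := cell_side_gt0 C.
Implicit Types (c : cell_index C) (x y : 'rV[R]_n.+1) (t : 'rV[R]_n).

Definition untilde t : 'rV[R]_n.+1 :=
  \row_i (if unlift ord_max i is Some j then t 0 j else 0).

Lemma untildeK t : tilde (untilde t) = t.
Proof. by apply/rowP => i; rewrite !mxE widen_lift liftK. Qed.

Lemma enorm_tilde_le x : enorm (tilde x) <= enorm x.
Proof.
rewrite -(ler_pXn2r (n := 2))// ?nnegrE ?enorm_ge0//.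
by rewrite (enorm_tilde x) lerDl sqr_ge0.
Qed.

Lemma enorm_untilde t : enorm (untilde t) = enorm t.
Proof.
apply/eqP; rewrite -(@eqrXn2 _ 2) ?enorm_ge0// enorm_tilde untildeK.
by rewrite mxE unlift_none expr0n addr0.
Qed.

Lemma untildeB t t' : untilde t - untilde t' = untilde (t - t').
Proof.
apply/rowP => i; rewrite !mxE; case: unliftP => [j _|_]; last by rewrite subrr.
by rewrite !mxE.
Qed.

Lemma shrunk_cube_sub (p : 'rV[R]_n) (r : R) t : 0 < r ->
  shrunk_cube e p r t -> cube p r t.
Proof.
move=> r0 tp i; have /andP[? ?] := tp i; have : 0 < e * r by rewrite mulr_gt0.
by move=> ?; apply/andP; split; lra.
Qed.

(** The cell is the image of part of the unit cube under a rescaling followed by the graph map,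
    which is Lipschitz with constant [(1 + e) s]. *)
Lemma surface_cell_le c :
  (surface_measure [set x | cube (cell_corner c) s (chart_base (cell_chart c) x) /\
     chart_height (cell_chart c) x = 0%R] <= (((1 + e) * s) ^+ n)%:E)%E.
Proof.
have cU := cell_rot c; have s0 := s_gt0; set p := cell_corner c; set ch := cell_chart c.
pose g y := chart_point ch (p + s *: tilde y) 0.
(* The unit cube is cut to the points sent into the half-open cube, where the graph function is
   known to have slope at most [e]. *)
pose A := [set y : 'rV[R]_n.+1 | unit_cube y /\ cube p s (p + s *: tilde y)].
have se : 0 < (1 + e) * s by rewrite mulr_gt0// addr_gt0.
apply: (@le_trans _ _ (surface_measure (g @` A))).
  apply: (surface_mono n_gt0) => x [xp xh].
  pose t := s^-1 *: (chart_base ch x - p).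
  have tE : p + s *: t = chart_base ch x.
    by rewrite /t scalerA mulfV ?gt_eqF// scale1r subrKC.
  exists (untilde t); last by rewrite /g untildeK tE -[RHS](chart_pointK cU) xh.
  split; last by rewrite untildeK tE.
  split; first by rewrite mxE unlift_none.
  move=> i; rewrite mxE; case: unliftP => [j _|_]; last by rewrite lexx ler01.
  have /andP[h1 h2] := xp j; rewrite mxE [X in _ * X]mxE [X in _ + X]mxE.
  by rewrite mulr_ge0 ?subr_ge0 ?invr_ge0 ?(ltW s0)//= mulrC ler_pdivrMr// mul1r; lra.
have lip x y : A x -> A y -> enorm (g x - g y) <= (1 + e) * s * enorm (x - y).
  move=> [_ xp] [_ yp]; apply: (le_trans (chart_point_dist _ _ _ _ cU)).
  rewrite !add0r; have := cell_lipschitz xp yp.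
  have E : p + s *: tilde x - (p + s *: tilde y) = s *: tilde (x - y).
    by rewrite opprD addrACA subrr add0r -scalerBr; congr (_ *: _);
      apply/rowP => i; rewrite !mxE.
  rewrite E enormZ (gtr0_norm s0) => h; have := enorm_tilde_le (x - y).
  set u := enorm (tilde _) in h *; set v := enorm (x - y) => uv.
  have : (1 + e) * s * u <= (1 + e) * s * v by rewrite ler_pM2l.
  move: h; rewrite -/ch; set w := `|_|; lra.
apply: (le_trans (surface_lipschitz n_gt0 se lip)).
rewrite -[leRHS]mule1; apply: lee_wpmul2l; first by rewrite lee_fin exprn_ge0// ltW.
by rewrite -(@surface_unit_cube R n n_gt0); apply: (surface_mono n_gt0) => y [].
Qed.

Definition shrunk_cell c : set 'rV[R]_n.+1 :=
  [set x | shrunk_cube e (cell_corner c) s (chart_base (cell_chart c) x) /\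
     chart_height (cell_chart c) x = 0].

(** Projection to the base does not increase distances; followed by a rescaling it maps the shrunk
    cell onto the unit cube with Lipschitz constant [1 / ((1 - e) s)]. *)
Lemma surface_cell_ge c :
  ((((1 - e) * s) ^+ n)%:E <= surface_measure (shrunk_cell c))%E.
Proof.
have cU := cell_rot c; have s0 := s_gt0; set p := cell_corner c; set ch := cell_chart c.
have r0 : 0 < (1 - e) * s by rewrite mulr_gt0// subr_gt0.
set r := (1 - e) * s in r0 *.
pose p' := p + const_mx (e * s / 2).
pose h x := untilde (r^-1 *: (chart_base ch x - p')).
have rV : 0 < r^-1 by rewrite invr_gt0.
have lip x y : shrunk_cell c x -> shrunk_cell c y ->
    enorm (h x - h y) <= r^-1 * enorm (x - y).
  move=> _ _; have -> : h x - h y = untilde (r^-1 *: (chart_base ch x - chart_base ch y)).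
    by rewrite /h untildeB -scalerBr opprB addrA subrK.
  rewrite enorm_untilde enormZ gtr0_norm// ler_pM2l//.
  exact: chart_base_dist.
have onto : @unit_cube R n `<=` h @` shrunk_cell c.
  move=> y [y0 y01]; pose t := p' + r *: tilde y.
  exists (chart_point ch t 0).
    split; last by rewrite chart_height_point.
    rewrite chart_base_point// => i.
    have /andP[l1 l2] := y01 (widen_ord (leqnSn n) i).
    have tE : t 0 i = p 0 i + e * s / 2 + r * y 0 (widen_ord (leqnSn n) i).
      by rewrite /t /p' !mxE.
    rewrite tE -/p; move: l1 l2; set z := y _ _ => l1 l2.
    have h1 : 0 <= r * z by rewrite mulr_ge0// ltW.
    have h2 : r * z <= r by rewrite ler_piMr// ltW.
    have rE : r = s - e * s by rewrite /r; ring.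
    by apply/andP; split; lra.
  rewrite /h chart_base_point// /t addrAC subrr add0r scalerA mulVf ?gt_eqF// scale1r.
  apply/rowP => i; rewrite mxE; case: unliftP => [j ->|->]; last by rewrite y0.
  by rewrite mxE widen_lift.
have := surface_lipschitz n_gt0 rV lip.
move=> /(le_trans (surface_mono n_gt0 onto)).
rewrite (@surface_unit_cube R n n_gt0) exprVn => h1.
have rn : 0 < r ^+ n by rewrite exprn_gt0.
have rn0 : (0 <= (r ^+ n)%:E)%E by rewrite lee_fin ltW.
have := lee_wpmul2l rn0 h1; rewrite mule1 muleA -EFinM mulfV ?gt_eqF//.
by rewrite mul1e.
Qed.

Lemma surface_upper : (surface_measure (boundary D) <=
  (#|[pred c : cell_index C | cell_used c]|%:R * ((1 + e) * s) ^+ n)%:E)%E.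
Proof.
pose A c := [set x | cube (cell_corner c) s (chart_base (cell_chart c) x) /\
     chart_height (cell_chart c) x = 0].
have sub : boundary D `<=` \big[setU/set0]_(c <- enum [pred c : cell_index C | cell_used c]) A c.
  move=> x /(cell_cover C)[c [uc xc xh]]; rewrite -bigcup_seq.
  by exists c => //=; rewrite mem_enum.
apply: (le_trans (surface_mono n_gt0 sub)).
apply: (le_trans (surface_bigsetU n_gt0 _ _)).
apply: (@le_trans _ _ (\sum_(c <- enum [pred c : cell_index C | cell_used c])
    (((1 + e) * s) ^+ n)%:E)%E).
  by apply: lee_sum => c _; exact: surface_cell_le.
by rewrite sumEFin big_const_seq count_predT -cardE iter_addr_0 mulr_natl.
Qed.

Lemma surface_lower : ((#|[pred c : cell_index C | cell_good c]|%:R * ((1 - e) * s) ^+ n)%:E <=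
  surface_measure (boundary D))%E.
Proof.
(* Goodness is built into the sets so that separation holds for all pairs of distinct indices. *)
pose A c := [set x | cell_good c /\ shrunk_cell c x].
pose r := enum [pred c : cell_index C | cell_good c].
have sub : \big[setU/set0]_(c <- r) A c `<=` boundary D.
  move=> x; rewrite -bigcup_seq => -[c _ [_ [xc xh]]].
  by apply: cell_boundary xh; exact: shrunk_cube_sub.
apply: le_trans (surface_mono n_gt0 sub).
apply: le_trans (surface_bigsetU_separated n_gt0 (cell_gap_gt0 C) (enum_uniq _) _); last first.
  by move=> i j x y ij [gi [xi xh]] [gj [yj yh]]; exact: (cell_separated ij gi gj).
apply: (@le_trans _ _ (\sum_(c <- r) (((1 - e) * s) ^+ n)%:E)%E).
  by rewrite sumEFin big_const_seq count_predT -cardE iter_addr_0 mulr_natl.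
rewrite big_seq [leRHS]big_seq; apply: lee_sum => c; rewrite mem_enum => gc.
rewrite (_ : A c = shrunk_cell c); first exact: surface_cell_ge.
by apply/seteqP; split=> x // [].
Qed.

End surface_sandwich.

(** The integral of a nonnegative function is a supremum over simple functions below it, hence
    monotone for arbitrary integrands. This is how the exit probability is bounded under the
    integral. *)
Lemma ge0_le_integral_nonmeasurable d (T : measurableType d) (R : realType)
    (m : {measure set T -> \bar R}) (A : set T) (f g : T -> \bar R) :
  (forall x, A x -> 0 <= f x)%E -> (forall x, A x -> f x <= g x)%E ->
  (\int[m]_(x in A) f x <= \int[m]_(x in A) g x)%E.
Proof.
move=> f0 fg; rewrite !ge0_integralE//; last first.
  by move=> x Ax; exact: le_trans (f0 _ Ax) (fg _ Ax).
apply: ge_ereal_sup => _ [h /= hf <-]; apply: ereal_sup_ubound.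
exists h => //= x.
apply: (le_trans (hf x)); rewrite !patchE; case: ifPn => // xA.
by apply: fg; rewrite inE in xA.
Qed.

(** * Pathwise criteria for staying and leaving *)

Section displacement.
Context {R : realType} {n : nat}.
Implicit Types (w : cadlag 'rV[R]_n.+1) (t s : R) (u : 'I_n.+1 -> R).

(** A sum of one-dimensional suprema, so that it controls displacements in all directions while its
    moments reduce to those of the components. *)
Definition range_bound t w := \sum_i labs (axis i) t w.

Lemma measurable_range_bound t : 0 < t <= 1 -> measurable_fun setT (range_bound t).
Proof. by move=> t01; apply: measurable_sum => i; exact: measurable_labs. Qed.

Lemma range_bound_ge0 t w : 0 <= t <= 1 -> 0 <= range_bound t w.
Proof. by move=> t01; apply: sumr_ge0 => i _; exact: labs_ge0. Qed.

Lemma enorm_le_range t w s : t <= 1 -> 0 <= s <= t -> enorm (w s) <= range_bound t w.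
Proof.
move=> t1 st; apply: (le_trans (enorm_le_sum _)); apply: ler_sum => i _.
by have := @le_labs _ _ (axis i) t w s t1 st; rewrite lin_axis.
Qed.

Lemma posup_le_range u t w : dot u u = 1 -> 0 <= t <= 1 ->
  posup u t w <= range_bound t w.
Proof.
move=> uu t01; rewrite ge_max range_bound_ge0//; apply: rsup_le => //.
  exact: lin_regular.
have t1 : t <= 1 by case/andP: t01.
move=> s st; apply: le_trans (enorm_le_range w t1 st).
have := cauchy_schwarz (\row_i u i) (w s).
have -> : enorm (\row_i u i) = 1.
  rewrite /enorm (_ : \sum_i _ = 1) ?sqrtr1// -uu.
  by apply: eq_bigr => i _; rewrite mxE expr2.
by rewrite mul1r /lin; under eq_bigr do rewrite mxE.
Qed.

(* [lin (inward c)] is the displacement against the height coordinate of c. *)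
Definition inward (c : @chart R n) (i : 'I_n.+1) := - chart_rot c ord_max i.

Lemma lin_inward c w s : lin (inward c) w s = - chart_dtop c (w s).
Proof.
rewrite /lin /chart_dtop mxE -sumrN; apply: eq_bigr => i _.
by rewrite mxE /inward mulNr mulrC.
Qed.

Lemma dot_inward c : chart_rot c *m (chart_rot c)^T = 1%:M ->
  dot (inward c) (inward c) = 1.
Proof.
move=> /(congr1 (fun M : 'M[R]_n.+1 => M ord_max ord_max)); rewrite !mxE eqxx => E.
by apply: etrans E; apply: eq_bigr => i _; rewrite mxE /inward mulrNN.
Qed.

(** Staying in [D] up to [t] gives only an exit time at least [t]. The inequality is strict because
    [D] is open and the path right continuous at [t < 1], so it remains in [D] a little longer. *)
Lemma exit_time_gt (D : set 'rV[R]_n.+1) (x : 'rV[R]_n.+1) w t : open D ->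
  0 < t < 1 -> (forall s, 0 < s <= t -> D (x + w s)) ->
  (t%:E < exit_time D (Defs.shift x w))%E.
Proof.
move=> oD /andP[t0 t1] stay.
have t01 : 0 <= t < 1 by rewrite ltW.
have tt : 0 < t <= t by rewrite t0 lexx.
have [e e0 eD] := open_enorm oD (stay t tt).
have [w1 _ _] := cadlagP w.
have /cvgrPdist_lt/(_ (e / n.+1%:R)) := w1 t t01.
have en : 0 < e / n.+1%:R by rewrite divr_gt0.
move=> /(_ en); rewrite /at_right near_withinE => -[d /= d0 dP].
have d0' : (t%:E < (t + d / 2)%:E)%E by rewrite lte_fin ltrDl divr_gt0.
apply: (lt_le_trans d0'); apply: le_ereal_inf_tmp => _ [s [/andP[s0 s1] nDs] <-].
rewrite lee_fin leNgt; apply/negP => sd; apply: nDs.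
rewrite /= /shift_fun (ltW s0) s1/=.
have [st|ts] := leP s t; first by apply: stay; rewrite s0.
apply: eD; rewrite opprD addrACA subrr add0r.
apply: (le_lt_trans (enorm_le_mx_norm _)).
rewrite mulrC -ltr_pdivlMr// distrC; apply: dP => //=.
by rewrite ltr0_norm ?subr_lt0//; lra.
Qed.

Lemma exit_time_le (D : set 'rV[R]_n.+1) (x : 'rV[R]_n.+1) w t s : t <= 1 ->
  0 < s <= t -> ~ D (x + w s) -> ~ (t%:E < exit_time D (Defs.shift x w))%E.
Proof.
move=> t1 /andP[s0 st] nD; apply/negP; rewrite -leNgt.
have s1 := le_trans st t1.
apply: (@le_trans _ _ s%:E); last by rewrite lee_fin.
apply: ereal_inf_lbound; exists s => //; split; first by rewrite s0.
by rewrite /= /shift_fun (ltW s0) s1.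
Qed.

End displacement.

Lemma sumr_natl (R : realType) (I : finType) (p : pred I) (x : R) :
  (\sum_(i | p i) x%:E)%E = (#|[pred i | p i]|%:R * x)%:E.
Proof. by rewrite sumEFin sumr_const mulr_natl. Qed.

Lemma sqr_sum_le (R : realType) (m : nat) (f : 'I_m -> R) :
  (\sum_i f i) ^+ 2 <= m%:R * \sum_i f i ^+ 2.
Proof.
rewrite expr2 mulr_suml.
apply: (@le_trans _ _ (\sum_i \sum_j (f i ^+ 2 + f j ^+ 2) / 2)).
  apply: ler_sum => i _; rewrite mulr_sumr; apply: ler_sum => j _.
  by have := sqr_ge0 (f i - f j); rewrite sqrrB; lra.
under eq_bigr => i _.
  rewrite -mulr_suml big_split/= sumr_const card_ord -[f i ^+ 2 *+ m]mulr_natl.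
  over.
rewrite -mulr_suml big_split/= -mulr_sumr sumr_const card_ord -[X in _ + X]mulr_natl.
by rewrite le_eqVlt; apply/orP; left; apply/eqP; field.
Qed.

Section heat.
Context {R : realType} {n : nat} (P : probability (cadlag 'rV[R]_n.+1) R).
Hypotheses (n_gt0 : (2 <= n.+1)%N)
  (X_start : P [set w : cadlag 'rV[R]_n.+1 | w 0 = 0] = 1%E)
  (X_indep : mutually_independent P (@component R n.+1))
  (X_id : identically_distributed P (@component R n.+1))
  (X_gauss : forall i : 'I_n.+1, gaussian_process P (fun t w => w t 0 i))
  (X_mean : forall i : 'I_n.+1, zero_mean_process P (fun t w => w t 0 i))
  (X_nondeg : forall t : R, 0 < t <= 1 ->
    (0 < P [set w : cadlag 'rV[R]_n.+1 | (w t != 0)%R])%E).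
Variables (D : set 'rV[R]_n.+1) (e : R) (C : cells D e).
Hypotheses (oD : open D) (e_gt0 : 0 < e) (e_lt1 : e < 1).
Variable (t : R).
Hypothesis t01 : 0 < t < 1.
Implicit Types (c : cell_index C) (x : 'rV[R]_n.+1) (w : cadlag 'rV[R]_n.+1).

Let t01' : 0 < t <= 1. Proof. by case/andP: t01 => -> /ltW. Qed.

Let t01'' : 0 <= t <= 1. Proof. by case/andP: t01' => /ltW ->. Qed.

Let t_le1 : t <= 1. Proof. by case/andP: t01'. Qed.

Let s := cell_side C.
Let mu := mean_sup P t.
Let rho w := range_bound t w.
Let h c w := posup (inward (cell_chart c)) t w.
Let height c x := chart_height (cell_chart c) x.
Let base c x := chart_base (cell_chart c) x.

Let rho_ge0 w : 0 <= rho w. Proof. exact: range_bound_ge0. Qed.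

Let h_ge0 c w : 0 <= h c w. Proof. exact: posup_ge0. Qed.

Let mrho : measurable_fun setT rho. Proof. exact: measurable_range_bound. Qed.

Let mh c : measurable_fun setT (h c). Proof. exact: measurable_posup. Qed.

Let h_le_rho c w : h c w <= rho w.
Proof. by apply: posup_le_range => //; apply: dot_inward; exact: cell_rot. Qed.

Lemma range_mean : (\int[P]_w (rho w)%:E <= (2 * n.+1%:R * mu)%:E)%E.
Proof.
under eq_integral do rewrite /rho /range_bound -sumEFin.
rewrite ge0_integral_sum//; last 2 first.
- by move=> i; apply/measurable_EFinP; exact: measurable_labs.
- by move=> i w _; rewrite lee_fin labs_ge0.
apply: (@le_trans _ _ (\sum_(i < n.+1) (2 * mu)%:E)%E).
  by apply: lee_sum => i _; exact: (labs_mean n_gt0 X_start X_indep X_id X_gauss X_mean).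
by rewrite sumEFin sumr_const card_ord -mulr_natl lee_fin; lra.
Qed.

(** One factor [n + 1] comes from squaring a sum of [n + 1] terms and the other from summing as many
    second moments, each at most [(192 mu) ^ 2]. *)
Let K : R := n.+1%:R ^+ 2 * 192 ^+ 2.

Lemma range_square : (\int[P]_w (rho w ^+ 2)%:E <= (K * mu ^+ 2)%:E)%E.
Proof.
have mq i : measurable_fun setT (fun w => labs (axis i) t w ^+ 2).
  by apply: measurable_funX; exact: measurable_labs.
apply: (@le_trans _ _ (\int[P]_w (n.+1%:R * \sum_(i < n.+1) labs (axis i) t w ^+ 2)%:E)%E).
  apply: ge0_le_integral_pr.
  - exact: measurable_funX.
  - by apply: measurable_funM => //; exact: measurable_sum.
  move=> w; rewrite sqr_ge0/= /rho /range_bound.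
  exact: sqr_sum_le.
under eq_integral do rewrite EFinM -sumEFin.
rewrite ge0_integralZl_EFin//; last 2 first.
- by move=> w _; apply: sume_ge0 => i _; rewrite lee_fin sqr_ge0.
- by apply: emeasurable_sum => i; exact/measurable_EFinP.
rewrite ge0_integral_sum//; last 2 first.
- by move=> i; apply/measurable_EFinP.
- by move=> i w _; rewrite lee_fin sqr_ge0.
apply: (@le_trans _ _ (n.+1%:R%:E * \sum_(i < n.+1) ((192 * mu) ^+ 2)%:E)%E).
  apply: lee_wpmul2l => //; apply: lee_sum => i _.
  exact: (labs_square_mean n_gt0 X_start X_indep X_id X_gauss X_mean X_nondeg).
rewrite sumEFin sumr_const card_ord -EFinM lee_fin -mulr_natl /K.
by rewrite le_eqVlt; apply/orP; left; apply/eqP; ring.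
Qed.

Lemma range_tail (r : R) : 0 < r ->
  (P [set w | (r <= rho w)%R] <= (K * mu ^+ 2 / r ^+ 2)%:E)%E.
Proof.
move=> r0; have r2 : 0 < r ^+ 2 by rewrite exprn_gt0.
have mA : measurable [set w | r <= rho w].
  rewrite (_ : mkset _ = rho @^-1` `[r, +oo[); first exact: measurable_preimage.
  by apply/seteqP; split=> w /=; rewrite in_itv/= andbT.
rewrite EFinM muleC -lee_pdivrMl// ?invr_gt0// invrK.
apply: le_trans range_square.
rewrite -(integral_indicT P mA) -ge0_integralZl_EFin//; last exact: ltW; first last.
- by apply/measurable_EFinP; exact: measurable_indic.
under eq_integral do rewrite -EFinM.
apply: ge0_le_integral_pr.
- by apply: measurable_funM => //; exact: measurable_indic.
- exact: measurable_funX.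
move=> w; rewrite mulr_ge0 ?(ltW r2)//= indicE.
have [rw|rw] := leP r (rho w).
  by rewrite mem_set//= mulr1 lerXn2r// nnegrE// ltW.
by rewrite memNset/= ?mulr0 ?sqr_ge0//; apply/negP; rewrite -ltNge.
Qed.

Lemma height_mean c : (\int[P]_w (h c w)%:E = mu%:E)%E.
Proof.
rewrite (posup_mean X_start X_indep X_id X_gauss X_mean t01'); last first.
  by apply: dot_inward; exact: cell_rot.
exact: (mean_supE n_gt0 X_start X_indep X_id X_gauss X_mean).
Qed.

Lemma height_move c x w (r : R) : 0 <= r <= t ->
  height c (x + w r) = height c x - lin (inward (cell_chart c)) w r -
    (chart_fun (cell_chart c) (base c (x + w r)) - chart_fun (cell_chart c) (base c x)).
Proof.
move=> _; rewrite /height /chart_height chart_topD lin_inward /base; ring.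
Qed.

Let stays x := [set w | (t%:E < exit_time D (Defs.shift x w))%E].

(** The height drops by at most [h + e rho]: the movement against the vertical axis and the
    variation of the graph. The second [e rho] in the hypothesis keeps the height strictly positive;
    if [rho = 0] the path does not move, and membership of [x] in [D] is used directly. *)
Lemma stay_cell c x w : D x -> cube (cell_corner c) s (base c x) -> height c x < s ->
  rho w < cell_reach C -> h c w + 2 * e * rho w <= height c x -> stays x w.
Proof.
move=> Dx xc xs wr hx; apply: exit_time_gt => // r /andP[r0 rt].
have rt' : 0 <= r <= t by rewrite ltW.
have wn : enorm (w r) <= rho w := enorm_le_range w t_le1 rt'.
have x0 : 0 <= height c x.
  by apply: le_trans hx; rewrite addr_ge0// mulr_ge0// mulr_ge0// ltW.
have xs' : `|height c x| <= s by rewrite ger0_norm// ltW.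
have [DP lip] := cell_local xc xs' (le_lt_trans wn wr).
have v0 : enorm (0 : 'rV[R]_n.+1) < cell_reach C by rewrite enorm0 cell_reach_gt0.
have [] := cell_local xc xs' v0; rewrite addr0 => -[/(_ Dx) xpos _] _.
apply/DP; rewrite -/(height _ _) height_move//.
have := le_posup (inward (cell_chart c)) w t_le1 rt'; rewrite -/(h c w) => lh.
move: lip; rewrite -/(base _ _) -/(base _ _) ler_norml => /andP[_ l2].
have ew : e * enorm (w r) <= e * rho w by rewrite ler_pM2l.
have [r0'|r0'] := eqVneq (rho w) 0; last first.
  have rp : 0 < rho w by rewrite lt_def r0' rho_ge0.
  have : 0 < e * rho w by rewrite mulr_gt0.
  by lra.
have w0 : w r = 0.
  by apply: enorm_eq0; apply/eqP; rewrite eq_le enorm_ge0 andbT -r0'.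
have l0 : lin (inward (cell_chart c)) w r = 0.
  by rewrite /lin big1// => i _; rewrite w0 mxE mulr0.
by move: xpos; rewrite l0 w0 addr0 subrr !subr0.
Qed.

Lemma stay_inside x w : D x -> rho w < cell_reach C ->
  (forall c, cell_used c -> cube (cell_corner c) s (base c x) ->
    ~~ (0 < height c x < s)) -> stays x w.
Proof.
move=> Dx wr far; apply: exit_time_gt => // r /andP[r0 rt].
have rt' : 0 <= r <= t by rewrite ltW.
have wn : enorm (w r) <= rho w := enorm_le_range w t_le1 rt'.
apply: contrapT => nD.
have [|c [uc xc xh]] := @cell_tube _ _ _ _ C _ _ Dx nD.
  rewrite opprD addrA subrr add0r enormN.
  exact: le_lt_trans wn wr.
by have := far c uc xc; rewrite xh.
Qed.

(** At some sampled time the downward displacement exceeds the height of [x] by more than [e rho],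
    which the graph cannot compensate. That time is not [0], since the path starts at [0] there, so
    it counts for the exit time. *)
Lemma exit_cell c x w : cube (cell_corner c) s (base c x) -> 0 < height c x < s ->
  rho w < cell_reach C -> w 0 = 0 -> height c x < h c w - e * rho w -> ~ stays x w.
Proof.
move=> xc /andP[x0 xs] wr w0 hx.
have er : 0 <= e * rho w by rewrite mulr_ge0// ltW.
have : height c x + e * rho w < lsup (inward (cell_chart c)) t w.
  have : height c x + e * rho w < h c w by lra.
  by rewrite /h lt_max => /orP[|//]; lra.
move=> /(rsup_gtP _ (lin_regular _ w) t01')[k].
set r := t * dense_time k => hk.
have rt : 0 <= r <= t.
  have /andP[d0 d1] := @dense_time01 R k; case/andP: t01'' => t0 t1.
  by rewrite mulr_ge0//= ler_piMr.
have r0 : 0 < r.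
  rewrite lt_def; case/andP: rt => -> _; rewrite andbT; apply/eqP => rE.
  have : lin (inward (cell_chart c)) w r = 0.
    by rewrite /lin big1// => i _; rewrite rE w0 mxE mulr0.
  by move: hk; lra.
have wn : enorm (w r) <= rho w := enorm_le_range w t_le1 rt.
have xs' : `|height c x| <= s by rewrite gtr0_norm// ltW.
have [DP lip] := cell_local xc xs' (le_lt_trans wn wr).
apply: (@exit_time_le _ _ _ _ _ _ r) => //; first by rewrite r0; case/andP: rt.
move=> /DP; rewrite -/(height _ _) height_move//.
move: lip; rewrite -/(base _ _) -/(base _ _) ler_norml => /andP[l1 _].
have ew : e * enorm (w r) <= e * rho w by rewrite ler_pM2l.
lra.
Qed.

Let mheight c : measurable_fun setT (height c).
Proof.
have [mg _] := graph_coord_preserving (cell_rot c) (cell_measurable c).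
exact: (measurableT_comp measurable_fst mg).
Qed.

(** The probability that [f] exceeds the height of the starting point, cut to the strip above [B].
    Depending on the height alone there, it integrates to a product in graph coordinates. *)
Let strip_term (f : cadlag 'rV[R]_n.+1 -> R) c (B : set 'rV[R]_n) : 'rV[R]_n.+1 -> R :=
  fun x => \1_[set x | `]0, s[%classic (height c x) /\ B (base c x)] x *
    tail P f (height c x).

Let mtail (f : cadlag 'rV[R]_n.+1 -> R) : measurable_fun setT f ->
  measurable_fun setT (tail P f).
Proof.
move=> mf; apply/measurable_EFinP; apply: eq_measurable_fun (measurable_tail_probability P mf).
by move=> u _; exact: tailE.
Qed.

Lemma strip_term_ge0 f c B x : 0 <= strip_term f c B x.
Proof. by rewrite mulr_ge0// tail_ge0. Qed.

Lemma measurable_strip_term f c B : measurable_fun setT f -> measurable B ->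
  measurable_fun setT (strip_term f c B).
Proof.
move=> mf mB; apply: measurable_funM.
  apply: measurable_indic.
  exact: (measurable_strip (cell_rot c) (cell_measurable c) mB).
exact: (measurableT_comp (mtail mf) (mheight c)).
Qed.

Lemma integral_strip_term f c B : measurable_fun setT f -> measurable B ->
  (\int[@lebesgue_rV R n.+1]_x (strip_term f c B x)%:E =
   @lebesgue_rV R n B * \int[lebesgue_measure]_(u in `]0%R, s[) (tail P f u)%:E)%E.
Proof.
move=> mf mB; set S := [set x | `]0, s[%classic (height c x) /\ B (base c x)].
transitivity (\int[@lebesgue_rV R n.+1]_(x in S) (tail P f (height c x))%:E)%E.
  rewrite [RHS]integral_mkcond; apply: eq_integral => x _.
  rewrite patchE /strip_term indicE -/S; case: ifPn => _; first by rewrite mul1r.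
  by rewrite mul0r.
apply: (@integral_chart_strip _ _ _ (cell_rot c) B `]0, s[%classic
  (fun u => (tail P f u)%:E)) => //.
- exact: cell_measurable.
- by apply/measurable_EFinP; exact: mtail.
- by move=> u; rewrite lee_fin tail_ge0.
Qed.

Let lam := @lebesgue_rV R n.+1.

Let mD : measurable D. Proof. exact: open_rV_measurable. Qed.

Let Q := heat_content P D t.

Let Pext x : \bar R := law_from P x [set w | (t%:E < exit_time D w)%E].

Let PextE x : Pext x = mu_ext P (stays x). Proof. by []. Qed.

Let Pext_ge0 x : (0 <= Pext x)%E. Proof. exact: mu_ext_ge0. Qed.

Let Pext_ge x F : measurable F -> F `<=` stays x -> (P F <= Pext x)%E.
Proof. by move=> mF FE; rewrite -(measurable_mu_extE P mF) PextE; exact: le_mu_ext. Qed.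

Let Pext_le x F : measurable F -> stays x `<=` F -> (Pext x <= P F)%E.
Proof. by move=> mF FE; rewrite -(measurable_mu_extE P mF) PextE; exact: le_mu_ext. Qed.

Let fup c w := h c w + 2 * e * rho w.

Let mfup c : measurable_fun setT (fup c).
Proof. by apply: measurable_funD => //; exact: measurable_funM. Qed.

Let kap := fine (P [set w | cell_reach C <= rho w]).

Let mA (r : R) : measurable [set w | r <= rho w].
Proof.
rewrite (_ : mkset _ = rho @^-1` `[r, +oo[); first exact: measurable_preimage.
by apply/seteqP; split=> w /=; rewrite in_itv/= andbT.
Qed.

Let kapE : P [set w | cell_reach C <= rho w] = kap%:E.
Proof. by rewrite fineK// fin_num_measure. Qed.

(** Used cells may overlap; summing over all of them only enlarges this bound for the probability of
    leaving. [kap] accounts for the paths whose range defeats the local description. *)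
Let upper_defect x : R :=
  \sum_(c | cell_used c) strip_term (fup c) c (cube (cell_corner c) s) x + kap.

Let kap_ge0 : 0 <= kap. Proof. by rewrite fine_ge0. Qed.

Lemma stay_probability x : D x -> ((1 - upper_defect x)%:E <= Pext x)%E.
Proof.
move=> Dx; have [[c uc [cx xc]]|no] := pselect (exists2 c, cell_used c &
    `]0, s[%classic (height c x) /\ cube (cell_corner c) s (base c x)).
  pose F := ~` ([set w | cell_reach C <= rho w] `|` [set w | height c x < fup c w]).
  have mB : measurable [set w | height c x < fup c w] by exact: measurable_superlevel.
  have mF : measurable F by apply: measurableC; exact: measurableU.
  have FE : F `<=` stays x.
    move=> w /not_orP[/negP]; rewrite -ltNge => wr /negP; rewrite -leNgt => hw.
    move: cx; rewrite /= in_itv/= => /andP[x0 xs].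
    exact: stay_cell hw.
  apply: le_trans (Pext_ge mF FE); rewrite /F probability_setC; last exact: measurableU.
  rewrite EFinB leeB//.
  apply: (le_trans (measureU2 P (mA _) mB)).
  have tB := tailE P (height c x) (mfup c).
  apply: (@le_trans _ _ (kap%:E + (tail P (fup c) (height c x))%:E)%E).
    by apply: leeD; [rewrite -kapE|rewrite -tB].
  rewrite -EFinD lee_fin /upper_defect addrC lerD2r (bigD1 c)//=.
  rewrite {1}/strip_term indicE mem_set//= mul1r lerDl.
  by apply: sumr_ge0 => c' _; exact: strip_term_ge0.
pose F := ~` [set w | cell_reach C <= rho w].
have FE : F `<=` stays x.
  move=> w /negP; rewrite -ltNge => wr; apply: stay_inside => // c uc xc.
  by apply/negP => hx; apply: no; exists c => //; split=> //=; rewrite in_itv.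
apply: le_trans (Pext_ge _ FE); last exact: measurableC.
rewrite probability_setC// EFinB leeB// kapE lee_fin lerDr.
by apply: sumr_ge0 => c' _; exact: strip_term_ge0.
Qed.

Lemma tail_mean (f : cadlag 'rV[R]_n.+1 -> R) : measurable_fun setT f ->
  (forall w, 0 <= f w) ->
  (\int[lebesgue_measure]_(u in `[0%R, +oo[) (tail P f u)%:E = \int[P]_w (f w)%:E)%E.
Proof.
move=> mf f0; rewrite layer_cake//; apply: eq_integral => u _.
by rewrite -tailE.
Qed.

Lemma upper_mean c : (\int[P]_w (fup c w)%:E <= ((1 + 4 * e * n.+1%:R) * mu)%:E)%E.
Proof.
rewrite /fup; under eq_integral do rewrite EFinD EFinM.
rewrite ge0_integralD//; first last.
- by apply/measurable_EFinP; exact: measurable_funM.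
- by move=> w _; rewrite -EFinM lee_fin mulr_ge0// mulr_ge0// ltW.
- exact/measurable_EFinP.
- by move=> w _; rewrite lee_fin.
rewrite height_mean ge0_integralZl_EFin//; first last.
- by rewrite mulr_ge0// ltW.
- exact/measurable_EFinP.
- by move=> w _; rewrite lee_fin.
have e2 : (0 <= (2 * e)%:E)%E by rewrite lee_fin mulr_ge0// ltW.
apply: (le_trans (leeD (lexx _) (lee_wpmul2l e2 range_mean))).
by rewrite -EFinM -EFinD lee_fin; lra.
Qed.

Lemma integral_upper_term c :
  (\int[lam]_x (strip_term (fup c) c (cube (cell_corner c) s) x)%:E <=
   (s ^+ n * ((1 + 4 * e * n.+1%:R) * mu))%:E)%E.
Proof.
have s0 : 0 < s := cell_side_gt0 C.
have f0 w : 0 <= fup c w by rewrite addr_ge0// mulr_ge0// mulr_ge0// ltW.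
rewrite integral_strip_term//; last exact: measurable_cube.
have Ec := lebesgue_rV_cube (cell_corner c) (ltW s0).
rewrite Ec [X in (_ <= X)%E]EFinM; apply: lee_wpmul2l.
  by rewrite lee_fin exprn_ge0// ltW.
apply: le_trans (upper_mean c); rewrite -(tail_mean (mfup c) f0).
apply: ge0_subset_integral => //.
- by apply: measurable_funTS; apply/measurable_EFinP; exact: mtail.
- by move=> u _; rewrite lee_fin tail_ge0.
- by move=> u; rewrite /= !in_itv/= andbT => /andP[/ltW].
Qed.

Let mu_ge0 : 0 <= mu.
Proof. by apply: ltW; exact: mean_sup_gt0. Qed.

(** The defect may exceed [1], so [1 - upper_defect] is cut at [0] to give a nonnegative measurable
    minorant of the staying probability; its sum with the defect is still at least [1]. *)
Lemma heat_content_ge : bounded_set D ->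
  (lam D <= Q + (#|[pred c : cell_index C | cell_used c]|%:R *
     (s ^+ n * ((1 + 4 * e * n.+1%:R) * mu)))%:E +
     (K * mu ^+ 2 / cell_reach C ^+ 2)%:E * lam D)%E.
Proof.
move=> bD.
have mt c : measurable_fun setT (strip_term (fup c) c (cube (cell_corner c) s)).
  by apply: measurable_strip_term => //; exact: measurable_cube.
have mG : measurable_fun setT upper_defect.
  apply: measurable_funD => //; under eq_fun do rewrite -big_filter.
  by apply: measurable_sum => c.
have G0 x : 0 <= upper_defect x.
  by rewrite addr_ge0//; apply: sumr_ge0 => c _; exact: strip_term_ge0.
pose m x : R := Num.max 0 (1 - upper_defect x).
have mm : measurable_fun setT m.
  by apply: measurable_maxr => //; exact: measurable_funB.
have m0 x : 0 <= m x by rewrite le_max lexx.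
have QE : Q = (\int[lam]_(x in D) Pext x)%E by [].
have h1 : (\int[lam]_(x in D) (m x)%:E <= Q)%E.
  rewrite QE; apply: ge0_le_integral_nonmeasurable => [x _|x Dx]; first by rewrite lee_fin.
  rewrite /m EFin_max ge_max; apply/andP; split; first exact: Pext_ge0.
  exact: stay_probability.
have h2 : (lam D <= \int[lam]_(x in D) (m x)%:E + \int[lam]_(x in D) (upper_defect x)%:E)%E.
  rewrite -ge0_integralD//; first last.
  - by apply: measurable_funTS; exact/measurable_EFinP.
  - by move=> x _; rewrite lee_fin.
  - by apply: measurable_funTS; exact/measurable_EFinP.
  - by move=> x _; rewrite lee_fin.
  rewrite -[leLHS]mul1e -integral_cst//; apply: ge0_le_integral => //.
  - by apply: measurable_funTS; apply: emeasurable_funD; exact/measurable_EFinP.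
  - by move=> x _; rewrite -EFinD lee_fin /m -lerBlDr le_max lexx orbT.
have h3 : (\int[lam]_(x in D) (upper_defect x)%:E <=
    (#|[pred c : cell_index C | cell_used c]|%:R *
     (s ^+ n * ((1 + 4 * e * n.+1%:R) * mu)))%:E +
     (K * mu ^+ 2 / cell_reach C ^+ 2)%:E * lam D)%E.
  rewrite /upper_defect; under eq_integral do rewrite EFinD.
  rewrite ge0_integralD//; first last.
  - apply: measurable_funTS; apply/measurable_EFinP.
    by under eq_fun do rewrite -big_filter; apply: measurable_sum => c.
  - by move=> x _; rewrite lee_fin; apply: sumr_ge0 => c _; exact: strip_term_ge0.
  apply: leeD; last first.
    rewrite integral_cst//; apply: lee_wpmul2r => //.
    by rewrite -kapE; apply: range_tail; exact: cell_reach_gt0.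
  under eq_integral do rewrite -sumEFin -big_filter.
  rewrite ge0_integral_sum//; last 2 first.
  - by move=> c; apply: measurable_funTS; exact/measurable_EFinP.
  - by move=> c x _; rewrite lee_fin strip_term_ge0.
  rewrite big_filter.
  apply: (@le_trans _ _ (\sum_(c | cell_used c)
      (s ^+ n * ((1 + 4 * e * n.+1%:R) * mu))%:E)%E); last first.
    by rewrite sumr_natl.
  apply: lee_sum => c _; apply: le_trans (integral_upper_term c).
  apply: ge0_subset_integral => //.
  - exact/measurable_EFinP.
  - by move=> x _; rewrite lee_fin strip_term_ge0.
by have := le_trans h2 (leeD h1 h3); rewrite addeA.
Qed.

Variable rho1 : R.
Hypotheses (rho1_gt0 : 0 < rho1) (rho1_reach : rho1 <= cell_reach C)
  (rho1_gap : rho1 <= cell_gap C / 4) (rho1_side : rho1 <= s).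

(** A lower version of the exit threshold, set to [0] on paths of range at least [rho1]. It stays
    below [rho1], hence so do the heights at which its tail is positive, and the contributions of
    distinct good cells have disjoint supports. *)
Let flow c w : R := Num.max 0 (h c w - e * rho w) * \1_[set w | rho w < rho1] w.

Let mflow c : measurable_fun setT (flow c).
Proof.
apply: measurable_funM.
  apply: measurable_maxr => //; apply: measurable_funB => //.
  exact: measurable_funM.
apply: measurable_indic.
rewrite (_ : mkset _ = rho @^-1` `]-oo, rho1[); first exact: measurable_preimage.
by apply/seteqP; split=> w /=; rewrite in_itv/=.
Qed.

Let flow_ge0 c w : 0 <= flow c w.
Proof. by rewrite mulr_ge0// le_max lexx. Qed.

Let flow_pos c w u : 0 <= u -> u < flow c w -> rho w < rho1 /\ u < h c w - e * rho w.
Proof.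
move=> u0; rewrite /flow indicE; case: (ltP (rho w) rho1) => [wr|wr].
  by rewrite mem_set//= mulr1 lt_max => /orP[|//]; rewrite ltNge u0.
rewrite memNset; last by rewrite /= ltNge wr.
by rewrite /= mulr0 ltNge u0.
Qed.

Let flow_lt c w : flow c w < rho1.
Proof.
rewrite ltNge; apply/negP => fr; have f0 : 0 < flow c w := lt_le_trans rho1_gt0 fr.
have [wr _] := flow_pos (lexx 0) f0.
move: fr; rewrite /flow indicE mem_set//= mulr1 le_max leNgt rho1_gt0/= => fr.
have : 0 <= e * rho w by rewrite mulr_ge0// ltW.
have := h_le_rho c w; lra.
Qed.

Let tail_flow0 c u : rho1 <= u -> tail P (flow c) u = 0.
Proof.
move=> ru; rewrite /tail (_ : mkset _ = set0) ?measure0//.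
by apply/seteqP; split=> // w /=; rewrite ltNge (le_trans (ltW (flow_lt c w)) ru).
Qed.

Let low_term c := strip_term (flow c) c (shrunk_cube e (cell_corner c) s).

Let lower_defect x : R := \sum_(c | cell_good c) low_term c x.

Let mshrunk c : measurable (shrunk_cube e (cell_corner c) s) /\
  @lebesgue_rV R n (shrunk_cube e (cell_corner c) s) = (((1 - e) * s) ^+ n)%:E.
Proof.
have s0 : 0 < s := cell_side_gt0 C; set p := cell_corner c.
pose I (i : 'I_n) := `[p 0 i + e * s / 2, p 0 i + s - e * s / 2]%classic.
have E : shrunk_cube e p s = [set v : 'rV[R]_n | forall i, I i (v 0 i)].
  by apply/seteqP; split=> v H i; have := H i; rewrite /I /= in_itv.
have mI i : measurable (I i) by exact: measurable_itv.
rewrite E; split; first exact: measurable_rV_box.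
rewrite lebesgue_rV_box//.
rewrite (eq_bigr (fun=> ((1 - e) * s)%:E)).
  by rewrite prodEFin prodr_const card_ord.
move=> i _; rewrite /I lebesgue_measure_itv/= lte_fin.
have : 0 < (1 - e) * s by rewrite mulr_gt0// subr_gt0.
by move=> h0; rewrite ifT; [rewrite -EFinD; congr EFin; field|lra].
Qed.

Lemma low_term_support c x : low_term c x != 0 -> [/\ 0 < height c x,
  height c x < rho1 & shrunk_cube e (cell_corner c) s (base c x)].
Proof.
rewrite /low_term /strip_term indicE.
case: (boolP (x \in _)) => [|_]; last by rewrite mul0r eqxx.
rewrite inE /= in_itv/= => -[/andP[x0 xs] xb]; rewrite mul1r => tz; split=> //.
by rewrite ltNge; apply: contra tz => /tail_flow0 ->.
Qed.

(** Dropping [x] vertically on each of the two graphs moves it by less than [rho1], at most a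
    quarter of the gap; the two feet would lie in distinct shrunk cells at distance below the
    gap. *)
Lemma low_term_unique c c' x : cell_good c -> cell_good c' -> c != c' ->
  low_term c x != 0 -> low_term c' x = 0.
Proof.
move=> gc gc' cc /low_term_support[x0 xr xb].
apply/eqP/negPn/negP => /low_term_support[x0' xr' xb'].
pose y d := chart_point (cell_chart d) (base d x) 0.
have yx d : 0 < height d x -> enorm (x - y d) <= height d x.
  move=> h0; rewrite -{1}(chart_pointK (cell_rot d) x).
  apply: (le_trans (chart_point_dist _ _ _ _ (cell_rot d))).
  by rewrite subrr enorm0 !add0r addrK gtr0_norm.
have sep := @cell_separated _ _ _ _ C c c' (y c) (y c') cc gc gc'.
have := sep; rewrite !chart_base_point ?chart_height_point; try exact: cell_rot.
move=> /(_ xb erefl xb' erefl).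
have := ler_enorm_dist (y c) x (y c'); have := yx c x0; have := yx c' x0'.
rewrite (enorm_distC (y c) x); have := cell_gap_gt0 C; have := rho1_gap.
lra.
Qed.

Lemma low_term_ge0 c x : 0 <= low_term c x.
Proof. exact: strip_term_ge0. Qed.

Lemma low_term_le1 c x : low_term c x <= 1.
Proof.
rewrite /low_term /strip_term -[leRHS]mulr1; apply: ler_pM => //; first exact: tail_ge0.
by rewrite -lee_fin -tailE// probability_le1//; exact: measurable_superlevel.
Qed.

Lemma start_null : measurable [set w : cadlag 'rV[R]_n.+1 | w 0 != 0] /\
  P [set w : cadlag 'rV[R]_n.+1 | (w 0 != 0)%R] = 0%E.
Proof.
have m0 : measurable [set w : cadlag 'rV[R]_n.+1 | w 0 = 0].
  rewrite (_ : [set _ | _] = \bigcap_(i in [set: 'I_n.+1])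
    ((fun w : cadlag 'rV[R]_n.+1 => w 0 0 i) @^-1` [set 0])).
    apply: fin_bigcap_measurable => // i _; apply: measurable_preimage => //.
    by apply: measurable_eval_coord; rewrite lexx ler01.
  apply/seteqP; split=> w /=; first by move=> w0 i _ /=; rewrite w0 mxE.
  by move=> w0; apply/rowP => i; rewrite mxE; exact: w0.
have E : [set w : cadlag 'rV[R]_n.+1 | w 0 != 0] = ~` [set w : cadlag 'rV[R]_n.+1 | w 0 = 0].
  by apply/seteqP; split=> w /= /eqP.
rewrite E; split; first exact: measurableC.
by rewrite probability_setC// X_start subee.
Qed.

(** At most one term of the defect is nonzero at [x], so a single cell is involved and its term is
    the probability of an event on which the path leaves. Paths not starting at [0] form a null set
    added to the covering event. *)
Lemma exit_probability x : D x -> (Pext x <= (1 - lower_defect x)%:E)%E.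
Proof.
move=> Dx; have [[c gc nz]|no] := pselect (exists2 c, cell_good c & low_term c x != 0).
  have -> : lower_defect x = low_term c x.
    rewrite /lower_defect (bigD1 c)//= big1 ?addr0// => c' /andP[gc' cc'].
    by apply: (low_term_unique gc gc') nz; rewrite eq_sym.
  have [x0 xr xb] := low_term_support nz.
  have s0 : 0 < s := cell_side_gt0 C.
  have xs : 0 < height c x < s by rewrite x0; exact: lt_le_trans xr rho1_side.
  have [m0 P0] := start_null.
  have mf : measurable [set w | height c x < flow c w] by exact: measurable_superlevel.
  pose F := ~` [set w | height c x < flow c w] `|` [set w : cadlag 'rV[R]_n.+1 | w 0 != 0].
  have mF : measurable F by apply: measurableU => //; exact: measurableC.
  have FE : stays x `<=` F.
    move=> w sw; apply: contrapT => /not_orP[/contrapT wf /negP/negPn/eqP w0].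
    have [wr hw] := flow_pos (ltW x0) wf.
    apply: (exit_cell (shrunk_cube_sub e_gt0 s0 xb) xs _ w0 hw) sw.
    exact: lt_le_trans wr rho1_reach.
  apply: (le_trans (Pext_le mF FE)).
  apply: (le_trans (measureU2 P (measurableC mf) m0)).
  have PC := probability_setC P mf.
  apply: (@le_trans _ _ (1 - P [set w | (height c x < flow c w)%R] + 0)%E).
    by apply: leeD; [rewrite -PC|rewrite -P0].
  rewrite adde0 EFinB leeB//.
  rewrite /low_term /strip_term indicE mem_set/= ?mul1r.
    by have := tailE P (height c x) (mflow c) => ->.
  by rewrite in_itv/=; split.
have -> : lower_defect x = 0.
  rewrite /lower_defect big1// => c gc; apply/eqP/negPn/negP => nz.
  by apply: no; exists c.
rewrite subr0; apply: (le_trans (@Pext_le x setT measurableT (fun _ _ => I))).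
exact: probability_le1.
Qed.

(** [h <= flow + e rho + rho ^ 2 / rho1] pathwise: when the range is at least [rho1], already
    [h <= rho <= rho ^ 2 / rho1]. The lost mass is therefore of order [e mu + mu ^ 2]. *)
Lemma flow_mean c : (mu%:E <= \int[P]_w (flow c w)%:E +
  (2 * e * n.+1%:R * mu + K * mu ^+ 2 / rho1)%:E)%E.
Proof.
pose g w : R := e * rho w + rho w ^+ 2 / rho1.
have g0 w : 0 <= g w.
  by rewrite addr_ge0// ?mulr_ge0 ?sqr_ge0 ?invr_ge0// ltW.
have mg : measurable_fun setT g.
  by apply: measurable_funD; apply: measurable_funM => //; exact: measurable_funX.
have le1 : (\int[P]_w (h c w)%:E <= \int[P]_w (flow c w + g w)%:E)%E.
  apply: ge0_le_integral_pr => //; first exact: measurable_funD.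
  move=> w; rewrite h_ge0/= /flow /g indicE.
  have sq : 0 <= rho w ^+ 2 / rho1 by rewrite divr_ge0 ?sqr_ge0// ltW.
  have [wr|wr] := ltP (rho w) rho1.
    rewrite mem_set//= mulr1.
    have : h c w - e * rho w <= Num.max 0 (h c w - e * rho w) by rewrite le_max lexx orbT.
    lra.
  rewrite memNset ?mulr0; last by rewrite /= ltNge wr.
  have : rho w <= rho w ^+ 2 / rho1.
    by rewrite ler_pdivlMr// expr2 ler_wpM2l.
  have := h_le_rho c w; have : 0 <= e * rho w by rewrite mulr_ge0// ltW.
  lra.
rewrite -(height_mean c); apply: (le_trans le1).
under eq_integral do rewrite EFinD.
rewrite ge0_integralD//; first last.
- exact/measurable_EFinP.
- by move=> w _; rewrite lee_fin.
- exact/measurable_EFinP.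
- by move=> w _; rewrite lee_fin.
apply: leeD => //; rewrite /g; under eq_integral do rewrite EFinD.
rewrite ge0_integralD//; first last.
- by apply/measurable_EFinP; apply: measurable_funM => //; exact: measurable_funX.
- by move=> w _; rewrite lee_fin divr_ge0 ?sqr_ge0// ltW.
- by apply/measurable_EFinP; exact: measurable_funM.
- by move=> w _; rewrite lee_fin mulr_ge0// ltW.
rewrite EFinD; apply: leeD.
  under eq_integral do rewrite EFinM.
  rewrite ge0_integralZl_EFin//; first last.
  - exact: ltW.
  - exact/measurable_EFinP.
  - by move=> w _; rewrite lee_fin.
  have e0 : (0 <= e%:E)%E by rewrite lee_fin ltW.
  apply: (le_trans (lee_wpmul2l e0 range_mean)).
  by rewrite -EFinM lee_fin; lra.
under eq_integral do rewrite mulrC EFinM.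
rewrite ge0_integralZl_EFin//; first last.
- by rewrite invr_ge0 ltW.
- by apply/measurable_EFinP; exact: measurable_funX.
- by move=> w _; rewrite lee_fin sqr_ge0.
have r0 : (0 <= rho1^-1%:E)%E by rewrite lee_fin invr_ge0 ltW.
apply: (le_trans (lee_wpmul2l r0 range_square)).
by rewrite -EFinM lee_fin mulrC.
Qed.

Lemma integral_low_term c :
  ((((1 - e) * s) ^+ n * (mu - (2 * e * n.+1%:R * mu + K * mu ^+ 2 / rho1)))%:E <=
   \int[lam]_x (low_term c x)%:E)%E.
Proof.
have s0 : 0 < s := cell_side_gt0 C.
have [ms Es] := mshrunk c.
have es0 : 0 <= (1 - e) * s by rewrite mulr_ge0 ?subr_ge0// ltW.
rewrite /low_term integral_strip_term// Es [X in (X <= _)%E]EFinM.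
apply: lee_wpmul2l; first by rewrite lee_fin exprn_ge0.
(* The tail of [flow] vanishes from [rho1 <= s] on, so restricting to heights below [s] loses
   nothing of its mean. *)
have -> : (\int[lebesgue_measure]_(u in `]0%R, s[) (tail P (flow c) u)%:E =
    \int[P]_w (flow c w)%:E)%E.
  rewrite -(tail_mean (mflow c) (flow_ge0 c)).
  rewrite -integral_itv_obnd_cbnd; last first.
    by apply: measurable_funTS; apply/measurable_EFinP; exact: mtail.
  rewrite integral_mkcond [RHS]integral_mkcond; apply: eq_integral => u _.
  rewrite !patchE !mem_setE !in_itv/= andbT; case: (ltP 0 u) => //= u0.
  by case: ltP => // su; rewrite tail_flow0//; exact: le_trans su.
by rewrite EFinB leeBlDr//; exact: flow_mean.
Qed.

Lemma low_term_inside c x : ~ D x -> low_term c x = 0.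
Proof.
move=> nD; apply/eqP/negPn/negP => /low_term_support[x0 xr xb]; apply: nD.
have s0 : 0 < s := cell_side_gt0 C.
have xs : `|height c x| <= s by rewrite gtr0_norm// ltW// (lt_le_trans xr).
have v0 : enorm (0 : 'rV[R]_n.+1) < cell_reach C by rewrite enorm0 cell_reach_gt0.
have [] := cell_local (shrunk_cube_sub e_gt0 s0 xb) xs v0.
by rewrite addr0 => -[_ H] _; apply: H.
Qed.

Lemma heat_content_le :
  (Q + (#|[pred c : cell_index C | cell_good c]|%:R *
     (((1 - e) * s) ^+ n * (mu - (2 * e * n.+1%:R * mu + K * mu ^+ 2 / rho1))))%:E <=
   lam D)%E.
Proof.
have mt c : measurable_fun setT (low_term c).
  by apply: measurable_strip_term => //; have [] := mshrunk c.
have mG : measurable_fun setT lower_defect.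
  rewrite /lower_defect; under eq_fun do rewrite -big_filter.
  by apply: measurable_sum => c.
have G0 x : 0 <= lower_defect x by apply: sumr_ge0 => c _; exact: low_term_ge0.
have G1 x : lower_defect x <= 1.
  have [[c gc nz]|no] := pselect (exists2 c, cell_good c & low_term c x != 0).
    rewrite /lower_defect (bigD1 c)//= big1 ?addr0; first exact: low_term_le1.
    move=> c' /andP[gc' cc'].
    by apply: (low_term_unique gc gc') nz; rewrite eq_sym.
  rewrite /lower_defect big1// => c gc; apply/eqP/negPn/negP => nz.
  by apply: no; exists c.
have QE : Q = (\int[lam]_(x in D) Pext x)%E by [].
have h1 : (Q <= \int[lam]_(x in D) (1 - lower_defect x)%:E)%E.
  rewrite QE; apply: ge0_le_integral_nonmeasurable => [x _|x Dx]; first exact: Pext_ge0.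
  exact: exit_probability.
have h2 : (\int[lam]_(x in D) (1 - lower_defect x)%:E +
    \int[lam]_(x in D) (lower_defect x)%:E = lam D)%E.
  rewrite -ge0_integralD//; first last.
  - by apply: measurable_funTS; exact/measurable_EFinP.
  - by move=> x _; rewrite lee_fin.
  - by apply: measurable_funTS; apply/measurable_EFinP; exact: measurable_funB.
  - by move=> x _; rewrite lee_fin subr_ge0.
  rewrite -[RHS]mul1e -integral_cst//; apply: eq_integral => x _.
  by rewrite -EFinD subrK.
rewrite -h2; apply: leeD => //.
rewrite /lower_defect; under [leRHS]eq_integral do rewrite -sumEFin -big_filter.
rewrite ge0_integral_sum//; last 2 first.
- by move=> c; apply: measurable_funTS; exact/measurable_EFinP.
- by move=> c x _; rewrite lee_fin low_term_ge0.
rewrite big_filter.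
apply: (@le_trans _ _ (\sum_(c | cell_good c) ((((1 - e) * s) ^+ n *
    (mu - (2 * e * n.+1%:R * mu + K * mu ^+ 2 / rho1))))%:E)%E).
  by rewrite sumr_natl.
apply: lee_sum => c _; apply: (le_trans (integral_low_term c)).
rewrite [leRHS]integral_mkcond le_eqVlt; apply/orP; left; apply/eqP.
apply: eq_integral => x _; rewrite patchE; case: ifPn => // xD.
by rewrite low_term_inside// -notin_setE.
Qed.

End heat.

Lemma bounded_lebesgue_lty (R : realType) n (A : set 'rV[R]_n) : bounded_set A ->
  measurable A -> (lebesgue_rV A < +oo)%E.
Proof.
move=> [M [_ bM]] mA; pose r := Num.max 0 (M + 2).
have r0 : 0 <= r by rewrite le_max lexx.
have rM : M < r - 1 by rewrite ltrBrDr lt_max ltrD2l ltr1n orbT.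
have sub : A `<=` cube (const_mx (- r)) (2 * r).
  move=> x Ax i; have xr : `|x| <= r - 1 := bM _ rM x Ax.
  have : `|x 0 i| <= r - 1.
    apply: le_trans xr; rewrite [leRHS]/Num.norm/= mx_normrE.
    exact: (le_bigmax _ (fun ij : 'I_1 * 'I_n => `|x ij.1 ij.2|) (0, i)).
  by rewrite ler_norml mxE => /andP[? ?]; apply/andP; split; lra.
have Ec := @lebesgue_rV_cube R n (const_mx (- r)) (2 * r).
apply: (@le_lt_trans _ _ (((2 * r) ^+ n)%:E)); last exact: ltry.
rewrite -Ec; last by rewrite mulr_ge0.
by apply: le_measure => //; rewrite inE//; exact: measurable_cube.
Qed.

(** * Rate of loss of heat content *)

Section heat_rate.
Context {R : realType} {n : nat} (P : probability (cadlag 'rV[R]_n.+1) R).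
Hypotheses (n_gt0 : (2 <= n.+1)%N)
  (X_start : P [set w : cadlag 'rV[R]_n.+1 | w 0 = 0] = 1%E)
  (X_indep : mutually_independent P (@component R n.+1))
  (X_id : identically_distributed P (@component R n.+1))
  (X_gauss : forall i : 'I_n.+1, gaussian_process P (fun t w => w t 0 i))
  (X_mean : forall i : 'I_n.+1, zero_mean_process P (fun t w => w t 0 i))
  (X_nondeg : forall t : R, 0 < t <= 1 ->
    (0 < P [set w : cadlag 'rV[R]_n.+1 | (w t != 0)%R])%E).
Variable D : set 'rV[R]_n.+1.
Hypotheses (D_bounded : bounded_set D) (D_C11 : C11_open D).

Let oD : open D. Proof. by case: D_C11. Qed.

Let A := fine (lebesgue_rV D).
Let S := fine (surface_measure (boundary D)).
Let q t := fine (heat_content P D t).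
Let mu t := mean_sup P t.

Lemma volume_fin : lebesgue_rV D = A%:E.
Proof.
rewrite /A fineK// ge0_fin_numE//.
by apply: bounded_lebesgue_lty => //; exact: open_rV_measurable.
Qed.

Lemma boundary_fin : surface_measure (boundary D) = S%:E.
Proof.
have h : (0 : R) < 1 by [].
have h2 : (0 : R) < 2^-1 by rewrite invr_gt0.
have h3 : (2^-1 : R) <= 1 by rewrite invf_le1// ler1n.
have [C _] := cell_decomposition D_C11 D_bounded h2 h3 h.
rewrite /S fineK// ge0_fin_numE; last exact: surface_ge0.
exact: le_lt_trans (surface_upper n_gt0 C h2) (ltry _).
Qed.

Lemma heat_content_fin t : heat_content P D t = (q t)%:E.
Proof.
rewrite /q fineK// ge0_fin_numE; last first.
  by apply: integral_ge0 => x _; exact: mu_ext_ge0.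
apply: (@le_lt_trans _ _ (\int[lebesgue_rV (n:=n.+1)]_(x in D) (1%R)%:E)%E).
  apply: ge0_le_integral_nonmeasurable => [x _|x _]; first exact: mu_ext_ge0.
  apply: (le_trans (le_mu_ext P (@subsetT _ _))).
  by rewrite measurable_mu_extE//; exact: probability_le1.
have mD : measurable D by exact: open_rV_measurable.
have VE := volume_fin.
by rewrite integral_cst// mul1e; apply: le_lt_trans (ltry A); rewrite -VE.
Qed.

(** Turns the terms of order [mu ^ 2] into errors of size [d mu]: their coefficients depend on the
    cells, which are fixed before [t] tends to [0]. *)
Let near_time (k d : R) : 0 <= k -> 0 < d ->
  \forall t \near 0^'+, 0 < t < 1 /\ k * mu t <= d.
Proof.
move=> k0 d0; have mc := mean_sup_cvg0 n_gt0 X_start X_indep X_id X_gauss X_mean.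
have : k * mu t @[t --> 0^'+] --> k * 0 by apply: cvgM => //; exact: cvg_cst.
rewrite mulr0 => kc.
near=> t; split; last first.
  apply: ltW; near: t; exact: (cvgr_lt 0 kc).
apply/andP; split; first by near: t; exact: nbhs_right_gt.
by near: t; exact: nbhs_right_lt.
Unshelve. all: by end_near. Qed.

Let mu_gt0 t : 0 < t < 1 -> 0 < mu t.
Proof. by move=> /andP[t0 t1]; apply: mean_sup_gt0 => //; rewrite t0 ltW. Qed.

Let K : R := n.+1%:R ^+ 2 * 192 ^+ 2.

Let K_ge0 : 0 <= K. Proof. by rewrite mulr_ge0. Qed.

Let A_ge0 : 0 <= A. Proof. by rewrite fine_ge0. Qed.

(** The flat areas of the used and of the good cells differ by at most [e] and enclose the surface
    up to powers of [1 + e] and [1 - e]; the heat content is compared with these two areas. *)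
Lemma cell_count e (C : cells D e) : 0 < e -> e < 1 ->
  #|[pred c : cell_index C | cell_used c && ~~ cell_good c]|%:R * cell_side C ^+ n <= e ->
  let G := #|[pred c : cell_index C | cell_good c]|%:R * cell_side C ^+ n in
  let N := #|[pred c : cell_index C | cell_used c]|%:R * cell_side C ^+ n in
  [/\ 0 <= G, N <= G + e, G * (1 - e) ^+ n <= S & S <= N * (1 + e) ^+ n].
Proof.
move=> e0 e1 bad G N; have s0 := cell_side_gt0 C; split.
- by rewrite mulr_ge0// exprn_ge0// ltW.
- rewrite /N /G (_ : #|_| = (#|[pred c : cell_index C | cell_good c]| +
    #|[pred c : cell_index C | cell_used c && ~~ cell_good c]|)%N).
    by rewrite natrD mulrDl lerD2l.
  rewrite -(cardID [pred c : cell_index C | cell_good c]); congr (_ + _)%N.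
    apply: eq_card => c; rewrite !inE; case: (boolP (cell_good c)) => gc; rewrite ?andbF//.
    by rewrite (cell_good_used gc).
  by apply: eq_card => c; rewrite !inE andbC.
- have := surface_lower n_gt0 C e0 e1; rewrite boundary_fin lee_fin exprMn /G.
  by rewrite mulrAC -mulrA.
- have := surface_upper n_gt0 C e0; rewrite boundary_fin lee_fin exprMn /N.
  by rewrite mulrAC -mulrA.
Qed.

(** The used cells bound the loss of heat, and their area is traded for that of the good ones, at
    most [S / (1 - e) ^ n], at the cost [e]. The last [e] absorbs the paths of large range. *)
Lemma heat_rate_upper e : 0 < e -> e < 1 -> \forall t \near 0^'+,
  (A - q t) / mu t <= (S / (1 - e) ^+ n + e) * (1 + 4 * e * n.+1%:R) + e.
Proof.
move=> e0 e1; have [C bad] := cell_decomposition D_C11 D_bounded e0 (ltW e1) e0.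
have [G0 NG GS _] := cell_count e0 e1 bad.
set G := _ * _ in G0 NG GS; set N := _ * _ in NG.
have r0 := cell_reach_gt0 C.
have k0 : 0 <= K * A / cell_reach C ^+ 2.
  by rewrite divr_ge0 ?exprn_ge0 ?mulr_ge0// ltW.
apply: filterS (near_time k0 e0) => t [t01 ht].
have m0 := mu_gt0 t01.
have := heat_content_ge n_gt0 X_start X_indep X_id X_gauss X_mean X_nondeg C oD e0 t01 D_bounded.
rewrite volume_fin heat_content_fin -EFinM -!EFinD lee_fin => H.
have a0 : 0 < 1 - e by lra.
have p0 : 0 < (1 - e) ^+ n by rewrite exprn_gt0.
have GS' : G <= S / (1 - e) ^+ n by rewrite ler_pdivlMr.
have f0 : 0 <= 1 + 4 * e * n.+1%:R by rewrite addr_ge0// mulr_ge0// mulr_ge0// ltW.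
have NN : N * (1 + 4 * e * n.+1%:R) <= (S / (1 - e) ^+ n + e) * (1 + 4 * e * n.+1%:R).
  by apply: ler_wpM2r => //; lra.
rewrite ler_pdivrMr//; apply: (@le_trans _ _
  ((N * (1 + 4 * e * n.+1%:R) + K * A / cell_reach C ^+ 2 * mu t) * mu t)); last first.
  by apply: ler_wpM2r; [exact: ltW|lra].
move: H; rewrite -/(mu t) -/K -addrA -lerBlDl.
suff -> : #|[pred c : cell_index C | cell_used c]|%:R *
      (cell_side C ^+ n * ((1 + 4 * e * n.+1%:R) * mu t)) +
    K * mu t ^+ 2 / cell_reach C ^+ 2 * A =
    (N * (1 + 4 * e * n.+1%:R) + K * A / cell_reach C ^+ 2 * mu t) * mu t by [].
by rewrite /N; field; rewrite gt_eqF.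
Qed.

Lemma heat_rate_lower e : 0 < e -> e < 1 -> 2 * e * n.+1%:R < 1 ->
  \forall t \near 0^'+,
  (S / (1 + e) ^+ n - e) * ((1 - e) ^+ n * (1 - 2 * e * n.+1%:R)) - e <= (A - q t) / mu t.
Proof.
move=> e0 e1 e2; have [C bad] := cell_decomposition D_C11 D_bounded e0 (ltW e1) e0.
have [G0 NG _ SN] := cell_count e0 e1 bad.
set G := _ * _ in G0 NG; set N := _ * _ in NG SN.
pose r := Num.min (cell_reach C) (Num.min (cell_gap C / 4) (cell_side C)).
have r0 : 0 < r by rewrite !lt_min cell_reach_gt0 cell_side_gt0 divr_gt0// cell_gap_gt0.
have r1 : r <= cell_reach C by rewrite ge_min lexx.
have r2 : r <= cell_gap C / 4 by rewrite !ge_min lexx orbT.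
have r3 : r <= cell_side C by rewrite !ge_min lexx !orbT.
have a0 : 0 < 1 - e by lra.
have b0 : 0 < 1 + e by lra.
have p0 : 0 < (1 - e) ^+ n by rewrite exprn_gt0.
have k0 : 0 <= G * (1 - e) ^+ n * (K / r).
  by apply: mulr_ge0; [apply: mulr_ge0 => //; exact: ltW|apply: divr_ge0 => //; exact: ltW].
apply: filterS (near_time k0 e0) => t [t01 ht].
have m0 := mu_gt0 t01.
have := heat_content_le n_gt0 X_start X_indep X_id X_gauss X_mean X_nondeg oD e0 e1 t01
  r0 r1 r2 r3.
rewrite volume_fin heat_content_fin -!EFinD lee_fin => H.
have GS : S / (1 + e) ^+ n - e <= G.
  by rewrite lerBlDr; apply: le_trans NG; rewrite ler_pdivrMr// exprn_gt0.
have f0 : 0 <= (1 - e) ^+ n * (1 - 2 * e * n.+1%:R) by rewrite mulr_ge0 ?subr_ge0// ltW.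
have GG := ler_wpM2r f0 GS.
rewrite ler_pdivlMr//; apply: (@le_trans _ _
  ((G * ((1 - e) ^+ n * (1 - 2 * e * n.+1%:R)) -
    G * (1 - e) ^+ n * (K / r) * mu t) * mu t)).
  by apply: ler_wpM2r; [exact: ltW|lra].
move: H; rewrite -/(mu t) -/K.
suff -> : #|[pred c : cell_index C | cell_good c]|%:R * (((1 - e) * cell_side C) ^+ n *
      (mu t - (2 * e * n.+1%:R * mu t + K * mu t ^+ 2 / r))) =
    (G * ((1 - e) ^+ n * (1 - 2 * e * n.+1%:R)) -
    G * (1 - e) ^+ n * (K / r) * mu t) * mu t by rewrite -lerBrDl.
by rewrite exprMn /G; field; rewrite gt_eqF.
Qed.

Let pow_cvg (f : R -> R) (l : R) : f e @[e --> (0 : R)^'+] --> l ->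
  f e ^+ n @[e --> (0 : R)^'+] --> l ^+ n.
Proof.
move=> fl; apply: (@cvg_comp _ _ _ f (fun u => u ^+ n) _ _ _ fl).
exact: exprn_continuous.
Qed.

Let inv_pow_cvg (a : R) : (1 + a * e)^-1 ^+ n @[e --> (0 : R)^'+] --> (1 : R).
Proof.
have h : 1 + a * e @[e --> 0^'+] --> 1 + a * 0.
  apply: cvgD; first exact: cvg_cst.
  apply: cvgM; first exact: cvg_cst.
  by apply: cvg_at_right_filter; exact: cvg_id.
rewrite -[X in _ --> X](expr1n _ n); apply: pow_cvg; rewrite -[X in _ --> X]invr1.
apply: cvgV; first exact: oner_neq0.
by rewrite mulr0 addr0 in h.
Qed.

(** Both bounds tend to [S] with [e]. For a tolerance [eta] a single [e] is fixed, after which the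
    decomposition it determines tells how small [t] must be. *)
Lemma heat_rate_cvg : (A - q t) / mu t @[t --> 0^'+] --> S.
Proof.
have id0 : e @[e --> (0 : R)^'+] --> (0 : R) by apply: cvg_at_right_filter; exact: cvg_id.
have up : (S / (1 - e) ^+ n + e) * (1 + 4 * e * n.+1%:R) + e @[e --> (0 : R)^'+] --> S.
  have E : (S * 1 + 0) * (1 + 4 * 0 * n.+1%:R) + 0 = S by ring.
  rewrite -[X in _ --> X]E.
  apply: cvgD => //; apply: cvgM.
    apply: cvgD => //; apply: cvgM; first exact: cvg_cst.
    under eq_fun do rewrite -exprVn -mulN1r.
    exact: inv_pow_cvg.
  apply: cvgD; first exact: cvg_cst.
  apply: cvgM; last exact: cvg_cst.
  by apply: cvgM => //; exact: cvg_cst.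
have lo : (S / (1 + e) ^+ n - e) * ((1 - e) ^+ n * (1 - 2 * e * n.+1%:R)) - e
    @[e --> (0 : R)^'+] --> S.
  have E : (S * 1 - 0) * ((1 - 0) ^+ n * (1 - 2 * 0 * n.+1%:R)) - 0 = S.
    by rewrite !subr0 expr1n; ring.
  rewrite -[X in _ --> X]E.
  apply: cvgB => //; apply: cvgM.
    apply: cvgB => //; apply: cvgM; first exact: cvg_cst.
    under eq_fun do rewrite -exprVn -[e in 1 + e]mul1r.
    exact: inv_pow_cvg.
  apply: cvgM; first by apply: pow_cvg; apply: cvgB => //; exact: cvg_cst.
  apply: cvgB; first exact: cvg_cst.
  apply: cvgM; last exact: cvg_cst.
  by apply: cvgM => //; exact: cvg_cst.
apply/cvgrPdist_le => eta eta0.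
have /filter_ex[e [[e0 e1 e2] [eu el]]] : \forall e \near (0 : R)^'+,
    [/\ 0 < e, e < 1 & 2 * e * n.+1%:R < 1] /\
    ((S / (1 - e) ^+ n + e) * (1 + 4 * e * n.+1%:R) + e <= S + eta /\
     S - eta <= (S / (1 + e) ^+ n - e) * ((1 - e) ^+ n * (1 - 2 * e * n.+1%:R)) - e).
  near=> e; split; first split.
  - by near: e; exact: nbhs_right_gt.
  - by near: e; exact: nbhs_right_lt.
  - have n2 : (0 : R) < 2 * n.+1%:R by rewrite mulr_gt0.
    rewrite -mulrA mulrCA -ltr_pdivlMr//; near: e; exact: nbhs_right_lt.
  split; apply: ltW; near: e.
    by apply: (cvgr_lt S up); rewrite ltrDl.
  by apply: (cvgr_gt S lo); rewrite ltrBlDr ltrDl.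
apply: filterS2 (heat_rate_upper e0 e1) (heat_rate_lower e0 e1 e2) => t h1 h2.
by rewrite ler_distlC; apply/andP; split; [exact: le_trans el h2|exact: le_trans h1 eu].
Unshelve. all: by end_near. Qed.

Lemma heat_content_rate :
  ((lebesgue_rV D - heat_content P D t) / expected_sup P t)%E @[t --> (0 : R)^'+]
    --> surface_measure (boundary D).
Proof.
rewrite boundary_fin; have H : ((A - q t) / mu t)%:E @[t --> (0 : R)^'+] --> S%:E.
  by apply: cvg_EFin; [near=> t|exact: heat_rate_cvg].
apply: cvg_trans H; apply: near_eq_cvg; near=> t.
have t01 : 0 < t < 1.
  by apply/andP; split; near: t; [exact: nbhs_right_gt|exact: nbhs_right_lt].
have t01' : 0 < t <= 1 by case/andP: t01 => -> /ltW.
rewrite (mean_supE n_gt0 X_start X_indep X_id X_gauss X_mean t01').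
rewrite volume_fin heat_content_fin -EFinB inver gt_eqF; last exact: mu_gt0.
by rewrite -EFinM.
Unshelve. all: by end_near. Qed.

End heat_rate.

Theorem theorem4p4 (R : realType) (n : nat) (hn : (2 <= n.+1)%N)
  (D : set 'rV[R]_n.+1)
  (D_neq0 : D !=set0) (D_bounded : bounded_set D) (D_connected : connected D)
  (D_C11 : C11_open D)
  (P : probability (cadlag 'rV[R]_n.+1) R)
  (X_start : P [set w : cadlag 'rV[R]_n.+1 | w 0 = 0] = 1%E)
  (X_indep : mutually_independent P (@component R n.+1))
  (X_id : identically_distributed P (@component R n.+1))
  (X_gauss : forall i : 'I_n.+1, gaussian_process P (fun t w => w t 0 i))
  (X_mean : forall i : 'I_n.+1, zero_mean_process P (fun t w => w t 0 i))
  (X_sup : forall t : R, 0 < t <= 1 ->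
    {ae P, forall w, (running_sup (component ord0 w) t < +oo)%E})
  (X_nondeg : forall t : R, 0 < t <= 1 ->
    (0 < P [set w : cadlag 'rV[R]_n.+1 | (w t != 0)%R])%E)
  (d' : measure_display) (Om' : measurableType d') (P' : probability Om' R)
  (Y : Om' -> cadlag R)
  (Y_measurable : measurable_fun setT Y)
  (Y_gauss : gaussian_process P' (fun s w => Y w s))
  (Y_continuous : forall w, {within `[0, 1], continuous (Y w : R -> R)})
  (Y_lim : weak_cvg P (0 : R)^'+ (scaled_component P) P' Y) :
  (\int[P']_w running_sup (Y w) 1 <= 1)%E /\
  ((lebesgue_rV D - heat_content P D t) / expected_sup P t)%E @[t --> (0 : R)^'+]
    --> (surface_measure (boundary D) * \int[P']_w running_sup (Y w) 1)%E.
Proof.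
have EY := limit_sup_mean hn X_start X_indep X_id X_gauss X_mean X_nondeg Y_measurable Y_lim.
split; first by rewrite EY.
rewrite EY mule1.
exact: (heat_content_rate hn X_start X_indep X_id X_gauss X_mean X_nondeg D_bounded D_C11).
Qed.
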